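(* There exists $\lambda_0>0$ such that for arbitrary $\lambda>\lambda_0$ one can choose $s_0=s_0(\lambda)>0$, and there exist a constant $C=C(s_0,\lambda_0)>0$ and a constant $C(\lambda)>0$ depending on $\lambda$, such that the following estimate holds for all $s>s_0$ and all $u\in\mathcal{U}$ which satisfy $$\partial_t u(x,v,t)-v^2\partial_x^2u(x,v,t)-L_1u(x,v,t)-\int_V K(x,v,v')u(x,v',t)\,dv'=f(x,v,t),\quad (x,t)\in Q,\ v\in V,$$ $$u(x,v,0)=0,\quad x\in\Omega,\ v\in V,\qquad u(x,v,t)=0,\quad (x,v)\in\Gamma_-,\ t\in(0,T):$$ $$\int_{Q\times V}\left[\frac{1}{s\varphi}|\partial_t u|^2+s\lambda^2\varphi|\partial_x u|^2+s^3\lambda^4\varphi^3|u|^2\right]e^{2s\alpha}\,dx\,dv\,dt$$ $$\le C\int_{Q\times V}|f|^2e^{2s\alpha}\,dx\,dv\,dt+Ce^{C(\lambda)s}\int_0^T\int_{\Gamma_+}\left(|u|^2+|\partial_t u|^2+|\partial_x u|^2\right)dS\,dv\,dt+Ce^{C(\lambda)s}\int_V\int_0^T|\partial_x u(0,v,t)|^2\,dt\,dv.$$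
   Context: $\ell,v_0,v_1,T$ are positive constants, $\Omega=(0,\ell)$, $Q=\{(x,t): x\in\Omega,\ 0<t<T\}$, $V=\{v\in\mathbb{R}: v_0\le|v|\le v_1\}$. The outgoing ($+$) and incoming ($-$) boundaries are $\Gamma_\pm=\{(x,v)\in\partial\Omega\times V:\ \pm v<0 \text{ at } x=0,\ \pm v>0\text{ at }x=\ell\}$, with $\int_{\Gamma_+}f(x,v)\,dS\,dv=\int_{-v_1}^{-v_0}f(0,v)\,dv+\int_{v_0}^{v_1}f(\ell,v)\,dv$. The coefficients satisfy $\sigma_t,\sigma_s\in C^1(\overline{\Omega};L^\infty(V))$, $p\in C^1(\overline{\Omega};L^\infty(V\times V))$, $p>0$ in $\Omega\times V\times V$. The operator $L_1$ is $$L_1u(x,v,t)=2v\sigma_t(x,v)\partial_xu(x,v,t)+\left(v\,\partial_x\sigma_t(x,v)+\sigma_t(x,v)^2\right)u(x,v,t),$$ and $K(x,v,v')$ is the first-order differential operator in $x$, acting on $u(x,v',t)$, $$K(x,v,v')u(x,v',t)=-v\left[\partial_x\left(\sigma_s(x,v)p(x,v,v')\right)\right]u(x,v',t)-\sigma_s(x,v)p(x,v,v')\left[(v+v')\partial_x+\sigma_t(x,v)+\sigma_t(x,v')\right]u(x,v',t)$$ $$+\left[\sigma_s(x,v)\int_V\sigma_s(x,v'')p(x,v,v'')p(x,v'',v')\,dv''\right]u(x,v',t).$$ $d\in C^2(\overline{\Omega})$ is a function with $d(x)>0$ for $x\in\Omega$ and $\partial_xd(x)<0$ for $x\in\overline{\Omega}$.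 The weight functions, depending on $\lambda$, are $$\alpha(x,t)=\frac{e^{\lambda d(x)}-e^{2\lambda\|d\|_{C(\overline{\Omega})}}}{t(T-t)},\qquad \varphi(x,t)=\frac{e^{\lambda d(x)}}{t(T-t)}.$$ $H^{k,0}(\Omega\times V)$ denotes the space of functions on $\Omega\times V$ with $x$-derivatives up to order $k$ in $L^2(\Omega\times V)$. Set $X=H^2(0,T;H^{1,0}(\Omega\times V))\cap L^\infty(0,T;H^{2,0}(\Omega\times V))$ and, for a fixed $M>0$, $\mathcal{U}=\{u\in X:\ \|u\|_X+\|\partial_x u\|_{H^1(\Omega\times(0,T);L^2(V))}\le M\}$. *)

(* Defs.v *)
From HB Require Import structures.
From mathcomp Require Import all_boot all_order all_algebra.
From mathcomp Require Import all_classical all_reals all_analysis.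
From mathcomp Require Import ess_sup_inf.
Import Order.TTheory GRing.Theory Num.Theory.
Import numFieldNormedType.Exports.

Set Implicit Arguments.
Unset Strict Implicit.
Unset Printing Implicit Defensive.

Local Open Scope classical_set_scope.
Local Open Scope ring_scope.

(* Functions are curried, u x v t.  Derivatives and traces are classical
   choices (xget) of a representative satisfying the defining relation; they
   are unique almost everywhere, and the default value 0 is only taken when the
   derivative or trace does not exist. *)

Notation leb1 := (@lebesgue_measure _).
Notation leb2 := (leb1 \x leb1)%E.
Notation leb3 := (leb2 \x leb1)%E.

Section uncurry.
Context {R : realType}.

Definition uncurry2 (g : R -> R -> R) (z : R * R) : R := g z.1 z.2.
Definition uncurry3 (u : R -> R -> R -> R) (z : R * R * R) : R :=
  u z.1.1 z.1.2 z.2.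

End uncurry.

Section Lp_on_a_set.
Context d (Y : measurableType d) {R : realType}.
Variables (mu : {measure set Y -> \bar R}) (D : set Y).

(* Norm of L^p(D), and membership in it, through extension by 0. *)
Definition norm_on (p : \bar R) (f : Y -> R) : \bar R :=
  ('N[mu]_p[EFin \o (f \_ D)])%E.

Definition Lp_on (p : \bar R) (f : Y -> R) : Prop := f \_ D \in Lfun mu p.

End Lp_on_a_set.

(* C^1([0, ell]; L^oo(D)) *)
Section C1_Linfty.
Context d (Y : measurableType d) {R : realType}.
Variables (mu : {measure set Y -> \bar R}) (D : set Y) (ell : R).
Implicit Types g h : R -> Y -> R.

Let I : set R := `[0, ell].

(* Coefficients are taken to be jointly measurable, which does not follow from
   being measurable in y for each x. *)
Definition measurable_on_ID g : Prop :=
  measurable_fun (I `*` D) (fun z : R * Y => g z.1 z.2).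

Definition is_dx_Linfty g h : Prop :=
  measurable_on_ID h /\
  forall x0, I x0 -> Lp_on mu D +oo%E (h x0) /\
    norm_on mu D +oo%E (fun y => (x - x0)^-1 * (g x y - g x0 y) - h x0 y)
      @[x --> within I (x0^')] --> 0%E.

Definition dx_Linfty g : R -> Y -> R :=
  xget (fun _ _ => 0) [set h | is_dx_Linfty g h].

Definition C1_Linfty g : Prop :=
  [/\ measurable_on_ID g,
      forall x, I x -> Lp_on mu D +oo%E (g x),
      is_dx_Linfty g (dx_Linfty g) &
      forall x0, I x0 ->
        norm_on mu D +oo%E (fun y => dx_Linfty g x y - dx_Linfty g x0 y)
          @[x --> within I (nbhs x0)] --> 0%E].

End C1_Linfty.

(* C^2([0, ell]), with one-sided derivatives at the end points *)
Section C2_interval.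
Context {R : realType}.
Variable ell : R.
Implicit Type g : R -> R.

Definition dquot g (x0 x : R) : R := (g x - g x0) / (x - x0).

Definition deriv_in g : R -> R :=
  fun x0 => lim (dquot g x0 x @[x --> within `[0, ell] (x0^')]).

Definition C1_in g : Prop :=
  [/\ {within `[0, ell], continuous g},
      forall x0, `[0, ell]%classic x0 ->
        cvg (dquot g x0 x @[x --> within `[0, ell] (x0^')]) &
      {within `[0, ell], continuous (deriv_in g)}].

Definition C2_in g : Prop := C1_in g /\ C1_in (deriv_in g).

Definition sup_norm_in g : R := sup [set `|g x| | x in `[0, ell]].

End C2_interval.

(* Weak derivatives and traces of functions of one real variable with values in
   L^2(D), D a measurable subset of the plane; g a y is the value at y of the
   function attached to a.  An identity or limit in L^2(D) is an identity for
   almost every y or a limit of L^2(D) norms. *)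
Section vector_valued.
Context {R : realType}.
Implicit Types (a b : R) (D : set (R * R)) (g h : R -> R * R -> R).

Definition test_fun a b (phi : R -> R) : Prop :=
  (forall n x, derivable (derive1n n phi) x 1) /\
  exists a' b', [/\ a < a', b' < b &
    forall x, ~ `[a', b']%classic x -> phi x = 0].

Definition weak_deriv a b D g h : Prop :=
  forall phi, test_fun a b phi ->
    {ae leb2, forall y, D y ->
      \int[leb1]_(x in `]a, b[) (g x y * derive1 phi x) =
      - \int[leb1]_(x in `]a, b[) (h x y * phi x)}.

(* tau is the value at x0 of the continuous representative [a, b] -> L^2(D),
   that is, the essential limit of g x at x0 from inside ]a, b[. *)
Definition is_trace a b D g (x0 : R) (tau : R * R -> R) : Prop :=
  Lp_on leb2 D 2%:E tau /\
  forall e, 0 < e -> exists2 del, 0 < del &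
    {ae leb1, forall x, a < x < b -> `|x - x0| < del ->
      (norm_on leb2 D 2%:E (fun y => g x y - tau y)%R <= e%:E)%E}.

End vector_valued.

Section phase_space.
Context {R : realType}.
Variables ell v0 v1 T : R.
Implicit Types u w : R -> R -> R -> R.

Definition Om : set R := `]0, ell[.
Definition Vel : set R := [set v | v0 <= `|v| <= v1].
Definition VV : set (R * R) := Vel `*` Vel.
Definition Tm : set R := `]0, T[.
Definition QV : set (R * R * R) := (Om `*` Vel) `*` Tm.

Definition Gamma_minus : set (R * R) :=
  [set z | Vel z.2 /\ ((z.1 = 0 /\ 0 < z.2) \/ (z.1 = ell /\ z.2 < 0))].

Definition xslice u : R -> R * R -> R := fun x z => u x z.1 z.2.
Definition tslice u : R -> R * R -> R := fun t z => u z.1 z.2 t.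

Definition L2 u : Prop := Lp_on leb3 QV 2%:E (uncurry3 u).
Definition nrm2 u : \bar R := norm_on leb3 QV 2%:E (uncurry3 u).

Definition is_dx u w : Prop :=
  L2 w /\ weak_deriv 0 ell (Vel `*` Tm) (xslice u) (xslice w).
Definition is_dt u w : Prop :=
  L2 w /\ weak_deriv 0 T (Om `*` Vel) (tslice u) (tslice w).

Definition has_dx u : Prop := exists w, is_dx u w.
Definition has_dt u : Prop := exists w, is_dt u w.

Definition dx u : R -> R -> R -> R := xget (fun _ _ _ => 0) [set w | is_dx u w].
Definition dt u : R -> R -> R -> R := xget (fun _ _ _ => 0) [set w | is_dt u w].

(* u(x0, ., .) for x0 = 0 or ell, and u(., ., t0) for t0 = 0 or T *)
Definition trx u (x0 v t : R) : R :=
  xget (fun=> 0) [set tau | is_trace 0 ell (Vel `*` Tm) (xslice u) x0 tau]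
    (v, t).
Definition trt u (x v t0 : R) : R :=
  xget (fun=> 0) [set tau | is_trace 0 T (Om `*` Vel) (tslice u) t0 tau]
    (x, v).

Local Open Scope ereal_scope.

Definition norm_H2H1 u : \bar R :=
  (\sum_(j < 3) (nrm2 (iter j dt u) ^+ 2 + nrm2 (dx (iter j dt u)) ^+ 2))
    `^ (2^-1).

(* norm of H^{2,0}(Om x V) at time t *)
Definition norm_H20 u (t : R) : \bar R :=
  (\sum_(k < 3) norm_on leb2 (Om `*` Vel) 2%:E (tslice (iter k dx u) t) ^+ 2)
    `^ (2^-1).

Definition norm_LinfH2 u : \bar R := ess_sup leb1 ((norm_H20 u) \_ Tm).

Definition in_X u : Prop :=
  [/\ L2 u,
      has_dt u /\ has_dt (dt u),
      forall j, (j < 3)%N -> has_dx (iter j dt u),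
      has_dx (dx u) &
      norm_LinfH2 u < +oo].

Definition norm_X u : \bar R := norm_H2H1 u + norm_LinfH2 u.

(* norm of H^1(Om x ]0, T[; L^2(V)) *)
Definition norm_H1L2 w : \bar R :=
  (nrm2 w ^+ 2 + nrm2 (dx w) ^+ 2 + nrm2 (dt w) ^+ 2) `^ (2^-1).

Definition in_U (M : R) u : Prop :=
  [/\ in_X u, has_dt (dx u) & norm_X u + norm_H1L2 (dx u) <= M%:E].

Definition int_QV (F : R -> R -> R -> R) : \bar R :=
  \int[leb3]_(z in QV) (F z.1.1 z.1.2 z.2)%:E.

(* Gamma_plus is {0} x [-v1, -v0] together with {ell} x [v0, v1], and dS is the
   counting measure on {0, ell}. *)
Definition int_Gamma_plus (F : R -> R -> R) : \bar R :=
  \int[leb1]_(v in `[(- v1)%R, (- v0)%R]) (F 0%R v)%:E +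
  \int[leb1]_(v in `[v0, v1]) (F ell v)%:E.

Local Close Scope ereal_scope.

Section operators.
Variables (sigma_t sigma_s : R -> R -> R) (p : R -> R -> R -> R).

Definition L1op u (x v t : R) : R :=
  2 * v * sigma_t x v * dx u x v t +
  (v * dx_Linfty leb1 Vel ell sigma_t x v + sigma_t x v ^+ 2) * u x v t.

(* x |-> sigma_s(x, v) p(x, v, v') as a family of functions of (v, v') *)
Definition scat (x : R) (z : R * R) : R := sigma_s x z.1 * p x z.1 z.2.

(* K(x, v, v') u(x, v', t) *)
Definition Kop u (x v v' t : R) : R :=
  - v * dx_Linfty leb2 VV ell scat x (v, v') * u x v' t
  - sigma_s x v * p x v v' *
      ((v + v') * dx u x v' t + sigma_t x v * u x v' t + sigma_t x v' * u x v' t)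
  + (sigma_s x v *
      \int[leb1]_(v'' in Vel) (sigma_s x v'' * p x v v'' * p x v'' v')) *
    u x v' t.

End operators.

End phase_space.

Section weights.
Context {R : realType}.
Variables (ell T : R) (d : R -> R) (lambda : R).

Definition alpha (x t : R) : R :=
  (expR (lambda * d x) - expR (2 * lambda * sup_norm_in ell d)) / (t * (T - t)).

Definition varphi (x t : R) : R := expR (lambda * d x) / (t * (T - t)).

End weights.

(* Main.v *)
(* Write theta = 1/(t(T-t)) and gamma(x) = e^{2 lambda |d|} - e^{lambda d(x)}, so
   that e^{2 s alpha} = e^{-2 s theta gamma}; for lambda large gamma' > 0 and
   gamma'' < 0 on [0, ell].

   For fixed v, conjugating d_t - v^2 d_x^2 by w = e^{-s theta gamma} u splits it
   as P1 + P2, where P1 P2 is a divergence plus terms which dominate the weighted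
   energy once s is large.  For almost every v the functions u, u_x, u_t are
   absolutely continuous on almost every line (du Bois-Reymond), so the divergence
   integrates to fluxes.  The flux in t vanishes at t = 0 and t = T because of the
   weight.  The flux in x is bounded by the traces of u, u_t, u_x; where u = 0 the
   trace of u_t vanishes as well, and the flux at ell has the right sign because
   gamma' > 0, which is why for v < 0 no trace at the inflow point ell is needed,
   while at 0 the trace of u_x remains.

   The weight does not depend on v, so after integration in v the Cauchy-Schwarz
   inequality bounds L_1 u and the scattering term by the weighted squares of u
   and u_x, which the energy absorbs for s large.

   As C = C(s_0, lambda_0) and s_0 is chosen after lambda, the choice C(s_0) = s_0
   absorbs all constants depending on lambda. *)

Require Import Defs.
From HB Require Import structures.
From mathcomp Require Import all_boot all_order all_algebra.
From mathcomp Require Import all_classical all_reals all_analysis.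
From mathcomp Require Import measurable_realfun ess_sup_inf ring lra.
Import Order.TTheory GRing.Theory Num.Theory.
Import numFieldNormedType.Exports.

Set Implicit Arguments.
Unset Strict Implicit.
Unset Printing Implicit Defensive.

Local Open Scope classical_set_scope.
Local Open Scope ring_scope.

(** The data provide [u] as a class of functions whose derivatives and traces are picked by choice,
    while the fluxes need values on lines. Each object is therefore replaced by an explicit, jointly
    measurable representative: [trace_at] is a primitive of the weak derivative whose constant of
    integration is itself an integral of the data. Exceptional sets can then be moved from one order
    of the variables to another by Tonelli.

    The mixed derivative at hand is the x-derivative of [u_t]. The time flux needs it as the
    t-derivative of [u_x], and the inflow condition passes to [u_t] only if the trace of [u_t] is
    the derivative of the trace of [u]. Both follow by writing [u] in two ways as a double integral.

    The pointwise inequality is pure algebra in the values of [u] and its derivatives, so it asks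
    for no regularity; absolute continuity enters only when the divergence is integrated.

    Two points need care at the end. Measurability of the scattering integrand is never established,
    so its integral is bounded through measurable majorants. Absorption subtracts a multiple of the
    energy, which must first be shown to be finite. *)

(* The library has no sigma-finite structure on the product of two Lebesgue
   measures, hence the alias. *)
Section planar_lebesgue_measure.
Context {R : realType}.

Definition planar_lebesgue : set (measurableTypeR R * measurableTypeR R) -> \bar R :=
  (@lebesgue_measure R \x @lebesgue_measure R)%E.

HB.instance Definition _ := Measure.on planar_lebesgue.

Let square (n : nat) : set (measurableTypeR R * measurableTypeR R) :=
  (`[- n%:R, n%:R] `*` `[- n%:R, n%:R])%classic.

Let sigma_finite_planar : sigma_finite setT planar_lebesgue.
Proof.
exists square.
  apply/seteqP; split => // -[x y] _.
  have [n /= xyn] : exists n, `|x| + `|y| <= n%:R.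
    by exists (Num.truncn (`|x| + `|y|)).+1; apply/ltW; exact: truncnS_gt.
  have [xn yn] : `|x| <= n%:R /\ `|y| <= n%:R.
    by split; apply: le_trans xyn; rewrite ?lerDl ?lerDr.
  by exists n => //; split; rewrite /= in_itv/= -ler_norml.
move=> n; split; first exact: measurableX.
rewrite /planar_lebesgue product_measure1E//.
have H (i : interval R) : i = `[- n%:R, n%:R] -> (@lebesgue_measure R [set` i] < +oo)%E.
  by move=> ->; rewrite lebesgue_measure_itv/=; case: ifPn; rewrite ?ltry.
by apply: lte_mul_pinfty => //; rewrite ?ge0_fin_numE// (H _ erefl).
Qed.

HB.instance Definition _ := Measure_isSigmaFinite.Build _ _ _
  planar_lebesgue sigma_finite_planar.

End planar_lebesgue_measure.

(** * Absolutely continuous functions and Tonelli's theorem *)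

Section tonelli.
Context d1 d2 (T1 : measurableType d1) (T2 : measurableType d2) (R : realType).
Variables (m1 : {sigma_finite_measure set T1 -> \bar R})
  (m2 : {sigma_finite_measure set T2 -> \bar R}).
Variable f : T1 * T2 -> \bar R.
Hypothesis mf : measurable_fun setT f.
Hypothesis f0 : forall z, (0 <= f z)%E.

Lemma measurable_int2 : measurable_fun setT (fun x => \int[m2]_y f (x, y))%E.
Proof. exact: (measurable_fun_fubini_tonelli_F (m2 := m2)). Qed.

Lemma measurable_int1 : measurable_fun setT (fun y => \int[m1]_x f (x, y))%E.
Proof. exact: (measurable_fun_fubini_tonelli_G (m1 := m1)). Qed.

Lemma tonelli12 : (\int[m1 \x m2]_z f z = \int[m1]_x \int[m2]_y f (x, y))%E.
Proof. exact: fubini_tonelli1. Qed.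

Lemma tonelli21 : (\int[m1 \x m2]_z f z = \int[m2]_y \int[m1]_x f (x, y))%E.
Proof. exact: fubini_tonelli2. Qed.

End tonelli.

Lemma integrable_patch d (Y : measurableType d) (R : realType)
    (mu : {measure set Y -> \bar R}) (D : set Y) (g : Y -> R) : measurable D ->
  mu.-integrable D (EFin \o g) -> mu.-integrable setT (EFin \o (g \_ D)).
Proof. by move=> mD ig; rewrite -restrict_EFin; exact: (iffLR (integrable_mkcond _ mD)). Qed.

Section absolutely_continuous.
Context {R : realType}.
Notation mu := (@lebesgue_measure R).
Implicit Types (a b c x : R) (G K g k : R -> R).

Lemma segment_subset a b c x : a <= c -> x <= b -> `[c, x] `<=` `[a, b].
Proof. by move=> ac xb; apply: subset_itv; rewrite bnd_simp. Qed.

Lemma continuous_prim a b g : a <= b -> mu.-integrable `[a, b] (EFin \o g) ->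
  {within `[a, b], continuous (fun x => \int[mu]_(t in `[a, x]) g t)}.
Proof. exact: parameterized_integral_continuous. Qed.

Lemma segment_continuous_bounded a b G : {within `[a, b], continuous G} ->
  exists M, forall x, a <= x <= b -> `|G x| <= M.
Proof.
move=> cG; have := continuous_compact cG (@segment_compact _ a b).
move=> /compact_bounded[M [_ /(_ (M + 1))]].
rewrite ltrDl ltr01 => /(_ isT) MG; exists (M + 1) => x xab.
by apply: MG => /=; exists x => //=; rewrite in_itv.
Qed.

Lemma segment_continuous_measurable a b G : {within `[a, b], continuous G} ->
  measurable_fun `[a, b] G.
Proof. by move=> cG; exact: subspace_continuous_measurable_fun. Qed.

Lemma integrable_mul_continuous a b G g : {within `[a, b], continuous G} ->
  mu.-integrable `[a, b] (EFin \o g) ->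
  mu.-integrable `[a, b] (EFin \o (g \* G)).
Proof.
move=> cG ig; have [M GM] := segment_continuous_bounded cG.
rewrite (_ : _ \o _ = (EFin \o g) \* (EFin \o G))%E; last first.
  by apply/funext => x /=; rewrite EFinM.
apply: integrableMl => //; first exact: segment_continuous_measurable.
exists M; split; first exact: num_real.
move=> y My x /=; rewrite in_itv/= => xab.
by apply: le_trans (ltW My); exact: GM.
Qed.

(** Fubini for [g x * k y] on the triangle [x < y] of the square: the two sides are the two iterated
    integrals. The strict inequality produces half-open sections; on the left-hand side the missing
    end point is restored as a null set. *)
Let prim_prodE a b g k : a <= b ->
  mu.-integrable `[a, b] (EFin \o g) -> mu.-integrable `[a, b] (EFin \o k) ->
  \int[mu]_(x in `[a, b]) (k x * \int[mu]_(t in `[a, x]) g t) =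
  \int[mu]_(x in `[a, b]) (g x * \int[mu]_(t in `]x, b]) k t).
Proof.
move=> ab ig ik.
pose g' := g \_ `[a, b]; pose k' := k \_ `[a, b].
have ig' : mu.-integrable setT (EFin \o g').
  exact: integrable_patch.
have ik' : mu.-integrable setT (EFin \o k').
  exact: integrable_patch.
have mg' : measurable_fun setT g' by apply/measurable_EFinP; exact: measurable_int ig'.
have mk' : measurable_fun setT k' by apply/measurable_EFinP; exact: measurable_int ik'.
pose A : set (R * R) := [set z | z.1 < z.2].
have mA : measurable A.
  rewrite (_ : A = (fun z => z.1 < z.2) @^-1` [set true]); last first.
    by apply/seteqP; split => z.
  rewrite -[X in measurable X]setTI.
  by apply: (measurable_fun_ltr (f := fst) (g := snd)).
pose f z := g' z.1 * k' z.2 * \1_A z.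
have mf : measurable_fun setT f.
  apply: measurable_funM; last exact: measurable_indic.
  by apply: measurable_funM; apply: measurableT_comp.
have if_ : (mu \x mu)%E.-integrable setT (EFin \o f).
  apply/integrable12ltyP; first exact/measurable_EFinP.
  apply: (@le_lt_trans _ _
    (\int[mu]_x (`|(g' x)%:E| * \int[mu]_y `|(k' y)%:E|)))%E.
    apply: ge0_le_integral => //=.
    - by move=> x _; exact: integral_ge0.
    - apply: (@measurable_int2 _ _ _ _ _ mu (fun z => `|(f z)%:E|)%E) => //=.
      by apply/measurable_EFinP; exact: measurableT_comp.
    - apply: emeasurable_funM => //.
      by apply/measurable_EFinP; exact: measurableT_comp.
    - move=> x _; rewrite -ge0_integralZl//=; last first.
        by apply/measurable_EFinP; exact: measurableT_comp.
      apply: ge0_le_integral => //=.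
      + apply/measurable_EFinP; apply: measurableT_comp => //.
        exact: (measurableT_comp mf (pair1_measurable x)).
      + apply: emeasurable_funM => //.
        by apply/measurable_EFinP; exact: measurableT_comp.
      + move=> y _; rewrite -EFinM lee_fin /f /= !normrM -[leRHS]mulr1.
        by rewrite ler_wpM2l// indicE; case: (_ \in _); rewrite ?normr1 ?normr0.
  have /integrableP[_ koo] := ik'; have /integrableP[_ goo] := ig'.
  have k0 : (0 <= \int[mu]_y `|(k' y)%:E|)%E by exact: integral_ge0.
  have kfin : (\int[mu]_y `|(k' y)%:E|)%E \is a fin_num by rewrite ge0_fin_numE.
  rewrite -(fineK kfin) ge0_integralZr//=.
  - by rewrite lte_mul_pinfty// ?ltry ?integral_ge0// ge0_fin_numE ?integral_ge0.
  - by apply/measurable_EFinP; exact: measurableT_comp.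
  - by rewrite lee_fin fine_ge0.
have := Fubini if_.
have -> : (\int[mu]_x \int[mu]_y (EFin \o f) (x, y) =
   \int[mu]_(x in `[a, b]) (g x * \int[mu]_(t in `]x, b]) k t)%:E)%E.
  rewrite [RHS]integral_mkcond; apply: eq_integral => x _.
  rewrite patchE; case: ifPn => xab; last first.
    rewrite integral0_eq// => y _ /=.
    by rewrite /f /g' /= patchE (negbTE xab) !mul0r.
  have xb : a <= x <= b by move: xab; rewrite inE /= in_itv.
  transitivity (\int[mu]_y ((g x)%:E * ((k \_ `]x, b]) y)%:E))%E.
    apply: eq_integral => y _ /=; rewrite -EFinM; congr EFin.
    rewrite /f /= /g' /k' patchE xab -mulrA; congr (_ * _).
    rewrite !patchE indicE /A.
    rewrite (_ : (y \in `]x, b]%classic) = (y \in `[a,b]%classic) && ((x,y) \in [set z : R * R | z.1 < z.2])); last first.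
      apply/idP/idP; rewrite !inE/= !in_itv/=.
        move=> /andP[xy yb]; apply/andP; rewrite !inE/= in_itv/= yb xy andbT.
        by split => //; apply: ltW; apply: le_lt_trans xy; case/andP: xb.
      by move=> /andP[]; rewrite !inE/= in_itv/= => /andP[_ ->] ->.
    by case: (y \in _) => //=; case: (_ \in _); rewrite ?mulr1 ?mulr0 ?mul0r.
  have ikx : mu.-integrable `]x, b] (EFin \o k).
    apply: integrableS ik => //; apply: subset_itv; rewrite bnd_simp//.
    by case/andP : xb.
  rewrite integralZl//=; last first.
    exact: (@integrable_patch _ _ _ mu _ k).
  rewrite EFinM; congr (_ * _)%E.
  rewrite -[LHS]fineK; first by rewrite [in RHS]Rintegral_mkcond.
  apply: integrable_fin_num => //.
  exact: (@integrable_patch _ _ _ mu _ k).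
have -> : (\int[mu]_y \int[mu]_x (EFin \o f) (x, y) =
   \int[mu]_(x in `[a, b]) (k x * \int[mu]_(t in `[a, x]) g t)%:E)%E.
  rewrite [RHS]integral_mkcond; apply: eq_integral => x _.
  rewrite patchE; case: ifPn => xab; last first.
    rewrite integral0_eq// => y _ /=.
    by rewrite /f /k' /= [X in _ * X * _]patchE (negbTE xab) mulr0 mul0r.
  have xb : a <= x <= b by move: xab; rewrite inE /= in_itv.
  have igx : mu.-integrable `[a, x[ (EFin \o g).
    apply: integrableS ig => //; apply: subset_itv; rewrite bnd_simp//.
    by case/andP : xb.
  transitivity (\int[mu]_y ((k x)%:E * ((g \_ `[a, x[) y)%:E))%E.
    apply: eq_integral => y _ /=; rewrite -EFinM; congr EFin.
    have kx : k' x = k x by rewrite /k' patchE xab.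
    rewrite /f /= kx mulrAC [RHS]mulrC; congr (_ * _).
    rewrite /g' !patchE indicE /A.
    rewrite (_ : (y \in `[a, x[%classic) = (y \in `[a,b]%classic) && ((y,x) \in [set z : R * R | z.1 < z.2])); last first.
      apply/idP/idP; rewrite !inE/= !in_itv/=.
        move=> /andP[xy yb]; apply/andP; rewrite !inE/= in_itv/= yb xy.
        by split => //; apply: ltW; apply: lt_le_trans yb _; case/andP: xb.
      by move=> /andP[]; rewrite !inE/= in_itv/= => /andP[-> _] ->.
    by case: (y \in _) => //=; case: (_ \in _); rewrite ?mulr1 ?mulr0 ?mul0r.
  rewrite integralZl//=; last first.
    exact: (@integrable_patch _ _ _ mu _ g).
  rewrite EFinM; congr (_ * _)%E.
  rewrite -Rintegral_itv_bndo_bndc//.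
  rewrite -[LHS]fineK; first by rewrite [in RHS]Rintegral_mkcond.
  apply: integrable_fin_num => //.
  exact: (@integrable_patch _ _ _ mu _ g).
by rewrite /Rintegral => ->.
Qed.

(** Integration by parts for two primitives vanishing at [a]. By [prim_prodE] one half of the
    integrand becomes [g] times the integral of [k] over []x, b]], which completes the other half to
    the full integral of [k]. *)
Lemma prim_prod a b g k : a <= b ->
  mu.-integrable `[a, b] (EFin \o g) -> mu.-integrable `[a, b] (EFin \o k) ->
  \int[mu]_(x in `[a, b]) (g x * (\int[mu]_(t in `[a, x]) k t)
                          + (\int[mu]_(t in `[a, x]) g t) * k x) =
  (\int[mu]_(t in `[a, b]) g t) * (\int[mu]_(t in `[a, b]) k t).
Proof.
move=> ab ig ik.
have cg := continuous_prim ab ig; have ck := continuous_prim ab ik.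
have igk := integrable_mul_continuous ck ig.
have ikg := integrable_mul_continuous cg ik.
under eq_Rintegral do rewrite [X in _ + X]mulrC.
rewrite RintegralD//= (prim_prodE ab ig ik).
rewrite (@eq_Rintegral _ _ _ mu `[a, b]
  (fun x => g x * \int[mu]_(t in `[a, b]) k t - g x * \int[mu]_(t in `[a, x]) k t)
  (fun x => g x * \int[mu]_(t in `]x, b]) k t)); last first.
  move=> x; rewrite inE/= in_itv/= => /andP[ax xb].
  by rewrite -mulrBr -(@Rintegral_itvB _ k (BLeft a) (BRight b) x)// bnd_simp.
rewrite RintegralB//; last first.
  rewrite (_ : _ \o _ = (EFin \o g) \* cst (\int[mu]_(t in `[a, b]) k t)%:E)%E.
    exact: integrableZr.
  by apply/funext => x; rewrite /= EFinM.
by rewrite RintegralZr//; ring.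
Qed.

(** Absolute continuity in integral form, with the derivative as an explicit argument known only
    almost everywhere. The fundamental theorem is then built in, and the Leibniz rule reduces to
    Fubini. *)
Definition AC a b G g := mu.-integrable `[a, b] (EFin \o g) /\
  forall x, a <= x <= b -> G x = G a + \int[mu]_(t in `[a, x]) g t.

Lemma AC_continuous a b G g : a <= b -> AC a b G g ->
  {within `[a, b], continuous G}.
Proof.
move=> ab [ig Gg].
have := @continuous_prim a b g ab ig.
move=> cg.
have cg' : {within `[a, b], continuous
   (fun x => G a + \int[mu]_(t in `[a, x]) g t)}.
  by move=> x; apply: cvgD; [exact: cvg_cst|exact: cg].
apply: subspace_eq_continuous cg' => x; rewrite inE/= in_itv/= => xab.
exact/esym/Gg.
Qed.

Lemma AC_cst a b c : AC a b (fun=> c) (fun=> 0).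
Proof.
split=> [|x xab]; first by apply: integrable0.
by rewrite /Rintegral integral0 /= addr0.
Qed.

Let integrable_sub a b x g : x <= b -> mu.-integrable `[a, b] (EFin \o g) ->
  mu.-integrable `[a, x] (EFin \o g).
Proof. by move=> xb; apply: integrableS => //; exact: segment_subset. Qed.

Lemma AC_add a b G K g k : AC a b G g -> AC a b K k ->
  AC a b (fun x => G x + K x) (fun x => g x + k x).
Proof.
move=> [ig Gg] [ik Kk]; split.
  rewrite (_ : _ \o _ = (EFin \o g) \+ (EFin \o k))%E; first exact: integrableD.
  by apply/funext => x /=; rewrite EFinD.
move=> x xab; have /andP[ax xb] := xab.
rewrite (Gg _ xab) (Kk _ xab) RintegralD//; [ring| |];
  by apply: integrable_sub; eassumption.
Qed.

Lemma AC_mul a b G K g k : a <= b -> AC a b G g -> AC a b K k ->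
  AC a b (fun x => G x * K x) (fun x => g x * K x + G x * k x).
Proof.
move=> ab ACG ACK.
have cG := AC_continuous ab ACG; have cK := AC_continuous ab ACK.
case: ACG ACK => ig Gg [ik Kk].
have igK := integrable_mul_continuous cK ig.
have ikG := integrable_mul_continuous cG ik.
have ikG' : mu.-integrable `[a, b] (EFin \o (fun x => G x * k x)).
  by apply: eq_integrable ikG => //= x _ /=; rewrite mulrC.
split.
  rewrite (_ : _ \o _ = (EFin \o (g \* K)%R) \+ (EFin \o (fun x => G x * k x)%R))%E.
    exact: integrableD.
  by apply/funext => x /=; rewrite EFinD.
move=> x xab; have /andP[ax xb] := xab.
have igx := integrable_sub xb ig; have ikx := integrable_sub xb ik.
(* Each function is its value at [a] plus a primitive: the integrand splits into a part linear in
   [g] and [k] and exactly the integrand of [prim_prod]. *)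
rewrite (@eq_Rintegral _ _ _ mu `[a, x]
  (fun t => (K a * g t + G a * k t) + (g t * (\int[mu]_(t in `[a, t]) k t)
                          + (\int[mu]_(t in `[a, t]) g t) * k t))); last first.
  move=> t; rewrite inE/= in_itv/= => /andP[at_ tx].
  have tab : a <= t <= b by rewrite at_ (le_trans tx).
  by rewrite (Gg _ tab) (Kk _ tab); ring.
have Zg (c : R) h : mu.-integrable `[a, x] (EFin \o h) ->
    mu.-integrable `[a, x] (EFin \o (fun t => c * h t)).
  move=> ih; rewrite (_ : _ \o _ = (fun t => c%:E * (EFin \o h) t)%E)//.
  exact: integrableZl.
have cg := continuous_prim ax igx; have ck := continuous_prim ax ikx.
have igk := integrable_mul_continuous ck igx.
have ikg := integrable_mul_continuous cg ikx.
have ikg' : mu.-integrable `[a, x]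
    (EFin \o (fun t => (\int[mu]_(t in `[a, t]) g t) * k t)).
  by apply: eq_integrable ikg => //= t _ /=; rewrite mulrC.
have Dg h1 h2 : mu.-integrable `[a, x] (EFin \o h1) ->
    mu.-integrable `[a, x] (EFin \o h2) ->
    mu.-integrable `[a, x] (EFin \o (fun t => h1 t + h2 t)).
  move=> ih1 ih2; rewrite (_ : _ \o _ = (EFin \o h1) \+ (EFin \o h2))%E//.
  exact: integrableD.
rewrite RintegralD//; [|exact: Dg (Zg _ _ _) (Zg _ _ _)|exact: Dg].
rewrite prim_prod// RintegralD//; [|exact: Zg|exact: Zg].
rewrite !RintegralZl// (Gg _ xab) (Kk _ xab); ring.
Qed.

Lemma AC_opp a b G g : a <= b -> AC a b G g ->
  AC a b (fun x => - G x) (fun x => - g x).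
Proof.
move=> ab ACG; have [ig Gg] := AC_mul ab (AC_cst a b (-1)) ACG.
split.
  by apply: eq_integrable ig => //= x _ /=; rewrite mul0r add0r mulN1r.
move=> x xab; rewrite -mulN1r Gg// mulN1r; congr (_ + _).
by apply: eq_Rintegral => t _; rewrite mul0r add0r mulN1r.
Qed.

Lemma AC_sub a b c d G g : a <= c -> d <= b -> AC a b G g -> AC c d G g.
Proof.
move=> ac db [ig Gg]; split.
  by apply: integrableS ig => //; exact: segment_subset.
move=> x /andP[cx xd].
have xb := le_trans xd db.
rewrite (Gg x); last by rewrite (le_trans ac cx).
rewrite (Gg c); last by rewrite ac (le_trans cx).
rewrite -addrA; congr (_ + _).
have igx := integrable_sub xb ig.
rewrite -(@Rintegral_itv_obnd_cbnd _ c); last first.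
  by apply: integrableS igx => //; apply: subset_itv; rewrite bnd_simp.
by rewrite -(@Rintegral_itvB _ g (BLeft a) (BRight x) c)//; first ring.
Qed.

Lemma AC_eq a b G G' g g' : AC a b G g ->
  (forall x, a <= x <= b -> G x = G' x) -> (forall x, a <= x <= b -> g x = g' x) ->
  AC a b G' g'.
Proof.
move=> [ig Gg] GG' gg'; split.
  apply: eq_integrable ig => //= x; rewrite inE/= in_itv/= => xab.
  by rewrite gg'.
move=> x xab; have /andP[ax xb] := xab.
have aab : a <= a <= b by rewrite lexx (le_trans ax).
rewrite -GG'// -GG'// Gg//; congr (_ + _).
apply: eq_Rintegral => t; rewrite inE/= in_itv/= => /andP[at_ tx].
by rewrite gg'// at_ (le_trans tx).
Qed.

Lemma AC_FTC a b G g : a <= b -> AC a b G g ->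
  \int[mu]_(t in `[a, b]) g t = G b - G a.
Proof. by move=> ab [_ Gg]; rewrite (Gg b) ?ab ?lexx//; ring. Qed.

End absolutely_continuous.

(** * Weak derivatives *)

Section smooth_bump.
Context {R : realType}.
Implicit Types (f g : R -> R) (P : {poly R}) (x y : R).

(** Derivatives are peeled off from the front, so that an induction hypothesis general in [f]
    applies to [derive1 f]; [smoothP] returns to the iterated derivatives of [test_fun]. *)
Fixpoint n_derivable (n : nat) f : Prop :=
  if n is m.+1 then (forall x, derivable f x 1) /\ n_derivable m (derive1 f)
  else True.

Definition smooth f := forall n, n_derivable n f.

Lemma n_derivableW n f : n_derivable n.+1 f -> n_derivable n f.
Proof.
elim: n f => [//|n IHn] f [df nf]; split => //; exact: IHn.
Qed.

Lemma smoothP f : smooth f -> forall n x, derivable (derive1n n f) x 1.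
Proof.
move=> sf n; elim: n f sf => [|n IHn] f sf x; first by have [] := sf 1%N.
rewrite derive1Sn; apply: IHn => m; by have [] := sf m.+1.
Qed.

Lemma smooth_derivable f : smooth f -> forall x, derivable f x 1.
Proof. by move=> /smoothP/(_ 0%N). Qed.

Lemma smooth_continuous f : smooth f -> continuous f.
Proof.
move=> sf x; apply: differentiable_continuous; apply/derivable1_diffP.
exact: smooth_derivable.
Qed.

Lemma derive1_smooth f g : (forall x, is_derive x 1 f (g x)) -> smooth g ->
  smooth f.
Proof.
move=> fg sg [//|n]; split=> [x|]; first by have [] := fg x.
rewrite (_ : derive1 f = g)//; apply/funext => x.
by rewrite derive1E; exact: derive_val.
Qed.

Lemma n_derivableD n f g : n_derivable n f -> n_derivable n g ->
  n_derivable n (fun x => f x + g x).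
Proof.
elim: n f g => [//|n IHn] f g [df nf] [dg ng].
split => [x|]; first exact: derivableD.
rewrite (_ : derive1 _ = (fun x => derive1 f x + derive1 g x)); first exact: IHn.
by apply/funext => x; rewrite !derive1E -(@deriveD _ _ _ f g).
Qed.

Lemma n_derivableM n f g : n_derivable n f -> n_derivable n g ->
  n_derivable n (fun x => f x * g x).
Proof.
elim: n f g => [//|n IHn] f g nf' ng'.
have [df nf] := nf'; have [dg ng] := ng'.
split => [x|]; first exact: derivableM.
rewrite (_ : derive1 _ = (fun x => f x * derive1 g x + g x * derive1 f x)).
  by apply: n_derivableD; apply: IHn => //; exact: n_derivableW.
by apply/funext => x; rewrite !derive1E (@deriveM _ _ f g).
Qed.

Lemma n_derivable_cst n (c : R) : n_derivable n (fun=> c).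
Proof.
elim: n c => [//|n IHn] c; split => [x|]; first exact: derivable_cst.
rewrite (_ : derive1 _ = fun=> 0)//; apply/funext => x.
by rewrite -(derive1_cst c x).
Qed.

Lemma smoothD f g : smooth f -> smooth g -> smooth (fun x => f x + g x).
Proof. by move=> sf sg n; exact: n_derivableD. Qed.

Lemma smoothM f g : smooth f -> smooth g -> smooth (fun x => f x * g x).
Proof. by move=> sf sg n; exact: n_derivableM. Qed.

Lemma is_derive_affine (c b x : R) : is_derive x 1 (fun y => c * y + b) c.
Proof.
apply: is_derive_eq; rewrite /= /GRing.scale/=; ring.
Qed.

Lemma is_derive_comp_affine f (c b x df : R) :
  is_derive (c * x + b) 1 f df -> is_derive x 1 (fun y => f (c * y + b)) (c * df).
Proof.
move=> fd; rewrite mulrC.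
exact: (@is_derive1_comp _ f (fun y => c * y + b) x df c fd (is_derive_affine c b x)).
Qed.

Lemma smoothZ f (c : R) : smooth f -> smooth (fun x => c * f x).
Proof. by move=> sf n; apply: n_derivableM => //; exact: n_derivable_cst. Qed.

Lemma smooth_comp_affine f (c b : R) : smooth f -> smooth (fun x => f (c * x + b)).
Proof.
move=> sf n; have : n_derivable n f by [].
elim: n f {sf} => [//|n IHn] f [df nf].
have dfx x : is_derive x 1 (fun y => f (c * y + b)) (c * derive1 f (c * x + b)).
  apply: is_derive_comp_affine; rewrite derive1E.
  by apply: DeriveDef.
split => [x|]; first by have [] := dfx x.
rewrite (_ : derive1 _ = (fun x => c * derive1 f (c * x + b))).
  by apply: n_derivableM; [exact: n_derivable_cst|exact: IHn].
by apply/funext => x; rewrite derive1E; apply: derive_val.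
Qed.

(** Induction on the polynomial: multiplication by X raises [n] by one, and the constant term needs
    only [y ^+ n <= n! e^y]. The larger constant [(n.+1)! * 2] also covers [n = 0]. *)
Lemma poly_expR_bounded P n : exists2 C : R, 0 <= C &
  forall y, 0 < y -> y ^+ n * `|P.[y]| * expR (- y) <= C.
Proof.
elim/poly_ind: P n => [|P c IHP] n.
  by exists 0 => // y _; rewrite horner0 normr0 mulr0 mul0r.
have [C1 C10 HC1] := IHP n.+1.
exists (C1 + `|c| * (n.+1)`!%:R * 2) => [|y y0].
  by rewrite addr_ge0// !mulr_ge0.
rewrite hornerMXaddC.
have e0 := expR_gt0 (- y).
have yn0 : 0 <= y ^+ n by rewrite exprn_ge0// ltW.
apply: (@le_trans _ _ (y ^+ n.+1 * `|P.[y]| * expR (- y)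
   + `|c| * (y ^+ n * expR (- y)))).
  rewrite (_ : _ + _ = y ^+ n * (`|P.[y]| * y + `|c|) * expR (- y)); last first.
    by rewrite exprS; ring.
  rewrite ler_wpM2r// ?(ltW e0)//; apply: ler_wpM2l => //.
  by rewrite (le_trans (ler_normD _ _))// normrM (gtr0_norm y0).
rewrite lerD ?HC1// -mulrA ler_wpM2l//.
rewrite expRN ler_pdivrMr ?expR_gt0//.
have [n0|n0] := eqVneq n 0%N.
  rewrite n0 expr0 (_ : 1`! = 1)%N// mul1r.
  have := expR_ge1Dx y; lra.
have := expR_ge1Dxn n.-1 (ltW y0); rewrite prednK ?lt0n// => H.
have f0 : (0 : R) < n`!%:R by rewrite ltr0n fact_gt0.
apply: (@le_trans _ _ (n`!%:R * expR y)).
  rewrite mulrC -ler_pdivrMr//; apply: le_trans H; by rewrite lerDr.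
rewrite ler_wpM2r ?expR_ge0//.
have : (n`!%:R : R) <= (n.+1)`!%:R by rewrite ler_nat factS leq_pmull.
have : (0 : R) <= (n.+1)`!%:R by [].
lra.
Qed.

(** The functions P(1/x) e^(-1/x), extended by 0, form a class stable under differentiation.
    Smoothness of all of them is then an induction resting on a single first derivative. *)
Definition exp_poly P x : R := if 0 < x then P.[x^-1] * expR (- x^-1) else 0.

(** A quadratic bound at 0 makes the difference quotient there tend to 0, which settles the only
    delicate point in the derivative of [exp_poly P]. *)
Lemma exp_poly_quadratic P : exists2 C : R, 0 <= C &
  forall x, `|exp_poly P x| <= C * x ^+ 2.
Proof.
have [C C0 HC] := poly_expR_bounded P 2.
exists C => // x; rewrite /exp_poly; case: ifPn => x0; last first.
  by rewrite normr0 mulr_ge0// sqr_ge0.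
have := HC x^-1; rewrite invr_gt0 => /(_ x0).
rewrite normrM (gtr0_norm (expR_gt0 _)) exprVn -mulrA ler_pdivrMl ?exprn_gt0//.
by rewrite [C * _]mulrC.
Qed.

Lemma is_derive_exp_poly P x :
  is_derive x 1 (exp_poly P) (exp_poly ('X^2 * (P - P^`())) x).
Proof.
have [x0|x0|->] := ltgtP x 0.
- rewrite {2}/exp_poly ltNge (ltW x0)/=.
  have near0 : \forall y \near x, (fun=> 0 : R) y = exp_poly P y.
    near=> y; rewrite /exp_poly ltNge ltW//.
    by near: y; exact: lt_nbhsl.
  have : is_derive x 1 (fun=> 0 : R) 0 by exact: is_derive_cst.
  exact: near_eq_is_derive.
- rewrite {2}/exp_poly x0 hornerM hornerXn hornerD hornerN.
  have near0 : \forall y \near x, P.[y^-1] * expR (- y^-1) = exp_poly P y.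
    near=> y; rewrite /exp_poly ifT//.
    by near: y; exact: lt_nbhsr.
  apply: (near_eq_is_derive near0).
  have xn0 : x != 0 by rewrite gt_eqF.
  have dV : is_derive x 1 (fun y : R => y^-1) (- x ^- 2).
    have did : derivable (@id R) x 1 by exact: derivable_id.
    apply: DeriveDef; first exact: (@derivableV _ _ id).
    by rewrite (@deriveV _ _ id)// derive_id /GRing.scale/= mulr1.
  have dP := @is_derive1_comp _ (horner P) _ x _ _ (is_derive_poly P x^-1) dV.
  have dE : is_derive x 1 (fun y : R => expR (- y^-1)) (expR (- x^-1) * x ^- 2).
    have dN : is_derive x 1 (fun y : R => - y^-1) (x ^- 2).
      by have := is_deriveN dV; rewrite opprK.
    exact: (@is_derive1_comp _ expR _ x _ _ (is_derive_expR _) dN).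
  apply: is_derive_eq (is_deriveM dP dE) _.
  by rewrite /GRing.scale/= exprVn; ring.
- rewrite {2}/exp_poly ltxx.
  have [C C0 HC] := exp_poly_quadratic P.
  have e0 : exp_poly P 0 = 0 by rewrite /exp_poly ltxx.
  have H : (fun h : R => h^-1 *: ((exp_poly P \o shift 0) (h *: (1:R)) - exp_poly P 0))
     @ (0 : R)^' --> (0 : R).
    rewrite e0; apply/cvgrPdist_le => /= e e_gt0.
    have C1 : 0 < C + 1 by rewrite ltr_wpDl.
    exists (e / (C + 1)) => /=; first by rewrite divr_gt0.
    move=> h /=; rewrite sub0r normrN => he h0.
    rewrite sub0r normrN subr0 addr0 /GRing.scale/= mulr1 normrM normfV.
    rewrite ler_pdivrMl ?normr_gt0//.
    apply: le_trans (HC h) _.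
    rewrite -(real_normK (num_real h)) mulrC expr2 -mulrA ler_wpM2l//.
    move: he; rewrite ltr_pdivlMr// => he; apply: le_trans (ltW he).
    by rewrite ler_wpM2l// lerDl.
  apply: DeriveDef; first by apply/cvg_ex; exists 0.
  by rewrite /derive; apply/cvg_lim.
Unshelve. all: by end_near. Qed.

Lemma smooth_exp_poly P : smooth (exp_poly P).
Proof.
move=> n; elim: n P => [//|n IHn] P; split => [x|].
  by have [] := is_derive_exp_poly P x.
rewrite (_ : derive1 _ = exp_poly ('X^2 * (P - P^`())))//.
apply/funext => x; rewrite derive1E.
by have [_ ->] := is_derive_exp_poly P x.
Qed.

End smooth_bump.

Section bump_step.
Context {R : realType}.
Notation mu := (@lebesgue_measure R).
Implicit Types x y : R.

Definition bump x : R := exp_poly 1 x * exp_poly 1 (-1 * x + 1).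

Lemma smooth_bump : smooth bump.
Proof.
by apply: smoothM; [|apply: (@smooth_comp_affine _ (exp_poly 1))];
  exact: smooth_exp_poly.
Qed.

Lemma bump_ge0 x : 0 <= bump x.
Proof.
rewrite /bump /exp_poly !hornerC !mul1r.
by case: ifPn => _; case: ifPn => _; rewrite ?(mul0r, mulr0)// mulr_ge0// expR_ge0.
Qed.

Lemma bump_le1 x : bump x <= 1.
Proof.
rewrite /bump /exp_poly !hornerC !mul1r.
have H y : 0 < y -> expR (- y^-1) <= 1.
  by move=> y0; rewrite -expR0 ler_expR oppr_le0 invr_ge0 ltW.
case: ifPn => x0; case: ifPn => x1; rewrite ?(mul0r, mulr0)//.
by rewrite -[leRHS]mulr1 ler_pM ?expR_ge0// H.
Qed.

Lemma bump_gt0 x : 0 < x < 1 -> 0 < bump x.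
Proof.
move=> /andP[x0 x1]; rewrite /bump /exp_poly !hornerC !mul1r x0.
by rewrite ifT ?mulr_gt0 ?expR_gt0//; lra.
Qed.

Lemma bump_out x : ~~ (0 < x < 1) -> bump x = 0.
Proof.
rewrite /bump /exp_poly !hornerC !mul1r negb_and => /orP[/negbTE ->|x1].
  by rewrite mul0r.
by rewrite (ifF _ _ (_ : (0 < -1 * x + 1) = false)) ?mulr0//; apply/negbTE; lra.
Qed.

Lemma integrable_bump (a b : R) : mu.-integrable `[a, b] (EFin \o bump).
Proof.
apply: continuous_compact_integrable; first exact: segment_compact.
apply: continuous_subspaceT => x; exact: smooth_continuous smooth_bump x.
Qed.

(** A smooth step, 0 up to the origin and constant from 1 on. It is not normalized, since its height
    [step 1] will cancel. The base point -1 makes 0 an interior point for the fundamental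
    theorem. *)
Definition step x : R := \int[mu]_(t in `[-1, x]) bump t.

Lemma step_le0 x : x <= 0 -> step x = 0.
Proof.
move=> x0; rewrite /step (@eq_Rintegral _ _ _ _ _ (fun=> 0)).
  by rewrite /Rintegral integral0.
move=> t; rewrite inE/= in_itv/= => /andP[_ tx]; apply: bump_out.
by rewrite negb_and -leNgt (le_trans tx).
Qed.

Lemma is_derive_step x : is_derive x 1 step (bump x).
Proof.
have [x0|x0] := ltP x 0.
  rewrite bump_out; last by rewrite negb_and -leNgt ltW.
  have near0 : \forall y \near x, (fun=> 0 : R) y = step y.
    by near=> y; rewrite step_le0// ltW//; near: y; exact: lt_nbhsl.
  have : is_derive x 1 (fun=> 0 : R) 0 by exact: is_derive_cst.
  exact: near_eq_is_derive.
have xx1 : x < x + 1 by rewrite ltrDl.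
have [] := @continuous_FTC1_closed _ bump (-1) x (x + 1) xx1
  (integrable_bump _ _) _ _.
- by rewrite (lt_le_trans _ x0)// ltrN10.
- exact: smooth_continuous smooth_bump x.
by move=> dS; rewrite derive1E => S'; exact: DeriveDef.
Unshelve. all: by end_near. Qed.

Lemma smooth_step : smooth step.
Proof. exact: derive1_smooth is_derive_step smooth_bump. Qed.

Lemma nondecreasing_step x y : x <= y -> step x <= step y.
Proof.
move=> xy.
have dS z : derivable step z 1 by have [] := is_derive_step z.
apply: (@ger0_derive1_ndecr _ step x y) => //.
- move=> z _; rewrite derive1E.
  by have [_ ->] := is_derive_step z; exact: bump_ge0.
- apply: continuous_subspaceT => z.
  exact: smooth_continuous smooth_step z.
Qed.

Lemma step_ge1 x : 1 <= x -> step x = step 1.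
Proof.
move=> x1.
apply/eqP; rewrite eq_le; apply/andP; split; last exact: nondecreasing_step.
have dS z : derivable step z 1 by have [] := is_derive_step z.
apply: (@ler0_derive1_nincr _ step 1 x) => //.
- move=> z; rewrite in_itv/= => /andP[z1 _]; rewrite derive1E.
  have [_ ->] := is_derive_step z; rewrite bump_out//.
  by rewrite negb_and -!leNgt (ltW z1) orbT.
- apply: continuous_subspaceT => z.
  exact: smooth_continuous smooth_step z.
Qed.

(** Otherwise [step], being monotone, would be constant on [[0, 1]], and its derivative at 1/2 would
    vanish although [bump] is positive there. *)
Lemma step1_gt0 : 0 < step 1.
Proof.
rewrite lt_neqAle eq_sym -(step_le0 (lexx 0)) nondecreasing_step// andbT.
apply/negP => /eqP S10.
have S0 z : 0 <= z <= 1 -> step z = step 0.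
  move=> /andP[z0 z1]; apply/eqP.
  by rewrite eq_le -{1}S10 !nondecreasing_step.
have near0 : \forall y \near (2^-1 : R), (fun=> step 0) y = step y.
  near=> y; rewrite S0//; apply/andP; split.
    by apply: ltW; near: y; apply: lt_nbhsr; rewrite invr_gt0.
  by apply: ltW; near: y; apply: lt_nbhsl; rewrite invf_lt1// ltr1n.
have : is_derive (2^-1 : R) 1 step 0.
  apply: (near_eq_is_derive near0); exact: is_derive_cst.
move=> [_ d0]; have [_ d1] := is_derive_step (2^-1 : R).
have := @bump_gt0 (2^-1); rewrite -d1 d0 ltxx => /(_ _)/negP; apply.
by lra.
Unshelve. all: by end_near. Qed.

End bump_step.

Section almost_everywhere.
Context d (Y : measurableType d) (R : realType) (mu : {measure set Y -> \bar R}).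
Implicit Types P Q : Y -> Prop.

Lemma aeW P : (forall x, P x) -> {ae mu, forall x, P x}.
Proof. by move=> HP; exists set0; split => // x; have := HP x. Qed.

Lemma aeS P Q : (forall x, P x -> Q x) ->
  {ae mu, forall x, P x} -> {ae mu, forall x, Q x}.
Proof. by apply: filterS; exact: (ae_filter_ringOfSetsType mu). Qed.

Lemma aeI P Q : {ae mu, forall x, P x} -> {ae mu, forall x, Q x} ->
  {ae mu, forall x, P x /\ Q x}.
Proof. by apply: filterI; exact: (ae_filter_ringOfSetsType mu). Qed.

Lemma aeS2 P Q P' : (forall x, P x -> Q x -> P' x) ->
  {ae mu, forall x, P x} -> {ae mu, forall x, Q x} -> {ae mu, forall x, P' x}.
Proof. by move=> H HP HQ; apply: aeS (aeI HP HQ) => x []; exact: H. Qed.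

Lemma ae_Rintegral (D : set Y) (f g : Y -> R) : measurable D ->
  measurable_fun D f -> measurable_fun D g ->
  {ae mu, forall x, D x -> f x = g x} ->
  \int[mu]_(x in D) f x = \int[mu]_(x in D) g x.
Proof.
move=> mD mf mg fg; rewrite /Rintegral; congr fine; apply: ae_eq_integral => //.
- exact/measurable_EFinP.
- exact/measurable_EFinP.
- by apply: aeS fg => x fg Dx; rewrite fg.
Qed.

End almost_everywhere.

Section weak_derivative_1d.
Context {R : realType}.
Notation mu := (@lebesgue_measure R).
Implicit Types (a b c x y : R) (G K g h k : R -> R).

Lemma AC_derive a b G g : a <= b -> {within `[a, b], continuous G} ->
  {within `[a, b], continuous g} ->
  (forall x, a < x < b -> is_derive x 1 G (g x)) -> AC a b G g.
Proof.
move=> ab cG cg dG; split.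
  by apply: continuous_compact_integrable => //; exact: segment_compact.
move=> x /andP[]; rewrite le_eqVlt => /predU1P[<- _|ax xb].
  by rewrite set_itv1 Rintegral_set1 addr0.
have sub : `[a, x] `<=` `[a, b] by exact: segment_subset.
have cGx := continuous_subspaceW sub cG.
have cgx := continuous_subspaceW sub cg.
have [cG1 cG2 cG3] := (continuous_within_itvP G ax).1 cGx.
rewrite /Rintegral (@continuous_FTC2 _ g G a x ax)//=.
- by ring.
- split => //= y; rewrite in_itv/= => /andP[ay yx].
  by have [] := dG y; first by rewrite ay (lt_le_trans yx).
- move=> y; rewrite in_itv/= => /andP[ay yx]; rewrite derive1E.
  by have [|_ ->] := dG y; first by rewrite ay (lt_le_trans yx).
Qed.

Lemma AC_derive_everywhere a b G g : a <= b -> continuous g ->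
  (forall x, is_derive x 1 G (g x)) -> AC a b G g.
Proof.
move=> ab cg dG; apply: AC_derive => //; apply: continuous_subspaceT => x.
  apply: differentiable_continuous; apply/derivable1_diffP.
  by have [] := dG x.
exact: cg.
Qed.

Lemma segment_RintegralD a b g h : mu.-integrable `[a, b] (EFin \o g) ->
  mu.-integrable `[a, b] (EFin \o h) ->
  \int[mu]_(t in `[a, b]) (g t + h t) =
  \int[mu]_(t in `[a, b]) g t + \int[mu]_(t in `[a, b]) h t.
Proof. by move=> ig ih; rewrite RintegralD. Qed.

Lemma segment_RintegralB a b g h : mu.-integrable `[a, b] (EFin \o g) ->
  mu.-integrable `[a, b] (EFin \o h) ->
  \int[mu]_(t in `[a, b]) (g t - h t) =
  \int[mu]_(t in `[a, b]) g t - \int[mu]_(t in `[a, b]) h t.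
Proof. by move=> ig ih; rewrite RintegralB. Qed.

Definition mollifier (n : nat) (p x : R) : R :=
  n.+1%:R * bump (n.+1%:R * x + - (n.+1%:R * p)).

(** A test function whose derivative is the difference of two mollifiers: testing against it
    compares the local averages of a function near [p] and near [q]. Its support is compact because
    both steps have the same height. *)
Definition plateau (n : nat) (p q x : R) : R :=
  step (n.+1%:R * x + - (n.+1%:R * p)) - step (n.+1%:R * x + - (n.+1%:R * q)).

Lemma is_derive_plateau n p q x :
  is_derive x 1 (plateau n p q) (mollifier n p x - mollifier n q x).
Proof.
apply: is_deriveB; apply: is_derive_comp_affine; exact: is_derive_step.
Qed.

Lemma smooth_mollifier n p : smooth (mollifier n p).
Proof. by apply: smoothZ; apply: smooth_comp_affine; exact: smooth_bump. Qed.

Lemma mollifier_out n p x : ~~ (p <= x <= p + n.+1%:R^-1) -> mollifier n p x = 0.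
Proof.
move=> xp; rewrite /mollifier bump_out ?mulr0//.
apply: contra xp => /andP[]; rewrite subr_gt0 ltr_pM2l// => /ltW -> /=.
by rewrite -mulrBr -ltr_pdivlMl// mulr1 ltrBlDl => /ltW.
Qed.

Lemma mollifier_bounds n p x : 0 <= mollifier n p x <= n.+1%:R.
Proof.
rewrite mulr_ge0 ?bump_ge0//=.
by rewrite -[leRHS]mulr1 ler_wpM2l// bump_le1.
Qed.

Lemma Rintegral_mollifier n p :
  \int[mu]_(t in `[p, p + n.+1%:R^-1]) mollifier n p t = step 1.
Proof.
have pn : p <= p + n.+1%:R^-1 by rewrite lerDl.
have := @AC_FTC _ p (p + n.+1%:R^-1)
  (fun x => step (n.+1%:R * x + - (n.+1%:R * p))) (mollifier n p) pn.
rewrite mulrDr divff// subrr (step_le0 (lexx 0)) subr0 addrAC subrr add0r.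
apply; apply: AC_derive_everywhere => //.
  exact: smooth_continuous (smooth_mollifier n p).
move=> x; apply: is_derive_comp_affine; exact: is_derive_step.
Qed.

Lemma plateau_test_fun a b n p q : a < p -> a < q ->
  p + n.+1%:R^-1 < b -> q + n.+1%:R^-1 < b -> test_fun a b (plateau n p q).
Proof.
move=> ap aq pb qb; split.
  apply: smoothP; apply: (derive1_smooth (is_derive_plateau n p q)).
  have := smoothD (smooth_mollifier n p) (smoothZ (-1) (smooth_mollifier n q)).
  congr smooth; apply/funext => x; ring.
exists (Num.min p q), (Num.max (p + n.+1%:R^-1) (q + n.+1%:R^-1)); split.
- by rewrite lt_min ap.
- by rewrite gt_max pb.
- move=> x; rewrite /= in_itv/= => /negP; rewrite negb_and -!ltNge => /orP[|].
    rewrite lt_min => /andP[xp xq].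
    by rewrite /plateau !step_le0 ?subr0// subr_le0 ler_pM2l// ltW.
  rewrite gt_max => /andP[xp xq].
  have H r : r + n.+1%:R^-1 < x -> 1 <= n.+1%:R * x - n.+1%:R * r.
    by move=> rx; rewrite -mulrBr -ler_pdivrMl// mulr1 lerBrDl ltW.
  by rewrite /plateau (step_ge1 (H _ xp)) (step_ge1 (H _ xq)) subrr.
Qed.

Lemma integrable_mul_mollifier a b k n p : mu.-integrable `[a, b] (EFin \o k) ->
  mu.-integrable `[a, b] (EFin \o (k \* mollifier n p)).
Proof.
apply: integrable_mul_continuous; apply: continuous_subspaceT => x.
exact: smooth_continuous (smooth_mollifier n p) x.
Qed.

(** The support of the mollifier lies in the ball of radius 1/(n+1) about [x], so the error is
    controlled by the average of [|k - k x|] over that ball. Uniformity in [p] close to [x] leaves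
    room for rational centres. *)
Lemma mollifier_lebesgue_pt k x e : 0 < e -> mu.-integrable setT (EFin \o k) ->
  lebesgue_pt k x -> \forall n \near \oo, forall p,
    x - n.+1%:R^-1 < p < x ->
    `|\int[mu]_(t in `[p, p + n.+1%:R^-1]) (k t * mollifier n p t) - k x * step 1|
    <= e.
Proof.
move=> e0 ik lx.
(* Half of [e], because the ball has length 2r while the mollifier has height at most 1/r. *)
have /fine_cvgP[fin /cvgrPdist_le/(_ (e / 2))] := lx.
rewrite divr_gt0// => /(_ isT) [d1 /= d10 H1].
have [d2 /= d20 H2] := fin.
have d0 : 0 < Num.min d1 d2 by rewrite lt_min d10.
near=> n.
have rd : n.+1%:R^-1 < Num.min d1 d2.
  by near: n; exact: (near_infty_natSinv_lt (PosNum d0)).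
move=> p /andP[xp px]; set r : R := n.+1%:R^-1.
have r0 : 0 < r by rewrite invr_gt0.
move: rd; rewrite -/r; rewrite lt_min => /andP[rd1 rd2].
have rdist d : r < d -> `|0 - r| < d by rewrite sub0r normrN gtr0_norm.
have {}H1 := H1 _ (rdist _ rd1) r0; have {}H2 := H2 _ (rdist _ rd2) r0.
set J := `[p, p + r]%classic.
have JB : J `<=` ball x r.
  rewrite ball_itv; apply: subset_itv; rewrite bnd_simp//.
  by rewrite ltrD2r.
have mJ : measurable J by exact: measurable_itv.
have ikJ : mu.-integrable J (EFin \o k) by apply: integrableS ik.
have ikx : mu.-integrable J (EFin \o cst (k x)).
  apply: continuous_compact_integrable; first exact: segment_compact.
  by apply: continuous_subspaceT => ?; exact: cvg_cst.
have ikkx : mu.-integrable J (EFin \o (fun t => k t - k x)).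
  rewrite (_ : _ \o _ = (EFin \o k) \- (EFin \o cst (k x)))%E//.
  exact: integrableB.
rewrite -(Rintegral_mollifier n p) -RintegralZl//; last first.
  apply: continuous_compact_integrable; first exact: segment_compact.
  apply: continuous_subspaceT => y.
  exact: smooth_continuous (smooth_mollifier n p) y.
rewrite -RintegralB//; last 2 first.
- exact: (@integrable_mul_mollifier _ _ k).
- exact: (@integrable_mul_mollifier _ _ (cst (k x))).
rewrite (@eq_Rintegral _ _ _ mu J (fun t => (k t - k x) * mollifier n p t));
  last by move=> t _; rewrite mulrBl.
have im := @integrable_mul_mollifier p (p + r) _ n p ikkx.
apply: le_trans (le_normr_Rintegral _ _) _ => //.
have ikkx' := integrable_norm ikkx.
apply: (@le_trans _ _ (\int[mu]_(t in J) (n.+1%:R * `|k t - k x|))).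
  apply: le_Rintegral => //.
  - exact: (integrable_norm im).
  - rewrite (_ : _ \o _ = (fun t => n.+1%:R%:E * (`|k t - k x|)%:E)%E)//.
    exact: (integrableZl _ _ ikkx').
  move=> t _; rewrite normrM mulrC ler_wpM2r//.
  by have /andP[m0 m1] := mollifier_bounds n p t; rewrite ger0_norm.
rewrite RintegralZl//.
have : (davg k x r <= (e / 2)%:E)%E.
  rewrite -(fineK H2) lee_fin; move: H1; rewrite /= sub0r normrN => H1.
  exact: le_trans (ler_norm _) H1.
rewrite /davg /iavg lebesgue_measure_ball ?(ltW r0)// => Hd.
have mk : measurable_fun setT k by apply/measurable_EFinP; exact: measurable_int ik.
have mkx : measurable_fun setT (fun t => k t - k x) by exact: measurable_funB.
have int0 : (0 <= \int[mu]_(y in ball x r) `|((center (k x) \o k) y)%:E|)%E.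
  exact: integral_ge0.
have JBint : (\int[mu]_(t in J) `|(k t - k x)%:E| <=
     \int[mu]_(y in ball x r) `|((center (k x) \o k) y)%:E|)%E.
  rewrite (_ : (fun y => `|((center (k x) \o k) y)%:E|)%E = fun t => `|(k t - k x)%:E|%E)//.
  apply: ge0_subset_integral => //; first exact: measurable_ball.
  apply: measurable_funTS; apply/measurable_EFinP; exact: measurableT_comp.
have {Hd JBint} : (\int[mu]_(t in J) `|(k t - k x)%:E| <= (r *+ 2)%:E * (e / 2)%:E)%E.
  apply: le_trans JBint _.
  move: Hd; rewrite inver mulrn_eq0/= gt_eqF// lee_pdivrMl// ?mulrn_wgt0//.
have -> : (\int[mu]_(t in J) `|(k t - k x)%:E|)%E =
    (\int[mu]_(t in J) `|k t - k x|)%:E.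
  rewrite /Rintegral fineK//; exact: (integrable_fin_num _ ikkx').
rewrite -EFinM lee_fin => H.
rewrite -ler_pdivlMl// (le_trans H)// -/r mulr2n.
rewrite (_ : (r + r) * (e / 2) = r * e)//; by field.
Unshelve. all: by end_near. Qed.

(* The test functions form a countable family, so that in the weak derivative
   of a vector-valued function the exceptional sets can be united. *)
Lemma weak_derivative_AC a b g h : a < b ->
  mu.-integrable `[a, b] (EFin \o g) -> mu.-integrable `[a, b] (EFin \o h) ->
  (forall n (p q : rat), test_fun a b (plateau n (ratr p) (ratr q)) ->
    \int[mu]_(x in `]a, b[) (g x * derive1 (plateau n (ratr p) (ratr q)) x) =
    - \int[mu]_(x in `]a, b[) (h x * plateau n (ratr p) (ratr q) x)) ->
  exists c, {ae mu, forall x, a < x < b -> g x = c + \int[mu]_(t in `[a, x]) h t}.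
Proof.
move=> ab ig ih Hw; have abw := ltW ab.
pose H x := \int[mu]_(t in `[a, x]) h t.
have ACH : AC a b H h.
  by split=> // x _; rewrite /H set_itv1 Rintegral_set1 add0r.
have cH := AC_continuous abw ACH.
have iH : mu.-integrable `[a, b] (EFin \o H).
  by apply: continuous_compact_integrable => //; exact: segment_compact.
pose k := (fun x => g x - H x) \_ `[a, b].
have igH : mu.-integrable `[a, b] (EFin \o (fun x => g x - H x)).
  rewrite (_ : _ \o _ = (EFin \o g) \- (EFin \o H))%E//.
  exact: integrableB.
have ik : mu.-integrable setT (EFin \o k) by exact: integrable_patch.
have ikab : mu.-integrable `[a, b] (EFin \o k) by apply: integrableS ik.
(* Integrating [H * phi] by parts and subtracting it from the tested identity leaves [k = g - H]
   integrated against the derivative of the plateau: the averages of [k] near any two rational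
   points agree. *)
have Hk n (p q : rat) : let r := n.+1%:R^-1 in
    a < ratr p -> a < ratr q -> ratr p + r < b -> ratr q + r < b ->
  \int[mu]_(x in `[ratr p, ratr p + r]) (k x * mollifier n (ratr p) x) =
  \int[mu]_(x in `[ratr q, ratr q + r]) (k x * mollifier n (ratr q) x).
  move=> r ap aq pb qb.
  have tf := plateau_test_fun ap aq pb qb.
  have := Hw n p q tf.
  set phi := plateau _ _ _ in tf *.
  have phi' x : derive1 phi x = mollifier n (ratr p) x - mollifier n (ratr q) x.
    rewrite derive1E.
    by have [_ ->] := is_derive_plateau n (ratr p) (ratr q) x.
  have cm (z : R) := smooth_continuous (smooth_mollifier n z).
  have ACphi : AC a b phi (fun x => mollifier n (ratr p) x - mollifier n (ratr q) x).
    apply: AC_derive_everywhere => // x; last exact: is_derive_plateau.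
    by apply: cvgB; exact: cm.
  have cphi := AC_continuous abw ACphi.
  have [p0 q0] : phi a = 0 /\ phi b = 0.
    have [_ [a' [b' [aa' bb' out]]]] := tf.
    by split; apply: out; rewrite /= in_itv/=; apply/negP; rewrite negb_and -!ltNge ?aa' ?bb' ?orbT.
  have igm z := integrable_mul_mollifier n z ig.
  have iHm z := integrable_mul_mollifier n z iH.
  have ikm z := integrable_mul_mollifier n z ikab.
  have oo F : mu.-integrable `[a, b] (EFin \o F) ->
      \int[mu]_(x in `]a, b[) F x = \int[mu]_(x in `[a, b]) F x.
    move=> iF; rewrite Rintegral_itv_bndo_bndc; last first.
      by apply: integrableS iF => //; apply: subset_itv; rewrite bnd_simp.
    rewrite Rintegral_itv_obnd_cbnd//.
    by apply: integrableS iF => //; apply: subset_itv; rewrite bnd_simp.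
  have ihphi := integrable_mul_continuous cphi ih.
  have igp : mu.-integrable `[a, b] (EFin \o (fun x => g x * derive1 phi x)).
    rewrite (_ : _ \o _ = (EFin \o (g \* mollifier n (ratr p))%R) \-
       (EFin \o (g \* mollifier n (ratr q))%R))%E; first exact: integrableB.
    by apply/funext => x /=; rewrite phi' mulrBr.
  rewrite (oo _ igp) (oo _ ihphi) => gh.
  have := AC_FTC abw (AC_mul abw ACH ACphi).
  rewrite p0 q0 !mulr0 subr0.
  have iHp : mu.-integrable `[a, b] (EFin \o (fun x => H x * (mollifier n (ratr p) x - mollifier n (ratr q) x))).
    rewrite (_ : _ \o _ = (EFin \o (H \* mollifier n (ratr p))%R) \-
       (EFin \o (H \* mollifier n (ratr q))%R))%E; first exact: integrableB.
    by apply/funext => x /=; rewrite mulrBr.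
  rewrite (segment_RintegralD ihphi iHp) => hH.
  have : \int[mu]_(x in `[a, b]) (k x * mollifier n (ratr p) x - k x * mollifier n (ratr q) x) = 0.
    rewrite (@eq_Rintegral _ _ _ mu `[a, b] (fun x => g x * derive1 phi x -
       H x * (mollifier n (ratr p) x - mollifier n (ratr q) x))).
      rewrite (segment_RintegralB igp iHp) gh.
      by rewrite -opprD hH oppr0.
    by move=> x xab; rewrite /k patchE xab phi'; ring.
  rewrite (segment_RintegralB (ikm _) (ikm _)).
  have loc z : a < z -> z + r < b ->
     \int[mu]_(x in `[a, b]) (k x * mollifier n z x) =
     \int[mu]_(x in `[z, z + r]) (k x * mollifier n z x).
    move=> az zb; rewrite Rintegral_mkcond [RHS]Rintegral_mkcond.
    apply: eq_Rintegral => x _; rewrite !patchE.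
    have [xz|xz] := boolP (x \in `[z, z + r]%classic).
      rewrite ifT//; move: xz; rewrite !inE/=; apply: subset_itv; rewrite bnd_simp ltW//.
    case: ifPn => // _; rewrite mollifier_out ?mulr0//.
    by apply: contra xz => xz; rewrite inE/= in_itv.
  rewrite (loc _ ap pb) (loc _ aq qb) => /eqP.
  by rewrite subr_eq0 => /eqP.
have lk : {ae mu, forall x, lebesgue_pt k x}.
  by apply: lebesgue_differentiation; apply: open_integrable_locally => //; exact: openT.
(* At a Lebesgue point the averages of [k] converge to [k x * step 1]. Rational centres just left of
   [x] and [y] make [Hk] available, and the positive factor [step 1] cancels. *)
have kc x y : a < x < b -> a < y < b -> lebesgue_pt k x -> lebesgue_pt k y ->
    k x = k y.
  move=> /andP[ax xb] /andP[ay yb] lx ly.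
  suff S : k x * step 1 = k y * step 1.
    by apply: (mulIf _ S); rewrite gt_eqF// step1_gt0.
  apply/eqP; rewrite -subr_eq0 -normr_le0; apply/ler_addgt0Pr => e e0.
  rewrite add0r.
  have e20 : 0 < e / 2 by rewrite divr_gt0.
  have d0 : 0 < Num.min (Num.min (x - a) (b - x)) (Num.min (y - a) (b - y)).
    by rewrite !lt_min !subr_gt0 ax xb ay.
  have Nx := mollifier_lebesgue_pt e20 ik lx.
  have Ny := mollifier_lebesgue_pt e20 ik ly.
  have Nd := near_infty_natSinv_lt (PosNum d0).
  have [N _ /(_ N (leqnn N))[[{}Nx {}Ny] {}Nd]] := filterI (filterI Nx Ny) Nd.
  move: Nd => /=; rewrite !lt_min => /andP[/andP[xa bx] /andP[ya by_]].
  have r0 : (0 : R) < N.+1%:R^-1 by rewrite invr_gt0.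
  have [p] := @rat_in_itvoo _ (x - N.+1%:R^-1) x ltac:(by rewrite ltrBlDr ltrDl).
  rewrite in_itv/= => /andP[p1 p2].
  have [q] := @rat_in_itvoo _ (y - N.+1%:R^-1) y ltac:(by rewrite ltrBlDr ltrDl).
  rewrite in_itv/= => /andP[q1 q2].
  have := Hk N p q; rewrite /= => /(_ _ _ _ _) HN.
  have {}Nx := Nx (ratr p) ltac:(by rewrite p1 p2).
  have {}Ny := Ny (ratr q) ltac:(by rewrite q1 q2).
  move: r0 xa bx ya by_ p1 q1 HN Nx Ny; move: (N.+1%:R^-1 : R) => r.
  move=> r0 xa bx ya by_ p1 q1 HN Nx Ny.
  have ap : a < ratr p by clear - xa p1; lra.
  have aq : a < ratr q by clear - ya q1; lra.
  have pb : ratr p + r < b by clear - bx p2; lra.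
  have qb : ratr q + r < b by clear - by_ q2; lra.
  rewrite -(HN ap aq pb qb) in Ny.
  move: Nx Ny; set I := Rintegral _ _ _ => Nx Ny.
  rewrite (_ : _ - _ = (I - k y * step 1) - (I - k x * step 1)); last by ring.
  apply: le_trans (ler_normB _ _) _; clear - Nx Ny; lra.
(* The constant is the value of [k] at any Lebesgue point of the interval. If there were none, the
   conclusion would hold vacuously, so existence need not be argued. *)
have [[x0 [x0ab lx0]]|nex] := pselect (exists x0, a < x0 < b /\ lebesgue_pt k x0).
  exists (k x0); apply: aeS lk => x lx xab.
  have := kc _ _ xab x0ab lx lx0 => <-.
  have /andP[ax xb] := xab.
  by rewrite /k patchE mem_set/= ?in_itv/= ?(ltW ax) ?(ltW xb)// /H subrK.
exists 0; apply: aeS lk => x lx xab.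
by case: nex; exists x.
Qed.

(** Lebesgue differentiation: almost everywhere [h] is the derivative of its primitive, which is
    identically zero near every interior point. *)
Lemma Rintegral_eq0_ae a b h : a < b -> mu.-integrable `[a, b] (EFin \o h) ->
  (forall x, a <= x <= b -> \int[mu]_(t in `[a, x]) h t = 0) ->
  {ae mu, forall x, a < x < b -> h x = 0}.
Proof.
move=> ab ih H0.
pose k := h \_ `[a, b].
have ik : mu.-integrable setT (EFin \o k) by exact: integrable_patch.
have := @FTC1 _ k (BLeft a).
have iky y : mu.-integrable `[a, y] (EFin \o k) by apply: integrableS ik.
have lk : locally_integrable setT k by exact: integrable_locally.
move=> /(_ iky lk); apply: aeS => x /= Hx /andP[ax xb].
have [dF F'] : derivable (fun x => \int[mu]_(t in `[a, x]) k t) x 1 /\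
    derive1 (fun x => \int[mu]_(t in `[a, x]) k t) x = k x.
  by apply: Hx; rewrite lte_fin.
have -> : h x = k x by rewrite /k patchE mem_set//= in_itv/= !ltW.
rewrite -F' derive1E.
have near0 : \forall y \near x, (fun=> 0 : R) y = \int[mu]_(t in `[a, y]) k t.
  near=> y.
  have ay : a <= y by apply: ltW; near: y; exact: lt_nbhsr.
  have yb : y <= b by apply: ltW; near: y; exact: lt_nbhsl.
  rewrite -(H0 y) ?ay//; apply: eq_Rintegral => t.
  rewrite /k patchE !inE/= !in_itv/= => /andP[at_ ty].
  by rewrite mem_set//= in_itv/= at_ (le_trans ty).
have [_ <-] := near_eq_is_derive near0 (is_derive_cst (0 : R) x (1 : R)).
by [].
Unshelve. all: by end_near. Qed.

End weak_derivative_1d.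

(** * Lines and traces of vector-valued functions *)

Section integrable_real.
Context d (Y : measurableType d) (R : realType) (mu : {measure set Y -> \bar R}).
Variables (D : set Y) (mD : measurable D).
Implicit Types f g : Y -> R.

Lemma integrable_addr f g : mu.-integrable D (EFin \o f) ->
  mu.-integrable D (EFin \o g) -> mu.-integrable D (EFin \o (fun x => f x + g x)).
Proof. by move=> i_f ig; exact: (integrableD mD i_f ig). Qed.

Lemma integrable_subr f g : mu.-integrable D (EFin \o f) ->
  mu.-integrable D (EFin \o g) -> mu.-integrable D (EFin \o (fun x => f x - g x)).
Proof. by move=> i_f ig; exact: (integrableB mD i_f ig). Qed.

Lemma integrable_mulr c f : mu.-integrable D (EFin \o f) ->
  mu.-integrable D (EFin \o (fun x => c * f x)).
Proof. by move=> i_f; exact: (integrableZl mD c i_f). Qed.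

End integrable_real.

Section Lebesgue2.
Context d (Y : measurableType d) (R : realType) (mu : {measure set Y -> \bar R}).
Implicit Types (D : set Y) (f g : Y -> R).

Lemma norm_on2E D f :
  norm_on mu D 2%:E f = ((\int[mu]_x (((f \_ D) x) ^+ 2)%:E) `^ 2^-1)%E.
Proof.
rewrite /norm_on unlock; congr (_ `^ _)%E; apply: eq_integral => x _ /=.
by rewrite powR_mulrn// -normrX ger0_norm// sqr_ge0.
Qed.

Let sq_int_ge0 D f : (0 <= \int[mu]_x (((f \_ D) x) ^+ 2)%:E)%E.
Proof. by apply: integral_ge0 => x _; rewrite lee_fin sqr_ge0. Qed.

Lemma norm_on2_le D f (e : R) : 0 <= e ->
  (norm_on mu D 2%:E f <= e%:E)%E =
  (\int[mu]_x (((f \_ D) x) ^+ 2)%:E <= (e ^+ 2)%:E)%E.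
Proof.
move=> e0; rewrite norm_on2E; have := sq_int_ge0 D f.
case: (integral _ _ _) => [r| |]//=; last first.
  by move=> _; rewrite invr_eq0 pnatr_eq0.
by rewrite !lee_fin => r0; rewrite powR12_sqrt// -[e]ger0_norm// -sqrtr_sqr ler_sqrt ?sqr_ge0// sqrtr_sqr real_normK// num_real.
Qed.

Lemma Lp_on2P D f : Lp_on mu D 2%:E f <->
  measurable_fun setT (f \_ D) /\ (\int[mu]_x (((f \_ D) x) ^+ 2)%:E < +oo)%E.
Proof.
rewrite /Lp_on; split.
  case/andP; rewrite !inE/= => mf; rewrite /finite_norm -/(norm_on mu D 2%:E f).
  rewrite norm_on2E => fin; split=> //; rewrite ltey.
  by apply: contraTneq fin => ->; rewrite /= invr_eq0 pnatr_eq0.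
move=> [mf fin]; apply/andP; rewrite !inE/=; split=> //.
rewrite /finite_norm -/(norm_on mu D 2%:E f) norm_on2E.
have := sq_int_ge0 D f; move: fin.
by case: (integral _ _ _) => [r| |]//= _ _; rewrite ltry.
Qed.

End Lebesgue2.

Section parameter_integrals.
Context d (Y : measurableType d) (R : realType)
  (nu : {sigma_finite_measure set Y -> \bar R}).
Notation mu := (@lebesgue_measure R).
Implicit Types (W : R -> Y -> R) (a b x : R).

Definition jointly_measurable W :=
  measurable_fun setT (fun z : R * Y => W z.1 z.2).

Lemma measurable_section W y : jointly_measurable W ->
  measurable_fun setT (W^~ y).
Proof.
by move=> mW; exact: (measurableT_comp mW (measurable_pair2 y)).
Qed.

(** Tonelli is applied to the positive and negative parts separately, so sections that fail to be
    integrable cause no trouble. *)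
Lemma measurable_Rintegral W a b : jointly_measurable W ->
  measurable_fun setT (fun y => \int[mu]_(x in `[a, b]) W x y).
Proof.
move=> mW; pose F (z : R * Y) : \bar R := ((W z.1 z.2)%:E * (\1_(`[a, b] : set R) z.1)%:E)%E.
have mF : measurable_fun setT F.
  apply: emeasurable_funM; first exact/measurable_EFinP.
  apply/measurable_EFinP; exact: (measurableT_comp _ measurable_fst).
have FE y : (\int[mu]_(x in `[a, b]) (W x y)%:E = \int[mu]_x F^\+ (x, y) -
    \int[mu]_x F^\- (x, y))%E.
  rewrite integral_mkcond integralE.
  have -> : ((fun x => (W x y)%:E) \_ `[a, b] = F \o (fun x => (x, y)))%E.
    apply/funext => x; rewrite patchE /F /= indicE.
    by case: ifPn => _; rewrite ?mule1 ?mule0.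
  by rewrite funepos_comp funeneg_comp.
rewrite /Rintegral; apply: measurableT_comp => //.
under eq_fun do rewrite FE.
apply: emeasurable_funB.
  apply: (@measurable_int1 _ _ _ _ _ mu (fun z => F^\+ z)%E) => //.
  exact: measurable_funepos.
apply: (@measurable_int1 _ _ _ _ _ mu (fun z => F^\- z)%E) => //.
exact: measurable_funeneg.
Qed.

(** Tonelli for the indicator of the complement of [A]. This exchange of quantifiers is what lets a
    property known on lines in one direction be used on lines in the other. *)
Lemma ae_swap (A : set (R * Y)) : measurable A ->
  {ae nu, forall y, {ae mu, forall x, A (x, y)}} ->
  {ae mu, forall x, {ae nu, forall y, A (x, y)}}.
Proof.
move=> mA Ayx.
pose F (z : R * Y) : \bar R := (\1_(~` A) z)%:E.
have mF : measurable_fun setT F.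
  by apply/measurable_EFinP; apply: measurable_indic; exact: measurableC.
have F0 z : (0 <= F z)%E by rewrite lee_fin.
have : (\int[nu]_y \int[mu]_x F (x, y) = 0)%E.
  rewrite (@ae_eq_integral _ _ _ nu setT (cst 0%E))//.
  - by rewrite integral0.
  - exact: (@measurable_int1 _ _ _ _ _ mu F).
  - apply: aeS Ayx => y Ay _ /=.
    rewrite (@ae_eq_integral _ _ _ mu setT (cst 0%E))//; first by rewrite integral0.
      exact: (measurableT_comp mF (measurable_pair2 y)).
    apply: aeS Ay => x Axy _ /=; rewrite /F indicE.
    have -> : ((x, y) \in ~` A) = false by apply: memNset => nA; exact: nA Axy.
    by [].
rewrite -(@tonelli21 _ _ _ _ _ mu nu F mF F0) (@tonelli12 _ _ _ _ _ mu nu F mF F0).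
move=> I0.
have mI : measurable_fun setT (fun x => \int[nu]_y F (x, y))%E.
  exact: (@measurable_int2 _ _ _ _ _ nu F).
have /ae_eq_integral_abs : (\int[mu]_x `|\int[nu]_y F (x, y)| = 0)%E.
  rewrite -[RHS]I0; apply: eq_integral => x _; rewrite gee0_abs//.
  exact: integral_ge0.
move=> /(_ measurableT mI); apply: aeS => x /(_ Logic.I) /= Ix0.
have mFx : measurable_fun setT (fun y => F (x, y)).
  exact: (measurableT_comp mF (measurable_pair1 x)).
have /ae_eq_integral_abs : (\int[nu]_y `|F (x, y)| = 0)%E.
  by rewrite -[RHS]Ix0; apply: eq_integral => y _; rewrite gee0_abs.
move=> /(_ measurableT mFx); apply: aeS => y /(_ Logic.I) /=.
rewrite /F indicE; have [//|nA] := pselect (A (x, y)).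
by rewrite mem_set//= => -[/eqP]; rewrite oner_eq0.
Qed.

End parameter_integrals.

Section parameter_primitive.
Context d (Y : measurableType d) (R : realType).
Notation mu := (@lebesgue_measure R).

(** [Num.min x b] freezes the primitive beyond [b]. The integral then runs over a fixed segment,
    with the indicator of [t <= x] moved into the integrand, and [measurable_Rintegral] applies. *)
Lemma jointly_measurable_prim (W : R -> Y -> R) a b : jointly_measurable W ->
  jointly_measurable (fun x y => \int[mu]_(t in `[a, Num.min x b]) W t y).
Proof.
move=> mW.
pose A : set (R * (R * Y)) := [set z | z.1 <= z.2.1].
have mA : measurable A.
  rewrite (_ : A = (fun z => z.1 <= z.2.1) @^-1` [set true]); last first.
    by apply/seteqP; split => z.
  rewrite -[X in measurable X]setTI.
  apply: (measurable_fun_ler (f := fst) (g := fun z => z.2.1)) => //.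
  exact: (measurableT_comp measurable_fst).
pose V (t : R) (z : R * Y) : R := W t z.2 * \1_A (t, z).
have mV : jointly_measurable V.
  apply: measurable_funM.
    apply: (measurableT_comp (f := fun z : R * Y => W z.1 z.2)
      (g := fun z : R * (R * Y) => (z.1, z.2.2))) => //.
    apply: measurable_fun_pair => //; exact: (measurableT_comp measurable_snd).
  have mI : measurable_fun setT (\1_A : _ -> R) by exact: measurable_indic.
  by apply: eq_measurable_fun mI => -[].
have := measurable_Rintegral a b mV.
rewrite /jointly_measurable; apply: eq_measurable_fun => z _.
rewrite Rintegral_mkcond [RHS]Rintegral_mkcond; apply: eq_Rintegral => t _.
rewrite !patchE; have [tab|tab] := boolP (t \in `[a, b]%classic).
  move: (tab); rewrite inE/= in_itv/= => /andP[at_ tb].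
  rewrite /V indicE; have [tz|tz] := leP t z.1.
    rewrite (@mem_set _ A)//= mulr1 mem_set//= in_itv/= at_.
    by rewrite le_min tz.
  rewrite (@memNset _ A)/= ?mulr0; last by apply/negP; rewrite -ltNge.
  rewrite memNset//= in_itv/= at_ le_min tb andbT/= => tz'.
  by move: tz; rewrite ltNge tz'.
rewrite memNset//= in_itv/= le_min => /and3P[at_ _ tb].
by move/negP: tab; apply; rewrite inE/= in_itv/= at_.
Qed.

End parameter_primitive.

Section cauchy_schwarz.
Context {R : realType}.
Notation mu := (@lebesgue_measure R).
Implicit Types (f : R -> R) (a b : R).

Lemma integrable_sq_integrable a b f : measurable_fun `[a, b] f ->
  mu.-integrable `[a, b] (EFin \o (fun x => f x ^+ 2)) ->
  mu.-integrable `[a, b] (EFin \o f).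
Proof.
move=> mf if2.
have i1 : mu.-integrable `[a, b] (EFin \o (fun x => 1 + f x ^+ 2)).
  apply: integrable_addr => //.
  apply: continuous_compact_integrable; first exact: segment_compact.
  by apply: continuous_subspaceT => ?; exact: cvg_cst.
apply: le_integrable i1 => //; first exact/measurable_EFinP.
move=> x _ /=; rewrite lee_fin [leRHS]ger0_norm ?addr_ge0 ?sqr_ge0//.
rewrite -(real_normK (num_real (f x))).
by have := sqr_ge0 (`|f x| - 1); have := normr_ge0 (f x); nra.
Qed.

Lemma Rintegral_cauchy_schwarz a b f : a <= b -> measurable_fun `[a, b] f ->
  mu.-integrable `[a, b] (EFin \o (fun x => f x ^+ 2)) ->
  (\int[mu]_(x in `[a, b]) f x) ^+ 2 <=
  (b - a) * \int[mu]_(x in `[a, b]) (f x ^+ 2).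
Proof.
rewrite le_eqVlt => /predU1P[<- _ _|ab mf if2].
  by rewrite set_itv1 Rintegral_set1 expr0n subrr mul0r.
have if1 := integrable_sq_integrable mf if2.
set I := \int[mu]_(x in `[a, b]) f x.
set J := \int[mu]_(x in `[a, b]) (f x ^+ 2).
(* The mean of [f]: expanding the integral of [(f - m) ^+ 2] gives the variance, whose sign is the
   inequality. *)
pose m := I / (b - a).
have ic (c : R) : mu.-integrable `[a, b] (EFin \o (fun=> c)).
  apply: continuous_compact_integrable; first exact: segment_compact.
  by apply: continuous_subspaceT => ?; exact: cvg_cst.
have iZ (c : R) : mu.-integrable `[a, b] (EFin \o (fun x => c * f x)).
  exact: integrable_mulr.
have iB : mu.-integrable `[a, b] (EFin \o (fun x => f x ^+ 2 - 2 * m * f x)).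
  exact: integrable_subr.
have : 0 <= \int[mu]_(x in `[a, b]) ((f x - m) ^+ 2).
  by apply: Rintegral_ge0 => x _; exact: sqr_ge0.
rewrite (@eq_Rintegral _ _ _ mu `[a, b] (fun x => (f x ^+ 2 - 2 * m * f x) + m ^+ 2)); last first.
  by move=> x _; ring.
rewrite (segment_RintegralD iB (ic _)) (segment_RintegralB if2 (iZ _)).
rewrite Rintegral_cst//= RintegralZl//= -/I -/J.
rewrite lebesgue_measure_itv/= lte_fin ab/=.
have ba : 0 < b - a by rewrite subr_gt0.
have -> : J - 2 * m * I + m ^+ 2 * (b - a) = J - I ^+ 2 / (b - a).
  by rewrite /m; field; rewrite gt_eqF.
by rewrite subr_ge0 ler_pdivrMr// mulrC.
Qed.

End cauchy_schwarz.

Lemma ae_forall_count d (Y : measurableType d) (R : realType)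
    (mu : {measure set Y -> \bar R}) (I : countType) (P : I -> Y -> Prop) :
  (forall i, {ae mu, forall y, P i y}) -> {ae mu, forall y, forall i, P i y}.
Proof.
move=> HP.
have H n : {ae mu, forall y, if unpickle n is Some i then P i y else True}.
  by case: (unpickle n) => [i|]; [exact: HP|exact: aeW].
by apply: aeS (ae_foralln H) => y Hy i; have := Hy (pickle i); rewrite pickleK.
Qed.

Lemma ae_neq (R : realType) (a : R) : {ae (@lebesgue_measure R), forall x, x != a}.
Proof.
exists [set a]; split => //; first by rewrite lebesgue_measure_set1.
by move=> x /= /negP; rewrite negbK => /eqP.
Qed.

Lemma ae_open_segment (R : realType) (a b : R) (P : R -> Prop) :
  {ae (@lebesgue_measure R), forall x, a < x < b -> P x} ->
  {ae (@lebesgue_measure R), forall x, a <= x <= b -> P x}.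
Proof.
move=> HP; apply: aeS2 (aeI (ae_neq a) (ae_neq b)) HP.
move=> x [xa xb] HP /andP[ax bx]; apply: HP.
by rewrite lt_neqAle eq_sym xa ax lt_neqAle xb bx.
Qed.

Lemma measurable_patch d (Y : measurableType d) (R : realType) (D : set Y)
    (f : Y -> R) : measurable D -> measurable_fun setT f ->
  measurable_fun setT (f \_ D).
Proof.
move=> mD mf; have mI : measurable_fun setT (\1_D : Y -> R).
  exact: measurable_indic.
apply: eq_measurable_fun (measurable_funM mf mI) => y _ /=.
by rewrite patchE indicE; case: (y \in D); rewrite ?mulr1 ?mulr0.
Qed.

(** Uses t^2 <= 2 (t - i)^2 + 2 i^2. In [trace_at_Lp], [t] is the trace at [x], [i] the trace at
    [a], [q] is 2/(b - a) and [k] is b - a. *)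
Lemma sqr_shift_le (R : realFieldType) (t i q k A B : R) :
  (t - i) ^+ 2 <= k * B -> i ^+ 2 <= q * A + 2 * k * B ->
  t ^+ 2 <= 2 * q * A + 6 * k * B.
Proof. by have := sqr_ge0 (t - 2 * i); lra. Qed.

Section square_integrable_families.
Context d (Y : measurableType d) (R : realType)
  (nu : {sigma_finite_measure set Y -> \bar R}).
Notation mu := (@lebesgue_measure R).
Implicit Types (W : R -> Y -> R) (a b x : R).

Definition L2_family W := jointly_measurable W /\
  (\int[nu]_y \int[mu]_x (W x y ^+ 2)%:E < +oo)%E.

Lemma measurable_sq_family W : jointly_measurable W ->
  measurable_fun setT (fun z : R * Y => (W z.1 z.2 ^+ 2)%:E).
Proof. by move=> mW; apply/measurable_EFinP; exact: measurable_funX. Qed.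

Lemma L2_family_section W : L2_family W ->
  {ae nu, forall y, mu.-integrable setT (EFin \o (fun x => W x y ^+ 2))}.
Proof.
move=> [mW Wfin].
have mW2 := measurable_sq_family mW.
have mI : measurable_fun setT (fun y => \int[mu]_x (W x y ^+ 2)%:E)%E.
  apply: (@measurable_int1 _ _ _ _ _ mu (fun z => (W z.1 z.2 ^+ 2)%:E)%E) => //.
  by move=> z; rewrite lee_fin sqr_ge0.
have iI : nu.-integrable setT (fun y => \int[mu]_x (W x y ^+ 2)%:E)%E.
  apply/integrableP; split => //.
  rewrite (eq_integral (fun y => \int[mu]_x (W x y ^+ 2)%:E)%E)// => y _.
  by rewrite gee0_abs// integral_ge0// => x _; rewrite lee_fin sqr_ge0.
have := integrable_ae measurableT iI; apply: aeS => y /(_ Logic.I) fy.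
apply/integrableP; split.
  exact: (measurableT_comp mW2 (measurable_pair2 y)).
rewrite [X in (X < _)%E](_ : _ = \int[mu]_x (W x y ^+ 2)%:E)%E.
  by rewrite ltey_eq fy.
by apply: eq_integral => x _ /=; rewrite ger0_norm// sqr_ge0.
Qed.

Lemma L2_family_sub W a b y : jointly_measurable W ->
  mu.-integrable setT (EFin \o (fun x => W x y ^+ 2)) ->
  [/\ measurable_fun `[a, b] (W^~ y),
      mu.-integrable `[a, b] (EFin \o (fun x => W x y ^+ 2)),
      mu.-integrable `[a, b] (EFin \o (W^~ y)) &
      ((\int[mu]_(x in `[a, b]) (W x y ^+ 2))%:E <= \int[mu]_x (W x y ^+ 2)%:E)%E].
Proof.
move=> mW iW.
have mWy : measurable_fun `[a, b] (W^~ y).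
  by apply: measurable_funTS; exact: measurable_section.
have iWab : mu.-integrable `[a, b] (EFin \o (fun x => W x y ^+ 2)).
  by apply: integrableS iW.
split => //; first exact: integrable_sq_integrable.
rewrite /Rintegral fineK; last exact: integrable_fin_num iWab.
apply: ge0_subset_integral => //; first exact: measurable_int iW.
by move=> x _; rewrite lee_fin sqr_ge0.
Qed.

(** The conditions on [x] and [y] are built into the set passed to [ae_swap], which contains
    everything outside []a, b[] times [D]. *)
Lemma ae_eq_swap (a b : R) (D : set Y) (g k : R -> Y -> R) :
  jointly_measurable g -> jointly_measurable k -> measurable D ->
  {ae nu, forall y, D y -> {ae mu, forall x, a < x < b -> g x y = k x y}} ->
  {ae mu, forall x, a < x < b -> {ae nu, forall y, D y -> g x y = k x y}}.
Proof.
move=> mg mk mD gk.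
pose A : set (R * Y) :=
  ((fun z => g z.1 z.2 - k z.1 z.2) @^-1` [set 0]) `|`
  ~` ([set z | a < z.1 < b] `&` [set z | D z.2]).
have mA : measurable A.
  apply: measurableU.
    rewrite -[X in measurable X]setTI.
    exact: (measurable_funB mg mk).
  apply: measurableC; apply: measurableI.
    rewrite (_ : [set z | _] = fst @^-1` `]a, b[%classic); last first.
      by apply/seteqP; split => z; rewrite /= in_itv.
    rewrite -[X in measurable X]setTI; exact: measurable_fst.
  rewrite -[X in measurable X]setTI; exact: measurable_snd.
have Ayx : {ae nu, forall y, {ae mu, forall x, A (x, y)}}.
  apply: aeS gk => y gky.
  have [Dy|nDy] := pselect (D y); last by apply: aeW => x; right => -[].
  apply: aeS (gky Dy) => x gkx.
  have [xab|nxab] := pselect (a < x < b); last by right => -[].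
  by left; rewrite /= gkx// subrr.
apply: aeS (ae_swap mA Ayx) => x Ax xab; apply: aeS Ax => y Axy Dy.
by case: Axy => [/= /eqP|[]//]; rewrite subr_eq0 => /eqP.
Qed.

End square_integrable_families.

Section representation.
Context {R : realType}.
Notation mu := (@lebesgue_measure R).
Notation nu := (@planar_lebesgue R).
Variables (a b : R) (D : set (R * R)) (g h : R -> R * R -> R).
Hypotheses (ab : a < b) (mD : measurable D).
Hypotheses (Lg : L2_family nu g) (Lh : L2_family nu h).
Hypothesis gh : weak_deriv a b D g h.

(** The constant of integration from [weak_derivative_AC] depends on [y] with no control on
    measurability. If G' = h, then (b - t) G has derivative -G + (b - t) h, so G(a) is the mean of g
    - (b - t) h. This explicit formula is jointly measurable and defined for every [y]. *)
Definition trace_at (x : R) (y : R * R) : R :=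
  (b - a)^-1 * \int[mu]_(t in `[a, b]) (g t y - (b - t) * h t y) +
  \int[mu]_(t in `[a, Num.min x b]) h t y.

Let mg := Lg.1. Let mh := Lh.1.

Let mgh : jointly_measurable (fun t y => g t y - (b - t) * h t y).
Proof.
apply: measurable_funB => //; apply: measurable_funM => //.
by apply: measurable_funB => //; exact: measurable_cst.
Qed.

Lemma jointly_measurable_trace_at : jointly_measurable trace_at.
Proof.
apply: measurable_funD; last exact: jointly_measurable_prim.
apply: measurable_funM => //.
exact: (measurableT_comp (measurable_Rintegral a b mgh)).
Qed.

Lemma trace_at_AC : {ae nu, forall y, D y ->
  AC a b (trace_at^~ y) (h^~ y) /\
  {ae mu, forall x, a < x < b -> g x y = trace_at x y}}.
Proof.
have Htest : {ae nu, forall y, forall i : nat * rat * rat,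
    test_fun a b (plateau i.1.1 (ratr i.1.2) (ratr i.2)) -> D y ->
    \int[mu]_(x in `]a, b[) (g x y * derive1 (plateau i.1.1 (ratr i.1.2) (ratr i.2)) x) =
    - \int[mu]_(x in `]a, b[) (h x y * plateau i.1.1 (ratr i.1.2) (ratr i.2) x)}.
  apply: ae_forall_count => i.
  have [tf|ntf] := pselect (test_fun a b (plateau i.1.1 (ratr i.1.2) (ratr i.2))).
    by apply: aeS (gh tf) => y Hy _.
  by apply: aeW.
apply: aeS2 (aeI (L2_family_section Lg) (L2_family_section Lh)) Htest.
move=> y [ig2 ih2] Ht Dy; have abw := ltW ab.
have [mgy _ igy _] := L2_family_sub a b mg ig2.
have [mhy _ ihy _] := L2_family_sub a b mh ih2.
have [n p q tf|c gc] := weak_derivative_AC ab igy ihy; first exact: (Ht (n, p, q)).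
pose G x := c + \int[mu]_(t in `[a, x]) h t y.
have ACG : AC a b G (h^~ y).
  split=> // x _; rewrite /G set_itv1 Rintegral_set1 addr0//.
have Ga : G a = c by rewrite /G set_itv1 Rintegral_set1 addr0.
have ACb : AC a b (fun x => b - x) (fun=> -1).
  apply: AC_derive_everywhere => //; first exact: cst_continuous.
  move=> x; rewrite (_ : (fun t => b - t) = fun t => -1 * t + b).
    exact: is_derive_affine.
  by apply/funext => t; ring.
have := AC_FTC abw (AC_mul abw ACb ACG).
rewrite subrr mul0r sub0r Ga => FTC.
have cE : (b - a)^-1 * \int[mu]_(t in `[a, b]) (g t y - (b - t) * h t y) = c.
  rewrite (@ae_Rintegral _ _ _ mu `[a, b] _ (fun t => - (-1 * G t + (b - t) * h t y)))//.
  - rewrite (@eq_Rintegral _ _ _ mu _ (fun t => -1 * (-1 * G t + (b - t) * h t y))); last first.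
      by move=> t _ /=; ring.
    rewrite RintegralZl//; last by case: (AC_mul abw ACb ACG).
    by rewrite FTC mulN1r opprK mulKf// subr_eq0 gt_eqF.
  - by apply: measurable_funTS; exact: measurable_section mgh.
  - apply: measurableT_comp => //.
    by have [/measurable_int/measurable_EFinP] := AC_mul abw ACb ACG.
  - apply: aeS (ae_open_segment gc) => t Ht' /=; rewrite in_itv/= => /Ht' ->.
    by rewrite /G; ring.
have GE x : a <= x <= b -> G x = trace_at x y.
  move=> /andP[_ xb]; rewrite /trace_at cE /G.
  by rewrite (min_idPl xb).
split; first exact: AC_eq ACG GE _.
by apply: aeS gc => x Hx xab; rewrite Hx// -GE// !ltW//; case/andP: xab.
Qed.

(** Hölder continuity of exponent 1/2 by Cauchy-Schwarz. Its constant is integrable in [y], which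
    turns it into continuity with values in L^2(D). *)
Let prim_diff y x x0 : AC a b (trace_at^~ y) (h^~ y) ->
  mu.-integrable setT (EFin \o (fun t => h t y ^+ 2)) ->
  a <= x <= b -> a <= x0 <= b ->
  (trace_at x y - trace_at x0 y) ^+ 2 <=
  `|x - x0| * \int[mu]_(t in `[a, b]) (h t y ^+ 2).
Proof.
wlog xx0 : x x0 / x <= x0.
  move=> H ACt ih2 xab x0ab; have [xx0|/ltW x0x] := leP x x0; first exact: H.
  by rewrite distrC -sqrrN opprB; exact: H.
move=> ACt ih2 /andP[ax xb] /andP[ax0 x0b].
have [_ tx0] := AC_sub ax x0b ACt.
rewrite (tx0 x0) ?xx0 ?lexx// opprD addrA subrr sub0r sqrrN.
have [mhx ihx2 ihx _] := L2_family_sub x x0 mh ih2.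
have [_ iab2 _ _] := L2_family_sub a b mh ih2.
apply: le_trans (Rintegral_cauchy_schwarz xx0 mhx ihx2) _.
rewrite distrC ger0_norm ?subr_ge0// ler_wpM2l ?subr_ge0//.
rewrite -lee_fin /Rintegral !fineK; [|exact: integrable_fin_num iab2
  |exact: integrable_fin_num ihx2].
apply: ge0_subset_integral => //.
- exact: measurable_int iab2.
- by move=> t _; rewrite lee_fin sqr_ge0.
- by apply: subset_itv; rewrite bnd_simp.
Qed.

(** At [a] the trace is an explicit mean, bounded by Cauchy-Schwarz; [prim_diff] carries the bound
    from [a] to [x]. *)
Lemma trace_at_Lp x : a <= x <= b -> Lp_on nu D 2%:E (trace_at x).
Proof.
move=> xab; have /andP[ax xb] := xab.
have mt : measurable_fun setT (trace_at x).
  exact: (measurableT_comp jointly_measurable_trace_at (measurable_pair1 x)).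
apply/Lp_on2P; split.
  exact: measurable_patch.
have mI W : jointly_measurable W ->
    measurable_fun setT (fun y => \int[mu]_x (W x y ^+ 2)%:E)%E.
  move=> mW.
  apply: (@measurable_int1 _ _ _ _ _ mu (fun z => (W z.1 z.2 ^+ 2)%:E)%E) => //.
    exact: measurable_sq_family.
  by move=> z; rewrite lee_fin sqr_ge0.
have I0 W y : (0 <= \int[mu]_x (W x y ^+ 2)%:E)%E.
  by apply: integral_ge0 => ? _; rewrite lee_fin sqr_ge0.
have ba0 : 0 < b - a by rewrite subr_gt0.
pose B := 4 / (b - a); pose B' := 6 * (b - a).
have B0 : 0 <= B by rewrite divr_ge0// ltW.
have B'0 : 0 <= B' by rewrite mulr_ge0// ltW.
apply: (@le_lt_trans _ _ (\int[nu]_y (B%:E * \int[mu]_x (g x y ^+ 2)%:E +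
    B'%:E * \int[mu]_x (h x y ^+ 2)%:E)))%E.
  apply: ae_ge0_le_integral => //.
  - by move=> y _; rewrite lee_fin sqr_ge0.
  - apply/measurable_EFinP; apply: measurable_funX.
    exact: measurable_patch.
  - by move=> y _; rewrite adde_ge0// mule_ge0.
  - apply: emeasurable_funD; apply: emeasurable_funM => //; exact: mI.
  apply: aeS2 (aeI (L2_family_section Lg) (L2_family_section Lh)) trace_at_AC.
  move=> y [ig2 ih2] AC_y _; rewrite patchE; case: ifPn; last first.
    by rewrite expr0n adde_ge0// mule_ge0.
  rewrite inE => Dy; have [ACy _] := AC_y Dy.
  have [mgy ig2ab igy Ig] := L2_family_sub a b mg ig2.
  have [mhy ih2ab ihy Ih] := L2_family_sub a b mh ih2.
  apply: (@le_trans _ _ (B%:E * (\int[mu]_(x in `[a, b]) (g x y ^+ 2))%:E +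
     B'%:E * (\int[mu]_(x in `[a, b]) (h x y ^+ 2))%:E))%E; last first.
    by apply: leeD; apply: lee_wpmul2l.
  rewrite -!EFinM -EFinD lee_fin.
  have d1 := prim_diff ACy ih2 xab (_ : a <= a <= b).
  have {d1} := d1 ltac:(by rewrite lexx ltW).
  have -> : trace_at a y = (b - a)^-1 * \int[mu]_(t in `[a, b]) (g t y - (b - t) * h t y).
    by rewrite /trace_at (min_idPl (ltW ab)) set_itv1 Rintegral_set1 addr0.
  set Jg := \int[mu]_(x in _) (g x y ^+ 2); set Jh := \int[mu]_(x in _) (h x y ^+ 2).
  set I := \int[mu]_(t in `[a, b]) (g t y - (b - t) * h t y).
  have Jh0 : 0 <= Jh by apply: Rintegral_ge0 => ? _; rewrite sqr_ge0.
  have i2 : mu.-integrable `[a, b] (EFin \o (fun t => 2 * g t y ^+ 2 + 2 * (b - a) ^+ 2 * h t y ^+ 2)).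
    by apply: integrable_addr => //; apply: integrable_mulr.
  have mGH : measurable_fun `[a, b] (fun t => g t y - (b - t) * h t y).
    by apply: measurable_funTS; exact: measurable_section mgh.
  have leGH t : a <= t <= b -> (g t y - (b - t) * h t y) ^+ 2 <=
     2 * g t y ^+ 2 + 2 * (b - a) ^+ 2 * h t y ^+ 2.
    move=> /andP[at_ tb].
    have H1 : ((b - t) * h t y) ^+ 2 <= (b - a) ^+ 2 * h t y ^+ 2.
      rewrite exprMn ler_wpM2r ?sqr_ge0// ler_sqr ?nnegrE ?subr_ge0//; last exact: ltW.
      by rewrite lerB.
    have := sqr_ge0 (g t y + (b - t) * h t y); move: H1.
    move: ((b - t) * h t y) (g t y) => r q; lra.
  have iGH : mu.-integrable `[a, b] (EFin \o (fun t => (g t y - (b - t) * h t y) ^+ 2)).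
    apply: le_integrable i2 => //.
      by apply/measurable_EFinP; exact: measurable_funX.
    move=> t /=; rewrite in_itv/= => tab; rewrite lee_fin ger0_norm ?sqr_ge0//.
    by apply: le_trans (leGH _ tab) _; exact: ler_norm.
  have := Rintegral_cauchy_schwarz (ltW ab) mGH iGH; rewrite -/I.
  have : \int[mu]_(t in `[a, b]) ((g t y - (b - t) * h t y) ^+ 2) <=
      2 * Jg + 2 * (b - a) ^+ 2 * Jh.
    rewrite -RintegralZl// -RintegralZl// -segment_RintegralD//; try exact: integrable_mulr.
    by apply: le_Rintegral => // t /=; rewrite in_itv/=; exact: leGH.
  set Q := Rintegral _ _ _ => HQ HI.
  have xa : `|x - a| <= b - a by rewrite ger0_norm ?subr_ge0// lerB.
  move=> HT.
  have {HT} HT : (trace_at x y - (b - a)^-1 * I) ^+ 2 <= (b - a) * Jh.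
    by apply: le_trans HT _; rewrite ler_wpM2r.
  have HI2 : ((b - a)^-1 * I) ^+ 2 <= (b - a)^-1 * (2 * Jg + 2 * (b - a) ^+ 2 * Jh).
    rewrite exprMn expr2 -mulrA ler_pM2l ?invr_gt0// ler_pdivrMl//.
    by apply: le_trans HI _; rewrite ler_pM2l.
  have E1 : (b - a)^-1 * (2 * Jg + 2 * (b - a) ^+ 2 * Jh) = 2 / (b - a) * Jg + 2 * (b - a) * Jh.
    by field; rewrite subr_eq0 gt_eqF.
  rewrite E1 in HI2.
  rewrite /B /B' (_ : 4 / (b - a) = 2 * (2 / (b - a))); last first.
    by field; rewrite subr_eq0 gt_eqF.
  exact: sqr_shift_le HT HI2.
rewrite ge0_integralD//=.
- rewrite !ge0_integralZl//; [|exact: mI|exact: mI].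
  by apply: lte_add_pinfty; rewrite lte_mul_pinfty//; [case: Lg|case: Lh].
- by move=> y _; rewrite mule_ge0.
- by apply: emeasurable_funM => //; exact: mI.
- by move=> y _; rewrite mule_ge0.
- by apply: emeasurable_funM => //; exact: mI.
Qed.

Lemma is_trace_trace_at x0 : a <= x0 <= b -> is_trace a b D g x0 (trace_at x0).
Proof.
move=> x0ab; split; first exact: trace_at_Lp.
move=> e e0.
have mt := jointly_measurable_trace_at.
have Ayx : {ae nu, forall y, D y -> {ae mu, forall x, a < x < b -> g x y = trace_at x y}}.
  by apply: aeS trace_at_AC => y + Dy => /(_ Dy)[].
have Axy := @ae_eq_swap _ _ R nu a b D g trace_at mg mt mD Ayx.
pose H := fine (\int[nu]_y \int[mu]_x (h x y ^+ 2)%:E)%E.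
have I0 y : (0 <= \int[mu]_x (h x y ^+ 2)%:E)%E.
  by apply: integral_ge0 => ? _; rewrite lee_fin sqr_ge0.
have HE : H%:E = (\int[nu]_y \int[mu]_x (h x y ^+ 2)%:E)%E.
  by rewrite /H fineK// ge0_fin_numE ?Lh.2// integral_ge0.
have H0 : 0 <= H by apply: fine_ge0; exact: integral_ge0.
have mI : measurable_fun setT (fun y => \int[mu]_x (h x y ^+ 2)%:E)%E.
  apply: (@measurable_int1 _ _ _ _ _ mu (fun z => (h z.1 z.2 ^+ 2)%:E)%E) => //.
    exact: measurable_sq_family.
  by move=> z; rewrite lee_fin sqr_ge0.
(* By [prim_diff] the squared distance is at most [|x - x0| * H]; the 1 avoids a division by zero
   when [h] vanishes. *)
exists (e ^+ 2 / (H + 1)); first by rewrite divr_gt0 ?exprn_gt0// ltr_wpDl.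
apply: aeS Axy => x Ax xab xx0; have {}Ax := Ax xab.
rewrite (norm_on2_le (planar_lebesgue : {measure set _ -> \bar R}))//; last exact: ltW.
have mgt : measurable_fun setT (fun y => g x y - trace_at x0 y).
  apply: measurable_funB.
    exact: (measurableT_comp mg (measurable_pair1 x)).
  exact: (measurableT_comp mt (measurable_pair1 x0)).
apply: (@le_trans _ _ (\int[nu]_y (`|x - x0|%:E * \int[mu]_x (h x y ^+ 2)%:E)))%E.
  apply: ae_ge0_le_integral => //.
  - by move=> y _; rewrite lee_fin sqr_ge0.
  - by apply/measurable_EFinP; apply: measurable_funX; exact: measurable_patch.
  - by move=> y _; rewrite mule_ge0// lee_fin.
  - by apply: emeasurable_funM.
  apply: aeS2 (aeI Ax (L2_family_section Lh)) trace_at_AC => y [gt ih2] ACy _.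
  rewrite patchE; case: ifPn; last by rewrite expr0n mule_ge0// lee_fin.
  rewrite inE => Dy; have {ACy}[ACy _] := ACy Dy.
  rewrite gt//.
  have [_ _ _ Ih] := L2_family_sub a b mh ih2.
  have xab' : a <= x <= b by case/andP: xab => ? ?; rewrite !ltW.
  have := prim_diff ACy ih2 xab' x0ab; rewrite -lee_fin => /le_trans; apply.
  by rewrite EFinM lee_wpmul2l// lee_fin.
rewrite ge0_integralZl//.
rewrite -HE -EFinM lee_fin.
apply: (@le_trans _ _ (e ^+ 2 / (H + 1) * (H + 1))).
  by rewrite ler_pM// ?(ltW xx0)// lerDl.
by rewrite divfK// gt_eqF// ltr_wpDl.
Qed.

End representation.

Section trace_uniqueness.
Context {R : realType}.
Notation mu := (@lebesgue_measure R).
Notation nu := (@planar_lebesgue R).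

(** Both traces are within [e] of one and the same [g x], for some [x] near [x0] outside the
    exceptional sets; hence they are within [2 * e] of each other. *)
Lemma is_trace_unique (a b x0 : R) (D : set (R * R)) (g : R -> R * R -> R) t1 t2 :
  a < b -> measurable D -> a <= x0 <= b -> jointly_measurable g ->
  is_trace a b D g x0 t1 -> is_trace a b D g x0 t2 ->
  {ae nu, forall y, D y -> t1 y = t2 y}.
Proof.
move=> ab mD x0ab mg [/Lp_on2P[m1 _] T1] [/Lp_on2P[m2 _] T2].
have mdiff : measurable_fun setT ((fun y => t1 y - t2 y) \_ D).
  rewrite (_ : _ \_ D = (fun y => (t1 \_ D) y - (t2 \_ D) y)).
    exact: measurable_funB.
  by apply/funext => y; rewrite !patchE; case: ifPn; rewrite ?subr0.
pose J := (\int[nu]_y (((fun y => t1 y - t2 y) \_ D) y ^+ 2)%:E)%E.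
have J0 : (0 <= J)%E by apply: integral_ge0 => y _; rewrite lee_fin sqr_ge0.
have Je e : 0 < e -> (J <= (4 * e ^+ 2)%:E)%E.
  move=> e0; have [d1 d10 H1] := T1 _ e0; have [d2 d20 H2] := T2 _ e0.
  pose r := Num.min d1 d2.
  have r0 : 0 < r by rewrite lt_min d10.
  (* The part of the neighbourhood of [x0] inside the segment is a nonempty interval even when [x0]
     is an end point, so it cannot be contained in a null set. *)
  pose c := Num.max a (x0 - r); pose c' := Num.min b (x0 + r).
  have cc' : c < c'.
    case/andP: x0ab => ax xb.
    rewrite lt_min !gt_max ab/=; apply/andP; split; first by lra.
    by apply/andP; split; lra.
  have [x [[[Hx1 Hx2] _] /andP[cx xc]]] : exists x,
      (((a < x < b -> `|x - x0| < d1 -> (norm_on leb2 D 2%:E (fun y => g x y - t1 y)%R <= e%:E)%E) /\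
      (a < x < b -> `|x - x0| < d2 -> (norm_on leb2 D 2%:E (fun y => g x y - t2 y)%R <= e%:E)%E)) /\ True)
      /\ c < x < c'.
    apply: contrapT => nex.
    have : {ae mu, forall x, ~ (c < x < c')}.
      apply: aeS2 H1 H2 => x h1 h2 xc; apply: nex; exists x.
      by split => //; split.
    move=> [N [mN N0 subN]].
    have : (mu `]c, c'[%classic <= mu N)%E.
      apply: le_measure; rewrite ?inE//.
      move=> x /=; rewrite in_itv/= => xc; apply: subN => /=; exact.
    rewrite N0 lebesgue_measure_itv/= lte_fin cc'.
    by rewrite -EFinB lee_fin leNgt subr_gt0 cc'.
  move: cx xc; rewrite gt_max lt_min => /andP[ax x0x] /andP[xb xx0].
  have xr : `|x - x0| < r by rewrite ltr_norml; lra.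
  move: xr; rewrite lt_min => /andP[xr1 xr2].
  have xab : a < x < b by rewrite ax.
  have {}Hx1 := Hx1 xab xr1; have {}Hx2 := Hx2 xab xr2.
  rewrite (norm_on2_le (planar_lebesgue : {measure set _ -> \bar R})) in Hx1; last exact: ltW.
  rewrite (norm_on2_le (planar_lebesgue : {measure set _ -> \bar R})) in Hx2; last exact: ltW.
  have mgx : measurable_fun setT (g x).
    exact: (measurableT_comp mg (measurable_pair1 x)).
  have mdi (t : R * R -> R) : measurable_fun setT (t \_ D) ->
      measurable_fun setT (fun y => ((((fun y => g x y - t y) \_ D) y) ^+ 2)%:E).
    move=> mt; apply/measurable_EFinP; apply: measurable_funX.
    rewrite (_ : _ \_ D = (fun y => (g x \_ D) y - (t \_ D) y)).
      by apply: measurable_funB => //; exact: measurable_patch.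
    by apply/funext => y; rewrite !patchE; case: ifPn; rewrite ?subr0.
  apply: (@le_trans _ _ (\int[nu]_y (2%:E * ((((fun y => g x y - t1 y) \_ D) y) ^+ 2)%:E +
     2%:E * ((((fun y => g x y - t2 y) \_ D) y) ^+ 2)%:E))%E).
    apply: ge0_le_integral => //.
    - by move=> y _; rewrite lee_fin sqr_ge0.
    - by apply/measurable_EFinP; exact: measurable_funX.
    - by apply: emeasurable_funD; apply: emeasurable_funM => //; exact: mdi.
    move=> y _; rewrite -!EFinM -EFinD lee_fin !patchE; case: ifPn => _; last first.
      by rewrite expr0n mulr0 addr0.
    have := sqr_ge0 (g x y - t1 y + (g x y - t2 y)); lra.
  rewrite ge0_integralD//=.
  - rewrite !ge0_integralZl//; try exact: mdi; try (by move=> y _; rewrite lee_fin sqr_ge0).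
    rewrite (_ : 4 * e ^+ 2 = 2 * e ^+ 2 + 2 * e ^+ 2); last by ring.
    have -> : ((2 * e ^+ 2 + 2 * e ^+ 2)%:E = 2%:E * (e ^+ 2)%:E + 2%:E * (e ^+ 2)%:E)%E.
      by rewrite -!EFinM -EFinD.
    by apply: leeD; apply: lee_wpmul2l.
  - by move=> y _; rewrite mule_ge0// lee_fin sqr_ge0.
  - by apply: emeasurable_funM => //; exact: mdi.
  - by move=> y _; rewrite mule_ge0// lee_fin sqr_ge0.
  - by apply: emeasurable_funM => //; exact: mdi.
have {Je} Jeq : J = 0%E.
  apply/eqP; rewrite eq_le J0 andbT; apply/lee_addgt0Pr => e e0; rewrite add0e.
  have := Je (Num.sqrt (e / 4)) _; rewrite sqrtr_gt0 divr_gt0// => /(_ isT).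
  rewrite sqr_sqrtr; last by rewrite divr_ge0// ltW.
  by rewrite (_ : 4 * (e / 4) = e)//; field.
have : (\int[nu]_y `|(((fun y => t1 y - t2 y) \_ D) y ^+ 2)%:E| = 0)%E.
  by rewrite -[RHS]Jeq; apply: eq_integral => y _; rewrite gee0_abs// lee_fin sqr_ge0.
move=> /ae_eq_integral_abs H.
have {}H := H measurableT _.
apply: aeS (H _); last by apply/measurable_EFinP; exact: measurable_funX.
move=> y /(_ Logic.I) /= + Dy.
by rewrite patchE mem_set// => -[/eqP]; rewrite sqrf_eq0 subr_eq0 => /eqP.
Qed.

End trace_uniqueness.

Lemma integrable_ge0 d (Y : measurableType d) (R : realType)
    (mu : {measure set Y -> \bar R}) (D : set Y) (f : Y -> R) :
  measurable_fun D f -> (forall x, D x -> 0 <= f x) ->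
  (\int[mu]_(x in D) (f x)%:E < +oo)%E -> mu.-integrable D (EFin \o f).
Proof.
move=> mf f0 fin; apply/integrableP; split; first exact/measurable_EFinP.
rewrite [X in (X < _)%E](_ : _ = \int[mu]_(x in D) (f x)%:E)%E//.
by apply: eq_integral => x /[!inE] Dx /=; rewrite ger0_norm// f0.
Qed.

Section real_fubini.
Context d1 d2 (T1 : measurableType d1) (T2 : measurableType d2) (R : realType).
Variables (m1 : {sigma_finite_measure set T1 -> \bar R})
  (m2 : {sigma_finite_measure set T2 -> \bar R}).
Variable f : T1 * T2 -> R.
Hypothesis if_ : (m1 \x m2)%E.-integrable setT (EFin \o f).

Let fine_integrable d (T : measurableType d) (m : {measure set T -> \bar R})
    (F : T -> \bar R) : m.-integrable setT F ->
  m.-integrable setT (EFin \o (fine \o F)) /\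
  \int[m]_x fine (F x) = fine (\int[m]_x F x).
Proof.
move=> iF; have mF := measurable_int m iF.
have mfF : measurable_fun setT (EFin \o (fine \o F)).
  by apply/measurable_EFinP; exact: measurableT_comp.
split.
  apply: le_integrable iF => // x _ /=.
  by case: (F x) => //= *; rewrite normr0 leey.
congr fine; apply: ae_eq_integral => //.
by apply: aeS (integrable_ae measurableT iF) => x /[apply] /fineK.
Qed.

Lemma Rintegral_fubini :
  [/\ m2.-integrable setT (EFin \o (fun s => \int[m1]_y f (y, s))),
      m1.-integrable setT (EFin \o (fun y => \int[m2]_s f (y, s))),
      \int[(m1 \x m2)%E]_z f z = \int[m2]_s \int[m1]_y f (y, s) &
      \int[(m1 \x m2)%E]_z f z = \int[m1]_y \int[m2]_s f (y, s)].
Proof.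
have [i1 E1] := fine_integrable (integrable_fubini_F if_).
have iG : m2.-integrable setT (fun s => \int[m1]_y (EFin \o f) (y, s))%E.
  have mb := measurable_int _ if_.
  apply/integrableP; split; first exact: (measurable_fubini_G if_).
  apply: le_lt_trans ((integrable21ltyP m1 m2 mb).1 if_).
  apply: ge0_le_integral => //.
  - by apply: measurableT_comp => //; exact: (measurable_fubini_G if_).
  - apply: (@measurable_int1 _ _ _ _ _ m1 (fun z => `|(EFin \o f) z|)%E) => //.
    exact: measurableT_comp.
  - move=> s _; apply: le_abse_integral => //.
    exact: (measurableT_comp mb (measurable_pair2 s)).
have [i2 E2] := fine_integrable iG.
split; [exact: i2|exact: i1| |].
  by rewrite [RHS]E2 /Rintegral -(integral21_prod_meas1 if_).
by rewrite [RHS]E1 /Rintegral -(integral12_prod_meas1 if_).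
Qed.

End real_fubini.

Section box_fubini.
Context d1 d2 (T1 : measurableType d1) (T2 : measurableType d2) (R : realType).
Variables (m1 : {sigma_finite_measure set T1 -> \bar R})
  (m2 : {sigma_finite_measure set T2 -> \bar R}).
Variables (A : set T1) (B : set T2) (W : T1 -> T2 -> R).
Hypotheses (mA : measurable A) (mB : measurable B).
Hypotheses (finA : (m1 A < +oo)%E) (finB : (m2 B < +oo)%E).
Hypothesis mW : measurable_fun setT (fun z : T1 * T2 => W z.1 z.2).
Hypothesis finW : (\int[m2]_s \int[m1]_y (W y s ^+ 2)%:E < +oo)%E.

Let box (z : T1 * T2) : R := W z.1 z.2 * \1_A z.1 * \1_B z.2.

(** Square integrability gives integrability on a box of finite measure, through
    [|W| <= 1 + W^2]. *)
Let integrable_box : (m1 \x m2)%E.-integrable setT (EFin \o box).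
Proof.
have mIA : measurable_fun setT (\1_A : T1 -> R) by exact: measurable_indic.
have mIB : measurable_fun setT (\1_B : T2 -> R) by exact: measurable_indic.
have mbox : measurable_fun setT box.
  apply: measurable_funM; last exact: (measurableT_comp mIB measurable_snd).
  by apply: measurable_funM => //; exact: (measurableT_comp mIA measurable_fst).
pose S := A `*` B.
have mS : measurable S by exact: measurableX.
have iS : (m1 \x m2)%E.-integrable setT (EFin \o (\1_S : T1 * T2 -> R)).
  apply: integrable_ge0; [exact: measurable_indic|by move=> z _; rewrite indicE|].
  rewrite integral_indic// setIT.
  have SE := product_measure1E m1 m2 mA mB.
  apply: (@le_lt_trans _ _ (m1 A * m2 B)%E); first by rewrite -SE.
  by apply: lte_mul_pinfty => //; rewrite ge0_fin_numE.
have mW2 : measurable_fun setT (fun z : T1 * T2 => W z.1 z.2 ^+ 2).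
  exact: measurable_funX.
have iW : (m1 \x m2)%E.-integrable setT (EFin \o (fun z => W z.1 z.2 ^+ 2)).
  apply: integrable_ge0 => //.
    by move=> z _; rewrite sqr_ge0.
  rewrite (@tonelli21 _ _ _ _ _ m1 m2 (fun z => (W z.1 z.2 ^+ 2)%:E))//.
    exact/measurable_EFinP.
  by move=> z; rewrite lee_fin sqr_ge0.
have iSW := integrable_addr measurableT iS iW.
apply: le_integrable iSW => //; first exact/measurable_EFinP.
move=> z _ /=; rewrite lee_fin.
have S0 : 0 <= \1_S z :> R by rewrite indicE.
rewrite [leRHS]ger0_norm ?addr_ge0 ?sqr_ge0//.
rewrite /box -mulrA.
have -> : \1_A z.1 * \1_B z.2 = \1_S z :> R.
  by case: z {S0} => z1 z2; rewrite !indicE /S in_setX -natrM mulnb.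
rewrite normrM (ger0_norm S0) indicE; case: (_ \in _) => /=; last first.
  by rewrite mulr0 add0r sqr_ge0.
rewrite mulr1 -(real_normK (num_real (W z.1 z.2))).
have := sqr_ge0 (`|W z.1 z.2| - 1); have := normr_ge0 (W z.1 z.2); nra.
Qed.

Lemma Rintegral_box :
  [/\ m2.-integrable B (EFin \o (fun s => \int[m1]_(y in A) W y s)),
      m1.-integrable A (EFin \o (fun y => \int[m2]_(s in B) W y s)) &
      \int[m2]_(s in B) (\int[m1]_(y in A) W y s) =
      \int[m1]_(y in A) (\int[m2]_(s in B) W y s)].
Proof.
have FE : (fun y => \int[m2]_s box (y, s)) = (fun y => \int[m2]_(s in B) W y s) \_ A.
  apply/funext => y; rewrite patchE /box /= indicE; case: (y \in A) => /=; last first.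
    by rewrite /Rintegral integral0_eq//= => s _; rewrite mulr0 mul0r.
  rewrite [RHS]Rintegral_mkcond; congr fine; apply: eq_integral => s _.
  by rewrite patchE indicE mulr1; case: (_ \in _); rewrite ?mulr1 ?mulr0.
have GE : (fun s => \int[m1]_y box (y, s)) = (fun s => \int[m1]_(y in A) W y s) \_ B.
  apply/funext => s; rewrite patchE /box /= indicE; case: (s \in B) => /=; last first.
    by rewrite /Rintegral integral0_eq//= => y _; rewrite mulr0.
  rewrite [RHS]Rintegral_mkcond; congr fine; apply: eq_integral => y _.
  by rewrite patchE indicE mulr1; case: (_ \in _); rewrite ?mulr1 ?mulr0.
have [i2 i1 E2 E1] := Rintegral_fubini integrable_box.
split.
- by apply/(integrable_mkcond _ mB); rewrite restrict_EFin -GE.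
- by apply/(integrable_mkcond _ mA); rewrite restrict_EFin -FE.
- by rewrite Rintegral_mkcond -GE -E2 E1 FE -Rintegral_mkcond.
Qed.

End box_fubini.

Section continuous_ae.
Context {R : realType}.
Notation mu := (@lebesgue_measure R).

Lemma continuous_ae_eq0 (a b : R) (F : R -> R) : a < b ->
  {within `[a, b], continuous F} -> {ae mu, forall x, a < x < b -> F x = 0} ->
  forall x, a <= x <= b -> F x = 0.
Proof.
move=> ab cF F0 x xab; apply/eqP; apply: contraT => Fx.
have Fx0 : 0 < `|F x| by rewrite normr_gt0.
have xab' : `[a, b]%classic x by rewrite /= in_itv.
move/subspace_continuousP: (cF) => /(_ x xab')/cvgrPdist_lt/(_ _ Fx0).
rewrite /prop_near1 /within/= => -[r /= r0 Hr].
pose c := Num.max a (x - r); pose c' := Num.min b (x + r).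
have cc' : c < c'.
  case/andP: xab => ax xb.
  rewrite lt_min !gt_max ab/=; apply/andP; split; first by lra.
  by apply/andP; split; lra.
have : {ae mu, forall y, ~ (c < y < c')}.
  apply: aeS F0 => y F0y; rewrite gt_max lt_min => /andP[/andP[ay xy] /andP[yb yx]].
  have yab : a < y < b by rewrite ay.
  have : `|F x - F y| < `|F x|.
    apply: (Hr y); last by rewrite /= in_itv/= !ltW.
    by rewrite /ball_/= ltr_norml; apply/andP; split; lra.
  by rewrite F0y// subr0 ltxx.
move=> [N [mN N0 subN]].
have : (mu `]c, c'[%classic <= mu N)%E.
  apply: le_measure; rewrite ?inE//.
  by move=> y /=; rewrite in_itv/= => yc; apply: subN => /=; exact.
rewrite N0 lebesgue_measure_itv/= lte_fin cc'.
by rewrite -EFinB lee_fin leNgt subr_gt0 cc'.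
Qed.

End continuous_ae.

(** * Exchange of the derivatives in space and time *)

Section mixed_derivative.
Context {R : realType}.
Notation mu := (@lebesgue_measure R).
Implicit Types (W : R -> R -> R) (a b c e x t : R).

Lemma jointly_measurable_flip W : jointly_measurable W ->
  jointly_measurable (fun t x => W x t).
Proof.
move=> mW; apply: (measurableT_comp (f := fun z : R * R => W z.1 z.2)
  (g := fun z : R * R => (z.2, z.1))) => //.
exact: measurable_fun_pair.
Qed.

Lemma Rintegral_rectangle a b c e W : L2_family mu W ->
  [/\ mu.-integrable `[c, e] (EFin \o (fun s => \int[mu]_(y in `[a, b]) W y s)),
      mu.-integrable `[a, b] (EFin \o (fun y => \int[mu]_(s in `[c, e]) W y s)) &
      \int[mu]_(s in `[c, e]) (\int[mu]_(y in `[a, b]) W y s) =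
      \int[mu]_(y in `[a, b]) (\int[mu]_(s in `[c, e]) W y s)].
Proof.
move=> [mW Wfin].
have fin (p q : R) (i : interval R) : i = `[p, q] -> (mu [set` i] < +oo)%E.
  by move=> ->; rewrite lebesgue_measure_itv/=; case: ifPn; rewrite ?ltry.
apply: (@Rintegral_box _ _ _ _ _ mu mu `[a, b]%classic `[c, e]%classic W) => //.
  exact: (fin a b).
exact: (fin c e).
Qed.

Lemma ae_swap_rectangle a b c e (g k : R -> R -> R) :
  jointly_measurable g -> jointly_measurable k ->
  {ae mu, forall t, c < t < e -> {ae mu, forall x, a < x < b -> g x t = k x t}} ->
  {ae mu, forall x, a < x < b -> {ae mu, forall t, c < t < e -> g x t = k x t}}.
Proof.
move=> mg mk gk.
have gk' : {ae mu, forall t, `]c, e[%classic t ->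
    {ae mu, forall x, a < x < b -> g x t = k x t}}.
  by apply: aeS gk => t Ht; rewrite /= in_itv/=.
have E := @ae_eq_swap _ _ R mu a b `]c, e[%classic g k mg mk (measurable_itv _) gk'.
apply: aeS E => x Ex xab; apply: aeS (Ex xab) => t Et tce.
by apply: Et; rewrite /= in_itv.
Qed.

Variables (l T : R) (l_gt0 : 0 < l) (T_gt0 : 0 < T).
Variables (U Ux Ut Utx : R -> R -> R) (r0 rl q0 ql : R -> R).
Hypotheses (LU : L2_family mu U) (LUx : L2_family mu Ux).
Hypotheses (LUt : L2_family mu Ut) (LUtx : L2_family mu Utx).
Hypotheses (mq0 : measurable_fun setT q0) (mql : measurable_fun setT ql).
Hypothesis iq0 : mu.-integrable `[0, T] (EFin \o q0).
Hypothesis slice : {ae mu, forall t, 0 < t < T -> exists G Gt,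
  [/\ AC 0 l G (Ux^~ t), AC 0 l Gt (Utx^~ t),
      {ae mu, forall x, 0 < x < l -> U x t = G x /\ Ut x t = Gt x},
      G 0 = r0 t /\ G l = rl t & Gt 0 = q0 t /\ Gt l = ql t]}.
Hypothesis init : {ae mu, forall x, 0 < x < l ->
  {ae mu, forall t, 0 < t < T -> U x t = \int[mu]_(s in `[0, t]) Ut x s}}.

(** Primitives of [Utx] in x, in t and in both, and of the boundary value [q0] in t. The goal is U =
    Q0 + HH: it exhibits [U] as a primitive in x of [H], while [U] is already known to be one of
    [Ux]. *)
Let P x s := \int[mu]_(y in `[0, Num.min x l]) Utx y s.
Let H y t := \int[mu]_(s in `[0, Num.min t T]) Utx y s.
Let HH x t := \int[mu]_(y in `[0, Num.min x l]) H y t.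
Let Q0 t := \int[mu]_(s in `[0, Num.min t T]) q0 s.

Let mP : jointly_measurable P.
Proof. exact: (jointly_measurable_prim 0 l LUtx.1). Qed.

Let mH : jointly_measurable H.
Proof.
apply: jointly_measurable_flip.
exact: (jointly_measurable_prim 0 T (jointly_measurable_flip LUtx.1)).
Qed.

Let mHH : jointly_measurable HH.
Proof. exact: (jointly_measurable_prim 0 l mH). Qed.

Let mQ0 : measurable_fun setT Q0.
Proof.
have mq : jointly_measurable (fun (s : R) (_ : R) => q0 s).
  exact: (measurableT_comp mq0 measurable_fst).
apply: (@measurable_section _ R R (fun t _ => Q0 t) 0).
exact: (jointly_measurable_prim 0 T mq).
Qed.

Let Ut_xslice : {ae mu, forall x, 0 < x < l ->
  {ae mu, forall s, 0 < s < T -> Ut x s = q0 s + P x s}}.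
Proof.
have mqP : jointly_measurable (fun x s => q0 s + P x s).
  apply: measurable_funD => //; exact: (measurableT_comp mq0 measurable_snd).
have D : {ae mu, forall t, 0 < t < T ->
    {ae mu, forall x, 0 < x < l -> Ut x t = q0 t + P x t}}.
  apply: aeS slice => t Ht tT.
  have [G [Gt [_ ACt Ux0 _ [Gt0 _]]]] := Ht tT.
  apply: aeS Ux0 => x Hx xl; have [_ ->] := Hx xl.
  have /andP[x0 xl'] := xl.
  by rewrite /P (min_idPl (ltW xl')) -Gt0; apply: ACt.2; rewrite !ltW.
exact: (ae_swap_rectangle LUt.1 mqP D).
Qed.

(** [Ut = q0 + P] is integrated in time from the zero initial value, and Fubini on a rectangle turns
    the time integral of [P] into [HH]. *)
Let U_decomposition : {ae mu, forall x, 0 < x < l ->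
  {ae mu, forall t, 0 < t < T -> U x t = Q0 t + HH x t}}.
Proof.
apply: aeS2 (aeI init Ut_xslice) (aeI (ae_neq 0) (ae_neq l)).
move=> x [Ix Ux0] _ xl; have /andP[x0 xl'] := xl.
apply: aeS (Ix xl) => t It tT; have /andP[t0 tT'] := tT.
rewrite It//.
have [iP _ PE] := Rintegral_rectangle 0 (Num.min x l) 0 t LUtx.
have mUx : measurable_fun `[0, t] (Ut x).
  apply: measurable_funTS; exact: (measurableT_comp LUt.1 (measurable_pair1 x)).
have mqx : measurable_fun `[0, t] (fun s => q0 s + P x s).
  apply: measurable_funTS; apply: measurable_funD => //.
  exact: (measurableT_comp mP (measurable_pair1 x)).
rewrite (@ae_Rintegral _ _ _ mu `[0, t] _ (fun s => q0 s + P x s))//; last first.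
  have := ae_open_segment (a := 0) (b := T) (P := fun s => Ut x s = q0 s + P x s) (Ux0 xl).
  apply: aeS => s Hs /=; rewrite in_itv/= => /andP[s0 st].
  by apply: Hs; rewrite s0 (le_trans st)// ltW.
have iq0t : mu.-integrable `[0, t] (EFin \o q0).
  by apply: integrableS iq0 => //; apply: subset_itv; rewrite bnd_simp// ltW.
rewrite (segment_RintegralD iq0t iP) /Q0 /HH /H (min_idPl (ltW tT')); congr (_ + _).
exact: PE.
Qed.

Let U_tslice : {ae mu, forall t, 0 < t < T ->
  {ae mu, forall x, 0 < x < l -> U x t = Q0 t + HH x t}}.
Proof.
have mQH : jointly_measurable (fun t x => Q0 t + HH x t).
  apply: measurable_funD.
    exact: (measurableT_comp mQ0 measurable_fst).
  exact: (jointly_measurable_flip mHH).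
exact: (ae_swap_rectangle (jointly_measurable_flip LU.1) mQH U_decomposition).
Qed.

(** At fixed [t] the functions [G] and [K] are both absolutely continuous in x and agree almost
    everywhere, hence everywhere: comparing derivatives identifies [Ux] with [H], comparing end
    values identifies the traces. *)
Let slice_eq : {ae mu, forall t, 0 < t < T ->
  [/\ {ae mu, forall x, 0 < x < l -> Ux x t = H x t},
      r0 t = Q0 t & rl t = Q0 t + HH l t]}.
Proof.
apply: aeS2 slice U_tslice => t St Ut' tT; have /andP[t0 tT'] := tT.
have [G [Gt [ACG _ UG [Gr0 Grl] _]]] := St tT.
have [_ iH _] := Rintegral_rectangle 0 l 0 t LUtx.
have HE y : H y t = \int[mu]_(s in `[0, t]) Utx y s.
  by rewrite /H (min_idPl (ltW tT')).
have {}iH : mu.-integrable `[0, l] (EFin \o (H^~ t)).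
  by apply: eq_integrable iH => // y _ /=; rewrite HE.
pose K x := Q0 t + \int[mu]_(y in `[0, x]) H y t.
have ACK : AC 0 l K (H^~ t).
  split=> // x _; rewrite /K set_itv1 Rintegral_set1 addr0//.
have KE x : 0 <= x <= l -> K x = Q0 t + HH x t.
  by move=> /andP[_ xl]; rewrite /K /HH (min_idPl xl).
have l0 := ltW l_gt0.
have ACD := AC_add ACG (AC_opp l0 ACK).
have GK : {ae mu, forall x, 0 < x < l -> G x - K x = 0}.
  apply: aeS2 UG (Ut' tT) => x UGx Ux' xl.
  have [<- _] := UGx xl; rewrite Ux'// KE ?subrr//.
  by case/andP: xl => *; rewrite !ltW.
have GK0 : forall x, 0 <= x <= l -> G x - K x = 0.
  by apply: continuous_ae_eq0 => //; exact: AC_continuous ACD.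
split.
- have iD : mu.-integrable `[0, l] (EFin \o (fun x => Ux x t + - H x t)) by case: ACD.
  have I0 x : 0 <= x <= l -> \int[mu]_(s in `[0, x]) (Ux s t + - H s t) = 0.
    move=> xl; have [_ D] := ACD; have := D x xl.
    by rewrite (GK0 x xl) (GK0 0) ?lexx// add0r.
  apply: aeS (Rintegral_eq0_ae l_gt0 iD I0) => x Dx xl.
  by apply/eqP; rewrite -subr_eq0 Dx.
- rewrite -Gr0; have /eqP := GK0 0 ltac:(by rewrite lexx); rewrite subr_eq0 => /eqP ->.
  by rewrite /K set_itv1 Rintegral_set1 addr0.
- rewrite -Grl; have /eqP := GK0 l ltac:(by rewrite lexx l0); rewrite subr_eq0 => /eqP ->.
  by rewrite KE// l0 lexx.
Qed.

Lemma mixed_derivative : {ae mu, forall x, 0 < x < l ->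
  {ae mu, forall t, 0 < t < T -> Ux x t = \int[mu]_(s in `[0, t]) Utx x s}}.
Proof.
have D : {ae mu, forall t, 0 < t < T ->
    {ae mu, forall x, 0 < x < l -> Ux x t = H x t}}.
  by apply: aeS slice_eq => t Ht /Ht[].
apply: aeS (ae_swap_rectangle LUx.1 mH D) => x Ex xl.
apply: aeS (Ex xl) => t Et tT; rewrite Et//.
by rewrite /H (min_idPl _)//; case/andP: tT => _ /ltW.
Qed.

Lemma trace_derivative0 :
  {ae mu, forall t, 0 < t < T -> r0 t = \int[mu]_(s in `[0, t]) q0 s}.
Proof.
apply: aeS slice_eq => t Ht tT; have [_ -> _] := Ht tT.
by rewrite /Q0 (min_idPl _)//; case/andP: tT => _ /ltW.
Qed.

(** The trace of [Ut] at [l] is [q0] plus the integral of [Utx] across the segment, so after Fubini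
    the formula for [rl] in [slice_eq] is the time integral of [ql]. *)
Lemma trace_derivativel :
  {ae mu, forall t, 0 < t < T -> rl t = \int[mu]_(s in `[0, t]) ql s}.
Proof.
apply: aeS slice_eq => t Ht tT; have [_ _ ->] := Ht tT.
have /andP[t0 tT'] := tT.
have [iP _ PE] := Rintegral_rectangle 0 l 0 t LUtx.
rewrite /Q0 /HH /H (min_idPl (ltW tT')) (min_idPl (lexx l)) -PE.
have iq0t : mu.-integrable `[0, t] (EFin \o q0).
  by apply: integrableS iq0 => //; apply: subset_itv; rewrite bnd_simp// ltW.
rewrite -(segment_RintegralD iq0t iP).
apply: ae_Rintegral => //.
- apply: measurable_funTS; apply: measurable_funD => //.
  exact: (measurable_Rintegral 0 l LUtx.1).
- exact: measurable_funTS.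
have H' : {ae mu, forall s, 0 < s < T -> q0 s + \int[mu]_(y in `[0, l]) Utx y s = ql s}.
  apply: aeS slice => s Hs sT; have [G [Gt [_ ACt _ _ [Gt0 Gtl]]]] := Hs sT.
  by rewrite -Gt0 -Gtl -ACt.2// lexx ltW.
apply: aeS (ae_open_segment H') => s Hs /=; rewrite in_itv/= => /andP[s0 st].
by apply: Hs; rewrite s0 (le_trans st)// ltW.
Qed.

End mixed_derivative.

(** * The pointwise Carleman inequality *)

Ltac nonneg := repeat first [ done | exact: sqr_ge0 | apply: exprn_ge0
  | rewrite invr_ge0 | apply: addr_ge0 | apply: mulr_ge0 ].

Section conjugated_jet.
Context {R : realFieldType}.

(* Here e stands for the weight exp(- s th g), with th = th(t) and g = g(x);
   th1, th2 and g1, g2 are the first two derivatives of th and g, and w, wx, ...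
   are the derivatives of e u written in terms of those of u. *)
Variables (a s th th1 th2 g g1 g2 e u ux uxx ut utx : R).

Definition jet_w := e * u.
Definition jet_wx := e * (ux - s * th * g1 * u).
Definition jet_wt := e * (ut - s * th1 * g * u).
Definition jet_wxx :=
  e * (uxx - 2 * s * th * g1 * ux - s * th * g2 * u + s ^+ 2 * th ^+ 2 * g1 ^+ 2 * u).
Definition jet_wtx :=
  e * (utx - s * th1 * g * ux - s * th1 * g1 * u
       - s * th * g1 * (ut - s * th1 * g * u)).

Definition flux_x :=
  - a * (jet_wt * jet_wx) + a ^+ 2 * s * th * (g1 * (jet_wx * jet_wx))
  + (a ^+ 2 * s ^+ 3 * th ^+ 3 * (g1 * (g1 * g1))
     - a * s ^+ 2 * th * th1 * (g1 * g)) * (jet_w * jet_w).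

Definition flux_t :=
  a / 2 * (jet_wx * jet_wx)
  + (- (a / 2) * s ^+ 2 * g1 ^+ 2 * (th * th) + s / 2 * g * th1) * (jet_w * jet_w).

(** The total x-derivative of [flux_x] written out by the product rule. Keeping it algebraic in the
    values allows [uxx] and [utx] to exist only almost everywhere. *)
Definition dx_flux_x :=
  - a * (jet_wtx * jet_wx + jet_wt * jet_wxx)
  + a ^+ 2 * s * th * (g2 * (jet_wx * jet_wx) + g1 * (2 * (jet_wx * jet_wxx)))
  + (a ^+ 2 * s ^+ 3 * th ^+ 3 * (3 * (g1 * (g1 * g2)))
     - a * s ^+ 2 * th * th1 * (g2 * g + g1 * g1)) * (jet_w * jet_w)
  + (a ^+ 2 * s ^+ 3 * th ^+ 3 * (g1 * (g1 * g1))
     - a * s ^+ 2 * th * th1 * (g1 * g)) * (2 * (jet_w * jet_wx)).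

Definition dt_flux_t :=
  a * (jet_wx * jet_wtx)
  + (- a * s ^+ 2 * g1 ^+ 2 * (th * th1) + s / 2 * g * th2) * (jet_w * jet_w)
  + (- (a / 2) * s ^+ 2 * g1 ^+ 2 * (th * th) + s / 2 * g * th1)
    * (2 * (jet_w * jet_wt)).

(** The antisymmetric part of the conjugated operator would also contain [- a * s * th * g2 * w].
    This term is kept out of [P1] and treated as an error in [P12], since multiplying it by the
    second-order part would lead to differentiating [g2]. *)
Let P1 := jet_wt - 2 * a * s * th * g1 * jet_wx.
Let P2 := - a * jet_wxx - a * s ^+ 2 * th ^+ 2 * g1 ^+ 2 * jet_w + s * th1 * g * jet_w.

Let P12 : P1 + P2 = e * (ut - a * uxx) + a * s * th * g2 * jet_w.
Proof. by rewrite /P1 /P2 /jet_wt /jet_wx /jet_wxx /jet_w; ring. Qed.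

(* No third derivative of g occurs: this is why d need only be C^2. *)
Let product_identity : P1 * P2 = dx_flux_x + dt_flux_t
  - a ^+ 2 * g2 * (s * th * jet_wx ^+ 2)
  - 3 * a ^+ 2 * g1 ^+ 2 * g2 * (s ^+ 3 * th ^+ 3 * jet_w ^+ 2)
  + a * s ^+ 2 * th * th1 * (g2 * g + 2 * g1 ^+ 2) * jet_w ^+ 2
  - s / 2 * th2 * g * jet_w ^+ 2.
Proof.
rewrite /P1 /P2 /dx_flux_x /dt_flux_t.
move: jet_w jet_wx jet_wt jet_wxx jet_wtx => W WX WT WXX WTX.
by field.
Qed.

Variables (a0 a1 m N K1 K2 th0 : R).
Hypotheses (a0_gt0 : 0 < a0) (m_gt0 : 0 < m) (N_gt0 : 0 < N) (th0_gt0 : 0 < th0).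
Hypotheses (K1_gt0 : 0 < K1) (K2_gt0 : 0 < K2).
Hypotheses (aa : a0 <= a <= a1) (g_bd : 0 <= g <= N) (g1_bd : m <= g1 <= N)
  (g2_bd : m <= - g2 <= N) (th_bd : th0 <= th)
  (th1_bd : `|th1| <= K1 * th ^+ 2) (th2_bd : `|th2| <= K2 * th ^+ 3).

(** The 1 gives [1 <= s], the inverse of [th0] gives [1 <= s * th], and the quotient lets one third
    of the positive term in [w] absorb the errors of lower order in [s]. *)
Definition carleman_threshold :=
  1 + th0^-1 + (3 * a1 * K1 * N ^+ 2 + K2 * N + a1 ^+ 2 * N ^+ 2 / th0) / (a0 ^+ 2 * m ^+ 3).

(** The first factor collects, for [ut], [ux] and [u] in turn, the cost of returning from [P1], [X]
    and [Y] to the unconjugated energy. The second bounds [P1 ^+ 2], [X] and [Y] by means of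
    [lower_bound]. *)
Definition carleman_cst :=
  (4 + 16 * a1 ^+ 2 * N ^+ 2 + 2 * K1 ^+ 2 * N ^+ 2 + 2 + 2 * N ^+ 2 + 1) *
  (2 + (a0 ^+ 2 * m)^-1 + (a0 ^+ 2 * m ^+ 3)^-1).

Hypothesis s_ge : carleman_threshold <= s.

Let a_gt0 : 0 < a. Proof. by case/andP: aa => + _; exact: lt_le_trans. Qed.
Let a1_gt0 : 0 < a1. Proof. by case/andP: aa => _; exact: lt_le_trans. Qed.
Let th_gt0 : 0 < th. Proof. exact: lt_le_trans th_bd. Qed.
Let a0_ge0 := ltW a0_gt0. Let a_ge0 := ltW a_gt0. Let a1_ge0 := ltW a1_gt0.
Let m_ge0 := ltW m_gt0. Let N_ge0 := ltW N_gt0. Let th0_ge0 := ltW th0_gt0.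
Let K1_ge0 := ltW K1_gt0. Let K2_ge0 := ltW K2_gt0. Let th_ge0 := ltW th_gt0.
Let C2 := 3 * a1 * K1 * N ^+ 2 + K2 * N + a1 ^+ 2 * N ^+ 2 / th0.
Let C2_gt0 : 0 < C2.
Proof. by rewrite /C2 !addr_gt0// ?mulr_gt0// ?exprn_gt0// ?invr_gt0. Qed.
Let am_gt0 : 0 < a0 ^+ 2 * m. Proof. by rewrite mulr_gt0// exprn_gt0. Qed.
Let am3_gt0 : 0 < a0 ^+ 2 * m ^+ 3. Proof. by rewrite mulr_gt0// exprn_gt0. Qed.

Let s_ge1 : 1 <= s.
Proof.
apply: le_trans s_ge; rewrite /carleman_threshold -/C2 -addrA lerDl.
by rewrite addr_ge0 ?invr_ge0 ?divr_ge0// ltW.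
Qed.
Let s_gt0 : 0 < s. Proof. exact: lt_le_trans s_ge1. Qed.
Let s_ge0 := ltW s_gt0.
Let g1_gt0 : 0 < g1. Proof. by case/andP: g1_bd => + _; exact: lt_le_trans. Qed.
Let g1_ge0 := ltW g1_gt0.
Let ng2_ge0 : 0 <= - g2. Proof. by case/andP: g2_bd => + _; exact: le_trans. Qed.

Let sth_ge1 : 1 <= s * th.
Proof.
have : th0^-1 <= s.
  apply: le_trans s_ge; rewrite /carleman_threshold -/C2 addrAC lerDr.
  by rewrite addr_ge0 ?divr_ge0// ltW.
move=> H; rewrite -[X in X <= _](@mulVf _ th0) ?gt_eqF//.
by apply: ler_pM; rewrite ?invr_ge0.
Qed.

Let C2_le : C2 <= a0 ^+ 2 * m ^+ 3 * s.
Proof.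
rewrite mulrC -ler_pdivrMr//; apply: le_trans s_ge; rewrite /carleman_threshold -/C2.
by rewrite lerDr addr_ge0 ?invr_ge0 ?ltW.
Qed.

Let X := s * th * jet_wx ^+ 2.
Let Y := s ^+ 3 * th ^+ 3 * jet_w ^+ 2.

Let X_ge0 : 0 <= X. Proof. by rewrite /X; nonneg. Qed.
Let Y_ge0 : 0 <= Y. Proof. by rewrite /Y; nonneg. Qed.

(** Expand (P1 + P2)^2, drop P2^2 and insert the product identity. As g2 < 0, its terms in [wx] and
    [w] are positive, the latter with coefficient 3; the errors t3, t4 and t5 are multiples of s^2
    th^3 w^2, one power of s below [Y], and cost 1 of the 3. *)
Let lower_bound :
  a0 ^+ 2 * m * X + 2 * (a0 ^+ 2 * m ^+ 3) * Y + 2^-1 * P1 ^+ 2 <=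
  (e * (ut - a * uxx)) ^+ 2 - dx_flux_x - dt_flux_t.
Proof.
have /andP[a0a aa1] := aa; have /andP[g0 gN] := g_bd.
have /andP[mg1 g1N] := g1_bd; have /andP[mg2 g2N] := g2_bd.
have W0 : 0 <= s ^+ 2 * th ^+ 3 * jet_w ^+ 2.
  by nonneg.
set Z := s ^+ 2 * th ^+ 3 * jet_w ^+ 2 in W0.
have YZ : Y = s * Z by rewrite /Y /Z; ring.
have C2Z : C2 * Z <= a0 ^+ 2 * m ^+ 3 * Y by rewrite YZ mulrA ler_wpM2r.
have a2 : a0 ^+ 2 <= a ^+ 2 by rewrite ler_sqr ?nnegrE.
have a12 : a ^+ 2 <= a1 ^+ 2 by rewrite ler_sqr ?nnegrE.
have g12 : m ^+ 2 <= g1 ^+ 2 by rewrite ler_sqr ?nnegrE .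
have g1N2 : g1 ^+ 2 <= N ^+ 2 by rewrite ler_sqr ?nnegrE .
have g22 : g2 ^+ 2 <= N ^+ 2 by rewrite -sqrrN ler_sqr ?nnegrE .
have t1 : a0 ^+ 2 * m * X <= - a ^+ 2 * g2 * X.
  apply: ler_wpM2r => //; rewrite (_ : - a ^+ 2 * g2 = a ^+ 2 * - g2); last by ring.
  by apply: ler_pM => //; nonneg.
have t2 : 3 * (a0 ^+ 2 * m ^+ 3) * Y <= - 3 * a ^+ 2 * g1 ^+ 2 * g2 * Y.
  apply: ler_wpM2r => //.
  have -> : - 3 * a ^+ 2 * g1 ^+ 2 * g2 = 3 * (a ^+ 2 * (g1 ^+ 2 * - g2)) by ring.
  rewrite ler_pM2l// (_ : m ^+ 3 = m ^+ 2 * m); last by ring.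
  apply: ler_pM => //; try by nonneg.
  by apply: ler_pM => //; nonneg.
have t3 : `|a * s ^+ 2 * th * th1 * (g2 * g + 2 * g1 ^+ 2) * jet_w ^+ 2| <=
    3 * a1 * K1 * N ^+ 2 * Z.
  have V0 := sqr_ge0 jet_w; have s20 := sqr_ge0 s.
  rewrite /Z; move: (jet_w ^+ 2) (s ^+ 2) V0 s20 => V S V0 S0.
  rewrite !normrM (ger0_norm a_ge0) (ger0_norm th_ge0) (ger0_norm V0) (ger0_norm S0).
  have q : `|g2 * g + 2 * g1 ^+ 2| <= 3 * N ^+ 2.
    rewrite ler_norml; have : 0 <= - g2 * g <= N * N.
      rewrite mulr_ge0//=.
      by apply: ler_pM.
    move: g1N2 (sqr_ge0 g1); rewrite (expr2 N); move: (g1 ^+ 2) (N * N) => p q.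
    rewrite mulNr; move: (g2 * g) => r; lra.
  have -> : 3 * a1 * K1 * N ^+ 2 * (S * th ^+ 3 * V) =
    a1 * S * th * (K1 * th ^+ 2) * (3 * N ^+ 2) * V by ring.
  apply: ler_wpM2r => //.
  apply: ler_pM => //.
    by nonneg.
  apply: ler_pM => //; first by nonneg.
  by rewrite ler_wpM2r// ler_wpM2r.
have t4 : `|s / 2 * th2 * g * jet_w ^+ 2| <= K2 * N * Z.
  have V0 := sqr_ge0 jet_w.
  rewrite /Z; move: (jet_w ^+ 2) V0 => V V0.
  rewrite !normrM (ger0_norm V0) (ger0_norm g0) (ger0_norm s_ge0) normfV (ger0_norm (ler0n R 2)).
  have -> : K2 * N * (s ^+ 2 * th ^+ 3 * V) = s ^+ 2 * (K2 * th ^+ 3) * N * V by ring.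
  apply: ler_wpM2r => //.
  apply: ler_pM => //; first by nonneg.
  apply: ler_pM => //; first by nonneg.
  have : s <= s ^+ 2 by rewrite expr2 ler_peMl.
  by have := s_gt0; lra.
have t5 : (P1 + P2) ^+ 2 <= 2 * (e * (ut - a * uxx)) ^+ 2 + 2 * (a1 ^+ 2 * N ^+ 2 / th0 * Z).
  rewrite P12.
  have : (a * s * th * g2 * jet_w) ^+ 2 <= a1 ^+ 2 * N ^+ 2 / th0 * Z.
    have -> : (a * s * th * g2 * jet_w) ^+ 2 = a ^+ 2 * g2 ^+ 2 * (s ^+ 2 * th ^+ 2 * jet_w ^+ 2) by ring.
    have -> : a1 ^+ 2 * N ^+ 2 / th0 * Z = a1 ^+ 2 * N ^+ 2 * (th0^-1 * Z) by ring.
    apply: ler_pM; try by nonneg.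
      by apply: ler_pM => //; exact: sqr_ge0.
    rewrite /Z ler_pdivlMl//.
    have -> : s ^+ 2 * th ^+ 3 * jet_w ^+ 2 = th * (s ^+ 2 * th ^+ 2 * jet_w ^+ 2) by ring.
    by apply: ler_wpM2r => //; nonneg.
  have := sqr_ge0 (e * (ut - a * uxx) - a * s * th * g2 * jet_w).
  move: (e * (ut - a * uxx)) (a * s * th * g2 * jet_w) (a1 ^+ 2 * N ^+ 2 / th0 * Z) => p q r.
  lra.
have := product_identity; have := sqr_ge0 P2.
move: t3 t4 t1 t2 t5 C2Z; rewrite /C2 -/X -/Y !ler_norml => /andP[t3 _] /andP[_ t4].
move: t3 t4.
set E1 := a * s ^+ 2 * th * th1 * _ * _; set E2 := s / 2 * th2 * g * _.
have -> : (3 * a1 * K1 * N ^+ 2 + K2 * N + a1 ^+ 2 * N ^+ 2 / th0) * Z =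
  3 * a1 * K1 * N ^+ 2 * Z + K2 * N * Z + a1 ^+ 2 * N ^+ 2 / th0 * Z by ring.
have -> : - a ^+ 2 * g2 * X = - (a ^+ 2 * g2 * X) by ring.
have -> : - 3 * a ^+ 2 * g1 ^+ 2 * g2 * Y = - (3 * a ^+ 2 * g1 ^+ 2 * g2 * Y) by ring.
move: E1 E2 (3 * a1 * K1 * N ^+ 2 * Z) (K2 * N * Z) (a1 ^+ 2 * N ^+ 2 / th0 * Z).
move: (3 * a ^+ 2 * g1 ^+ 2 * g2 * Y) (a ^+ 2 * g2 * X) (e * (ut - a * uxx)).
have -> : 3 * (a0 ^+ 2 * m ^+ 3) * Y = 3 * (a0 ^+ 2 * m ^+ 3 * Y) by ring.
have -> : 2 * (a0 ^+ 2 * m ^+ 3) * Y = 2 * (a0 ^+ 2 * m ^+ 3 * Y) by ring.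
move: (a0 ^+ 2 * m ^+ 3 * Y) (a0 ^+ 2 * m * X) P1 P2 dx_flux_x dt_flux_t.
move=> *; lra.
Qed.

(** [lower_bound] controls [P1] rather than [w_t]. Recovering [w_t] from [P1] brings in
    [s * th * wx], whose square is affordable only after division by [s * th]: this is the origin of
    the weight on [ut]. *)
Lemma pointwise_carleman :
  ((s * th)^-1 * ut ^+ 2 + s * th * ux ^+ 2 + s ^+ 3 * th ^+ 3 * u ^+ 2) * e ^+ 2 <=
  carleman_cst * ((e * (ut - a * uxx)) ^+ 2 - dx_flux_x - dt_flux_t).
Proof.
have /andP[a0a aa1] := aa; have /andP[g0 gN] := g_bd.
have /andP[mg1 g1N] := g1_bd; have /andP[mg2 g2N] := g2_bd.
have sth0 : 0 < s * th by rewrite mulr_gt0.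
have sth0' := ltW sth0.
have a12 : a ^+ 2 <= a1 ^+ 2 by rewrite ler_sqr ?nnegrE.
have g1N2 : g1 ^+ 2 <= N ^+ 2 by rewrite ler_sqr ?nnegrE .
have gN2 : g ^+ 2 <= N ^+ 2 by rewrite ler_sqr ?nnegrE.
have sq2 (p q : R) : (p + q) ^+ 2 <= 2 * p ^+ 2 + 2 * q ^+ 2.
  by have := sqr_ge0 (p - q); lra.
have hwt : (s * th)^-1 * jet_wt ^+ 2 <= 2 * P1 ^+ 2 + 8 * a1 ^+ 2 * N ^+ 2 * X.
  have -> : jet_wt = P1 + 2 * a * s * th * g1 * jet_wx by rewrite /P1; ring.
  rewrite ler_pdivrMl//; apply: le_trans (sq2 _ _) _.
  rewrite [leRHS]mulrDr; apply: lerD.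
    by rewrite ler_peMl// mulr_ge0// sqr_ge0.
  have -> : 2 * (2 * a * s * th * g1 * jet_wx) ^+ 2 = 8 * (a ^+ 2 * g1 ^+ 2) * (s * th * X).
    by rewrite /X; ring.
  have -> : s * th * (8 * a1 ^+ 2 * N ^+ 2 * X) = 8 * (a1 ^+ 2 * N ^+ 2) * (s * th * X) by ring.
  apply: ler_wpM2r; first by nonneg.
  by rewrite ler_pM2l//; apply: ler_pM; nonneg.
have hut : (s * th)^-1 * (e * ut) ^+ 2 <= 4 * P1 ^+ 2 + 16 * a1 ^+ 2 * N ^+ 2 * X + 2 * K1 ^+ 2 * N ^+ 2 * Y.
  have -> : e * ut = jet_wt + s * th1 * g * jet_w by rewrite /jet_wt /jet_w; ring.
  apply: (@le_trans _ _ ((s * th)^-1 * (2 * jet_wt ^+ 2 + 2 * (s * th1 * g * jet_w) ^+ 2))).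
    by rewrite ler_wpM2l ?invr_ge0.
  have : (s * th)^-1 * (s * th1 * g * jet_w) ^+ 2 <= K1 ^+ 2 * N ^+ 2 * Y.
    rewrite ler_pdivrMl//.
    have -> : (s * th1 * g * jet_w) ^+ 2 = th1 ^+ 2 * g ^+ 2 * (s ^+ 2 * jet_w ^+ 2) by ring.
    have -> : s * th * (K1 ^+ 2 * N ^+ 2 * Y) =
      (K1 * th ^+ 2) ^+ 2 * N ^+ 2 * (s ^+ 2 * s ^+ 2 * jet_w ^+ 2) by rewrite /Y; ring.
    apply: ler_pM; try by nonneg.
      apply: ler_pM; try by nonneg.
      rewrite -(real_normK (num_real th1)) ler_sqr ?nnegrE//.
      by nonneg.
    rewrite ler_wpM2r ?sqr_ge0// ler_peMl ?sqr_ge0//.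
    by rewrite expr2 -[1]mulr1 ler_pM.
  by move: hwt; lra.
have hux : s * th * (e * ux) ^+ 2 <= 2 * X + 2 * N ^+ 2 * Y.
  have -> : e * ux = jet_wx + s * th * g1 * jet_w by rewrite /jet_wx /jet_w; ring.
  apply: (@le_trans _ _ (s * th * (2 * jet_wx ^+ 2 + 2 * (s * th * g1 * jet_w) ^+ 2))).
    by rewrite ler_wpM2l.
  rewrite mulrDr; apply: lerD; first by rewrite /X le_eqVlt; apply/orP; left; apply/eqP; ring.
  have -> : s * th * (2 * (s * th * g1 * jet_w) ^+ 2) = 2 * g1 ^+ 2 * Y by rewrite /Y; ring.
  by rewrite ler_wpM2r// ler_pM2l.
have hu : s ^+ 3 * th ^+ 3 * (e * u) ^+ 2 = Y by [].
set C3 := 4 + 16 * a1 ^+ 2 * N ^+ 2 + 2 * K1 ^+ 2 * N ^+ 2 + 2 + 2 * N ^+ 2 + 1.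
have P10 := sqr_ge0 P1.
have hL : ((s * th)^-1 * ut ^+ 2 + s * th * ux ^+ 2 + s ^+ 3 * th ^+ 3 * u ^+ 2) * e ^+ 2
   <= C3 * (P1 ^+ 2 + X + Y).
  have -> : ((s * th)^-1 * ut ^+ 2 + s * th * ux ^+ 2 + s ^+ 3 * th ^+ 3 * u ^+ 2) * e ^+ 2 =
    (s * th)^-1 * (e * ut) ^+ 2 + s * th * (e * ux) ^+ 2 + s ^+ 3 * th ^+ 3 * (e * u) ^+ 2.
    by rewrite !exprMn; move: (_^-1) => i; ring.
  rewrite hu; move: hut hux.
  have c1 : 0 <= a1 ^+ 2 * N ^+ 2 by nonneg.
  have c2 : 0 <= K1 ^+ 2 * N ^+ 2 by nonneg.
  have c3 := sqr_ge0 N.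
  rewrite /C3 -(mulrA 16) -(mulrA 2 (K1 ^+ 2)).
  move: P10 X_ge0 Y_ge0 (_^-1 * _) (s * th * _) c1 c2 c3.
  move: (P1 ^+ 2) X Y (N ^+ 2) (K1 ^+ 2 * N ^+ 2) (a1 ^+ 2 * N ^+ 2).
  move=> p x y C B A p0 x0 y0 i j A0 B0 C0 H1 H2.
  have n1 : 0 <= A * p by rewrite mulr_ge0.
  have n2 : 0 <= A * y by rewrite mulr_ge0.
  have n3 : 0 <= B * p by rewrite mulr_ge0.
  have n4 : 0 <= B * x by rewrite mulr_ge0.
  have n5 : 0 <= C * p by rewrite mulr_ge0.
  have n6 : 0 <= C * x by rewrite mulr_ge0.
  lra.
apply: le_trans hL _; rewrite /carleman_cst -/C3 -mulrA.
have C30 : 0 <= C3.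
  by rewrite /C3; nonneg.
rewrite ler_wpM2l//; have LB := lower_bound.
set Q := _ - _ - _ in LB *.
move: am_gt0 am3_gt0 LB; set k1 := a0 ^+ 2 * m; set k2 := a0 ^+ 2 * m ^+ 3.
move=> k1_gt0 k2_gt0 LB.
have n1 : 0 <= k1 * X by rewrite mulr_ge0// ltW.
have n2 : 0 <= k2 * Y by rewrite mulr_ge0// ltW.
move: LB; rewrite -(mulrA 2) => LB.
have Q0 : 0 <= Q by lra.
have b1 : X <= k1^-1 * Q by rewrite ler_pdivlMl//; lra.
have b2 : Y <= k2^-1 * Q by rewrite ler_pdivlMl//; lra.
have b3 : P1 ^+ 2 <= 2 * Q by lra.
by rewrite mulrDl; apply: lerD => //; rewrite mulrDl; exact: lerD.
Qed.

End conjugated_jet.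

(** * Growth of the fluxes in the large parameters *)

Section weighted_growth.
Context {R : realFieldType} (J : Type) (valid : J -> Prop).
Variables (Th e S : J -> R).
Hypotheses (Th_ge1 : forall z, valid z -> 1 <= Th z).
Hypotheses (e_ge0 : forall z, valid z -> 0 <= e z).
Hypotheses (S_ge0 : forall z, valid z -> 0 <= S z).
Implicit Types (p i j : nat) (f g : J -> R).

(** Degrees in the weight [e] and in the unknown [S] are tracked exactly and must agree in a sum.
    The power of [Th], which is at least 1, may be enlarged freely, because the exponential weight
    will dominate any power. *)
Definition growth p i j f := exists2 K, 0 <= K &
  forall z, valid z -> `|f z| <= K * Th z ^+ p * (e z ^+ i * S z ^+ j).

Let es_ge0 i j z : valid z -> 0 <= e z ^+ i * S z ^+ j.
Proof. by move=> vz; rewrite mulr_ge0 ?exprn_ge0 ?e_ge0 ?S_ge0. Qed.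

Lemma growth_opp p i j f : growth p i j f -> growth p i j (fun z => - f z).
Proof. by move=> [K K0 Hf]; exists K => // z vz; rewrite normrN Hf. Qed.

Lemma growth_mul p i j p' i' j' i2 j2 f g : growth p i j f -> growth p' i' j' g ->
  i2 = (i + i')%N -> j2 = (j + j')%N -> growth (p + p') i2 j2 (fun z => f z * g z).
Proof.
move=> [K K0 Hf] [K' K'0 Hg] -> ->; exists (K * K'); first exact: mulr_ge0.
move=> z vz; rewrite normrM !exprD.
have -> : K * K' * (Th z ^+ p * Th z ^+ p') *
     (e z ^+ i * e z ^+ i' * (S z ^+ j * S z ^+ j')) =
  (K * Th z ^+ p * (e z ^+ i * S z ^+ j)) * (K' * Th z ^+ p' * (e z ^+ i' * S z ^+ j')).
  by ring.
by apply: ler_pM => //; [exact: Hf|exact: Hg].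
Qed.

Lemma growth_add p i j p' i' j' f g : growth p i j f -> growth p' i' j' g ->
  i' = i -> j' = j -> growth (p + p') i j (fun z => f z + g z).
Proof.
move=> [K K0 Hf] [K' K'0 Hg] ii' jj'; subst i' j'.
exists (K + K'); first exact: addr_ge0.
move=> z vz; apply: le_trans (ler_normD _ _) _.
rewrite mulrDl mulrDl; apply: lerD.
  apply: le_trans (Hf z vz) _; rewrite ler_wpM2r ?es_ge0// ler_wpM2l//.
  by apply: ler_weXn2l; [exact: Th_ge1|exact: leq_addr].
apply: le_trans (Hg z vz) _; rewrite ler_wpM2r ?es_ge0// ler_wpM2l//.
by apply: ler_weXn2l; [exact: Th_ge1|exact: leq_addl].
Qed.

Lemma growth_exp p i j i2 j2 f n : growth p i j f ->
  i2 = (i * n)%N -> j2 = (j * n)%N -> growth (p * n) i2 j2 (fun z => f z ^+ n).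
Proof.
move=> [K K0 Hf] -> ->; exists (K ^+ n); first exact: exprn_ge0.
move=> z vz; rewrite normrX !exprM -!exprMn.
by apply: lerXn2r; rewrite ?nnegrE//; [exact: le_trans (Hf z vz)|exact: Hf].
Qed.

Lemma growth_norm p i j f : growth p i j f -> growth p i j (fun z => `|f z|).
Proof. by move=> [K K0 Hf]; exists K => // z vz; rewrite normr_id Hf. Qed.

Lemma growth_cst c : growth 0 0 0 (fun=> c).
Proof. by exists `|c| => // z _; rewrite !expr0 !mulr1. Qed.

Lemma growth_weight : growth 0 1 0 e.
Proof.
by exists 1 => // z vz; rewrite !expr0 !mul1r mulr1 expr1 ger0_norm ?e_ge0.
Qed.

Lemma growth_unknown f : (forall z, valid z -> `|f z| <= S z) -> growth 0 0 1 f.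
Proof. by move=> fS; exists 1 => // z vz; rewrite !expr0 !mul1r expr1 fS. Qed.

End weighted_growth.

Section flux_bounds.
Context {R : realFieldType}.
Variables (a1 N K1 K2 : R).
Hypotheses (K1_ge0 : 0 <= K1) (K2_ge0 : 0 <= K2).

(* The arguments of the fluxes, in order:
   a s th th1 th2 g g1 g2 e u ux uxx ut utx. *)
Let valid (z : nat -> R) :=
  [/\ `|z 0%N| <= a1, 0 <= z 1%N /\ 0 <= z 2%N, `|z 3%N| <= K1 * z 2%N ^+ 2 /\ `|z 4%N| <= K2 * z 2%N ^+ 3,
      [/\ `|z 5%N| <= N, `|z 6%N| <= N & `|z 7%N| <= N] & 0 <= z 8%N].

Let Th (z : nat -> R) := (1 + z 1%N) * (1 + z 2%N).
Let S (z : nat -> R) := `|z 9%N| + `|z 10%N| + `|z 11%N| + `|z 12%N| + `|z 13%N|.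

Let Th_ge1 z : valid z -> 1 <= Th z.
Proof.
by case=> _ [s0 t0] _ _ _; rewrite /Th -[leLHS]mulr1 ler_pM// lerDl.
Qed.

Let e_ge0 z : valid z -> 0 <= z 8%N. Proof. by case. Qed.

Let S_ge0 z : valid z -> 0 <= S z.
Proof. by move=> _; rewrite /S !addr_ge0. Qed.

Let G p i j f := @growth R (nat -> R) valid Th (fun z => z 8%N) S p i j f.

Let th_le z : valid z -> z 2%N <= Th z /\ z 1%N <= Th z.
Proof.
case=> _ [s0 t0] _ _ _; rewrite /Th; split; last by rewrite mulrDr; nra.
by rewrite mulrDl; nra.
Qed.

Let Ga : G 0 0 0 (fun z => z 0%N).
Proof. exists (`|a1|) => // z [za _ _ _ _]; rewrite !expr0 !mulr1; exact: le_trans za (ler_norm _). Qed.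

Let Gs : G 1 0 0 (fun z => z 1%N).
Proof.
exists (1) => // z vz; rewrite !expr0 !mulr1; have [_ sT] := th_le vz.
by case: vz => _ [s0 _] _ _ _; rewrite expr1 mul1r ger0_norm.
Qed.

Let Gth : G 1 0 0 (fun z => z 2%N).
Proof.
exists (1) => // z vz; rewrite !expr0 !mulr1; have [tT _] := th_le vz.
by case: vz => _ [_ t0] _ _ _; rewrite expr1 mul1r ger0_norm.
Qed.

Let Gth1 : G 2 0 0 (fun z => z 3%N).
Proof.
exists (K1) => // z vz; rewrite !expr0 !mulr1; have [tT _] := th_le vz.
case: vz => _ [_ t0] [h _] _ _; apply: le_trans h _.
by rewrite ler_wpM2l// lerXn2r// nnegrE// (le_trans t0).
Qed.

Let Gth2 : G 3 0 0 (fun z => z 4%N).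
Proof.
exists (K2) => // z vz; rewrite !expr0 !mulr1; have [tT _] := th_le vz.
case: vz => _ [_ t0] [_ h] _ _; apply: le_trans h _.
by rewrite ler_wpM2l// lerXn2r// nnegrE// (le_trans t0).
Qed.

Let Gg : G 0 0 0 (fun z => z 5%N).
Proof. by exists (`|N|) => // z [_ _ _ [zg _ _] _]; rewrite !expr0 !mulr1; exact: le_trans zg (ler_norm _). Qed.
Let Gg1 : G 0 0 0 (fun z => z 6%N).
Proof. by exists (`|N|) => // z [_ _ _ [_ zg _] _]; rewrite !expr0 !mulr1; exact: le_trans zg (ler_norm _). Qed.
Let Gg2 : G 0 0 0 (fun z => z 7%N).
Proof. by exists (`|N|) => // z [_ _ _ [_ _ zg] _]; rewrite !expr0 !mulr1; exact: le_trans zg (ler_norm _). Qed.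
Let Ge : G 0 1 0 (fun z => z 8%N). Proof. exact: growth_weight. Qed.

Let S_le k z : (k \in [:: 9; 10; 11; 12; 13])%N -> `|z k| <= S z.
Proof.
rewrite !inE /S => /or4P[/eqP->|/eqP->|/eqP->|/orP[]/eqP->];
  move: (normr_ge0 (z 9%N)) (normr_ge0 (z 10%N)) (normr_ge0 (z 11%N))
    (normr_ge0 (z 12%N)) (normr_ge0 (z 13%N)); lra.
Qed.

Let Gu : G 0 0 1 (fun z => z 9%N). Proof. by apply: growth_unknown => z _; exact: S_le. Qed.
Let Gux : G 0 0 1 (fun z => z 10%N). Proof. by apply: growth_unknown => z _; exact: S_le. Qed.
Let Guxx : G 0 0 1 (fun z => z 11%N). Proof. by apply: growth_unknown => z _; exact: S_le. Qed.
Let Gut : G 0 0 1 (fun z => z 12%N). Proof. by apply: growth_unknown => z _; exact: S_le. Qed.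
Let Gutx : G 0 0 1 (fun z => z 13%N). Proof. by apply: growth_unknown => z _; exact: S_le. Qed.

Ltac growth_tac := lazymatch goal with
  | |- growth _ _ _ _ _ _ _ (fun z => - _) => eapply growth_opp; growth_tac
  | |- growth _ _ _ _ _ _ _ (fun z => _ + _) =>
      eapply (@growth_add _ _ _ _ _ _ Th_ge1 e_ge0 S_ge0); [growth_tac|growth_tac|reflexivity|reflexivity]
  | |- growth _ _ _ _ _ _ _ (fun z => _ * _) => eapply growth_mul; [growth_tac|growth_tac|reflexivity|reflexivity]
  | |- growth _ _ _ _ _ _ _ (fun z => _ ^+ _) => eapply growth_exp; [growth_tac|reflexivity|reflexivity]
  | |- growth _ _ _ _ _ _ _ (fun z => `|_|) => eapply growth_norm; growth_tac
  | |- _ => first [ exact: Ga | exact: Gs | exact: Gth | exact: Gth1 | exact: Gth2 | exact: Gg | exact: Gg1 | exact: Gg2 | exact: Ge | exact: Gu | exact: Gux | exact: Guxx | exact: Gut | exact: Gutx | eapply growth_cst | idtac]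
  end.

(** A single sum, so that one exponent and one constant serve all four quantities. *)
Definition flux_sum (z : nat -> R) :=
  `|flux_x (z 0%N) (z 1%N) (z 2%N) (z 3%N) (z 5%N) (z 6%N) (z 8%N) (z 9%N) (z 10%N) (z 12%N)|
  + `|flux_t (z 0%N) (z 1%N) (z 2%N) (z 3%N) (z 5%N) (z 6%N) (z 8%N) (z 9%N) (z 10%N)|
  + `|dx_flux_x (z 0%N) (z 1%N) (z 2%N) (z 3%N) (z 5%N) (z 6%N) (z 7%N) (z 8%N) (z 9%N) (z 10%N) (z 11%N)
       (z 12%N) (z 13%N)|
  + `|dt_flux_t (z 0%N) (z 1%N) (z 2%N) (z 3%N) (z 4%N) (z 5%N) (z 6%N) (z 8%N) (z 9%N) (z 10%N) (z 12%N)
       (z 13%N)|.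

Let Gsum : exists p, G p 2 2 flux_sum.
Proof.
rewrite /flux_sum /flux_x /flux_t /dx_flux_x /dt_flux_t.
rewrite /jet_wtx /jet_wxx /jet_wt /jet_wx /jet_w /G; eexists; growth_tac.
Qed.

(** Each flux is quadratic in the conjugated unknowns, with coefficients polynomial in [s] and [th]
    once [th1] and [th2] are bounded by powers of [th]. Only the existence of an exponent
    matters. *)
Lemma flux_growth : exists p K, 0 <= K /\
  forall a s th th1 th2 g g1 g2 e u ux uxx ut utx : R,
  `|a| <= a1 -> 0 <= s -> 0 <= th -> `|th1| <= K1 * th ^+ 2 ->
  `|th2| <= K2 * th ^+ 3 -> `|g| <= N -> `|g1| <= N -> `|g2| <= N -> 0 <= e ->
  let B := K * ((1 + s) * (1 + th)) ^+ p *
    (e ^+ 2 * (`|u| + `|ux| + `|uxx| + `|ut| + `|utx|) ^+ 2) in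
  [/\ `|flux_x a s th th1 g g1 e u ux ut| <= B,
      `|flux_t a s th th1 g g1 e u ux| <= B,
      `|dx_flux_x a s th th1 g g1 g2 e u ux uxx ut utx| <= B &
      `|dt_flux_t a s th th1 th2 g g1 e u ux ut utx| <= B].
Proof.
have [p [K K0 H]] := Gsum; exists p, K; split => //.
move=> a s th th1 th2 g g1 g2 e u ux uxx ut utx ha hs hth hth1 hth2 hg hg1 hg2 he B.
have := H (nth 0 [:: a; s; th; th1; th2; g; g1; g2; e; u; ux; uxx; ut; utx]) _.
rewrite /Th /S /flux_sum /= -/B ger0_norm; last by rewrite !addr_ge0.
move: (flux_x _ _ _ _ _ _ _ _ _ _) (flux_t _ _ _ _ _ _ _ _ _) => A1 A2.
move: (dx_flux_x _ _ _ _ _ _ _ _ _ _ _ _ _) (dt_flux_t _ _ _ _ _ _ _ _ _ _ _ _) => A3 A4.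
move=> H1.
have {}H1 : `|A1| + `|A2| + `|A3| + `|A4| <= B by apply: H1; split.
move: (normr_ge0 A1) (normr_ge0 A2) (normr_ge0 A3) (normr_ge0 A4).
by split; lra.
Qed.

End flux_bounds.

(** * The Carleman estimate for a fixed velocity *)

Lemma measurable_inv (R : realType) : measurable_fun setT (fun x : R => x^-1).
Proof.
have -> : [set: R] = [set 0] `|` ~` [set 0] by rewrite setUv.
apply/measurable_funU => //; first exact: measurableC.
split; first exact: measurable_fun_set1.
apply: open_continuous_measurable_fun; first exact: closed_openC.
by move=> x /[!inE]/= /eqP x0; exact: inv_continuous.
Qed.

(** As [1 <= s] and [m <= g], the exponential is at most e^(-m th), which beats every power of
    [1 + th]; the power of [1 + s] is simply bounded by e^(p s). *)
Lemma exp_weight_bound (R : realType) (m : R) p : 0 < m -> exists2 M : R, 0 <= M &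
  forall s th g, 1 <= s -> 0 <= th -> m <= g ->
  ((1 + s) * (1 + th)) ^+ p * expR (- (s * th * g)) <= M * expR (p%:R * s).
Proof.
(* Rescaled by 1/m, so that its value at [m * th] is [(1 + th) ^+ p]. *)
move=> m0; have [M M0 HM] := poly_expR_bounded ((1 + m^-1 *: 'X) ^+ p) 0.
exists (1 + M); first by rewrite addr_ge0.
move=> s th g s1 th0 mg; rewrite exprMn -[leLHS]mulrA [leLHS]mulrC; apply: ler_pM.
- by rewrite mulr_ge0 ?expR_ge0// exprn_ge0// addr_ge0.
- by rewrite exprn_ge0// addr_ge0// (le_trans _ s1).
- apply: (@le_trans _ _ ((1 + th) ^+ p * expR (- (m * th)))).
    rewrite ler_wpM2l ?exprn_ge0 ?addr_ge0// ler_expR lerN2.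
    rewrite -mulrA mulrCA [leLHS]mulrC ler_wpM2l//.
    by rewrite -[leLHS]mul1r ler_pM// ltW.
  move: th0; rewrite le_eqVlt => /predU1P[<-|th0].
    by rewrite addr0 expr1n mulr0 oppr0 expR0 mulr1 lerDl.
  have := HM (m * th); rewrite mulr_gt0// => /(_ isT).
  rewrite expr0 mul1r horner_exp hornerD hornerC hornerZ hornerX [m^-1 * _]mulrA.
  rewrite mulVf ?gt_eqF// mul1r => H.
  apply: le_trans (le_trans _ H) _; last by rewrite lerDr.
  by rewrite ler_wpM2r ?expR_ge0// ler_norm.
- rewrite expRM_natl; apply: lerXn2r; rewrite ?nnegrE ?expR_ge0//.
    by rewrite addr_ge0// (le_trans _ s1).
  exact: expR_ge1Dx.
Qed.

Section time_weight.
Context {R : realType}.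
Variables (T : R) (T_gt0 : 0 < T).
Implicit Types t : R.

Definition theta t := (t * (T - t))^-1.
Definition theta1 t := - (T - 2 * t) * theta t ^+ 2.
Definition theta2 t := 2 * theta t ^+ 2 + 2 * (T - 2 * t) ^+ 2 * theta t ^+ 3.

Lemma measurable_theta : measurable_fun setT theta.
Proof.
apply: (measurableT_comp (@measurable_inv R)).
by apply: measurable_funM => //; exact: measurable_funB.
Qed.

Lemma theta_gt0 t : 0 < t < T -> 0 < theta t.
Proof. by move=> /andP[t0 tT]; rewrite invr_gt0 mulr_gt0// subr_gt0. Qed.

Lemma theta_ge t : 0 < t < T -> 4 / T ^+ 2 <= theta t.
Proof.
move=> tT; have t0 := theta_gt0 tT; case/andP: tT => t0' tT.
rewrite /theta ler_pdivrMr ?exprn_gt0// mulrC ler_pdivlMr; last first.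
  by rewrite mulr_gt0// subr_gt0.
have := sqr_ge0 (T - 2 * t); nra.
Qed.

Let sqr_le t : 0 < t < T -> `|T - 2 * t| <= T.
Proof. by move=> /andP[t0 tT]; rewrite ler_norml; apply/andP; split; lra. Qed.

Lemma theta1_le t : 0 < t < T -> `|theta1 t| <= T * theta t ^+ 2.
Proof.
move=> tT; rewrite /theta1 normrM normrN normrX (gtr0_norm (theta_gt0 tT)).
by rewrite ler_wpM2r ?sqr_ge0// sqr_le.
Qed.

(** The lower bound [4 <= T^2 * theta] raises the quadratic term to cubic order with coefficient
    1/2; the cubic term itself contributes 2. *)
Lemma theta2_le t : 0 < t < T -> `|theta2 t| <= 5 / 2 * T ^+ 2 * theta t ^+ 3.
Proof.
move=> tT; have t0 := theta_gt0 tT; have t4 := theta_ge tT.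
have s2 : (T - 2 * t) ^+ 2 <= T ^+ 2.
  rewrite -(real_normK (num_real (T - 2 * t))); apply: lerXn2r; rewrite ?nnegrE ?(ltW T_gt0)//.
  exact: sqr_le.
have T4 : 4 <= T ^+ 2 * theta t by rewrite -ler_pdivrMl ?exprn_gt0// mulrC.
rewrite /theta2; move: (theta t) t0 T4 => h h0 T4.
have h2 := sqr_ge0 h; have h3 : 0 <= h ^+ 3 by rewrite exprn_ge0// ltW.
rewrite ger0_norm; last by nonneg.
have e1 : 4 * h ^+ 2 <= T ^+ 2 * h ^+ 3.
  by rewrite (_ : T ^+ 2 * h ^+ 3 = T ^+ 2 * h * h ^+ 2) ?ler_wpM2r//; ring.
have e2 : (T - 2 * t) ^+ 2 * h ^+ 3 <= T ^+ 2 * h ^+ 3 by rewrite ler_wpM2r.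
move: e1 e2; rewrite -(mulrA 2) -(mulrA (5 / 2)).
by move: (T ^+ 2 * _) ((_ - _) ^+ 2 * _) (h ^+ 2) => A B C; lra.
Qed.

Lemma is_derive_theta t : 0 < t < T -> is_derive t 1 theta (theta1 t).
Proof.
move=> tT; have := theta_gt0 tT; rewrite invr_gt0 => t0.
have d1 : is_derive t 1 (fun x : R => x * (T - x)) (T - 2 * t).
  apply: is_derive_eq; rewrite /= /GRing.scale/=; ring.
apply: (is_derive_eq (is_deriveV (f := fun x => x * (T - x)) _ d1)); first by rewrite gt_eqF.
by rewrite /theta1 /theta /GRing.scale/= exprVn; ring.
Qed.

Lemma is_derive_theta1 t : 0 < t < T -> is_derive t 1 theta1 (theta2 t).
Proof.
move=> tT; have d1 := is_derive_theta tT.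
have d0 : is_derive t 1 (fun x : R => - (T - 2 * x)) 2.
  apply: is_derive_eq; rewrite /= /GRing.scale/=; ring.
apply: (is_derive_eq (is_deriveM d0 (is_deriveX 2 d1))).
by rewrite !fctE /theta2 /theta1 /GRing.scale/=; ring.
Qed.

End time_weight.

Lemma ae_integrable d (Y : measurableType d) (R : realType)
    (mu : {measure set Y -> \bar R}) (D : set Y) (f g : Y -> R) : measurable D ->
  mu.-integrable D (EFin \o f) -> measurable_fun D g ->
  {ae mu, forall x, D x -> f x = g x} -> mu.-integrable D (EFin \o g).
Proof.
move=> mD /integrableP[mf fin] mg fg; apply/integrableP; split.
  exact/measurable_EFinP.
rewrite (@ae_eq_integral _ _ _ mu D (fun x => `|(f x)%:E|)%E)//.
- by apply: measurableT_comp => //; exact/measurable_EFinP.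
- exact: measurableT_comp.
- by apply: aeS fg => x E /E /= ->.
Qed.

Section absolutely_continuous_more.
Context {R : realType}.
Notation mu := (@lebesgue_measure R).
Implicit Types (a b c x : R) (G K g k : R -> R).

Lemma AC_ae a b G g k : AC a b G g -> measurable_fun `[a, b] k ->
  {ae mu, forall x, a < x < b -> g x = k x} -> AC a b G k.
Proof.
move=> [ig Gg] mk /ae_open_segment gk.
have mg : measurable_fun `[a, b] g by apply/measurable_EFinP; exact: measurable_int ig.
have eq c : `[a, c] `<=` `[a, b] -> {ae mu, forall x, `[a, c]%classic x -> g x = k x}.
  by move=> sub; apply: aeS gk => x E /sub; rewrite /= in_itv/=.
split.
  by apply: (ae_integrable _ ig) => //; exact: eq.
move=> x xab; have sub : `[a, x] `<=` `[a, b].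
  by apply: segment_subset => //; case/andP: xab.
rewrite Gg//; congr (_ + _); apply: ae_Rintegral => //.
- exact: measurable_funS mg.
- exact: measurable_funS mk.
- exact: eq.
Qed.

(** Meant for the time flux, which contains powers of [theta] and is known to be absolutely
    continuous only away from 0 and T. The primitive of [g] is continuous up to the ends, where [h]
    tends to 0. *)
Lemma AC_vanishing a b c h g : a < b -> mu.-integrable `[a, b] (EFin \o g) ->
  (forall x y, a < x -> x <= y -> y < b ->
    \int[mu]_(t in `[x, y]) g t = h y - h x) ->
  (forall x, a < x < b -> `|h x| <= c * ((x - a) * (b - x))) ->
  \int[mu]_(t in `[a, b]) g t = 0.
Proof.
move=> ab ig gh hc; have cP := continuous_prim (ltW ab) ig.
set P := (fun x => _) in cP; rewrite -/(P b).
have Pxy x y : a < x -> x <= y -> y < b -> P y - P x = h y - h x.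
  move=> ax xy yb; rewrite -gh//; rewrite /P.
  have iy : mu.-integrable `[a, y] (EFin \o g).
    by apply: integrableS ig => //; apply: segment_subset => //; exact: ltW.
  rewrite -(@Rintegral_itv_obnd_cbnd _ x); last first.
    by apply: integrableS iy => //; apply: subset_itv; rewrite bnd_simp// ltW.
  by rewrite -(@Rintegral_itvB _ g (BLeft a) (BRight y) x)// bnd_simp// ltW.
have Pa : P a = 0 by rewrite /P set_itv1 Rintegral_set1.
have [cP1 cP2 cP3] := (continuous_within_itvP P ab).1 cP.
apply/eqP; rewrite -normr_le0; apply/ler_addgt0Pr => e e0; rewrite add0r.
have e4 : 0 < e / 4 by rewrite divr_gt0.
have c0 : 0 <= `|c| by [].
move/cvgrPdist_lt: cP2 => /(_ _ e4) [r1 /= r10 H1].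
move/cvgrPdist_lt: cP3 => /(_ _ e4) [r2 /= r20 H2].
pose D := (`|c| + 1) * (b - a + 1).
have D0 : 0 < D by rewrite /D mulr_gt0// ?ltr_wpDl// ?subr_ge0 ?ltW.
pose r := Num.min (Num.min r1 r2) (Num.min ((b - a) / 2) (e / 4 / D)).
have r0 : 0 < r by rewrite !lt_min r10 r20/= !divr_gt0// subr_gt0.
pose q := r / 2.
have q0 : 0 < q by rewrite divr_gt0.
have qr : q < r by rewrite /q; lra.
have [q1 q2 q3 q4] : [/\ q < r1, q < r2, q < (b - a) / 2 & q < e / 4 / D].
  by move: qr; rewrite !lt_min => /andP[/andP[-> ->] /andP[-> ->]].
have {}H1 : `|P a - P (a + q)| < e / 4.
  by apply: H1 => /=; [rewrite opprD addNKr normrN gtr0_norm|rewrite ltrDl].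
have {}H2 : `|P b - P (b - q)| < e / 4.
  by apply: H2 => /=; [rewrite opprB addrC subrK gtr0_norm|rewrite ltrBlDr ltrDl].
have Hx x : a < x < b -> (x - a) * (b - x) <= q * (b - a) -> `|h x| < e / 4.
  move=> xab xq; apply: le_lt_trans (hc x xab) _.
  move: q4; rewrite ltr_pdivlMr// => q4; apply: le_lt_trans q4.
  apply: (@le_trans _ _ (`|c| * (q * (b - a)))).
    case/andP: xab => ax xb.
    apply: (@le_trans _ _ (`|c| * ((x - a) * (b - x)))); last by rewrite ler_wpM2l.
    by rewrite ler_wpM2r ?ler_norm// mulr_ge0// subr_ge0 ltW.
  rewrite mulrCA ler_wpM2l ?ltW// /D; nra.
have := Pxy (a + q) (b - q); rewrite ltrDl q0 => /(_ isT).
have -> : a + q <= b - q by lra.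
have -> : b - q < b by lra.
move=> /(_ isT isT).
have ha : `|h (a + q)| < e / 4.
  by apply: Hx; [apply/andP; split; lra|nra].
have hb : `|h (b - q)| < e / 4.
  by apply: Hx; [apply/andP; split; lra|nra].
move: H1 H2 ha hb; rewrite Pa sub0r normrN.
move: (P b) (P (a + q)) (P (b - q)) (h _) (h _) => p1 p2 p3 h1 h2.
rewrite !ltr_norml !ler_norml => /andP[? ?] /andP[? ?] /andP[? ?] /andP[? ?] ?.
by apply/andP; split; lra.
Qed.

End absolutely_continuous_more.

Lemma AC_eqr (R : realType) (a b : R) (G g k : R -> R) : AC a b G g ->
  (forall x, g x = k x) -> AC a b G k.
Proof. by move=> ACG gk; apply: AC_eq ACG _ _ => // x _. Qed.

Ltac AC_tac := lazymatch goal with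
  | |- AC _ _ (fun x => - _) _ => first [eapply AC_cst | eapply AC_opp; [eassumption|AC_tac]]
  | |- AC _ _ (fun x => _ + _) _ => first [eapply AC_cst | eapply AC_add; AC_tac]
  | |- AC _ _ (fun x => _ * _) _ =>
      first [eapply AC_cst | eapply AC_mul; [eassumption|AC_tac|AC_tac]]
  | |- _ => first [eassumption | eapply AC_cst]
  end.

Section flux_slices.
Context {R : realType}.
Notation mu := (@lebesgue_measure R).
Variables (b c : R) (bc : b <= c) (a s : R).

Section space_slices.
Variables (th th1 : R) (g g1 g2 e u ux ut uxx utx : R -> R).
Hypotheses (ACg : AC b c g g1) (ACg1 : AC b c g1 g2).
Hypothesis ACe : AC b c e (fun x => - (s * th * g1 x) * e x).
Hypotheses (ACu : AC b c u ux) (ACux : AC b c ux uxx) (ACut : AC b c ut utx).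

Let ACw : AC b c (fun x => jet_w (e x) (u x))
  (fun x => jet_wx s th (g1 x) (e x) (u x) (ux x)).
Proof.
rewrite /jet_w; eapply AC_eqr; [by AC_tac|].
by move=> x; rewrite /jet_wx /=; ring.
Qed.

Let ACwx : AC b c (fun x => jet_wx s th (g1 x) (e x) (u x) (ux x))
  (fun x => jet_wxx s th (g1 x) (g2 x) (e x) (u x) (ux x) (uxx x)).
Proof.
rewrite {1}/jet_wx; eapply AC_eqr; [by AC_tac|].
by move=> x; rewrite /jet_wxx /=; ring.
Qed.

Let ACwt : AC b c (fun x => jet_wt s th1 (g x) (e x) (u x) (ut x))
  (fun x => jet_wtx s th th1 (g x) (g1 x) (e x) (u x) (ux x) (ut x) (utx x)).
Proof.
rewrite {1}/jet_wt; eapply AC_eqr; [by AC_tac|].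
by move=> x; rewrite /jet_wtx /=; ring.
Qed.

Lemma AC_flux_x :
  AC b c (fun x => flux_x a s th th1 (g x) (g1 x) (e x) (u x) (ux x) (ut x))
    (fun x => dx_flux_x a s th th1 (g x) (g1 x) (g2 x) (e x) (u x) (ux x) (uxx x)
      (ut x) (utx x)).
Proof.
rewrite /flux_x; eapply AC_eqr; [by AC_tac|].
by move=> x; rewrite /dx_flux_x /=; ring.
Qed.

End space_slices.

Section time_slices.
Variables (th th1 th2 : R -> R) (g g1 : R) (e u ux ut utx : R -> R).
Hypotheses (ACth : AC b c th th1) (ACth1 : AC b c th1 th2).
Hypothesis ACe : AC b c e (fun t => - (s * th1 t * g) * e t).
Hypotheses (ACu : AC b c u ut) (ACux : AC b c ux utx).

Let ACw : AC b c (fun t => jet_w (e t) (u t))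
  (fun t => jet_wt s (th1 t) g (e t) (u t) (ut t)).
Proof.
rewrite /jet_w; eapply AC_eqr; [by AC_tac|].
by move=> x; rewrite /jet_wt /=; ring.
Qed.

Let ACwx : AC b c (fun t => jet_wx s (th t) g1 (e t) (u t) (ux t))
  (fun t => jet_wtx s (th t) (th1 t) g g1 (e t) (u t) (ux t) (ut t) (utx t)).
Proof.
rewrite {1}/jet_wx; eapply AC_eqr; [by AC_tac|].
by move=> x; rewrite /jet_wtx /=; ring.
Qed.

Lemma AC_flux_t :
  AC b c (fun t => flux_t a s (th t) (th1 t) g g1 (e t) (u t) (ux t))
    (fun t => dt_flux_t a s (th t) (th1 t) (th2 t) g g1 (e t) (u t) (ux t) (ut t)
      (utx t)).
Proof.
rewrite /flux_t; eapply AC_eqr; [by AC_tac|].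
by move=> x; rewrite /dt_flux_t /=; field.
Qed.

End time_slices.

End flux_slices.

Section weighted_flux_bounds.
Context {R : realType}.
Variables (T a1 m N : R).
Hypotheses (T_gt0 : 0 < T) (m_gt0 : 0 < m).

Lemma sqr_sum5_le (u ux uxx ut utx : R) :
  (`|u| + `|ux| + `|uxx| + `|ut| + `|utx|) ^+ 2 <=
  5 * (u ^+ 2 + ux ^+ 2 + uxx ^+ 2 + ut ^+ 2 + utx ^+ 2).
Proof.
rewrite -(real_normK (num_real u)) -(real_normK (num_real ux)).
rewrite -(real_normK (num_real uxx)) -(real_normK (num_real ut)).
rewrite -(real_normK (num_real utx)).
move: `|u| `|ux| `|uxx| `|ut| `|utx| => p q r v w.
have := sqr_ge0 (p - q); have := sqr_ge0 (p - r); have := sqr_ge0 (p - v).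
have := sqr_ge0 (p - w); have := sqr_ge0 (q - r); have := sqr_ge0 (q - v).
have := sqr_ge0 (q - w); have := sqr_ge0 (r - v); have := sqr_ge0 (r - w).
have := sqr_ge0 (v - w); lra.
Qed.

(** Uniform in [a], hence later in the velocity. The extra factor [t * (T - t)] on [flux_t] is what
    makes the time flux vanish at both ends. *)
Definition weighted_flux_bound p M :=
  forall a s t g g1 g2 u ux uxx ut utx : R,
  `|a| <= a1 -> 1 <= s -> 0 < t < T -> m <= g <= N -> `|g1| <= N -> `|g2| <= N ->
  let th := theta T t in let th1 := theta1 T t in let th2 := theta2 T t in
  let e := expR (- (s * th * g)) in
  let B := M * expR (p%:R * s) * (u ^+ 2 + ux ^+ 2 + uxx ^+ 2 + ut ^+ 2 + utx ^+ 2) in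
  [/\ `|flux_x a s th th1 g g1 e u ux ut| <= B,
      `|flux_t a s th th1 g g1 e u ux| <= B * (t * (T - t)),
      `|dx_flux_x a s th th1 g g1 g2 e u ux uxx ut utx| <= B &
      `|dt_flux_t a s th th1 th2 g g1 e u ux ut utx| <= B].

(** The weight absorbs one power of [Th] more than [flux_growth] requires; the spare power dominates
    [th], the inverse of [t * (T - t)]. The factor 5 comes from [sqr_sum5_le]. *)
Lemma weighted_flux_bounds : exists p M, 0 <= M /\ weighted_flux_bound p M.
Proof.
have K2_ge0 : 0 <= 5 / 2 * T ^+ 2 by nonneg.
have [p [K [K0 H]]] := flux_growth a1 N (ltW T_gt0) K2_ge0.
have [M M0 HM] := exp_weight_bound p.+1 m_gt0.
exists p.+1, (K * M * 5); split; first by nonneg.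
move=> a s t g g1 g2 u ux uxx ut utx ha s1 tT /andP[mg gN] hg1 hg2 th th1 th2 e B.
have th0 := theta_gt0 tT; have th0' := ltW th0.
have s0 : 0 <= s by rewrite (le_trans _ s1).
have g0 : 0 <= g by rewrite (le_trans _ mg)// ltW.
have [] := H a s th th1 th2 g g1 g2 e u ux uxx ut utx ha s0 th0'
  (theta1_le tT) (theta2_le T_gt0 tT) _ hg1 hg2 (expR_ge0 _).
  by rewrite ger0_norm.
set S := `|u| + _ + _ + _ + _; set Th := (1 + s) * (1 + th).
have Th_ge1 : 1 <= Th.
  by rewrite -[leLHS]mulr1; apply: ler_pM => //; rewrite lerDl.
have Th_th : th <= Th.
  rewrite -[leLHS]mul1r; apply: ler_pM => //; first by rewrite lerDl.
  by rewrite lerDr.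
have e2 : Th ^+ p.+1 * e ^+ 2 <= M * expR (p.+1%:R * s).
  have -> : e ^+ 2 = expR (- (s * th * (g + g))).
    by rewrite /e -expRM_natl; congr expR; ring.
  by apply: HM => //; rewrite (le_trans mg)// lerDl.
have S5 := sqr_sum5_le u ux uxx ut utx; rewrite -/S in S5.
have ME : 0 <= M * expR (p.+1%:R * s) by rewrite mulr_ge0// expR_ge0.
have P0 : 0 <= Th ^+ p by rewrite exprn_ge0// (le_trans _ Th_ge1).
move: (sqr_ge0 e) (sqr_ge0 S) P0 e2 S5; rewrite (exprS Th p) /B.
set U := u ^+ 2 + _ + _ + _ + _.
move: (e ^+ 2) (S ^+ 2) (Th ^+ p) U => E S2 P U E0 S20 P0 e2 S5 {B}.
set B := K * M * 5 * _ * _.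
have KB : K * (Th * P * E * S2) <= B.
  rewrite [leRHS](_ : B = K * (M * expR (p.+1%:R * s) * (5 * U))); last first.
    by rewrite /B; ring.
  rewrite ler_wpM2l//; apply: ler_pM => //; rewrite mulr_ge0// mulr_ge0//.
  exact: le_trans Th_ge1.
have W0 : 0 <= P * E * S2 by rewrite !mulr_ge0.
have KB' : K * P * (E * S2) <= B.
  apply: le_trans KB; rewrite -[leLHS]mulrA ler_wpM2l// mulrA.
  by rewrite (_ : Th * P * E * S2 = Th * (P * E * S2)); [rewrite ler_peMl|ring].
have KBt : K * P * (E * S2) <= B * (t * (T - t)).
  have -> : t * (T - t) = th^-1 by rewrite /th /theta invrK.
  rewrite ler_pdivlMr//; apply: le_trans KB.
  rewrite (_ : K * P * (E * S2) * th = K * (th * (P * E * S2))); last by ring.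
  rewrite (_ : Th * P * E * S2 = Th * (P * E * S2)); last by ring.
  by rewrite ler_wpM2l// ler_wpM2r.
move=> h1 h2 h3 h4.
by split; [exact: le_trans h1 KB'|exact: le_trans h2 KBt
  |exact: le_trans h3 KB'|exact: le_trans h4 KB'].
Qed.

End weighted_flux_bounds.

Section box_slices.
Context d1 d2 (T1 : measurableType d1) (T2 : measurableType d2) (R : realType).
Variables (m1 : {sigma_finite_measure set T1 -> \bar R})
  (m2 : {sigma_finite_measure set T2 -> \bar R}).
Variables (A : set T1) (B : set T2) (mA : measurable A) (mB : measurable B).
Variable W : T1 * T2 -> R.
Hypothesis iW : (m1 \x m2)%E.-integrable (A `*` B) (EFin \o W).

Let iW' : (m1 \x m2)%E.-integrable setT (EFin \o (W \_ (A `*` B))).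
Proof. by apply: integrable_patch => //; exact: measurableX. Qed.

Lemma Rintegral_box_slices2 (h : T2 -> R) : measurable_fun setT h ->
  {ae m2, forall s, B s -> \int[m1]_(y in A) W (y, s) = h s} ->
  m2.-integrable B (EFin \o h) /\
  \int[(m1 \x m2)%E]_(z in A `*` B) W z = \int[m2]_(s in B) h s.
Proof.
move=> mh Wh; have [i2 _ E2 _] := Rintegral_fubini iW'.
have E : {ae m2, forall s, setT s ->
    \int[m1]_y (W \_ (A `*` B)) (y, s) = (h \_ B) s}.
  apply: aeS Wh => s Ws _; rewrite patchE; case: ifPn => [/set_mem Bs|Bs].
    rewrite -Ws// [RHS]Rintegral_mkcond; congr fine; apply: eq_integral => y _.
    by rewrite !patchE in_setX/= (mem_set Bs) andbT.
  rewrite /Rintegral integral0_eq// => y _.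
  by rewrite patchE in_setX/= (negbTE Bs) andbF.
have ih : m2.-integrable setT (EFin \o (h \_ B)).
  by apply: (ae_integrable _ i2 _ E) => //; exact: measurable_patch.
split; first by apply/(integrable_mkcond _ mB); rewrite restrict_EFin.
rewrite Rintegral_mkcond [RHS]Rintegral_mkcond E2; apply: ae_Rintegral => //.
- by apply/measurable_EFinP; exact: measurable_int i2.
- exact: measurable_patch.
Qed.

Lemma Rintegral_box_slices1 (h : T1 -> R) : measurable_fun setT h ->
  {ae m1, forall y, A y -> \int[m2]_(s in B) W (y, s) = h y} ->
  m1.-integrable A (EFin \o h) /\
  \int[(m1 \x m2)%E]_(z in A `*` B) W z = \int[m1]_(y in A) h y.
Proof.
move=> mh Wh; have [_ i1 _ E1] := Rintegral_fubini iW'.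
have E : {ae m1, forall y, setT y ->
    \int[m2]_s (W \_ (A `*` B)) (y, s) = (h \_ A) y}.
  apply: aeS Wh => y Wy _; rewrite patchE; case: ifPn => [/set_mem Ay|Ay].
    rewrite -Wy// [RHS]Rintegral_mkcond; congr fine; apply: eq_integral => s _.
    by rewrite !patchE in_setX/= (mem_set Ay).
  rewrite /Rintegral integral0_eq// => s _.
  by rewrite patchE in_setX/= (negbTE Ay).
have ih : m1.-integrable setT (EFin \o (h \_ A)).
  by apply: (ae_integrable _ i1 _ E) => //; exact: measurable_patch.
split; first by apply/(integrable_mkcond _ mA); rewrite restrict_EFin.
rewrite Rintegral_mkcond [RHS]Rintegral_mkcond E1; apply: ae_Rintegral => //.
- by apply/measurable_EFinP; exact: measurable_int i1.
- exact: measurable_patch.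
Qed.

Lemma ae_integrable_box_slice : {ae m1, forall y, A y ->
  m2.-integrable B (EFin \o (fun s => W (y, s)))}.
Proof.
apply: aeS (ae_integrable1 iW') => y iy Ay; apply/(integrable_mkcond _ mB).
rewrite restrict_EFin; apply: eq_integrable iy => // s _ /=.
by rewrite !patchE in_setX/= (mem_set Ay).
Qed.

End box_slices.

Lemma Rintegral_open_segment (R : realType) (a b : R) (f : R -> R) :
  measurable_fun `]a, b[ f ->
  \int[@lebesgue_measure R]_(x in `]a, b[) f x =
  \int[@lebesgue_measure R]_(x in `[a, b]) f x.
Proof.
move=> mf; rewrite /Rintegral; congr fine.
symmetry; apply: (@integral_itv_bndoo R a b (EFin \o f) true false).
exact/measurable_EFinP.
Qed.

Ltac meas_tac := lazymatch goal with
  | |- measurable_fun _ (fun z => _ + _) => apply: measurable_funD; meas_tac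
  | |- measurable_fun _ (fun z => - _) =>
      apply: measurable_funN; meas_tac
  | |- measurable_fun _ (fun z => _ * _) => apply: measurable_funM; meas_tac
  | |- measurable_fun _ (fun z => _ ^+ _) => apply: measurable_funX; meas_tac
  | |- measurable_fun _ ( *%R _) => exact: mulrl_measurable
  | |- _ => first [eassumption | exact: measurable_cst | idtac]
  end.

Lemma within_continuousM (R : realType) (A : set R) (f g : R -> R) :
  {within A, continuous f} -> {within A, continuous g} ->
  {within A, continuous (fun x => f x * g x)}.
Proof. by move=> cf cg x; exact: (@continuousM _ (subspace A) f g x (cf x) (cg x)). Qed.

Lemma AC_expR (R : realType) (b c k : R) (f f' : R -> R) : b <= c ->
  {within `[b, c], continuous f} -> {within `[b, c], continuous f'} ->
  (forall x, b < x < c -> is_derive x 1 f (f' x)) ->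
  AC b c (fun x => expR (k * f x)) (fun x => k * f' x * expR (k * f x)).
Proof.
move=> bc cf cf' df.
have ck : {within `[b, c], continuous (fun=> k)}.
  by apply: continuous_subspaceT => x; exact: cst_continuous.
have ce : {within `[b, c], continuous (fun x => expR (k * f x))}.
  move=> x; apply: continuous_comp; last exact: continuous_expR.
  exact: (within_continuousM ck cf).
apply: (@AC_derive R b c _ _ bc ce).
  exact: (within_continuousM (within_continuousM ck cf') ce).
move=> x /df dfx; rewrite mulrC.
apply: (@is_derive1_comp _ expR (fun x => k * f x) x _ _ (is_derive_expR _)).
Qed.

Lemma AC_id (R : realType) (b c : R) : b <= c -> AC b c (fun x => x) (fun=> 1).
Proof. by move=> bc; apply: AC_derive_everywhere => //; exact: cst_continuous. Qed.

Lemma AC_theta (R : realType) (T b c : R) : 0 < b -> b <= c -> c < T ->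
  AC b c (theta T) (theta1 T) /\ AC b c (theta1 T) (theta2 T).
Proof.
move=> b0 bc cT.
have tT x : b <= x <= c -> 0 < x < T.
  by move=> /andP[bx xc]; rewrite (lt_le_trans b0)// (le_lt_trans xc).
have tT' x : b < x < c -> 0 < x < T.
  by move=> /andP[/ltW bx /ltW xc]; apply: tT; rewrite bx.
have ACth : AC b c (theta T) (theta1 T).
  apply: AC_derive => //.
  - apply: derivable_within_continuous => x; rewrite in_itv/= => /tT /is_derive_theta.
    by case.
  - apply: derivable_within_continuous => x; rewrite in_itv/= => /tT /is_derive_theta1.
    by case.
  - by move=> x /tT' /is_derive_theta.
split => //; have ACi := AC_id bc.
have -> : theta1 T = fun t => - (T + - (t * 2)) * (theta T t * theta T t).
  by apply/funext => t; rewrite /theta1 (mulrC t).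
eapply AC_eqr; first by AC_tac.
by move=> t /=; rewrite /theta2 /theta1; ring.
Qed.

Lemma integrable_closed_segment (R : realType) (a b : R) (f : R -> R) :
  (@lebesgue_measure R).-integrable `]a, b[ (EFin \o f) ->
  measurable_fun `[a, b] f ->
  (@lebesgue_measure R).-integrable `[a, b] (EFin \o f).
Proof.
move=> /integrableP[mf fin] mf'; apply/integrableP; split; first exact/measurable_EFinP.
rewrite (_ : (\int[_]_(x in _) _)%E =
    \int[@lebesgue_measure R]_(x in `]a, b[) `|(EFin \o f) x|)%E//.
apply: (@integral_itv_bndoo R a b (abse \o (EFin \o f)) true false).
exact: measurableT_comp.
Qed.

Lemma le_Rintegral_combination d (Y : measurableType d) (R : realType)
    (mu : {measure set Y -> \bar R}) (D : set Y) (E F A B : Y -> R) (c : R) :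
  measurable D -> measurable_fun D E -> (forall z, D z -> 0 <= E z) ->
  mu.-integrable D (EFin \o F) -> mu.-integrable D (EFin \o A) ->
  mu.-integrable D (EFin \o B) ->
  (forall z, D z -> E z <= c * (F z - A z - B z)) ->
  mu.-integrable D (EFin \o E) /\ \int[mu]_(z in D) E z <=
    c * (\int[mu]_(z in D) F z - \int[mu]_(z in D) A z - \int[mu]_(z in D) B z).
Proof.
move=> mD mE E0 iF iA iB EFAB.
have iFA := integrable_subr mD iF iA; have iFAB := integrable_subr mD iFA iB.
have iR := integrable_mulr mD c iFAB.
have iE : mu.-integrable D (EFin \o E).
  apply: le_integrable iR => //; first exact/measurable_EFinP.
  move=> z Dz /=; rewrite lee_fin ger0_norm ?E0//.
  exact: le_trans (EFAB z Dz) (ler_norm _).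
split => //; apply: le_trans (le_Rintegral mD iE iR EFAB) _.
by rewrite (RintegralZl _ mD iFAB) (RintegralB mD iFA iB) (RintegralB mD iF iA).
Qed.

Lemma RintegralN d (Y : measurableType d) (R : realType)
    (mu : {measure set Y -> \bar R}) (D : set Y) (f : Y -> R) : measurable D ->
  mu.-integrable D (EFin \o f) ->
  \int[mu]_(x in D) - f x = - \int[mu]_(x in D) f x.
Proof.
move=> mD if_; rewrite -mulN1r -(RintegralZl _ mD if_).
by apply: eq_Rintegral => t _; rewrite mulN1r.
Qed.

Section carleman_rectangle.
Context {R : realType}.
Notation mu := (@lebesgue_measure R).
Variables (l T a0 a1 m N a s : R) (g g1 g2 : R -> R).
Hypotheses (l_gt0 : 0 < l) (T_gt0 : 0 < T) (a0_gt0 : 0 < a0) (m_gt0 : 0 < m).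
Hypotheses (N_gt0 : 0 < N) (aa : a0 <= a <= a1).
Hypotheses (mg : measurable_fun setT g) (mg1 : measurable_fun setT g1)
  (mg2 : measurable_fun setT g2).
Hypotheses (cg : {within `[0, l], continuous g}) (cg1 : {within `[0, l], continuous g1})
  (cg2 : {within `[0, l], continuous g2}).
Hypotheses (dg : forall x, 0 < x < l -> is_derive x 1 g (g1 x))
  (dg1 : forall x, 0 < x < l -> is_derive x 1 g1 (g2 x)).
Hypothesis g_bd : forall x, 0 <= x <= l ->
  [/\ m <= g x <= N, m <= g1 x <= N & m <= - g2 x <= N].
Let K2 := 5 / 2 * T ^+ 2.
Let th0 := 4 / T ^+ 2.
Hypothesis s_ge : carleman_threshold a0 a1 m N T K2 th0 <= s.

Definition weight x t := expR (- (s * theta T t * g x)).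

Variables (U Ux Uxx Ut Utx : R -> R -> R) (r0 rl p0 pl q0 ql : R -> R).
Hypotheses (LU : L2_family mu U) (LUx : L2_family mu Ux) (LUxx : L2_family mu Uxx).
Hypotheses (LUt : L2_family mu Ut) (LUtx : L2_family mu Utx).
Hypotheses (mr0 : measurable_fun setT r0) (mrl : measurable_fun setT rl)
  (mp0 : measurable_fun setT p0) (mpl : measurable_fun setT pl)
  (mq0 : measurable_fun setT q0) (mql : measurable_fun setT ql).
Hypothesis slice : {ae mu, forall t, 0 < t < T -> exists G Gx Gt,
  [/\ AC 0 l G (Ux^~ t), AC 0 l Gx (Uxx^~ t), AC 0 l Gt (Utx^~ t),
      {ae mu, forall x, 0 < x < l -> [/\ U x t = G x, Ux x t = Gx x & Ut x t = Gt x]} &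
      [/\ G 0 = r0 t /\ G l = rl t, Gx 0 = p0 t /\ Gx l = pl t &
          Gt 0 = q0 t /\ Gt l = ql t]]}.
Hypothesis init : {ae mu, forall x, 0 < x < l -> {ae mu, forall t, 0 < t < T ->
  U x t = \int[mu]_(s in `[0, t]) Ut x s /\ Ux x t = \int[mu]_(s in `[0, t]) Utx x s}}.

Let FA x t := dx_flux_x a s (theta T t) (theta1 T t) (g x) (g1 x) (g2 x) (weight x t)
  (U x t) (Ux x t) (Uxx x t) (Ut x t) (Utx x t).
Let FB x t := dt_flux_t a s (theta T t) (theta1 T t) (theta2 T t) (g x) (g1 x)
  (weight x t) (U x t) (Ux x t) (Ut x t) (Utx x t).
Let flux x t u ux ut := flux_x a s (theta T t) (theta1 T t) (g x) (g1 x) (weight x t)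
  u ux ut.

(** The divergence enters the pointwise inequality with a minus sign, so the flux at 0 counts
    positively and the flux at [l] negatively. *)
Definition boundary_flux t := flux 0 t (r0 t) (p0 t) (q0 t) - flux l t (rl t) (pl t) (ql t).
Definition residual_sq x t := (weight x t * (Ut x t - a * Uxx x t)) ^+ 2.
Definition energy x t := ((s * theta T t)^-1 * Ut x t ^+ 2 + s * theta T t * Ux x t ^+ 2
   + s ^+ 3 * theta T t ^+ 3 * U x t ^+ 2) * weight x t ^+ 2.

Let Sq x t := U x t ^+ 2 + Ux x t ^+ 2 + Uxx x t ^+ 2 + Ut x t ^+ 2 + Utx x t ^+ 2.
Let Q := `]0, l[%classic `*` `]0, T[%classic.

Let mQ : measurable Q. Proof. exact: measurableX. Qed.

Let mth : measurable_fun setT (fun t => theta T t).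
Proof. exact: measurable_theta. Qed.
Let mth1 : measurable_fun setT (fun t => theta1 T t).
Proof. by rewrite /theta1; meas_tac. Qed.
Let mth2 : measurable_fun setT (fun t => theta2 T t).
Proof. by rewrite /theta2; meas_tac. Qed.

Let mfst (f : R -> R) : measurable_fun setT f ->
  measurable_fun setT (fun z : R * R => f z.1).
Proof. by move=> mf; exact: (measurableT_comp mf measurable_fst). Qed.
Let msnd (f : R -> R) : measurable_fun setT f ->
  measurable_fun setT (fun z : R * R => f z.2).
Proof. by move=> mf; exact: (measurableT_comp mf measurable_snd). Qed.

Let mg_ := mfst mg. Let mg1_ := mfst mg1. Let mg2_ := mfst mg2.
Let mth_ := msnd mth. Let mth1_ := msnd mth1. Let mth2_ := msnd mth2.
Let mU : jointly_measurable U := LU.1. Let mUx : jointly_measurable Ux := LUx.1.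
Let mUxx : jointly_measurable Uxx := LUxx.1. Let mUt : jointly_measurable Ut := LUt.1.
Let mUtx : jointly_measurable Utx := LUtx.1.

Let mweight : jointly_measurable weight.
Proof. by apply: (measurableT_comp (@measurable_expR R)); meas_tac. Qed.

Let mFA : jointly_measurable FA.
Proof.
move: mU mUx mUxx mUt mUtx mweight; rewrite /jointly_measurable => ? ? ? ? ? ?.
by rewrite /FA /dx_flux_x /jet_wtx /jet_wxx /jet_wt /jet_wx /jet_w; meas_tac.
Qed.

Let mFB : jointly_measurable FB.
Proof.
move: mU mUx mUxx mUt mUtx mweight; rewrite /jointly_measurable => ? ? ? ? ? ?.
by rewrite /FB /dt_flux_t /jet_wtx /jet_wxx /jet_wt /jet_wx /jet_w; meas_tac.
Qed.

Let mF : jointly_measurable residual_sq.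
Proof.
move: mU mUx mUxx mUt mUtx mweight; rewrite /jointly_measurable => ? ? ? ? ? ?.
by rewrite /residual_sq; meas_tac.
Qed.

Let mL : jointly_measurable energy.
Proof.
move: mU mUx mUxx mUt mUtx mweight; rewrite /jointly_measurable => ? ? ? ? ? ?.
rewrite /energy; meas_tac; apply: (measurableT_comp (@measurable_inv R)); meas_tac.
Qed.

Let mbf : measurable_fun setT boundary_flux.
Proof.
have mw x : measurable_fun setT (fun t => weight x t).
  by apply: (measurableT_comp (@measurable_expR R)); meas_tac.
rewrite /boundary_flux /flux /flux_x /jet_wt /jet_wx /jet_w.
have := mw 0; have := mw l => ? ?.
meas_tac.
Qed.

Let s_ge1 : 1 <= s.
Proof.
apply: le_trans s_ge; rewrite /carleman_threshold -addrA lerDl.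
have a1_ge0 : 0 <= a1 by case/andP: aa => a0a aa1; rewrite (le_trans (ltW a0_gt0))// (le_trans a0a).
have := ltW a0_gt0; have := ltW m_gt0; have := ltW N_gt0; have := ltW T_gt0 => *.
by rewrite /th0 /K2; nonneg.
Qed.

Let in_Q (z : R * R) : Q z -> 0 < z.1 < l /\ 0 < z.2 < T.
Proof. by move=> [] /=; rewrite !in_itv/=. Qed.

Let segW x : 0 < x < l -> 0 <= x <= l.
Proof. by move=> /andP[/ltW -> /ltW ->]. Qed.

Let normN x : 0 <= x <= l -> [/\ m <= g x <= N, `|g1 x| <= N & `|g2 x| <= N].
Proof.
move=> /g_bd[-> /andP[? g1N] /andP[? g2N]]; have := m_gt0; split => //.
  by rewrite ger0_norm//; lra.
by rewrite ler0_norm//; lra.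
Qed.

Let a_le : `|a| <= a1.
Proof. by case/andP: aa => a0a ?; rewrite ger0_norm// (le_trans (ltW a0_gt0)). Qed.

Let integrable_Sq : (mu \x mu)%E.-integrable setT (EFin \o (fun z => Sq z.1 z.2)).
Proof.
have i W : L2_family mu W ->
    (mu \x mu)%E.-integrable setT (EFin \o (fun z => W z.1 z.2 ^+ 2)).
  move=> [mW fW]; apply: integrable_ge0 => //.
  - exact: measurable_funX.
  - by move=> z _; exact: sqr_ge0.
  rewrite (@tonelli21 _ _ _ _ _ mu mu (fun z => (W z.1 z.2 ^+ 2)%:E))//.
  - exact: measurable_sq_family.
  - by move=> z; rewrite lee_fin sqr_ge0.
have h1 := integrable_addr measurableT (i _ LU) (i _ LUx).
have h2 := integrable_addr measurableT h1 (i _ LUxx).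
have h3 := integrable_addr measurableT h2 (i _ LUt).
exact: (integrable_addr measurableT h3 (i _ LUtx)).
Qed.

Let Sq_ge0 x t : 0 <= Sq x t.
Proof. by rewrite /Sq !addr_ge0// sqr_ge0. Qed.

Let integrable_Q (W : R -> R -> R) K : jointly_measurable W ->
  (forall z, Q z -> `|W z.1 z.2| <= K * Sq z.1 z.2) ->
  (mu \x mu)%E.-integrable Q (EFin \o (fun z => W z.1 z.2)).
Proof.
move=> mW WK; have iS := integrable_mulr measurableT K integrable_Sq.
have iSQ : (mu \x mu)%E.-integrable Q (EFin \o (fun z => K * Sq z.1 z.2)).
  exact: integrableS iS.
apply: le_integrable iSQ => //.
  by apply/measurable_EFinP; exact: measurable_funTS.
move=> z Qz /=; rewrite lee_fin; apply: le_trans (WK z Qz) _; exact: ler_norm.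
Qed.

Let flux_bounded : exists2 K, 0 <= K & forall x t u ux uxx ut utx,
  0 <= x <= l -> 0 < t < T ->
  let B := K * (u ^+ 2 + ux ^+ 2 + uxx ^+ 2 + ut ^+ 2 + utx ^+ 2) in
  [/\ `|flux_x a s (theta T t) (theta1 T t) (g x) (g1 x) (weight x t) u ux ut| <= B,
      `|flux_t a s (theta T t) (theta1 T t) (g x) (g1 x) (weight x t) u ux|
        <= B * (t * (T - t)),
      `|dx_flux_x a s (theta T t) (theta1 T t) (g x) (g1 x) (g2 x) (weight x t)
        u ux uxx ut utx| <= B &
      `|dt_flux_t a s (theta T t) (theta1 T t) (theta2 T t) (g x) (g1 x) (weight x t)
        u ux ut utx| <= B].
Proof.
have [p [M [M0 H]]] := weighted_flux_bounds a1 N T_gt0 m_gt0.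
exists (M * expR (p%:R * s)) => [|x t u ux uxx ut utx xl tT].
  by rewrite mulr_ge0// expR_ge0.
have [b1 b2 b3] := normN xl.
exact: (H a s t (g x) (g1 x) (g2 x) u ux uxx ut utx a_le s_ge1 tT b1 b2 b3).
Qed.

Let iFA : (mu \x mu)%E.-integrable Q (EFin \o (fun z => FA z.1 z.2)).
Proof.
have [K K0 H] := flux_bounded; apply: (@integrable_Q _ K) => // z /in_Q[xl tT].
by have [] := H z.1 z.2 (U z.1 z.2) (Ux z.1 z.2) (Uxx z.1 z.2) (Ut z.1 z.2)
  (Utx z.1 z.2) (segW xl) tT.
Qed.

Let iFB : (mu \x mu)%E.-integrable Q (EFin \o (fun z => FB z.1 z.2)).
Proof.
have [K K0 H] := flux_bounded; apply: (@integrable_Q _ K) => // z /in_Q[xl tT].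
by have [] := H z.1 z.2 (U z.1 z.2) (Ux z.1 z.2) (Uxx z.1 z.2) (Ut z.1 z.2)
  (Utx z.1 z.2) (segW xl) tT.
Qed.

Let weight_le1 x t : 0 <= x <= l -> 0 < t < T -> 0 <= weight x t <= 1.
Proof.
move=> /normN[/andP[mgx _] _ _] tT; rewrite expR_ge0/= -expR0 ler_expR oppr_le0.
have := s_ge1; have := ltW (theta_gt0 tT); have := m_gt0 => ? ? ?.
by rewrite !mulr_ge0//; lra.
Qed.

Let iF : (mu \x mu)%E.-integrable Q (EFin \o (fun z => residual_sq z.1 z.2)).
Proof.
apply: (@integrable_Q _ (2 + 2 * a ^+ 2)) => // z /in_Q[/segW xl tT].
have /andP[w0 w1] := weight_le1 xl tT.
rewrite /residual_sq /Sq ger0_norm ?sqr_ge0// exprMn.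
have w2 : weight z.1 z.2 ^+ 2 <= 1 by rewrite expr_le1.
apply: (@le_trans _ _ ((Ut z.1 z.2 - a * Uxx z.1 z.2) ^+ 2)).
  by rewrite ler_piMl ?sqr_ge0.
move: (U _ _) (Ux _ _) (Uxx _ _) (Ut _ _) (Utx _ _) => A B C D E.
have := sqr_ge0 (D + a * C).
have := mulr_ge0 (sqr_ge0 a) (sqr_ge0 A); have := mulr_ge0 (sqr_ge0 a) (sqr_ge0 B).
have := mulr_ge0 (sqr_ge0 a) (sqr_ge0 D); have := mulr_ge0 (sqr_ge0 a) (sqr_ge0 E).
have := sqr_ge0 A; have := sqr_ge0 B; have := sqr_ge0 C; have := sqr_ge0 E; lra.
Qed.

Let energy_ge0 x t : 0 < t < T -> 0 <= energy x t.
Proof.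
move=> tT; have := s_ge1; have := ltW (theta_gt0 tT) => t0 s1.
have s0 : 0 <= s by lra.
rewrite /energy; nonneg.
Qed.

Let pointwise z : Q z -> energy z.1 z.2 <=
  carleman_cst a0 a1 m N T * (residual_sq z.1 z.2 - FA z.1 z.2 - FB z.1 z.2).
Proof.
move=> /in_Q[/segW xl tT]; have [/andP[mgx gN] g1x g2x] := g_bd xl.
apply: (@pointwise_carleman R a s _ _ _ _ _ _ _ _ _ _ _ _ a0 a1 m N T K2 th0) => //.
- by rewrite /th0 divr_gt0// exprn_gt0.
- by rewrite /K2 mulr_gt0// ?exprn_gt0// divr_gt0.
- by rewrite gN andbT (le_trans (ltW m_gt0)).
- exact: theta_ge.
- exact: theta1_le.
- exact: theta2_le.
Qed.

Let l_ge0 := ltW l_gt0.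
Let T_ge0 := ltW T_gt0.

Let slice_FA : {ae mu, forall t, `]0, T[%classic t ->
  \int[mu]_(x in `]0, l[) FA x t = - boundary_flux t}.
Proof.
apply: aeS slice => t H; rewrite /= in_itv/= => tT.
have [G [Gx [Gt [ACG ACGx ACGt GE [[G0 Gl] [Gx0 Gxl] [Gt0 Gtl]]]]]] := H tT.
have ACg := AC_derive l_ge0 cg cg1 dg.
have ACg1 := AC_derive l_ge0 cg1 cg2 dg1.
have ACe : AC 0 l (weight^~ t) (fun x => - (s * theta T t * g1 x) * weight x t).
  apply: AC_eq (AC_expR (- (s * theta T t)) l_ge0 cg cg1 dg) _ _ => x _.
    by rewrite /weight mulNr.
  by rewrite /weight !mulNr.
(* [G] is given as a primitive of [Ux]; replacing this by its continuous version [Gx] yields the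
   chain G, Gx, Uxx which [AC_flux_x] needs. *)
have ACGU : AC 0 l G Gx.
  apply: AC_ae ACG _ _; first exact: segment_continuous_measurable (AC_continuous l_ge0 ACGx).
  by apply: aeS GE => x E /E[].
have AF := AC_flux_x l_ge0 a (theta1 T t) ACg ACg1 ACe ACGU ACGx ACGt.
have mFAt := measurable_section t mFA.
have AFA : AC 0 l (fun x => flux x t (G x) (Gx x) (Gt x)) (FA^~ t).
  apply: (AC_ae AF); first exact: measurable_funTS.
  by apply: aeS GE => x E /E[UG UxG UtG]; rewrite /FA UG UxG UtG.
rewrite Rintegral_open_segment; last exact: measurable_funTS.
rewrite (AC_FTC l_ge0 AFA) /boundary_flux opprB /flux.
by rewrite G0 Gl Gx0 Gxl Gt0 Gtl.
Qed.

Let integrable_tslice (W : R -> R -> R) : L2_family mu W ->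
  {ae mu, forall x, mu.-integrable `[0, T] (EFin \o W x)}.
Proof.
move=> LW; have [mW fW] := LW.
have i : (mu \x mu)%E.-integrable setT (EFin \o (fun z => W z.1 z.2 ^+ 2)).
  apply: integrable_ge0 => //.
  - exact: measurable_funX.
  - by move=> z _; exact: sqr_ge0.
  rewrite (@tonelli21 _ _ _ _ _ mu mu (fun z => (W z.1 z.2 ^+ 2)%:E))//.
  - exact: measurable_sq_family.
  - by move=> z; rewrite lee_fin sqr_ge0.
apply: aeS (ae_integrable1 i) => x ix; apply: integrable_sq_integrable.
  by apply: measurable_funTS; exact: (measurable_section x (jointly_measurable_flip mW)).
by apply: integrableS ix.
Qed.

(** [U] and [Ux] are replaced by their time primitives [S0] and [S1], which are continuous and hence
    bounded on the closed interval. The flux is then at most a constant times [t * (T - t)], as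
    [AC_vanishing] requires. *)
Let slice_FB : {ae mu, forall x, `]0, l[%classic x ->
  \int[mu]_(t in `]0, T[) FB x t = 0}.
Proof.
have mFBx x : measurable_fun setT (FB x).
  exact: (measurable_section x (jointly_measurable_flip mFB)).
have IT := aeI (integrable_tslice LUt) (integrable_tslice LUtx).
have IB := @ae_integrable_box_slice _ _ _ _ _ mu mu _ _ (measurable_itv _) (measurable_itv _) _ iFB.
apply: aeS (aeI init (aeI IT IB)) => x [Ix [[iUt iUtx] Bx]].
rewrite /= in_itv/= => xl.
have {}Bx : mu.-integrable `[0, T] (EFin \o FB x).
  apply: integrable_closed_segment; last exact: measurable_funTS.
  by apply: Bx; rewrite /= in_itv/=.
have {}Ix := Ix xl.
rewrite Rintegral_open_segment; last exact: measurable_funTS.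
pose S0 t := \int[mu]_(s in `[0, t]) Ut x s.
pose S1 t := \int[mu]_(s in `[0, t]) Utx x s.
have AC0 : AC 0 T S0 (Ut x).
  by split => // t _; rewrite {2}/S0 set_itv1 Rintegral_set1 add0r.
have AC1 : AC 0 T S1 (Utx x).
  by split => // t _; rewrite {2}/S1 set_itv1 Rintegral_set1 add0r.
have [M0 HM0] := segment_continuous_bounded (AC_continuous T_ge0 AC0).
have [M1 HM1] := segment_continuous_bounded (AC_continuous T_ge0 AC1).
have [K K_ge0 HK] := flux_bounded.
pose h t := flux_t a s (theta T t) (theta1 T t) (g x) (g1 x) (weight x t) (S0 t) (S1 t).
apply: (@AC_vanishing _ 0 T (K * (M0 ^+ 2 + M1 ^+ 2)) h) => //.
  move=> t1 t2 t10 t12 t2T.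
  have [ACth ACth1] := AC_theta t10 t12 t2T.
  have ACe : AC t1 t2 (weight x) (fun t => - (s * theta1 T t * g x) * weight x t).
    have d t : t1 < t < t2 -> is_derive t 1 (theta T) (theta1 T t).
      move=> /andP[t1t tt2]; apply: is_derive_theta.
      by rewrite (lt_trans t10)// (lt_trans tt2).
    apply: AC_eq (AC_expR (- (s * g x)) t12 (AC_continuous t12 ACth)
      (AC_continuous t12 ACth1) d) _ _ => t _.
      by rewrite /weight; congr expR; ring.
    by rewrite /weight; congr (_ * expR _); ring.
  have ACs W w : AC 0 T W w -> AC t1 t2 W w by apply: AC_sub; exact: ltW.
  have AF := AC_flux_t t12 a (g1 x) ACth ACth1 ACe (ACs _ _ AC0) (ACs _ _ AC1).
  have AFB : AC t1 t2 h (FB x).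
    apply: (AC_ae AF); first exact: measurable_funTS.
    apply: aeS Ix => t E /andP[t1t tt2]; rewrite /FB.
    by have [|-> ->] := E; first by rewrite (lt_trans t10)// (lt_trans tt2).
  exact: AC_FTC AFB.
move=> t tT; rewrite subr0.
have [_ H _ _] := HK x t (S0 t) (S1 t) 0 0 0 (segW xl) tT.
apply: le_trans H _; have /andP[t0 tT'] := tT.
have tt : 0 <= t <= T by rewrite !ltW.
rewrite ler_wpM2r//; first by rewrite mulr_ge0 ?subr_ge0// ltW.
rewrite !expr0n/= !addr0 ler_wpM2l// lerD//.
  by rewrite -(real_normK (num_real (S0 t))) lerXn2r// ?nnegrE ?HM0// (le_trans _ (HM0 t tt)).
by rewrite -(real_normK (num_real (S1 t))) lerXn2r// ?nnegrE ?HM1// (le_trans _ (HM1 t tt)).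
Qed.

(** Joint integrability allows the two halves of the divergence to be integrated in different
    orders: [FA] first along x, [FB] first along t. *)
Lemma carleman_rectangle :
  [/\ (mu \x mu)%E.-integrable Q (EFin \o (fun z => energy z.1 z.2)),
      (mu \x mu)%E.-integrable Q (EFin \o (fun z => residual_sq z.1 z.2)),
      mu.-integrable `]0, T[ (EFin \o boundary_flux) &
      \int[(mu \x mu)%E]_(z in Q) energy z.1 z.2 <= carleman_cst a0 a1 m N T *
        (\int[(mu \x mu)%E]_(z in Q) residual_sq z.1 z.2 +
         \int[mu]_(t in `]0, T[) boundary_flux t)].
Proof.
set c := carleman_cst a0 a1 m N T.
have mNb : measurable_fun setT (fun t => - boundary_flux t) by exact: measurable_funN.
have [iA EA] := @Rintegral_box_slices2 _ _ _ _ R mu mu _ _ (measurable_itv _) (measurable_itv _)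
  _ iFA _ mNb slice_FA.
have [_ EB] := @Rintegral_box_slices1 _ _ _ _ R mu mu _ _ (measurable_itv _) (measurable_itv _)
  _ iFB _ (measurable_cst (0 : R)) slice_FB.
have [iE EL] := @le_Rintegral_combination _ _ _ (mu \x mu)%E Q _ _ _ _ c mQ
  (measurable_funTS mL) (fun z Qz => energy_ge0 _ (in_Q Qz).2) iF iFA iFB pointwise.
have ib : mu.-integrable `]0, T[ (EFin \o boundary_flux).
  rewrite (_ : EFin \o boundary_flux = EFin \o (fun t => -1 * - boundary_flux t)).
    exact: integrable_mulr.
  by apply/funext => t /=; rewrite mulN1r opprK.
split => //; apply: le_trans EL _.
have E0 : \int[mu]_(y in `]0, l[) cst 0 y = 0 :> R.
  by rewrite /Rintegral integral0_eq.
have EN := @RintegralN _ _ R mu _ boundary_flux (measurable_itv _) ib.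
by rewrite EA EB E0 subr0 EN opprK.
Qed.

End carleman_rectangle.

Lemma EFin_Rintegral d (Y : measurableType d) (R : realType)
    (mu : {measure set Y -> \bar R}) (D : set Y) (f : Y -> R) : measurable D ->
  mu.-integrable D (EFin \o f) ->
  (\int[mu]_(x in D) f x)%:E = (\int[mu]_(x in D) (f x)%:E)%E.
Proof. by move=> mD if_; rewrite /Rintegral fineK//; exact: integrable_fin_num. Qed.

(** [g] may have infinite integral and [f] may change sign, so the comparison passes through the
    positive part of [f]. *)
Lemma le_Rintegral_ae_ge0 d (Y : measurableType d) (R : realType)
    (mu : {measure set Y -> \bar R}) (D : set Y) (f g : Y -> R) : measurable D ->
  mu.-integrable D (EFin \o f) -> measurable_fun D g -> (forall x, D x -> 0 <= g x) ->
  {ae mu, forall x, D x -> f x <= g x} ->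
  ((\int[mu]_(x in D) f x)%:E <= \int[mu]_(x in D) (g x)%:E)%E.
Proof.
move=> mD if_ mg g0 fg; have mf : measurable_fun D (EFin \o f) := measurable_int _ if_.
rewrite EFin_Rintegral//.
have mf' : measurable_fun D f by apply/measurable_EFinP.
have mmax : measurable_fun D (fun x => (Num.max (f x) 0)%:E).
  by apply/measurable_EFinP; exact: measurable_maxr.
apply: (@le_trans _ _ (\int[mu]_(x in D) (Num.max (f x) 0)%:E)%E).
  apply: le_integral => //.
    apply: le_integrable if_ => // x Dx /=; rewrite lee_fin.
    by rewrite maxEle; case: ifP => _; rewrite ?normr0.
  by move=> x _; rewrite lee_fin le_max lexx.
apply: ae_ge0_le_integral => //.
- by move=> x _; rewrite lee_fin le_max lexx orbT.
- exact/measurable_EFinP.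
- by apply: aeS fg => x h Dx; rewrite lee_fin ge_max h// g0.
Qed.

Section carleman_slice.
Context {R : realType}.
Notation mu := (@lebesgue_measure R).
Variables (l T a0 a1 m N a s : R) (g g1 g2 : R -> R) (p : nat) (M : R).
Hypotheses (l_gt0 : 0 < l) (T_gt0 : 0 < T) (a0_gt0 : 0 < a0) (m_gt0 : 0 < m).
Hypotheses (N_gt0 : 0 < N) (aa : a0 <= a <= a1).
Hypotheses (mg : measurable_fun setT g) (mg1 : measurable_fun setT g1)
  (mg2 : measurable_fun setT g2).
Hypotheses (cg : {within `[0, l], continuous g}) (cg1 : {within `[0, l], continuous g1})
  (cg2 : {within `[0, l], continuous g2}).
Hypotheses (dg : forall x, 0 < x < l -> is_derive x 1 g (g1 x))
  (dg1 : forall x, 0 < x < l -> is_derive x 1 g1 (g2 x)).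
Hypothesis g_bd : forall x, 0 <= x <= l ->
  [/\ m <= g x <= N, m <= g1 x <= N & m <= - g2 x <= N].
Hypotheses (M_ge0 : 0 <= M) (fluxM : weighted_flux_bound T a1 m N p M).
Hypothesis s_ge :
  carleman_threshold a0 a1 m N T (5 / 2 * T ^+ 2) (4 / T ^+ 2) <= s.

Variables (U Ux Uxx Ut Utx : R -> R -> R) (r0 rl p0 pl q0 ql : R -> R).
Hypotheses (LU : L2_family mu U) (LUx : L2_family mu Ux) (LUxx : L2_family mu Uxx).
Hypotheses (LUt : L2_family mu Ut) (LUtx : L2_family mu Utx).
Hypotheses (mr0 : measurable_fun setT r0) (mrl : measurable_fun setT rl)
  (mp0 : measurable_fun setT p0) (mpl : measurable_fun setT pl)
  (mq0 : measurable_fun setT q0) (mql : measurable_fun setT ql).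
Hypotheses (iq0 : mu.-integrable `[0, T] (EFin \o q0))
  (iql : mu.-integrable `[0, T] (EFin \o ql)).
Hypothesis slice : {ae mu, forall t, 0 < t < T -> exists G Gx Gt,
  [/\ AC 0 l G (Ux^~ t), AC 0 l Gx (Uxx^~ t), AC 0 l Gt (Utx^~ t),
      {ae mu, forall x, 0 < x < l -> [/\ U x t = G x, Ux x t = Gx x & Ut x t = Gt x]} &
      [/\ G 0 = r0 t /\ G l = rl t, Gx 0 = p0 t /\ Gx l = pl t &
          Gt 0 = q0 t /\ Gt l = ql t]]}.
Hypothesis init : {ae mu, forall x, 0 < x < l -> {ae mu, forall t, 0 < t < T ->
  U x t = \int[mu]_(s in `[0, t]) Ut x s}}.

Let slice2 : {ae mu, forall t, 0 < t < T -> exists G Gt,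
  [/\ AC 0 l G (Ux^~ t), AC 0 l Gt (Utx^~ t),
      {ae mu, forall x, 0 < x < l -> U x t = G x /\ Ut x t = Gt x},
      G 0 = r0 t /\ G l = rl t & Gt 0 = q0 t /\ Gt l = ql t]}.
Proof.
apply: aeS slice => t /[apply] -[G [Gx [Gt [h1 h2 h3 h4 [h5 h6 h7]]]]].
by exists G, Gt; split => //; apply: aeS h4 => x /[apply] -[].
Qed.

Let init2 : {ae mu, forall x, 0 < x < l -> {ae mu, forall t, 0 < t < T ->
  U x t = \int[mu]_(s in `[0, t]) Ut x s /\ Ux x t = \int[mu]_(s in `[0, t]) Utx x s}}.
Proof.
have H := mixed_derivative l_gt0 LU LUx LUt LUtx mq0 iq0 slice2 init.
apply: aeS2 init H => x h1 h2 xl; apply: aeS2 (h1 xl) (h2 xl) => t k1 k2 tT.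
by split; [exact: k1|exact: k2].
Qed.

Let s_ge1 : 1 <= s.
Proof.
apply: le_trans s_ge; rewrite /carleman_threshold -addrA lerDl.
have a1_ge0 : 0 <= a1.
  by case/andP: aa => a0a aa1; rewrite (le_trans (ltW a0_gt0))// (le_trans a0a).
have := ltW a0_gt0; have := ltW m_gt0; have := ltW N_gt0; have := ltW T_gt0 => *.
nonneg.
Qed.

(** This passes the inflow condition from [u] to [u_t]: the primitive of [q] is continuous and
    vanishes almost everywhere, hence everywhere, and so does [q] almost everywhere. *)
Let deriv_trace_eq0 (r q : R -> R) : measurable_fun setT q ->
  mu.-integrable `[0, T] (EFin \o q) ->
  {ae mu, forall t, 0 < t < T -> r t = \int[mu]_(s in `[0, t]) q s} ->
  {ae mu, forall t, 0 < t < T -> r t = 0} ->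
  {ae mu, forall t, 0 < t < T -> q t = 0}.
Proof.
move=> mq iq rq r0'; apply: Rintegral_eq0_ae => //.
apply: (continuous_ae_eq0 T_gt0); first exact: continuous_prim (ltW T_gt0) iq.
by apply: aeS2 rq r0' => t h1 h2 tT; rewrite -h1// h2.
Qed.

Let Q := Om l `*` Tm T.
Let c := carleman_cst a0 a1 m N T.

Let carleman_slice_bd (bd : R -> R) : measurable_fun setT bd -> (forall t, 0 <= bd t) ->
  {ae mu, forall t, 0 < t < T ->
    boundary_flux l T a s g g1 r0 rl p0 pl q0 ql t <= 2 * M * expR (p%:R * s) * bd t} ->
  (\int[(mu \x mu)%E]_(z in Q) (energy T s g U Ux Ut z.1 z.2)%:E <=
   c%:E * (\int[(mu \x mu)%E]_(z in Q) (residual_sq T a s g Uxx Ut z.1 z.2)%:E +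
     (2 * M * expR (p%:R * s))%:E * \int[mu]_(t in Tm T) (bd t)%:E))%E.
Proof.
move=> mbd bd0 Hbd.
have [iE iF ib H] := carleman_rectangle l_gt0 T_gt0 a0_gt0 m_gt0 N_gt0 aa mg mg1 mg2
  cg cg1 cg2 dg dg1 g_bd s_ge LU LUx LUxx LUt LUtx mr0 mrl mp0 mpl mq0 mql slice init2.
have mQ : measurable Q by apply: measurableX; exact: measurable_itv.
have c0 : 0 <= c.
  rewrite /c /carleman_cst.
  have := ltW a0_gt0; have := ltW m_gt0; have := ltW N_gt0; have := ltW T_gt0 => *.
  nonneg.
have K0 : 0 <= 2 * M * expR (p%:R * s) by rewrite mulr_ge0 ?expR_ge0// mulr_ge0.
have EE := @EFin_Rintegral _ _ R (mu \x mu)%E Q _ mQ iE.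
have EF := @EFin_Rintegral _ _ R (mu \x mu)%E Q _ mQ iF.
rewrite -EE -EF; apply: (@le_trans _ _ (c%:E * ((\int[(mu \x mu)%E]_(z in Q)
  residual_sq T a s g Uxx Ut z.1 z.2)%:E + (\int[mu]_(t in Tm T)
    boundary_flux l T a s g g1 r0 rl p0 pl q0 ql t)%:E))%E).
  by rewrite -EFinD -EFinM lee_fin.
apply: lee_wpmul2l; first by rewrite lee_fin.
apply: leeD2l; rewrite -ge0_integralZl_EFin//.
- apply: (@le_Rintegral_ae_ge0 _ _ R mu (Tm T) _
    (fun t => 2 * M * expR (p%:R * s) * bd t)) => //.
  + exact: measurable_itv.
  + by apply: measurable_funTS; exact: measurable_funM.
  + by move=> t _; rewrite mulr_ge0.
- exact: measurable_itv.
- by move=> t _; rewrite lee_fin.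
- by apply/measurable_EFinP; exact: measurable_funTS.
Qed.

Let xl0 : 0 <= (0 : R) <= l. Proof. by rewrite lexx ltW. Qed.
Let xll : 0 <= l <= l. Proof. by rewrite lexx andbT ltW. Qed.

Let flux_le x t u ux ut : 0 <= x <= l -> 0 < t < T ->
  `|flux_x a s (theta T t) (theta1 T t) (g x) (g1 x) (weight T s g x t) u ux ut| <=
  M * expR (p%:R * s) * (u ^+ 2 + ux ^+ 2 + ut ^+ 2).
Proof.
move=> xl tT; have [b1 b2 b3] := g_bd xl.
have a_le : `|a| <= a1.
  by case/andP: aa => a0a ?; rewrite ger0_norm// (le_trans (ltW a0_gt0)).
have [] := fluxM u ux 0 ut 0 a_le s_ge1 tT b1 _ (g2 := g2 x) (g1 := g1 x).
- by case/andP: b2 => mg1x ?; rewrite ger0_norm// (le_trans (ltW m_gt0)).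
- by case/andP: b3 => mg2x ?; rewrite ler0_norm//; have := m_gt0; lra.
by rewrite expr0n/= !addr0 => + _ _ _; apply.
Qed.

(** Positive velocities. At 0 only the trace [p0] of the x-derivative survives, whereas the flux at
    [l] costs all three traces; the 2 leaves one flux constant for each end point. *)
Lemma carleman_slice_inflow0 : {ae mu, forall t, 0 < t < T -> r0 t = 0} ->
  (\int[(mu \x mu)%E]_(z in Q) (energy T s g U Ux Ut z.1 z.2)%:E <=
   c%:E * (\int[(mu \x mu)%E]_(z in Q) (residual_sq T a s g Uxx Ut z.1 z.2)%:E +
     (2 * M * expR (p%:R * s))%:E * \int[mu]_(t in Tm T)
       (rl t ^+ 2 + ql t ^+ 2 + pl t ^+ 2 + p0 t ^+ 2)%:E))%E.
Proof.
move=> r00; apply: carleman_slice_bd.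
- by meas_tac.
- by move=> t; rewrite !addr_ge0 ?sqr_ge0.
have q00 : {ae mu, forall t, 0 < t < T -> q0 t = 0}.
  apply: deriv_trace_eq0 r00 => //.
  exact: (trace_derivative0 l_gt0 LU LUt LUtx mq0 iq0 slice2 init).
apply: aeS2 r00 q00 => t h1 h2 tT; rewrite /boundary_flux h1// h2//.
have := flux_le 0 (p0 t) 0 xl0 tT; have := flux_le (rl t) (pl t) (ql t) xll tT.
rewrite !expr0n/= add0r addr0 !ler_norml => /andP[B1 _] /andP[_ B2].
have K0 : 0 <= M * expR (p%:R * s) by rewrite mulr_ge0 ?expR_ge0.
rewrite -(mulrA 2); move: B1 B2 (sqr_ge0 (rl t)) (sqr_ge0 (ql t)) (sqr_ge0 (pl t)) (sqr_ge0 (p0 t)).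
move: (flux_x _ _ _ _ _ _ _ _ _ _) (flux_x _ _ _ _ _ _ _ _ _ _) => F1 F2.
move: (M * _) K0 (rl t ^+ 2) (ql t ^+ 2) (pl t ^+ 2) (p0 t ^+ 2) => K K0 A B C D H1 H2 A0 B0 C0 D0.
have := mulr_ge0 K0 A0; have := mulr_ge0 K0 B0; have := mulr_ge0 K0 C0.
have := mulr_ge0 K0 D0; lra.
Qed.

(** Negative velocities. [p0] is counted twice, once as an outflow trace and once as the additional
    trace at 0, so that both signs of the velocity lead to the same shape of boundary integrand. *)
Lemma carleman_slice_inflowl : {ae mu, forall t, 0 < t < T -> rl t = 0} ->
  (\int[(mu \x mu)%E]_(z in Q) (energy T s g U Ux Ut z.1 z.2)%:E <=
   c%:E * (\int[(mu \x mu)%E]_(z in Q) (residual_sq T a s g Uxx Ut z.1 z.2)%:E +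
     (2 * M * expR (p%:R * s))%:E * \int[mu]_(t in Tm T)
       (r0 t ^+ 2 + q0 t ^+ 2 + p0 t ^+ 2 + p0 t ^+ 2)%:E))%E.
Proof.
move=> rl0; apply: carleman_slice_bd.
- by meas_tac.
- by move=> t; rewrite !addr_ge0 ?sqr_ge0.
have ql0 : {ae mu, forall t, 0 < t < T -> ql t = 0}.
  apply: deriv_trace_eq0 rl0 => //.
  exact: (trace_derivativel l_gt0 LU LUt LUtx mq0 mql iq0 slice2 init).
apply: aeS2 rl0 ql0 => t h1 h2 tT; rewrite /boundary_flux h1// h2//.
have := flux_le (r0 t) (p0 t) (q0 t) xl0 tT; rewrite ler_norml => /andP[_].
(* the flux at l has a sign, as the weight decreases there *)
have : 0 <= flux_x a s (theta T t) (theta1 T t) (g l) (g1 l) (weight T s g l t) 0 (pl t) 0.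
  rewrite /flux_x /jet_wt /jet_w /jet_wx !mulr0 !subr0 !mulr0 mul0r mulr0 add0r addr0.
  have [_ /andP[g1l _] _] := g_bd xll.
  have s0 : 0 <= s by rewrite (le_trans _ s_ge1).
  have := ltW (theta_gt0 tT); have := le_trans (ltW m_gt0) g1l => *.
  by rewrite -expr2; nonneg.
have K0 : 0 <= M * expR (p%:R * s) by rewrite mulr_ge0 ?expR_ge0.
rewrite -(mulrA 2); move: (sqr_ge0 (r0 t)) (sqr_ge0 (q0 t)) (sqr_ge0 (p0 t)).
move: (flux_x _ _ _ _ _ _ _ _ _ _) (flux_x _ _ _ _ _ _ _ _ _ _) => F1 F2.
move: (M * _) K0 (r0 t ^+ 2) (q0 t ^+ 2) (p0 t ^+ 2) => K K0 A B C A0 B0 C0 H1 H2.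
have := mulr_ge0 K0 A0; have := mulr_ge0 K0 B0; have := mulr_ge0 K0 C0; lra.
Qed.

End carleman_slice.

(** * Integration over the velocities *)

Section reassociation.
Context d1 d2 d3 d (T1 : measurableType d1) (T2 : measurableType d2)
  (T3 : measurableType d3) (U : measurableType d) (f : T1 * T2 * T3 -> U).
Hypothesis mf : measurable_fun setT f.

Lemma measurable_uncurry1 :
  measurable_fun setT (fun w : T1 * (T2 * T3) => f (w.1, w.2.1, w.2.2)).
Proof.
apply: (measurableT_comp mf); apply: measurable_fun_pair.
  apply: measurable_fun_pair; first exact: measurable_fst.
  exact: (measurableT_comp measurable_fst measurable_snd).
exact: (measurableT_comp measurable_snd measurable_snd).
Qed.

Lemma measurable_uncurry3 :
  measurable_fun setT (fun w : T3 * (T1 * T2) => f (w.2, w.1)).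
Proof.
apply: (measurableT_comp mf).
by apply: measurable_fun_pair; [exact: measurable_snd|exact: measurable_fst].
Qed.

Lemma measurable_slice2 v : measurable_fun setT (fun w : T1 * T3 => f (w.1, v, w.2)).
Proof.
apply: (measurableT_comp mf); apply: measurable_fun_pair; last exact: measurable_snd.
by apply: measurable_fun_pair; [exact: measurable_fst|exact: measurable_cst].
Qed.

End reassociation.

Section triple_tonelli.
Context d1 d2 d3 (T1 : measurableType d1) (T2 : measurableType d2)
  (T3 : measurableType d3) (R : realType).
Variables (m1 : {sigma_finite_measure set T1 -> \bar R})
  (m2 : {sigma_finite_measure set T2 -> \bar R})
  (m3 : {sigma_finite_measure set T3 -> \bar R})
  (m12 : {sigma_finite_measure set (T1 * T2)%type -> \bar R}).
(** The measure on the first two factors is abstract and known only through its iterated integrals,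
    so that [planar_lebesgue] can take its place. *)
Hypothesis m12T : forall g : T1 * T2 -> \bar R, measurable_fun setT g ->
  (forall z, (0 <= g z)%E) -> (\int[m12]_z g z = \int[m2]_y \int[m1]_x g (x, y))%E.
Variable f : T1 * T2 * T3 -> \bar R.
Hypothesis mf : measurable_fun setT f.
Hypothesis f0 : forall z, (0 <= f z)%E.

Let mfA := measurable_uncurry1 mf.

Let mfB : measurable_fun setT (fun w : T2 * T3 => \int[m1]_x f (x, w.1, w.2))%E.
Proof.
exact: (@measurable_int1 _ _ _ _ _ m1 (fun w : T1 * (T2 * T3) => f (w.1, w.2.1, w.2.2))).
Qed.

Lemma tonelli_321 :
  (\int[(m12 \x m3)%E]_z f z = \int[m3]_t \int[m2]_v \int[m1]_x f (x, v, t))%E.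
Proof.
rewrite (tonelli21 m12 m3 mf f0); apply: eq_integral => t _.
by rewrite m12T//; exact: (measurableT_comp mf (measurable_pair2 t)).
Qed.

Lemma tonelli_231 :
  (\int[(m12 \x m3)%E]_z f z = \int[m2]_v \int[m3]_t \int[m1]_x f (x, v, t))%E.
Proof.
have B0 (w : T2 * T3) : (0 <= \int[m1]_x f (x, w.1, w.2))%E by exact: integral_ge0.
by rewrite tonelli_321 -(tonelli21 m2 m3 mfB B0) (tonelli12 m2 m3 mfB B0).
Qed.

Lemma tonelli_middle :
  (\int[(m12 \x m3)%E]_z f z = \int[m2]_v \int[(m1 \x m3)%E]_w f (w.1, v, w.2))%E.
Proof.
rewrite tonelli_231; apply: eq_integral => v _.
rewrite (tonelli21 m1 m3 (f := fun w => f (w.1, v, w.2)))//.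
exact: measurable_slice2.
Qed.

Lemma measurable_middle :
  measurable_fun setT (fun v => \int[(m1 \x m3)%E]_w f (w.1, v, w.2))%E.
Proof.
have B0 (w : T2 * T3) : (0 <= \int[m1]_x f (x, w.1, w.2))%E by exact: integral_ge0.
have := measurable_int2 m3 mfB B0; congr measurable_fun; apply/funext => v.
rewrite (tonelli21 m1 m3 (f := fun w => f (w.1, v, w.2)))//.
exact: measurable_slice2.
Qed.

End triple_tonelli.

Section ae_sections.
Context d1 d2 (T1 : measurableType d1) (T2 : measurableType d2) (R : realType).
Variables (m1 : {sigma_finite_measure set T1 -> \bar R})
  (m2 : {sigma_finite_measure set T2 -> \bar R}).

Let ae_eq0 d (T : measurableType d) (m : {measure set T -> \bar R}) (g : T -> \bar R) :
  measurable_fun setT g -> (forall x, (0 <= g x)%E) -> (\int[m]_x g x = 0)%E ->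
  {ae m, forall x, g x = 0%E}.
Proof.
move=> mg g0 I0; have /ae_eq_integral_abs : (\int[m]_x `|g x| = 0)%E.
  by rewrite -[RHS]I0; apply: eq_integral => x _; rewrite gee0_abs.
by move=> /(_ measurableT mg); apply: aeS => x /(_ Logic.I).
Qed.

Variable P : T1 * T2 -> Prop.
Hypothesis aeP : {ae (m1 \x m2)%E, forall z, P z}.

Let null_cover : exists F : T1 * T2 -> \bar R,
  [/\ measurable_fun setT F, (forall z, (0 <= F z)%E), (forall z, F z = 0%E -> P z) &
      (\int[(m1 \x m2)%E]_z F z = 0)%E].
Proof.
have [N [mN N0 PN]] := aeP; exists (EFin \o (\1_N : T1 * T2 -> R)); split.
- by apply/measurable_EFinP; exact: measurable_indic.
- by move=> z; rewrite lee_fin.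
- move=> z /= [] /eqP; rewrite indicE; case: (boolP (z \in N)) => [_|/negP zN _].
    by rewrite oner_eq0.
  by apply: contrapT => nP; apply: zN; rewrite inE; exact: PN.
- by rewrite integral_indic// setIT.
Qed.

Lemma ae_section1 : {ae m1, forall x, {ae m2, forall y, P (x, y)}}.
Proof.
have [F [mF F0 FP]] := null_cover; rewrite (tonelli12 m1 m2 mF F0) => I0.
apply: aeS (ae_eq0 (measurable_int2 m2 mF F0) _ I0) => [x Ix|x]; last exact: integral_ge0.
apply: aeS (ae_eq0 _ _ Ix) => // y; first exact: FP.
exact: (measurableT_comp mF (measurable_pair1 x)).
Qed.

Lemma ae_section2 : {ae m2, forall y, {ae m1, forall x, P (x, y)}}.
Proof.
have [F [mF F0 FP]] := null_cover; rewrite (tonelli21 m1 m2 mF F0) => I0.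
apply: aeS (ae_eq0 (measurable_int1 m1 mF F0) _ I0) => [y Iy|y]; last exact: integral_ge0.
apply: aeS (ae_eq0 _ _ Iy) => // x; first exact: FP.
exact: (measurableT_comp mF (measurable_pair2 y)).
Qed.

End ae_sections.

Lemma measurable_Vel (R : realType) (v0 v1 : R) : measurable (Vel v0 v1).
Proof.
have -> : Vel v0 v1 = (fun v : R => `|v|) @^-1` `[v0, v1].
  by apply/seteqP; split => v /=; rewrite in_itv.
rewrite -[X in measurable X]setTI.
by apply: (@normr_measurable R setT).
Qed.

(** * Slices and traces of functions on the phase space *)

Section slicing.
Context {R : realType}.
Notation mu := (@lebesgue_measure R).
Notation nu := (@planar_lebesgue R).
Variables (ell v0 v1 T : R) (ell_gt0 : 0 < ell) (T_gt0 : 0 < T).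
Implicit Types u w : R -> R -> R -> R.

Let Q := QV ell v0 v1 T.
Let Dx_ := Vel v0 v1 `*` Tm T.
Let Dt_ := Om ell `*` Vel v0 v1.

Lemma measurable_QV : measurable Q.
Proof.
apply: measurableX; last exact: measurable_itv.
by apply: measurableX; [exact: measurable_itv|exact: measurable_Vel].
Qed.

Lemma measurable_VelTm : measurable Dx_.
Proof. by apply: measurableX; [exact: measurable_Vel|exact: measurable_itv]. Qed.

Lemma measurable_OmVel : measurable Dt_.
Proof. by apply: measurableX; [exact: measurable_itv|exact: measurable_Vel]. Qed.

(** Membership in L^2 yields measurability only of the extension by 0, so it is this extension that
    is sliced in the three variables. *)
Definition cut w x v t : R := (uncurry3 w \_ Q) (x, v, t).

Lemma cutE w x v t : Om ell x -> Vel v0 v1 v -> Tm T t -> cut w x v t = w x v t.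
Proof. by move=> ox vv tt; rewrite /cut patchE mem_set. Qed.

Section one_function.
Variables (w : R -> R -> R -> R) (Lw : L2 ell v0 v1 T w).

Lemma measurable_cut : measurable_fun setT (uncurry3 (cut w)).
Proof.
have [+ _] := (Lp_on2P leb3 Q (uncurry3 w)).1 Lw.
by congr measurable_fun; apply/funext => -[[x v] t].
Qed.

Let msq : measurable_fun setT (fun z : R * R * R => (uncurry3 (cut w) z ^+ 2)%:E).
Proof. by apply/measurable_EFinP; apply: measurable_funX; exact: measurable_cut. Qed.

Let sq0 (z : R * R * R) : (0 <= (uncurry3 (cut w) z ^+ 2)%:E)%E.
Proof. by rewrite lee_fin sqr_ge0. Qed.

Let nuT (g : R * R -> \bar R) : measurable_fun setT g -> (forall z, (0 <= g z)%E) ->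
  (\int[nu]_z g z = \int[mu]_y \int[mu]_x g (x, y))%E.
Proof. by move=> mg g0; exact: (@tonelli21 _ _ _ _ R mu mu). Qed.

Lemma cut_sq_lty : (\int[leb3]_z (uncurry3 (cut w) z ^+ 2)%:E < +oo)%E.
Proof.
have [_ +] := (Lp_on2P leb3 Q (uncurry3 w)).1 Lw.
by congr (_ < _)%E; apply: eq_integral => -[[x v] t] _.
Qed.

Lemma L2_family_cut_x : L2_family nu (xslice (cut w)).
Proof.
split; first exact: (measurable_uncurry1 measurable_cut).
have := cut_sq_lty.
rewrite (@tonelli_321 _ _ _ _ _ _ R mu mu mu nu nuT _ msq sq0).
rewrite nuT//; first exact: (@measurable_int1 _ _ _ _ _ mu _ (measurable_uncurry1 msq)).
by move=> z; apply: integral_ge0 => x _; rewrite lee_fin sqr_ge0.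
Qed.

Lemma L2_family_cut_t : L2_family nu (tslice (cut w)).
Proof.
split; first exact: (measurable_uncurry3 measurable_cut).
by have := cut_sq_lty; rewrite (@tonelli12 _ _ _ _ R nu mu _ msq sq0).
Qed.

Lemma L2_family_cut_v :
  {ae mu, forall v, L2_family mu (fun x t => cut w x v t)}.
Proof.
have := cut_sq_lty.
rewrite (@tonelli_231 _ _ _ _ _ _ R mu mu mu nu nuT _ msq sq0) => fin.
have mI := @measurable_int1 _ _ _ _ _ mu _ (measurable_uncurry1 msq)
  (fun z => sq0 (z.1, z.2.1, z.2.2)).
have J0 v : (0 <= \int[mu]_t \int[mu]_x (cut w x v t ^+ 2)%:E)%E.
  by apply: integral_ge0 => t _; apply: integral_ge0 => x _; rewrite lee_fin sqr_ge0.
have I0 (z : R * R) : (0 <= \int[mu]_x (uncurry3 (cut w) (x, z.1, z.2) ^+ 2)%:E)%E.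
  by apply: integral_ge0 => x _; rewrite lee_fin sqr_ge0.
have mJ := @measurable_int2 _ _ _ _ _ mu _ mI I0.
have iJ : mu.-integrable setT (fun v => \int[mu]_t \int[mu]_x (cut w x v t ^+ 2)%:E)%E.
  apply/integrableP; split; first exact: mJ.
  apply: le_lt_trans fin; rewrite le_eqVlt; apply/orP; left; apply/eqP.
  by apply: eq_integral => v _; rewrite gee0_abs.
apply: aeS (integrable_ae measurableT iJ) => v /(_ Logic.I) Jv.
split; first exact: (measurable_slice2 measurable_cut v).
by rewrite ltey_eq Jv.
Qed.

End one_function.
End slicing.

Section weak_congruence.
Context {R : realType}.
Variables (a b : R) (D : set (R * R)).

Lemma weak_deriv_eq (g g' h h' : R -> R * R -> R) :
  (forall x y, a < x < b -> D y -> g x y = g' x y) ->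
  (forall x y, a < x < b -> D y -> h x y = h' x y) ->
  weak_deriv a b D g h -> weak_deriv a b D g' h'.
Proof.
move=> gg' hh' gh phi tphi; apply: aeS (gh phi tphi) => y + Dy => /(_ Dy) H.
transitivity (\int[leb1]_(x in `]a, b[) (g x y * derive1 phi x)).
  by apply: eq_Rintegral => x /[!inE]/=; rewrite in_itv/= => xab; rewrite gg'.
rewrite H; congr (- _).
by apply: eq_Rintegral => x /[!inE]/=; rewrite in_itv/= => xab; rewrite hh'.
Qed.

Lemma is_trace_eq (g g' : R -> R * R -> R) x0 tau :
  (forall x y, a < x < b -> D y -> g x y = g' x y) ->
  is_trace a b D g x0 tau -> is_trace a b D g' x0 tau.
Proof.
move=> gg' [Ltau H]; split => // e e0; have [del del0 Hd] := H e e0.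
exists del => //; apply: aeS Hd => x Hx xab xdel; have := Hx xab xdel.
rewrite /norm_on; congr (Lnorm _ _ _ <= _)%E; congr (_ \o _); apply/funext => y.
by rewrite !patchE; case: ifPn => // /set_mem Dy; rewrite gg'.
Qed.

End weak_congruence.

Section traces.
Context {R : realType}.
Notation mu := (@lebesgue_measure R).
Notation nu := (@planar_lebesgue R).
Variables (ell v0 v1 T : R) (ell_gt0 : 0 < ell) (T_gt0 : 0 < T).
Variables (u w : R -> R -> R -> R).
Hypotheses (Lu : L2 ell v0 v1 T u) (Lw : L2 ell v0 v1 T w).

Let Dx_ := Vel v0 v1 `*` Tm T.
Let Dt_ := Om ell `*` Vel v0 v1.
Let cutu := cut ell v0 v1 T u.
Let cutw := cut ell v0 v1 T w.

Let cut_x (f : R -> R -> R -> R) x y : 0 < x < ell -> Dx_ y ->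
  xslice f x y = xslice (cut ell v0 v1 T f) x y.
Proof. by move=> xl [vy ty]; rewrite /xslice cutE//= /Om/= in_itv. Qed.

Let cut_t (f : R -> R -> R -> R) t y : 0 < t < T -> Dt_ y ->
  tslice f t y = tslice (cut ell v0 v1 T f) t y.
Proof. by move=> xl [vy ty]; rewrite /tslice cutE//= /Tm/= in_itv. Qed.

Section space_trace.
Hypothesis uw : weak_deriv 0 ell Dx_ (xslice u) (xslice w).

(** Jointly measurable in all variables and, for almost every (v, t), absolutely continuous in [x0];
    neither property can be read off the chosen trace [trx]. *)
Definition space_trace x0 := trace_at 0 ell (xslice cutu) (xslice cutw) x0.

Let uw' : weak_deriv 0 ell Dx_ (xslice cutu) (xslice cutw).
Proof. by apply: weak_deriv_eq uw => x y xl Dy; exact: cut_x. Qed.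

Let mD : measurable Dx_ := measurable_VelTm v0 v1 T.

Lemma measurable_space_trace x0 : measurable_fun setT (space_trace x0).
Proof.
have := jointly_measurable_trace_at 0 ell (L2_family_cut_x Lu) (L2_family_cut_x Lw).
by move=> mW; exact: (measurableT_comp mW (measurable_pair1 x0)).
Qed.

Lemma space_trace_AC : {ae nu, forall y, Dx_ y ->
  AC 0 ell (space_trace^~ y) (xslice cutw ^~ y) /\
  {ae mu, forall x, 0 < x < ell -> xslice cutu x y = space_trace x y}}.
Proof.
exact: (trace_at_AC ell_gt0 (L2_family_cut_x Lu) (L2_family_cut_x Lw) uw').
Qed.

(** The explicit function is a trace, so the choice in [trx] is not the default value and yields
    some trace; traces are unique almost everywhere. *)
Lemma trxE x0 : 0 <= x0 <= ell ->
  {ae nu, forall y, Dx_ y -> trx ell v0 v1 T u x0 y.1 y.2 = space_trace x0 y}.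
Proof.
move=> xl; have H := is_trace_trace_at ell_gt0 mD (L2_family_cut_x Lu)
  (L2_family_cut_x Lw) uw' xl.
have H' : is_trace 0 ell Dx_ (xslice u) x0 (space_trace x0).
  by apply: is_trace_eq H => x y xl' Dy; apply/esym/cut_x.
have /is_trace_eq-/(_ (xslice cutu) (fun x y => @cut_x u x y)) Ht :=
  xgetPex (fun=> 0) (ex_intro _ _ H').
have := is_trace_unique ell_gt0 mD xl (L2_family_cut_x Lu).1 Ht H.
by apply: aeS => -[v t].
Qed.

Lemma measurable_trx x0 : 0 <= x0 <= ell ->
  measurable_fun Dx_ (fun y => trx ell v0 v1 T u x0 y.1 y.2).
Proof.
move=> xl; have H := is_trace_trace_at ell_gt0 mD (L2_family_cut_x Lu)
  (L2_family_cut_x Lw) uw' xl.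
have H' : is_trace 0 ell Dx_ (xslice u) x0 (space_trace x0).
  by apply: is_trace_eq H => x y xl' Dy; apply/esym/cut_x.
have [/Lp_on2P[mtau _] _] := xgetPex (fun=> 0) (ex_intro _ _ H').
have := (measurable_restrictT _ mD).2 mtau.
by congr measurable_fun; apply/funext => -[v t].
Qed.

Lemma space_trace_sq x0 : 0 <= x0 <= ell ->
  {ae mu, forall v, Vel v0 v1 v ->
    mu.-integrable `[0, T] (EFin \o (fun t => space_trace x0 (v, t)))}.
Proof.
move=> xl; have [_] := (Lp_on2P nu Dx_ _).1 (trace_at_Lp ell_gt0 mD (L2_family_cut_x Lu)
  (L2_family_cut_x Lw) uw' xl).
rewrite -/(space_trace x0) => fin; have mt := measurable_space_trace x0.
have it : (mu \x mu)%E.-integrable (Vel v0 v1 `*` Tm T)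
    (EFin \o (fun y => space_trace x0 y ^+ 2)).
  apply: integrable_ge0; [|by move=> y _; exact: sqr_ge0|].
    by apply: measurable_funTS; exact: measurable_funX.
  apply: le_lt_trans fin; rewrite integral_mkcond le_eqVlt; apply/orP; left; apply/eqP.
  apply: eq_integral => y _; rewrite !patchE -/Dx_; case: ifPn => //.
  by rewrite expr0n.
have mtv v : measurable_fun setT (fun t => space_trace x0 (v, t)).
  exact: (measurableT_comp mt (measurable_pair1 v)).
have := @ae_integrable_box_slice _ _ _ _ R mu mu _ _ (measurable_Vel v0 v1)
  (measurable_itv _) _ it.
apply: aeS => v Hv Vv; apply: integrable_sq_integrable; first exact: measurable_funTS.
apply: integrable_closed_segment; first exact: Hv.
by apply: measurable_funTS; exact: measurable_funX.
Qed.

End space_trace.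

Section initial_trace.
Hypothesis uw : weak_deriv 0 T Dt_ (tslice u) (tslice w).
Hypothesis u0 : {ae leb2, forall z, Dt_ z -> trt ell v0 v1 T u z.1 z.2 0 = 0}.

Let mD : measurable Dt_ := measurable_OmVel ell v0 v1.

Let uw' : weak_deriv 0 T Dt_ (tslice cutu) (tslice cutw).
Proof. by apply: weak_deriv_eq uw => x y xl Dy; exact: cut_t. Qed.

Lemma initial_trace_primitive : {ae nu, forall y, Dt_ y ->
  {ae mu, forall t, 0 < t < T ->
    cutu y.1 y.2 t = \int[mu]_(s in `[0, t]) cutw y.1 y.2 s}}.
Proof.
have tT : 0 <= (0 : R) <= T by rewrite lexx ltW.
have H := is_trace_trace_at T_gt0 mD (L2_family_cut_t Lu) (L2_family_cut_t Lw) uw' tT.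
have H' : is_trace 0 T Dt_ (tslice u) 0 (trace_at 0 T (tslice cutu) (tslice cutw) 0).
  by apply: is_trace_eq H => x y xl' Dy; apply/esym/cut_t.
have /is_trace_eq-/(_ (tslice cutu) (fun x y => @cut_t u x y)) Ht :=
  xgetPex (fun=> 0) (ex_intro _ _ H').
have U : {ae nu, forall y, Dt_ y -> trt ell v0 v1 T u y.1 y.2 0 =
    trace_at 0 T (tslice cutu) (tslice cutw) 0 y}.
  by apply: aeS (is_trace_unique T_gt0 mD tT (L2_family_cut_t Lu).1 Ht H) => -[x v].
have A := trace_at_AC T_gt0 (L2_family_cut_t Lu) (L2_family_cut_t Lw) uw'.
apply: aeS2 A (aeI U u0) => -[x v] HA [HU H0] Dy.
have [[_ ACy] E] := HA Dy.
apply: aeS E => t Et tT'; rewrite [LHS](Et tT') ACy; last by case/andP: tT' => /ltW -> /ltW ->.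
by rewrite -HU// [X in X + _]H0// add0r.
Qed.

End initial_trace.

End traces.

Section ge0_box.
Context d1 d2 (T1 : measurableType d1) (T2 : measurableType d2) (R : realType).
Variables (m1 : {sigma_finite_measure set T1 -> \bar R})
  (m2 : {sigma_finite_measure set T2 -> \bar R}).
Variables (A : set T1) (B : set T2) (mA : measurable A) (mB : measurable B).
Variable W : T1 * T2 -> R.
Hypothesis mW : measurable_fun (A `*` B) W.
Hypothesis W0 : forall z, (A `*` B) z -> 0 <= W z.

Let f : T1 * T2 -> \bar R := (EFin \o W) \_ (A `*` B).

Let mf : measurable_fun setT f.
Proof.
apply/(measurable_restrictT _ _).1; first exact: measurableX.
exact/measurable_EFinP.
Qed.

Let f0 z : (0 <= f z)%E.
Proof. by rewrite /f patchE; case: ifPn => // /set_mem /W0; rewrite lee_fin. Qed.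

Let f1 : (fun x => \int[m2]_y f (x, y))%E = (fun x => \int[m2]_(y in B) (W (x, y))%:E)%E \_ A.
Proof.
apply/funext => x; rewrite patchE; case: ifPn => xA.
  rewrite [RHS]integral_mkcond; apply: eq_integral => y _.
  by rewrite /f !patchE in_setX/= xA.
by rewrite integral0_eq// => y _; rewrite /f patchE in_setX/= (negbTE xA).
Qed.

Let f2 : (fun y => \int[m1]_x f (x, y))%E = (fun y => \int[m1]_(x in A) (W (x, y))%:E)%E \_ B.
Proof.
apply/funext => y; rewrite patchE; case: ifPn => yB.
  rewrite [RHS]integral_mkcond; apply: eq_integral => x _.
  by rewrite /f !patchE in_setX/= yB andbT.
by rewrite integral0_eq// => x _; rewrite /f patchE in_setX/= (negbTE yB) andbF.
Qed.

Lemma tonelli_box12 : (\int[(m1 \x m2)%E]_(z in A `*` B) (W z)%:E =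
  \int[m1]_(x in A) \int[m2]_(y in B) (W (x, y))%:E)%E.
Proof. by rewrite integral_mkcond (tonelli12 m1 m2 mf f0) f1 -integral_mkcond. Qed.

Lemma tonelli_box21 : (\int[(m1 \x m2)%E]_(z in A `*` B) (W z)%:E =
  \int[m2]_(y in B) \int[m1]_(x in A) (W (x, y))%:E)%E.
Proof. by rewrite integral_mkcond (tonelli21 m1 m2 mf f0) f2 -integral_mkcond. Qed.

Lemma measurable_box1 : measurable_fun A (fun x => \int[m2]_(y in B) (W (x, y))%:E)%E.
Proof.
by apply/(measurable_restrictT _ mA); rewrite -f1; exact: measurable_int2.
Qed.

Lemma measurable_box2 : measurable_fun B (fun y => \int[m1]_(x in A) (W (x, y))%:E)%E.
Proof.
by apply/(measurable_restrictT _ mB); rewrite -f2; exact: measurable_int1.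
Qed.

End ge0_box.

Section QV_slices.
Context {R : realType}.
Notation mu := (@lebesgue_measure R).
Notation nu := (@planar_lebesgue R).
Variables (ell v0 v1 T : R) (F : R -> R -> R -> R).
Hypothesis mF : measurable_fun (QV ell v0 v1 T) (uncurry3 F).
Hypothesis F0 : forall x v t, Om ell x -> Vel v0 v1 v -> Tm T t -> 0 <= F x v t.

Let f : R * R * R -> \bar R := (EFin \o uncurry3 F) \_ (QV ell v0 v1 T).

Let mf : measurable_fun setT f.
Proof.
apply/(measurable_restrictT _ _).1; first exact: measurable_QV.
exact/measurable_EFinP.
Qed.

Let f0 z : (0 <= f z)%E.
Proof.
rewrite /f patchE; case: ifPn => // /set_mem [[? ?] ?]; rewrite lee_fin; exact: F0.
Qed.

Let nuT (g : R * R -> \bar R) : measurable_fun setT g -> (forall z, (0 <= g z)%E) ->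
  (\int[nu]_z g z = \int[mu]_y \int[mu]_x g (x, y))%E.
Proof. by move=> mg g0; exact: (@tonelli21 _ _ _ _ R mu mu). Qed.

Let fv : (fun v => \int[(mu \x mu)%E]_w f (w.1, v, w.2))%E =
  (fun v => \int[(mu \x mu)%E]_(w in Om ell `*` Tm T) (F w.1 v w.2)%:E)%E \_ (Vel v0 v1).
Proof.
apply/funext => v; rewrite patchE; case: ifPn => vV.
  rewrite [RHS]integral_mkcond; apply: eq_integral => w _.
  by rewrite /f !patchE /QV !in_setX/= vV andbT.
rewrite integral0_eq// => w _; rewrite /f patchE /QV !in_setX/=.
by rewrite (negbTE vV) andbF.
Qed.

Lemma integral_QV_slices : (\int[leb3]_(z in QV ell v0 v1 T) (uncurry3 F z)%:E =
  \int[mu]_(v in Vel v0 v1)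
    \int[(mu \x mu)%E]_(w in Om ell `*` Tm T) (F w.1 v w.2)%:E)%E.
Proof.
rewrite integral_mkcond (@tonelli_middle _ _ _ _ _ _ R mu mu mu nu nuT _ mf f0).
by rewrite fv -integral_mkcond.
Qed.

Lemma measurable_QV_slices : measurable_fun (Vel v0 v1) (fun v =>
  \int[(mu \x mu)%E]_(w in Om ell `*` Tm T) (F w.1 v w.2)%:E)%E.
Proof.
apply/(measurable_restrictT _ (measurable_Vel v0 v1)); rewrite -fv.
exact: (@measurable_middle _ _ _ _ _ _ R mu mu _ mf f0).
Qed.

End QV_slices.

(** * The estimate for all velocities together *)

Section carleman_phase_space.
Context {R : realType}.
Notation mu := (@lebesgue_measure R).
Notation nu := (@planar_lebesgue R).
Variables (ell v0 v1 T m N s : R) (g g1 g2 : R -> R) (p : nat) (M : R).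
Hypotheses (ell_gt0 : 0 < ell) (v0_gt0 : 0 < v0) (v1_gt0 : 0 < v1) (T_gt0 : 0 < T).
Hypotheses (m_gt0 : 0 < m) (N_gt0 : 0 < N).
Hypotheses (mg : measurable_fun setT g) (mg1 : measurable_fun setT g1)
  (mg2 : measurable_fun setT g2).
Hypotheses (cg : {within `[0, ell], continuous g})
  (cg1 : {within `[0, ell], continuous g1}) (cg2 : {within `[0, ell], continuous g2}).
Hypotheses (dg : forall x, 0 < x < ell -> is_derive x 1 g (g1 x))
  (dg1 : forall x, 0 < x < ell -> is_derive x 1 g1 (g2 x)).
Hypothesis g_bd : forall x, 0 <= x <= ell ->
  [/\ m <= g x <= N, m <= g1 x <= N & m <= - g2 x <= N].
Hypotheses (M_ge0 : 0 <= M) (fluxM : weighted_flux_bound T (v1 ^+ 2) m N p M).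
Hypothesis s_ge : carleman_threshold (v0 ^+ 2) (v1 ^+ 2) m N T (5 / 2 * T ^+ 2)
  (4 / T ^+ 2) <= s.

Variables (u ux uxx ut utx : R -> R -> R -> R).
Hypotheses (Lu : L2 ell v0 v1 T u) (du : is_dx ell v0 v1 T u ux)
  (dux : is_dx ell v0 v1 T ux uxx) (dtu : is_dt ell v0 v1 T u ut)
  (dut : is_dx ell v0 v1 T ut utx).
Hypothesis u_init : {ae leb2, forall z, (Om ell `*` Vel v0 v1) z ->
  trt ell v0 v1 T u z.1 z.2 0 = 0}.
Hypothesis u_inflow : forall x, x = 0 \/ x = ell ->
  {ae leb2, forall z, Gamma_minus ell v0 v1 (x, z.1) -> Tm T z.2 ->
    trx ell v0 v1 T u x z.1 z.2 = 0}.

Let Lux := du.1. Let Luxx := dux.1. Let Lut := dtu.1. Let Lutx := dut.1.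
Let c := carleman_cst (v0 ^+ 2) (v1 ^+ 2) m N T.
Let K := 2 * M * expR (p%:R * s).
Local Notation cut := (cut ell v0 v1 T).
Local Notation V := (Vel v0 v1).

Definition energy3 x v t := energy T s g (fun x t => u x v t) (fun x t => ux x v t)
  (fun x t => ut x v t) x t.
Definition residual3 x v t := residual_sq T (v ^+ 2) s g (fun x t => uxx x v t)
  (fun x t => ut x v t) x t.

Let r x0 := space_trace ell v0 v1 T u ux x0.
Let q x0 := space_trace ell v0 v1 T ut utx x0.
Let k x0 := space_trace ell v0 v1 T ux uxx x0.

Let mr x0 : measurable_fun setT (r x0). Proof. exact: measurable_space_trace. Qed.
Let mq x0 : measurable_fun setT (q x0). Proof. exact: measurable_space_trace. Qed.
Let mk x0 : measurable_fun setT (k x0). Proof. exact: measurable_space_trace. Qed.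

Let outflow (x0 : R) (z : R * R) := r x0 z ^+ 2 + q x0 z ^+ 2 + k x0 z ^+ 2.
(** The outflow point is [ell] for positive and 0 for negative velocities. A single formula for both
    signs keeps the boundary integrand measurable in the velocity. *)
Let bd (z : R * R) := outflow (if 0 < z.1 then ell else 0) z + k 0 z ^+ 2.

Let mv (f : R * R -> R) v : measurable_fun setT f ->
  measurable_fun setT (fun t => f (v, t)).
Proof. by move=> mf; exact: (measurableT_comp mf (measurable_pair1 v)). Qed.

(** The facts on traces hold for almost every (v, t), the initial condition for almost every (x, v).
    Taking sections of these null sets gives, for almost every [v], all that the estimate with
    [a = v ^+ 2] requires. *)
Let velocity_slice : {ae mu, forall v, V v ->
  (\int[(mu \x mu)%E]_(w in Om ell `*` Tm T) (energy3 w.1 v w.2)%:E <=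
   c%:E * (\int[(mu \x mu)%E]_(w in Om ell `*` Tm T) (residual3 w.1 v w.2)%:E +
     K%:E * \int[mu]_(t in Tm T) (bd (v, t))%:E))%E}.
Proof.
have xl0 : 0 <= (0 : R) <= ell by rewrite lexx ltW.
have xll : 0 <= ell <= ell by rewrite lexx andbT ltW.
have S1 := ae_section1 (space_trace_AC ell_gt0 Lu Lux du.2).
have S2 := ae_section1 (space_trace_AC ell_gt0 Lux Luxx dux.2).
have S3 := ae_section1 (space_trace_AC ell_gt0 Lut Lutx dut.2).
have I := ae_section2 (initial_trace_primitive T_gt0 Lu Lut dtu.2 u_init).
have Z0 := ae_section1 (aeI (u_inflow (or_introl erefl)) (trxE ell_gt0 Lu Lux du.2 xl0)).
have Zl := ae_section1 (aeI (u_inflow (or_intror erefl)) (trxE ell_gt0 Lu Lux du.2 xll)).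
have Q0 := space_trace_sq ell_gt0 Lut Lutx dut.2 xl0.
have Ql := space_trace_sq ell_gt0 Lut Lutx dut.2 xll.
have LV1 := aeI (L2_family_cut_v Lu) (aeI (L2_family_cut_v Lux) (L2_family_cut_v Luxx)).
have LV2 := aeI (L2_family_cut_v Lut) (L2_family_cut_v Lutx).
apply: aeS2 (aeI (aeI S1 (aeI S2 S3)) (aeI I (aeI Z0 Zl)))
  (aeI (aeI Q0 Ql) (aeI LV1 LV2)).
move=> v [[HS1 [HS2 HS3]] [HI [HZ0 HZl]]] [[HQ0 HQl] [[Lu' [Lux' Luxx']] [Lut' Lutx']]] Vv.
have aa : v0 ^+ 2 <= v ^+ 2 <= v1 ^+ 2.
  case/andP: Vv => v0v vv1; rewrite -(real_normK (num_real v)).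
  by rewrite !ler_sqr ?nnegrE ?(ltW v0_gt0) ?(ltW v1_gt0)// v0v.
have a0_gt0 : 0 < v0 ^+ 2 by rewrite exprn_gt0.
have slice : {ae mu, forall t, 0 < t < T -> exists G Gx Gt,
  [/\ AC 0 ell G (cut ux ^~ v ^~ t), AC 0 ell Gx (cut uxx ^~ v ^~ t),
      AC 0 ell Gt (cut utx ^~ v ^~ t),
      {ae mu, forall x, 0 < x < ell ->
        [/\ cut u x v t = G x, cut ux x v t = Gx x & cut ut x v t = Gt x]} &
      [/\ G 0 = r 0 (v, t) /\ G ell = r ell (v, t),
          Gx 0 = k 0 (v, t) /\ Gx ell = k ell (v, t) &
          Gt 0 = q 0 (v, t) /\ Gt ell = q ell (v, t)]]}.
  apply: aeS2 HS1 (aeI HS2 HS3) => t h1 [h2 h3] tT.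
  have Dvt : (V `*` Tm T) (v, t) by split => //=; rewrite /Tm/= in_itv.
  have [A1 B1] := h1 Dvt; have [A2 B2] := h2 Dvt; have [A3 B3] := h3 Dvt.
  exists (r ^~ (v, t)), (k ^~ (v, t)), (q ^~ (v, t)); split => //.
  by apply: aeS2 B1 (aeI B2 B3) => x e1 [e2 e3] xl; split; [exact: e1|exact: e2|exact: e3].
have init : {ae mu, forall x, 0 < x < ell -> {ae mu, forall t, 0 < t < T ->
    cut u x v t = \int[mu]_(s in `[0, t]) cut ut x v s}}.
  by apply: aeS HI => x Hx xl; apply: Hx; split => //=; rewrite /Om/= in_itv.
have CE : (\int[(mu \x mu)%E]_(w in Om ell `*` Tm T) (energy3 w.1 v w.2)%:E =
    \int[(mu \x mu)%E]_(w in Om ell `*` Tm T) (energy T s g (fun x t => cut u x v t)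
      (fun x t => cut ux x v t) (fun x t => cut ut x v t) w.1 w.2)%:E)%E.
  apply: eq_integral => w /[!inE] -[w1 w2]; congr EFin.
  by rewrite /energy3 /energy !cutE.
have CR : (\int[(mu \x mu)%E]_(w in Om ell `*` Tm T) (residual3 w.1 v w.2)%:E =
    \int[(mu \x mu)%E]_(w in Om ell `*` Tm T) (residual_sq T (v ^+ 2) s g
      (fun x t => cut uxx x v t) (fun x t => cut ut x v t) w.1 w.2)%:E)%E.
  apply: eq_integral => w /[!inE] -[w1 w2]; congr EFin.
  by rewrite /residual3 /residual_sq !cutE.
rewrite CE CR /bd /outflow /=; case: ifPn => v_sgn.
- apply: (@carleman_slice_inflow0 R ell T (v0 ^+ 2) (v1 ^+ 2) m N (v ^+ 2) s g g1 g2 p M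
    ell_gt0 T_gt0 a0_gt0 m_gt0 N_gt0 aa mg mg1 mg2 cg cg1 cg2 dg dg1 g_bd M_ge0 fluxM s_ge
    _ _ _ _ _ _ _ _ _ _ _ Lu' Lux' Luxx' Lut' Lutx' (mv v (mr 0)) (mv v (mr ell))
    (mv v (mk 0)) (mv v (mk ell)) (mv v (mq 0)) (mv v (mq ell)) (HQ0 Vv) slice init).
  apply: aeS HZ0 => t [e1 e2] tT; have tT' : Tm T t by rewrite /Tm/= in_itv.
  rewrite -[LHS]e2//; apply: e1 => //; split => //; left; split => //.
- apply: (@carleman_slice_inflowl R ell T (v0 ^+ 2) (v1 ^+ 2) m N (v ^+ 2) s g g1 g2 p M
    ell_gt0 T_gt0 a0_gt0 m_gt0 N_gt0 aa mg mg1 mg2 cg cg1 cg2 dg dg1 g_bd M_ge0 fluxM s_ge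
    _ _ _ _ _ _ _ _ _ _ _ Lu' Lux' Luxx' Lut' Lutx' (mv v (mr 0)) (mv v (mr ell))
    (mv v (mk 0)) (mv v (mk ell)) (mv v (mq 0)) (mv v (mq ell)) (HQ0 Vv) (HQl Vv) slice init).
  apply: aeS HZl => t [e1 e2] tT; have tT' : Tm T t by rewrite /Tm/= in_itv.
  rewrite -[LHS]e2//; apply: e1 => //; split => //; right; split => //=.
  (* The velocity 0, which would have no inflow point, is excluded by [0 < v0]. *)
  rewrite ltNge; apply: contra v_sgn; rewrite le_eqVlt => /predU1P[v0'|//].
  by move: Vv; rewrite /Vel/= -v0' normr0 leNgt v0_gt0.
Qed.

Let mcut (w : R -> R -> R -> R) : L2 ell v0 v1 T w ->
  measurable_fun setT (fun z : R * R * R => cut w z.1.1 z.1.2 z.2).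
Proof. exact: measurable_cut. Qed.

Let mz1 (f : R -> R) : measurable_fun setT f ->
  measurable_fun setT (fun z : R * R * R => f z.1.1).
Proof.
by move=> mf; exact: (measurableT_comp mf (measurableT_comp measurable_fst measurable_fst)).
Qed.
Let mz2 (f : R -> R) : measurable_fun setT f ->
  measurable_fun setT (fun z : R * R * R => f z.1.2).
Proof.
by move=> mf; exact: (measurableT_comp mf (measurableT_comp measurable_snd measurable_fst)).
Qed.
Let mz3 (f : R -> R) : measurable_fun setT f ->
  measurable_fun setT (fun z : R * R * R => f z.2).
Proof. by move=> mf; exact: (measurableT_comp mf measurable_snd). Qed.

Let mweight : measurable_fun setT (fun z : R * R * R => weight T s g z.1.1 z.2).
Proof.
have h1 := mz3 (measurable_theta T); have h2 := mz1 mg.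
by apply: (measurableT_comp (@measurable_expR R)); meas_tac.
Qed.

Lemma measurable_energy3 : measurable_fun (QV ell v0 v1 T) (uncurry3 energy3).
Proof.
apply: (@eq_measurable_fun _ _ _ _ _ (fun z : R * R * R => energy T s g
  (fun x t => cut u x z.1.2 t) (fun x t => cut ux x z.1.2 t)
  (fun x t => cut ut x z.1.2 t) z.1.1 z.2)).
  by move=> [[x v] t] /[!inE] -[[/= ? ?] ?]; rewrite /uncurry3/energy3/energy/= !cutE.
apply: measurable_funTS; rewrite /energy.
have := mcut Lu; have := mcut Lux; have := mcut Lut; have := mweight.
have := mz3 (measurable_theta T) => ? ? ? ? ?.
meas_tac; apply: (measurableT_comp (@measurable_inv R)); meas_tac.
Qed.

Lemma measurable_residual3 : measurable_fun (QV ell v0 v1 T) (uncurry3 residual3).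
Proof.
apply: (@eq_measurable_fun _ _ _ _ _ (fun z : R * R * R => residual_sq T (z.1.2 ^+ 2) s g
  (fun x t => cut uxx x z.1.2 t) (fun x t => cut ut x z.1.2 t) z.1.1 z.2)).
  by move=> [[x v] t] /[!inE] -[[/= ? ?] ?]; rewrite /uncurry3/residual3/residual_sq/= !cutE.
apply: measurable_funTS; rewrite /residual_sq.
have := mcut Luxx; have := mcut Lut; have := mweight.
have := mz2 (@measurable_id _ R setT) => ? ? ? ?.
by meas_tac.
Qed.

Let s_ge1 : 1 <= s.
Proof.
apply: le_trans s_ge; rewrite /carleman_threshold -addrA lerDl.
have := ltW v0_gt0; have := ltW v1_gt0; have := ltW m_gt0; have := ltW N_gt0.
have := ltW T_gt0 => *; nonneg.
Qed.

Lemma energy3_ge0 x v t : Tm T t -> 0 <= energy3 x v t.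
Proof.
rewrite /Tm/= in_itv/= => tT; have := ltW (theta_gt0 tT) => t0.
have s0 : 0 <= s by rewrite (le_trans _ s_ge1).
rewrite /energy3 /energy; nonneg.
Qed.

Let VelE : V = `[- v1, - v0]%classic `|` `[v0, v1]%classic.
Proof.
apply/seteqP; split => v /=; rewrite !in_itv/=.
  case: (lerP 0 v) => v0' /andP[h1 h2]; [right|left].
    by rewrite -[X in _ <= X]ger0_norm// h1 -[X in X <= _]ger0_norm.
  by move: h1 h2; rewrite ltr0_norm// => ? ?; apply/andP; split; lra.
have := v0_gt0; rewrite /Vel/= => h0 [] /andP[h1 h2].
  by rewrite ler0_norm; [apply/andP; split; lra|lra].
by rewrite ger0_norm; [apply/andP; split; lra|lra].
Qed.

Let mbd : measurable_fun setT bd.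
Proof.
rewrite /bd; apply: measurable_funD; last exact: measurable_funX.
have mo x0 : measurable_fun setT (outflow x0) by rewrite /outflow; meas_tac.
have -> : (fun z => outflow (if 0 < z.1 then ell else 0) z) =
    (fun z : R * R => if 0 < z.1 then outflow ell z else outflow 0 z).
  by apply/funext => z; case: ifP.
by apply: measurable_fun_ifT => //; apply: measurable_fun_ltr.
Qed.

Let bd_ge0 z : 0 <= bd z.
Proof. by rewrite /bd /outflow !addr_ge0// sqr_ge0. Qed.

Lemma carleman_velocity_integrated :
  (\int[leb3]_(z in QV ell v0 v1 T) (uncurry3 energy3 z)%:E <=
   c%:E * (\int[leb3]_(z in QV ell v0 v1 T) (uncurry3 residual3 z)%:E +
     K%:E * \int[mu]_(v in V) \int[mu]_(t in Tm T) (bd (v, t))%:E))%E.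
Proof.
have mV := measurable_Vel v0 v1.
have R0 x v t : 0 <= residual3 x v t by exact: sqr_ge0.
have E0 x v t : Om ell x -> V v -> Tm T t -> 0 <= energy3 x v t.
  by move=> _ _; exact: energy3_ge0.
have c0 : 0 <= c.
  rewrite /c /carleman_cst; have := ltW v0_gt0; have := ltW v1_gt0.
  have := ltW m_gt0; have := ltW N_gt0; have := ltW T_gt0 => *; nonneg.
have K0 : 0 <= K by rewrite mulr_ge0 ?expR_ge0// mulr_ge0.
have mE := measurable_QV_slices measurable_energy3 E0.
have mR := measurable_QV_slices measurable_residual3 (fun x v t _ _ _ => R0 x v t).
have mB : measurable_fun V (fun v => \int[mu]_(t in Tm T) (bd (v, t))%:E)%E.
  apply: (@measurable_box1 _ _ _ _ R mu V (Tm T) mV (measurable_itv _) bd) => //.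
  exact: measurable_funTS.
have IR0 v : (0 <= \int[(mu \x mu)%E]_(w in Om ell `*` Tm T) (residual3 w.1 v w.2)%:E)%E.
  by apply: integral_ge0 => w _; rewrite lee_fin.
have IB0 v : (0 <= \int[mu]_(t in Tm T) (bd (v, t))%:E)%E.
  by apply: integral_ge0 => w _; rewrite lee_fin.
rewrite (integral_QV_slices measurable_energy3 E0).
rewrite (integral_QV_slices measurable_residual3 (fun x v t _ _ _ => R0 x v t)).
have mKB : measurable_fun V (fun v => K%:E * \int[mu]_(t in Tm T) (bd (v, t))%:E)%E.
  exact: measurable_funeM.
rewrite -ge0_integralZl_EFin// -ge0_integralD//; last by move=> v _; rewrite mule_ge0.
rewrite -ge0_integralZl_EFin//; last 2 first.
- by move=> v _; rewrite adde_ge0// mule_ge0.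
- exact: emeasurable_funD.
apply: ae_ge0_le_integral => //.
- move=> v Vv; apply: integral_ge0 => w [_ tw]; rewrite lee_fin; exact: energy3_ge0.
- by move=> v _; rewrite mule_ge0// adde_ge0// mule_ge0.
- by apply: measurable_funeM; exact: emeasurable_funD.
Qed.

Local Notation tr := (trx ell v0 v1 T).

Let trF (x0 : R) (z : R * R) :=
  `|tr u x0 z.1 z.2| ^+ 2 + `|tr ut x0 z.1 z.2| ^+ 2 + `|tr ux x0 z.1 z.2| ^+ 2.

Let sqr_norm (x : R) : `|x| ^+ 2 = x ^+ 2.
Proof. by rewrite real_normK// num_real. Qed.

Let trF_ae x0 : 0 <= x0 <= ell ->
  {ae (mu \x mu)%E, forall z, (V `*` Tm T) z -> outflow x0 z = trF x0 z}.
Proof.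
move=> xl; have h1 := trxE ell_gt0 Lu Lux du.2 xl.
have h2 := trxE ell_gt0 Lut Lutx dut.2 xl.
have h3 := trxE ell_gt0 Lux Luxx dux.2 xl.
apply: aeS2 h1 (aeI h2 h3) => z e1 [e2 e3] Dz.
by rewrite /trF e1// e2// e3// !sqr_norm.
Qed.

Let measurable_trF x0 : 0 <= x0 <= ell -> measurable_fun (V `*` Tm T) (trF x0).
Proof.
move=> xl; have h1 := measurable_trx ell_gt0 Lu Lux du.2 xl.
have h2 := measurable_trx ell_gt0 Lut Lutx dut.2 xl.
have h3 := measurable_trx ell_gt0 Lux Luxx dux.2 xl.
have -> : trF x0 = fun z => tr u x0 z.1 z.2 ^+ 2 + tr ut x0 z.1 z.2 ^+ 2
    + tr ux x0 z.1 z.2 ^+ 2 by apply/funext => z; rewrite /trF !sqr_norm.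
by meas_tac.
Qed.

Let trF_ge0 x0 z : 0 <= trF x0 z.
Proof. by rewrite /trF !addr_ge0// sqr_ge0. Qed.

Let outflow_ge0 x0 z : 0 <= outflow x0 z.
Proof. by rewrite /outflow !addr_ge0// sqr_ge0. Qed.

Let measurable_outflow x0 : measurable_fun setT (outflow x0).
Proof. by rewrite /outflow; meas_tac. Qed.

(** The explicit and the chosen traces agree only almost everywhere in the plane, so they are
    exchanged on the product set, between the two uses of Tonelli. *)
Let outflow_swap x0 (J : set R) : 0 <= x0 <= ell -> measurable J -> J `<=` V ->
  (\int[mu]_(v in J) \int[mu]_(t in Tm T) (outflow x0 (v, t))%:E =
   \int[mu]_(t in Tm T) \int[mu]_(v in J) (trF x0 (v, t))%:E)%E.
Proof.
move=> xl mJ JV; have mTm : measurable (Tm T) by exact: measurable_itv.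
have JD : J `*` Tm T `<=` V `*` Tm T by move=> z [/JV].
have mD : measurable (V `*` Tm T) by exact: measurable_VelTm.
have mJD : measurable (J `*` Tm T) by exact: measurableX.
have mtr : measurable_fun (J `*` Tm T) (trF x0).
  exact: measurable_funS mD JD (measurable_trF xl).
have mo : measurable_fun (J `*` Tm T) (outflow x0).
  exact: measurable_funTS.
rewrite -(@tonelli_box12 _ _ _ _ R mu mu J (Tm T) mJ mTm _ mo (fun z _ => outflow_ge0 x0 z)).
rewrite -(@tonelli_box21 _ _ _ _ R mu mu J (Tm T) mJ mTm _ mtr (fun z _ => trF_ge0 x0 z)).
apply: ae_eq_integral => //; [exact/measurable_EFinP|exact/measurable_EFinP|].
by apply: aeS (trF_ae xl) => z E /JD Dz; congr EFin; exact: E.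
Qed.

Let inner_trF x0 (J : set R) : 0 <= x0 <= ell -> measurable J -> J `<=` V ->
  measurable_fun (Tm T) (fun t => \int[mu]_(v in J) (trF x0 (v, t))%:E)%E.
Proof.
move=> xl mJ JV; have mTm : measurable (Tm T) by exact: measurable_itv.
have JD : J `*` Tm T `<=` V `*` Tm T by move=> z [/JV].
have mD : measurable (V `*` Tm T) by exact: measurable_VelTm.
apply: (@measurable_box2 _ _ _ _ R mu J (Tm T) mJ mTm) => //.
exact: measurable_funS mD JD (measurable_trF xl).
Qed.

Lemma boundary_integral :
  (\int[mu]_(v in V) \int[mu]_(t in Tm T) (bd (v, t))%:E =
   \int[mu]_(t in Tm T) int_Gamma_plus ell v0 v1 (fun x v =>
     (`|tr u x v t| ^+ 2 + `|tr ut x v t| ^+ 2 + `|tr ux x v t| ^+ 2)%R) +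
   \int[mu]_(v in V) \int[mu]_(t in Tm T) (`|tr ux 0 v t| ^+ 2)%:E)%E.
Proof.
have xl0 : 0 <= (0 : R) <= ell by rewrite lexx ltW.
have xll : 0 <= ell <= ell by rewrite lexx andbT ltW.
have mTm : measurable (Tm T) by exact: measurable_itv.
have mV := measurable_Vel v0 v1.
have mD : measurable (V `*` Tm T) by exact: measurable_VelTm.
have NV : `[- v1, - v0]%classic `<=` V by rewrite VelE; exact: subsetUl.
have PV : `[v0, v1]%classic `<=` V by rewrite VelE; exact: subsetUr.
have mN : measurable `[- v1, - v0]%classic by exact: measurable_itv.
have mP : measurable `[v0, v1]%classic by exact: measurable_itv.
pose o (z : R * R) := outflow (if 0 < z.1 then ell else 0) z.
have mo : measurable_fun setT o.
  have -> : o = (fun z : R * R => if 0 < z.1 then outflow ell z else outflow 0 z).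
    by apply/funext => z; rewrite /o; case: ifP.
  by apply: measurable_fun_ifT => //; apply: measurable_fun_ltr.
have o0 z : 0 <= o z by rewrite /o; exact: outflow_ge0.
have mk2 : measurable_fun setT (fun z => k 0 z ^+ 2) by exact: measurable_funX.
have mvT (f : R * R -> R) v : measurable_fun setT f ->
    measurable_fun (Tm T) (fun t => (f (v, t))%:E).
  by move=> mf; apply/measurable_EFinP; apply: measurable_funTS; exact: mv.
have mbox (f : R * R -> R) : measurable_fun setT f -> (forall z, 0 <= f z) ->
    measurable_fun V (fun v => \int[mu]_(t in Tm T) (f (v, t))%:E)%E.
  move=> mf f0; apply: (@measurable_box1 _ _ _ _ R mu V (Tm T) mV mTm f) => //.
  exact: measurable_funTS.
have I0 (f : R * R -> R) v : (forall z, 0 <= f z) ->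
    (0 <= \int[mu]_(t in Tm T) (f (v, t))%:E)%E.
  by move=> f0; apply: integral_ge0 => t _; rewrite lee_fin.
transitivity ((\int[mu]_(v in V) \int[mu]_(t in Tm T) (o (v, t))%:E) +
  \int[mu]_(v in V) \int[mu]_(t in Tm T) (k 0 (v, t) ^+ 2)%:E)%E.
  rewrite -ge0_integralD//; first last.
  - by apply: (mbox (fun z => k 0 z ^+ 2)) => // z; exact: sqr_ge0.
  - by move=> v _; apply: (I0 (fun z => k 0 z ^+ 2)) => z; exact: sqr_ge0.
  - exact: mbox.
  - by move=> v _; exact: I0.
  apply: eq_integral => v _; rewrite -ge0_integralD//.
  - by move=> t _; rewrite lee_fin.
  - exact: mvT.
  - by move=> t _; rewrite lee_fin sqr_ge0.
  - exact: (mvT _ v mk2).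
congr (_ + _)%E; last first.
  have mtr2 : measurable_fun (V `*` Tm T) (fun z => `|tr ux 0 z.1 z.2| ^+ 2).
    have -> : (fun z => `|tr ux 0 z.1 z.2| ^+ 2) = fun z => tr ux 0 z.1 z.2 ^+ 2.
      by apply/funext => z; rewrite sqr_norm.
    by apply: measurable_funX; exact: (measurable_trx ell_gt0 Lux Luxx dux.2 xl0).
  have mk2' : measurable_fun (V `*` Tm T) (fun z => k 0 z ^+ 2) by exact: measurable_funTS.
  rewrite -(@tonelli_box12 _ _ _ _ R mu mu V (Tm T) mV mTm _ mk2' (fun z _ => sqr_ge0 _)).
  rewrite -(@tonelli_box12 _ _ _ _ R mu mu V (Tm T) mV mTm _ mtr2 (fun z _ => sqr_ge0 _)).
  apply: ae_eq_integral => //; [exact/measurable_EFinP|exact/measurable_EFinP|].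
  apply: aeS (trxE ell_gt0 Lux Luxx dux.2 xl0) => z E Dz; congr EFin.
  by rewrite sqr_norm E.
rewrite VelE ge0_integral_setU//; first last.
- apply/disj_setPS => v [/=]; rewrite !in_itv/= => /andP[_ h1] /andP[h2 _].
  by have := v0_gt0; lra.
- by move=> v _; exact: I0.
- by rewrite -VelE; exact: mbox.
transitivity ((\int[mu]_(t in Tm T) \int[mu]_(v in `[(- v1)%R, (- v0)%R]) (trF 0 (v, t))%:E) +
  \int[mu]_(t in Tm T) \int[mu]_(v in `[v0, v1]) (trF ell (v, t))%:E)%E.
  have EN := outflow_swap xl0 mN NV; have EP := outflow_swap xll mP PV.
  congr (_ + _)%E.
    apply: etrans EN.
    apply: eq_integral => v /[!inE]/=; rewrite in_itv/= => /andP[_ h].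
    apply: eq_integral => t _; rewrite /o/= ltNge (le_trans h)//.
    by rewrite oppr_le0 ltW.
  apply: etrans EP.
  apply: eq_integral => v /[!inE]/=; rewrite in_itv/= => /andP[h _].
  by apply: eq_integral => t _; rewrite /o/= (lt_le_trans v0_gt0 h).
rewrite -ge0_integralD//.
- by move=> t _; apply: integral_ge0 => v _; rewrite lee_fin.
- exact: inner_trF.
- by move=> t _; apply: integral_ge0 => v _; rewrite lee_fin.
- exact: inner_trF.
Qed.

Lemma carleman_phase_space :
  (\int[leb3]_(z in QV ell v0 v1 T) (uncurry3 energy3 z)%:E <=
   c%:E * (\int[leb3]_(z in QV ell v0 v1 T) (uncurry3 residual3 z)%:E +
     K%:E * (\int[mu]_(t in Tm T) int_Gamma_plus ell v0 v1 (fun x v =>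
     (`|tr u x v t| ^+ 2 + `|tr ut x v t| ^+ 2 + `|tr ux x v t| ^+ 2)%R) +
   \int[mu]_(v in V) \int[mu]_(t in Tm T) (`|tr ux 0 v t| ^+ 2)%:E)))%E.
Proof. by rewrite -boundary_integral; exact: carleman_velocity_integrated. Qed.

End carleman_phase_space.

(** * Bounds on the coefficients *)

Section essential_bounds.
Context d (Y : measurableType d) {R : realType}.
Variables (mu : {measure set Y -> \bar R}) (D : set Y) (ell : R).
Implicit Types (f : Y -> R) (g h : R -> Y -> R) (B : R).

Definition ess_bounded f B := {ae mu, forall y, D y -> `|f y| <= B}.

Lemma norm_on_pinfty_le f B : (norm_on mu D +oo f <= B%:E)%E -> ess_bounded f B.
Proof.
rewrite /norm_on unlock; case: ifPn => [_ /ess_supP|].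
  by apply: aeS => y /= + Dy; rewrite patchE mem_set// lee_fin.
(* If the whole space has measure zero, the norm carries no information, but every property holds
   almost everywhere. *)
rewrite -leNgt => mu0 _; exists setT; split => //.
by apply/eqP; rewrite eq_le mu0 measure_ge0.
Qed.

Lemma Lp_on_pinfty_bounded f : Lp_on mu D +oo f -> exists2 B, 0 <= B & ess_bounded f B.
Proof.
rewrite /Lp_on inE => /andP[_]; rewrite inE/= /finite_norm => fin.
have N0 : (0 <= norm_on mu D +oo f)%E by exact: Lnorm_ge0.
have fN : norm_on mu D +oo f \is a fin_num by rewrite ge0_fin_numE.
exists (fine (norm_on mu D +oo f)); first exact: fine_ge0.
by apply: norm_on_pinfty_le; rewrite fineK.
Qed.

Lemma ess_bounded_le f B B' : B <= B' -> ess_bounded f B -> ess_bounded f B'.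
Proof. by move=> BB'; apply: aeS => y /[apply] /le_trans; exact. Qed.

Lemma ess_bounded_add f f' B B' : ess_bounded f B -> ess_bounded f' B' ->
  ess_bounded (fun y => f y + f' y) (B + B').
Proof.
by apply: aeS2 => y h1 h2 Dy; rewrite (le_trans (ler_normD _ _))// lerD ?h1 ?h2.
Qed.

Lemma ess_bounded_mul f f' B B' : ess_bounded f B -> ess_bounded f' B' ->
  ess_bounded (fun y => f y * f' y) (B * B').
Proof. by apply: aeS2 => y h1 h2 Dy; rewrite normrM ler_pM ?h1 ?h2. Qed.

Lemma ess_bounded_cst c : ess_bounded (fun=> c) `|c|.
Proof. by apply: aeW => y _. Qed.

Let I : set R := `[0, ell].

Lemma cvg0_ess_bounded (F : set_system R) (k : R -> Y -> R) : Filter F ->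
  norm_on mu D +oo (k x) @[x --> F] --> 0%E ->
  forall e, 0 < e -> \forall x \near F, ess_bounded (k x) e.
Proof.
move=> FF /= k0 e e0.
have : \forall x \near F, (norm_on mu D +oo (k x) < e%:E)%E.
  have := k0 [set z | (z < e%:E)%E]; apply; exists e => //= r.
  by rewrite /ball/= sub0r normrN lte_fin; exact: le_lt_trans (ler_norm _).
by apply: filterS => x /ltW; exact: norm_on_pinfty_le.
Qed.

(** Compactness of the segment, in the form of a near-covering whose second variable is the bound
    tending to infinity. *)
Lemma locally_ess_bounded (k : R -> Y -> R) :
  (forall x0, I x0 -> exists B, \forall x \near x0, I x -> ess_bounded (k x) B) ->
  exists2 B, 0 <= B & forall x, I x -> ess_bounded (k x) B.
Proof.
move=> loc; have := @segment_compact R 0 ell.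
move=> /compact_near_coveringP/(_ R +oo (fun B x => I x -> ess_bounded (k x) B)).
have P x : `[0, ell]%classic x ->
    \forall x' \near x & B \near +oo, I x' -> ess_bounded (k x') B.
  move=> /loc[B HB]; exists ([set x | I x -> ess_bounded (k x) B], [set B' | B < B']).
    by split => //=; exact: (nbhs_pinfty_gt (num_real B)).
  by move=> [x' B'] /= [H /ltW BB'] /H; exact: ess_bounded_le.
move=> /(_ _ P)[B [_ HB]]; exists (Num.max 0 (B + 1)); first by rewrite le_max lexx.
move=> x Ix; apply: (HB _ _ x Ix Ix).
by rewrite lt_max ltrDl ltr01 orbT.
Qed.

Lemma difference_quotient_bounded g h x0 B e : 0 < e ->
  is_dx_Linfty mu D ell g h -> I x0 -> ess_bounded (h x0) B ->
  \forall x \near x0, I x -> x != x0 ->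
    ess_bounded (fun y => (x - x0)^-1 * (g x y - g x0 y)) (B + e).
Proof.
move=> e0 [_ H] Ix0 hB; have [_ cv] := H x0 Ix0.
have : nbhs x0 (fun x => x != x0 -> I x ->
    ess_bounded (fun y => (x - x0)^-1 * (g x y - g x0 y) - h x0 y) e).
  exact: (@cvg0_ess_bounded (within I (x0^'))
    (fun x y => (x - x0)^-1 * (g x y - g x0 y) - h x0 y) _ cv e e0).
apply: filterS => x Hx Ix xx0; have := ess_bounded_add hB (Hx xx0 Ix).
by apply: aeS => y /[apply]; rewrite addrC subrK.
Qed.

(** One point [x] close to [x0] suffices, with the quotient within 1 of the derivative. As
    [0 < ell], such a point of the segment exists: to the right of [x0], or to its left at the right
    end. *)
Lemma difference_quotient_limit g h x0 B : 
  is_dx_Linfty mu D ell g h -> I x0 -> 0 < ell ->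
  (\forall x \near x0, I x -> x != x0 ->
    ess_bounded (fun y => (x - x0)^-1 * (g x y - g x0 y)) B) ->
  ess_bounded (h x0) (B + 1).
Proof.
move=> [_ H] Ix0 ell0 hB; have [_ cv] := H x0 Ix0.
have : nbhs x0 (fun x => x != x0 -> I x ->
    ess_bounded (fun y => (x - x0)^-1 * (g x y - g x0 y) - h x0 y) 1).
  exact: (@cvg0_ess_bounded (within I (x0^'))
    (fun x y => (x - x0)^-1 * (g x y - g x0 y) - h x0 y) _ cv 1 ltr01).
move=> /(filterI hB)[r /= r0 Hr].
have [x [Ix xx0 xr]] : exists x, [/\ I x, x != x0 & `|x0 - x| < r].
  move: Ix0; rewrite /I/= in_itv/= => /andP[x00 x0l].
  have [x0l'|lx0] := ltP x0 ell.
    pose e := Num.min (ell - x0) r / 2.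
    have e0 : 0 < e by rewrite divr_gt0// lt_min subr_gt0 x0l'.
    have [e1 e2] : e < ell - x0 /\ e < r.
      have : e * 2 <= ell - x0 /\ e * 2 <= r.
        by rewrite /e divfK// !ge_min !lexx orbT.
      by move: e0; lra.
    exists (x0 + e); split.
    - by rewrite /I/= in_itv/=; apply/andP; split; lra.
    - by rewrite gt_eqF// ltrDl.
    - by rewrite opprD addNKr normrN gtr0_norm.
  pose e := Num.min ell r / 2.
  have e0 : 0 < e by rewrite divr_gt0// lt_min ell0.
  have [e1 e2] : e < ell /\ e < r.
    have : e * 2 <= ell /\ e * 2 <= r.
      by rewrite /e divfK// !ge_min !lexx orbT.
    by move: e0; lra.
  exists (x0 - e); split.
  - by rewrite /I/= in_itv/=; apply/andP; split; lra.
  - by rewrite lt_eqF// ltrBlDr ltrDl.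
  - by rewrite opprB addrC subrK gtr0_norm.
have [h1 h2] := Hr x xr; have := ess_bounded_add (h1 Ix xx0)
  (ess_bounded_mul (ess_bounded_cst (-1)) (h2 xx0 Ix)).
rewrite normrN1 mul1r; apply: aeS => y /[apply].
by rewrite mulN1r opprB addrC subrK.
Qed.

(** The derivative is locally bounded by continuity; this bounds the difference quotients and,
    through them, [g] itself. The quotients are part of the conclusion because the product rule for
    [scat] is carried out on them. *)
Lemma C1_Linfty_bounded g : C1_Linfty mu D ell g -> exists2 B, 0 <= B & forall x, I x ->
  [/\ ess_bounded (g x) B, ess_bounded (dx_Linfty mu D ell g x) B &
      \forall x' \near x, I x' -> x' != x ->
        ess_bounded (fun y => (x' - x)^-1 * (g x' y - g x y)) B].
Proof.
move=> [_ Lg dg cdg].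
have [B1 B10 HB1] : exists2 B, 0 <= B &
    forall x, I x -> ess_bounded (dx_Linfty mu D ell g x) B.
  apply: locally_ess_bounded => x0 Ix0.
  have [B _ hB] := Lp_on_pinfty_bounded (dg.2 x0 Ix0).1; exists (B + 1).
  have : nbhs x0 (fun x => I x -> ess_bounded
      (fun y => dx_Linfty mu D ell g x y - dx_Linfty mu D ell g x0 y) 1).
    exact: (@cvg0_ess_bounded (within I (nbhs x0)) (fun x y =>
      dx_Linfty mu D ell g x y - dx_Linfty mu D ell g x0 y) _ (cdg x0 Ix0) 1 ltr01).
  apply: filterS => x Hx Ix; have := ess_bounded_add hB (Hx Ix).
  by apply: aeS => y /[apply]; rewrite addrC subrK.
have dq x0 : I x0 -> \forall x \near x0, I x -> x != x0 ->
    ess_bounded (fun y => (x - x0)^-1 * (g x y - g x0 y)) (B1 + 1).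
  by move=> Ix0; apply: difference_quotient_bounded dg Ix0 (HB1 x0 Ix0).
have [B0 B00 HB0] : exists2 B, 0 <= B & forall x, I x -> ess_bounded (g x) B.
  apply: locally_ess_bounded => x0 Ix0.
  have [B B_0 hB] := Lp_on_pinfty_bounded (Lg x0 Ix0); exists (B + (B1 + 1)).
  have x01 : \forall x \near x0, `|x0 - x| < 1 by exists 1 => //=.
  apply: filterS2 x01 (dq x0 Ix0) => x x1 Hx Ix.
  have [->|xx0] := eqVneq x x0.
    by apply: ess_bounded_le hB; rewrite lerDl addr_ge0.
  have := ess_bounded_add hB (ess_bounded_mul (ess_bounded_cst (x - x0)) (Hx Ix xx0)).
  apply: aeS => y H Dy; have := H Dy.
  rewrite mulrA mulfV ?subr_eq0// mul1r addrC subrK => /le_trans; apply.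
  by rewrite lerD2l ler_piMl ?addr_ge0// distrC ltW.
exists (B0 + (B1 + 1)); first by rewrite !addr_ge0.
move=> x Ix; split.
- by apply: ess_bounded_le (HB0 x Ix); rewrite lerDl addr_ge0.
- by apply: ess_bounded_le (HB1 x Ix); lra.
- apply: filterS (dq x Ix) => x' H Ix' xx'.
  by apply: ess_bounded_le (H Ix' xx'); lra.
Qed.

End essential_bounds.

Section product_null_sets.
Context d1 d2 (T1 : measurableType d1) (T2 : measurableType d2) (R : realType).
Variables (m1 : {sigma_finite_measure set T1 -> \bar R})
  (m2 : {sigma_finite_measure set T2 -> \bar R}).

Lemma ae_fst (P : T1 -> Prop) : {ae m1, forall x, P x} ->
  {ae (m1 \x m2)%E, forall z, P z.1}.
Proof.
move=> [N [mN N0 PN]]; exists (N `*` setT); split.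
- exact: measurableX.
- by transitivity (m1 N * m2 setT)%E; [exact: product_measure1E|rewrite N0 mul0e].
- by move=> z /= nP; split => //; exact: PN.
Qed.

End product_null_sets.

Section integral_majorant.
Context d (Y : measurableType d) (R : realType) (mu : {measure set Y -> \bar R}).
Variables (D : set Y) (mD : measurable D).
Import HBNNSimple.

(* f need not be measurable: its integral is a difference of suprema of integrals
   of simple functions *)
Lemma Rintegral_abs_le (f H : Y -> R) : measurable_fun D H ->
  (forall y, D y -> 0 <= H y) -> {ae mu, forall y, D y -> `|f y| <= H y} ->
  (`|\int[mu]_(y in D) f y|%:E <= \int[mu]_(y in D) (H y)%:E)%E.
Proof.
move=> mH H0 fH; set J := (\int[mu]_(y in D) (H y)%:E)%E.
have J0 : (0 <= J)%E by apply: integral_ge0 => y Dy; rewrite lee_fin H0.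
have mHD : measurable_fun setT (EFin \o (H \_ D)).
  by apply/measurable_EFinP; apply/(measurable_restrictT _ mD).
have JE : J = (\int[mu]_y ((H \_ D) y)%:E)%E.
  by rewrite /J integral_mkcond; apply: eq_integral => y _; rewrite !patchE; case: ifP.
have le_sup (g : Y -> \bar R) : (forall y, (0 <= g y)%E) ->
    {ae mu, forall y, (g y <= ((H \_ D) y)%:E)%E} -> (\int[mu]_y g y <= J)%E.
  move=> g0 gH; rewrite ge0_integralTE//; apply/ge_ereal_sup => _ /= [h hg <-].
  have := integral_nnsfun mu measurableT h; rewrite patch_setT => <-.
  rewrite JE; apply: ae_ge0_le_integral => //.
  - by move=> y _; rewrite lee_fin; exact: fun_ge0.
  - exact/measurable_EFinP/measurable_funPT.
  - by move=> y _; rewrite /= lee_fin patchE; case: ifPn => // /set_mem /H0.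
  - by apply: aeS gH => y gy _; exact: le_trans (hg y) gy.
have le_part (F : (Y -> \bar R) -> Y -> \bar R) :
    F = @funepos _ R \/ F = @funeneg _ R ->
    (0 <= \int[mu]_(y in D) F (fun x => (f x)%:E) y <= J)%E.
  move=> FE; have F0 y : (0 <= F (fun x => (f x)%:E) y)%E.
    by case: FE => ->; [exact: funepos_ge0|exact: funeneg_ge0].
  apply/andP; split; first exact: integral_ge0.
  rewrite integral_mkcond; apply: le_sup.
    by move=> y; rewrite patchE; case: ifPn.
  apply: aeS fH => y Hy; rewrite !patchE; case: ifPn => // /set_mem Dy.
  have := Hy Dy; rewrite ler_norml => /andP[h1 h2].
  case: FE => ->; rewrite ?funeposE ?funenegE/= -?EFinN -EFin_max lee_fin ge_max H0// andbT//.
  by rewrite lerNl.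
rewrite /Rintegral integralE.
have /andP[] := le_part _ (or_introl erefl); have /andP[] := le_part _ (or_intror erefl).
case: J {le_sup le_part JE} J0 => [j| |] // j0; last by move=> *; rewrite leey.
move: (\int[mu]_(y in D) (_ ^\+) y)%E (\int[mu]_(y in D) (_ ^\-) y)%E.
move=> [a| |] [b| |] //=; rewrite !lee_fin => ? ? ? ?.
by rewrite ler_norml; apply/andP; split; lra.
Qed.

(** Cauchy-Schwarz on a set of finite measure, with a measurable majorant [H] in place of the square
    of [f], which need not be measurable. *)
Lemma sq_Rintegral_le (f H : Y -> R) (L : R) : 0 < L -> (mu D <= L%:E)%E ->
  measurable_fun D H -> (forall y, D y -> 0 <= H y) ->
  {ae mu, forall y, D y -> f y ^+ 2 <= H y} ->
  (((\int[mu]_(y in D) f y) ^+ 2)%:E <= L%:E * \int[mu]_(y in D) (H y)%:E)%E.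
Proof.
move=> L0 muD mH H0 fH; set J := \int[mu]_(y in D) f y.
have I0 : (0 <= \int[mu]_(y in D) (H y)%:E)%E.
  by apply: integral_ge0 => y Dy; rewrite lee_fin H0.
have [->|J0] := eqVneq J 0; first by rewrite expr0n mule_ge0// lee_fin ltW.
have {}J0 : 0 < `|J| by rewrite normr_gt0.
pose dl := `|J| / L; have dl0 : 0 < dl by rewrite divr_gt0.
(* AM-GM, with the parameter that makes it sharp *)
have : (`|J|%:E <= \int[mu]_(y in D) (dl / 2 + (2 * dl)^-1 * H y)%:E)%E.
  apply: Rintegral_abs_le.
  - by apply: measurable_funD => //; exact: measurable_funM.
  - by move=> y Dy; rewrite addr_ge0 ?mulr_ge0 ?invr_ge0 ?H0// ?divr_ge0// ltW// mulr_gt0.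
  - apply: aeS fH => y fy Dy; have {}fy := fy Dy.
    rewrite -(real_normK (num_real (f y))) in fy; move: fy.
    have : (2 * dl)^-1 * (2 * dl) = 1 by rewrite mulVf// gt_eqF// mulr_gt0.
    have i0 : 0 < (2 * dl)^-1 by rewrite invr_gt0 mulr_gt0.
    move: ((2 * dl)^-1) i0 => i i0 idl fy.
    have := mulr_ge0 (ltW i0) (sqr_ge0 (`|f y| - dl)).
    have : i * `|f y| ^+ 2 <= i * H y by rewrite ler_wpM2l// ltW.
    have e : i * (`|f y| - dl) ^+ 2 =
      i * `|f y| ^+ 2 - i * (2 * dl) * `|f y| + i * (2 * dl) * (dl / 2) by field.
    by move: e; rewrite idl !mul1r; lra.
have mHE : measurable_fun D (EFin \o H) by exact/measurable_EFinP.
have EI : (\int[mu]_(y in D) (dl / 2 + (2 * dl)^-1 * H y)%:E =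
    (dl / 2)%:E * mu D + ((2 * dl)^-1)%:E * \int[mu]_(y in D) (H y)%:E)%E.
  rewrite -ge0_integralZl_EFin//; last by rewrite invr_ge0 mulr_ge0// ltW.
  rewrite -(integral_cst mu mD) -ge0_integralD//.
  - by move=> y _; rewrite lee_fin divr_ge0// ltW.
  - by move=> y Dy; rewrite lee_fin mulr_ge0 ?H0// invr_ge0 mulr_ge0// ltW.
  - by apply/measurable_EFinP; exact: measurable_funM.
rewrite EI; case: (\int[mu]_(y in D) (H y)%:E)%E I0 => [I| |]//; last first.
  by move=> _ _; rewrite gt0_muley ?lte_fin// leey.
rewrite lee_fin => I0 h.
have : (`|J|%:E <= (dl / 2)%:E * L%:E + (((2 * dl)^-1) * I)%:E)%E.
  by apply: le_trans h _; rewrite leeD2r// lee_wpmul2l// lee_fin divr_ge0// ltW.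
rewrite -EFinM -EFinD !lee_fin /dl -(real_normK (num_real J)) => h'.
have : `|J| / L / 2 * L = `|J| / 2 by field; rewrite gt_eqF.
have E2 : (2 * (`|J| / L))^-1 * I * (2 * `|J|) = L * I.
  by field; rewrite !gt_eqF.
move=> E1; rewrite E1 in h'.
have : `|J| / 2 <= (2 * (`|J| / L))^-1 * I by lra.
have J2 : 0 <= 2 * `|J| by rewrite mulr_ge0// ltW.
move=> /(ler_wpM2r J2); rewrite E2; have : `|J| / 2 * (2 * `|J|) = `|J| ^+ 2 by field.
by move=> ->.
Qed.

End integral_majorant.

Lemma Vel_measure_le (R : realType) (v0 v1 : R) : 0 < v1 ->
  (@lebesgue_measure R (Vel v0 v1) <= (2 * v1)%:E)%E.
Proof.
move=> v1_gt0; have sub : Vel v0 v1 `<=` `[- v1, v1]%classic.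
  by move=> v /= /andP[_]; rewrite in_itv/= ler_norml.
have E : lebesgue_measure (`[- v1, v1]%classic : set R) = (2 * v1)%:E.
  rewrite lebesgue_measure_itv/= lte_fin ifT; last by move: v1_gt0; lra.
  by rewrite -EFinB; congr EFin; ring.
rewrite -E; apply: le_measure => //; rewrite inE; first exact: measurable_Vel.
exact: measurable_itv.
Qed.

Section coefficient_bounds.
Context {R : realType}.
Notation mu := (@lebesgue_measure R).
Variables (ell v0 v1 T : R) (ell_gt0 : 0 < ell) (v1_gt0 : 0 < v1).
Variables (sigma_t sigma_s : R -> R -> R) (p : R -> R -> R -> R).
Hypotheses (sigma_tC1 : C1_Linfty leb1 (Vel v0 v1) ell sigma_t)
  (sigma_sC1 : C1_Linfty leb1 (Vel v0 v1) ell sigma_s)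
  (pC1 : C1_Linfty leb2 (VV v0 v1) ell (fun x z => p x z.1 z.2)).

Let I : set R := `[0, ell].
Local Notation V := (Vel v0 v1).
Local Notation W := (VV v0 v1).
Local Notation bounded1 := (@ess_bounded _ _ R mu V).
Local Notation bounded2 := (@ess_bounded _ _ R (mu \x mu)%E W).

Let lift1 f B : bounded1 f B -> bounded2 (fun z => f z.1) B.
Proof. by move=> /(ae_fst mu); apply: aeS => z Hz [Vz _]; exact: Hz. Qed.

Let dscat := dx_Linfty leb2 W ell (scat sigma_s p).

(** The product rule is used only for difference quotients, whose bound passes to the limit.
    Differentiability of the product itself is never proved. *)
Lemma dx_scat_bounded : exists2 B, 0 <= B & forall x, I x -> bounded2 (dscat x) B.
Proof.
have [Bs Bs0 Hs] := C1_Linfty_bounded sigma_sC1.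
have [Bp Bp0 Hp] := C1_Linfty_bounded pC1.
have B0 : 0 <= Bs * Bp + Bs * Bp + 1 by rewrite !addr_ge0// mulr_ge0.
exists (Bs * Bp + Bs * Bp + 1) => // x0 Ix0; rewrite /dscat /dx_Linfty.
(* Were there no derivative, [dx_Linfty] would take its default value 0, which satisfies any
   bound. *)
have [ex|nex] := pselect (exists h, is_dx_Linfty leb2 W ell (scat sigma_s p) h); last first.
  rewrite xgetPN; last by move=> h hP; apply: nex; exists h.
  by apply: aeW => z _; rewrite normr0.
have [sx0 _ dsx0] := Hs x0 Ix0; have [px0 _ dpx0] := Hp x0 Ix0.
apply: difference_quotient_limit (xgetPex _ ex) Ix0 ell_gt0 _.
apply: filterS2 dsx0 dpx0 => x hs hp Ix xx0.
have [sx _ _] := Hs x Ix.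
have := ess_bounded_add (ess_bounded_mul (lift1 sx) (hp Ix xx0))
  (ess_bounded_mul (lift1 (hs Ix xx0)) px0).
apply: aeS => z /[apply]; congr (`|_| <= _); rewrite /scat.
by move: (_^-1) => i; ring.
Qed.

Let sq_le (A a b U X : R) : `|a| <= A -> `|b| <= A ->
  (a * U + b * X) ^+ 2 <= 2 * A ^+ 2 * (X ^+ 2 + U ^+ 2).
Proof.
move=> aA bA; have A0 : 0 <= A by exact: le_trans aA.
have a2 : a ^+ 2 <= A ^+ 2 by rewrite -(real_normK (num_real a)) lerXn2r// nnegrE.
have b2 : b ^+ 2 <= A ^+ 2 by rewrite -(real_normK (num_real b)) lerXn2r// nnegrE.
have := sqr_ge0 (a * U - b * X).
have : a ^+ 2 * U ^+ 2 <= A ^+ 2 * U ^+ 2 by rewrite ler_wpM2r// sqr_ge0.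
have : b ^+ 2 * X ^+ 2 <= A ^+ 2 * X ^+ 2 by rewrite ler_wpM2r// sqr_ge0.
rewrite -!exprMn; lra.
Qed.

(** Both operators are a coefficient times [u] plus a coefficient times its x-derivative, with
    essentially bounded coefficients. The exceptional velocities depend on [x] but not on [u] or
    [t], and bounds on pairs of velocities are used through their sections. *)
Lemma coefficient_bounds : exists2 A, 0 <= A & forall x, I x -> {ae mu, forall v, V v ->
  (forall u t, L1op ell v0 v1 T sigma_t u x v t ^+ 2 <=
     A * (dx ell v0 v1 T u x v t ^+ 2 + u x v t ^+ 2)) /\
  {ae mu, forall v', V v' ->
     forall u t, Kop ell v0 v1 T sigma_t sigma_s p u x v v' t ^+ 2 <=
       A * (dx ell v0 v1 T u x v' t ^+ 2 + u x v' t ^+ 2)}}.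
Proof.
have [Bt Bt0 Ht] := C1_Linfty_bounded sigma_tC1.
have [Bs Bs0 Hs] := C1_Linfty_bounded sigma_sC1.
have [Bp Bp0 Hp] := C1_Linfty_bounded pC1.
have [Bd Bd0 Hd] := dx_scat_bounded.
have v1_ge0 := ltW v1_gt0.
(* Bound on the inner integral over [v'']: the velocity set has measure at most [2 * v1]. *)
pose Bi := Bs * Bp * Bp * (2 * v1).
have Bi0 : 0 <= Bi by rewrite /Bi; nonneg.
pose A1 := 2 * v1 * Bt + v1 * Bt + Bt ^+ 2.
pose A2 := v1 * Bd + 2 * (Bs * Bp * Bt) + Bs * Bi + 2 * (Bs * Bp * v1).
have A10 : 0 <= A1 by rewrite /A1; nonneg.
have A20 : 0 <= A2 by rewrite /A2; nonneg.
exists (2 * (A1 + A2) ^+ 2); first by nonneg.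
move=> x Ix; have [tx dtx _] := Ht x Ix; have [sx _ _] := Hs x Ix.
have [px _ _] := Hp x Ix; have dx_ := Hd x Ix.
have px1 := ae_section1 px; have px2 := ae_section2 px; have dx1 := ae_section1 dx_.
apply: aeS2 (aeI tx dtx) (aeI sx (aeI px1 dx1)).
move=> v [/= tv dtv] [sv [pv dv]] Vv.
have {}tv := tv Vv; have {}dtv := dtv Vv; have {}sv := sv Vv.
have vv1 : `|v| <= v1 by case/andP: Vv.
split=> [u t|].
  rewrite /L1op (addrC (2 * v * sigma_t x v * _)); apply: sq_le.
    apply: (@le_trans _ _ (v1 * Bt + Bt ^+ 2)); last first.
      have := mulr_ge0 v1_ge0 Bt0; rewrite /A1; move: A20; lra.
    apply: le_trans (ler_normD _ _) _; apply: lerD; first by rewrite normrM ler_pM.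
    by rewrite normrX lerXn2r ?nnegrE.
  apply: (@le_trans _ _ (2 * v1 * Bt)); last first.
    have := mulr_ge0 v1_ge0 Bt0; have := sqr_ge0 Bt; rewrite /A1; move: A20; lra.
  by rewrite !normrM (ger0_norm (ler0n R 2)) !ler_pM.
apply: aeS2 tx (aeI pv (aeI px2 dv)) => v' tv' [pvv' [pv' dvv']] Vv' u t.
have {}tv' := tv' Vv'; have {}pvv' := pvv' (conj Vv Vv'); have {}dvv' := dvv' (conj Vv Vv').
have vv1' : `|v'| <= v1 by case/andP: Vv'.
set inner := \int[leb1]_(v'' in Vel v0 v1) (sigma_s x v'' * p x v v'' * p x v'' v').
have inner_le : `|inner| <= Bi.
  rewrite -lee_fin; apply: (@le_trans _ _ (\int[mu]_(v'' in V) (Bs * Bp * Bp)%:E)%E).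
    apply: Rintegral_abs_le; first exact: measurable_Vel.
    - exact: measurable_cst.
    - by move=> w _; nonneg.
    - apply: aeS2 sx (aeI pv pv') => w sw [pw pw'] Vw.
      have h1 := sw Vw; have h2 := pw (conj Vv Vw); have h3 := pw' (conj Vw Vv').
      by rewrite !normrM ler_pM ?mulr_ge0// ler_pM.
  rewrite integral_cst; last exact: measurable_Vel.
  rewrite /Bi [leRHS]EFinM; apply: lee_wpmul2l; last exact: Vel_measure_le.
  by rewrite lee_fin; nonneg.
have -> : Kop ell v0 v1 T sigma_t sigma_s p u x v v' t =
  (- v * dscat x (v, v') - sigma_s x v * p x v v' * sigma_t x v
   - sigma_s x v * p x v v' * sigma_t x v' + sigma_s x v * inner) * u x v' t +
  - (sigma_s x v * p x v v' * (v + v')) * dx ell v0 v1 T u x v' t.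
  by rewrite /Kop -/inner -/dscat; ring.
have sp : `|sigma_s x v * p x v v'| <= Bs * Bp by rewrite normrM ler_pM.
have k1 : 0 <= v1 * Bd by nonneg.
have k2 : 0 <= Bs * Bp * Bt by nonneg.
have k3 : 0 <= Bs * Bi by nonneg.
have k4 : 0 <= Bs * Bp * v1 by nonneg.
apply: sq_le.
  apply: (@le_trans _ _ (v1 * Bd + Bs * Bp * Bt + Bs * Bp * Bt + Bs * Bi)); last first.
    move: k1 k2 k3 k4 A10; rewrite /A2; move: (v1 * Bd) (Bs * Bp * Bt) (Bs * Bi).
    by move: (Bs * Bp * v1) A1 => *; lra.
  apply: le_trans (ler_normD _ _) _; apply: lerD; last by rewrite normrM ler_pM.
  apply: le_trans (ler_normB _ _) _; apply: lerD; last by rewrite normrM ler_pM.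
  apply: le_trans (ler_normB _ _) _; apply: lerD; last by rewrite normrM ler_pM.
  by rewrite normrM normrN ler_pM.
apply: (@le_trans _ _ (Bs * Bp * (v1 + v1))); last first.
  rewrite mulrDr; move: k1 k2 k3 k4 A10; rewrite /A2.
  by move: (v1 * Bd) (Bs * Bp * Bt) (Bs * Bi) (Bs * Bp * v1) A1 => *; lra.
rewrite normrN normrM ler_pM//.
by apply: le_trans (ler_normD _ _) _; exact: lerD.
Qed.

End coefficient_bounds.

(** * Absorption of the lower-order terms *)

(** [J], the square of the scattering integral, need not be measurable. It is replaced by its bound,
    constant in the velocity, before integrating; the integration then contributes a second factor
    [L]. *)
Lemma velocity_slice_bound d (Y : measurableType d) (R : realType)
    (mu : {measure set Y -> \bar R}) (D : set Y) (L A w2 : R) (res phi h J : Y -> R) :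
  measurable D -> 0 <= L -> (mu D <= L%:E)%E -> 0 < A -> 0 < w2 ->
  measurable_fun D res -> measurable_fun D phi -> measurable_fun D h ->
  (forall y, D y -> 0 <= res y) -> (forall y, D y -> 0 <= phi y) ->
  (forall y, D y -> 0 <= h y) ->
  {ae mu, forall y, D y -> res y <= 3 * w2 * (phi y + A * h y + J y) /\
    ((J y)%:E <= L%:E * \int[mu]_(y in D) (A * h y)%:E)%E} ->
  (\int[mu]_(y in D) (res y)%:E <=
   \int[mu]_(y in D) (3 * (w2 * phi y) + 3 * A * (1 + L ^+ 2) * (w2 * h y))%:E)%E.
Proof.
move=> mD L0 muD A0 w0 mres mphi mh res0 phi0 h0 H.
have A0' := ltW A0; have w0' := ltW w0.
have k0 : 0 < 3 * A * (1 + L ^+ 2) * w2.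
  by rewrite !mulr_gt0// ltr_pwDl// sqr_ge0.
have k0' := ltW k0.
have mhE : measurable_fun D (EFin \o h) by exact/measurable_EFinP.
have mpE : measurable_fun D (EFin \o phi) by exact/measurable_EFinP.
have h0E y : D y -> (0 <= (h y)%:E)%E by move=> /h0; rewrite lee_fin.
have p0E y : D y -> (0 <= (phi y)%:E)%E by move=> /phi0; rewrite lee_fin.
set q := (\int[mu]_(y in D) (h y)%:E)%E.
set f := (\int[mu]_(y in D) (phi y)%:E)%E.
have f0 : (0 <= f)%E by exact: integral_ge0.
have q0 : (0 <= q)%E by exact: integral_ge0.
have -> : (\int[mu]_(y in D)
    (3 * (w2 * phi y) + 3 * A * (1 + L ^+ 2) * (w2 * h y))%:E =
    (3 * w2)%:E * f + (3 * A * (1 + L ^+ 2) * w2)%:E * q)%E.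
  rewrite -!ge0_integralZl_EFin//; last by rewrite mulr_ge0.
  rewrite -ge0_integralD//.
  - by apply: eq_integral => y _; rewrite -EFinM -EFinM -EFinD !mulrA.
  - by move=> y Dy; rewrite mule_ge0 ?p0E// lee_fin mulr_ge0.
  - exact: measurable_funeM.
  - by move=> y Dy; rewrite mule_ge0 ?h0E// lee_fin.
  - exact: measurable_funeM.
have AqE : (\int[mu]_(y in D) (A * h y)%:E = A%:E * q)%E.
  by rewrite -ge0_integralZl_EFin.
have qE : (\int[mu]_(y in D) (h y)%:E = q)%E by [].
(* When the integral of [h] is infinite, so is the right-hand side. Otherwise it is a real number
   that can enter a constant integrand. *)
move: q0 f0 qE; case: q AqE => [q| |] // AqE; last first.
  move=> _ f0 _; rewrite gt0_muley ?lte_fin// addey ?leey//.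
  by rewrite gt_eqF// (@lt_le_trans _ _ 0%E)// mule_ge0// lee_fin mulr_ge0.
rewrite lee_fin => q0 f0 qE.
apply: (@le_trans _ _ (\int[mu]_(y in D)
    ((3 * w2)%:E * (phi y)%:E + ((3 * w2 * A)%:E * (h y)%:E +
      (3 * w2 * (L * (A * q)))%:E)))%E).
  apply: ae_ge0_le_integral => //.
  - exact/measurable_EFinP.
  - move=> y Dy; rewrite -!EFinM -!EFinD lee_fin.
    have := phi0 y Dy; have := h0 y Dy => ? ?; nonneg.
  - by apply: emeasurable_funD; [exact: measurable_funeM|
      apply: emeasurable_funD => //; exact: measurable_funeM].
  - apply: aeS H => y Hy Dy; have [h1] := Hy Dy.
    rewrite AqE -!EFinM -!EFinD !lee_fin => h2; apply: le_trans h1 _.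
    have : 3 * w2 * J y <= 3 * w2 * (L * (A * q)) by rewrite ler_wpM2l// mulr_ge0.
    by lra.
have n1 : 0 <= 3 * w2 by rewrite mulr_ge0.
have n2 : 0 <= 3 * w2 * A by rewrite mulr_ge0.
have n3 : 0 <= 3 * w2 * (L * (A * q)) by rewrite mulr_ge0// mulr_ge0// mulr_ge0.
rewrite ge0_integralD//; first last.
- by apply: emeasurable_funD => //; exact: measurable_funeM.
- by move=> y Dy; rewrite adde_ge0 ?lee_fin ?mulr_ge0 ?h0// mule_ge0 ?h0E.
- exact: measurable_funeM.
- by move=> y Dy; rewrite mule_ge0 ?p0E.
rewrite ge0_integralD//; first last.
- exact: measurable_funeM.
- by move=> y Dy; rewrite mule_ge0 ?h0E.
rewrite !ge0_integralZl_EFin// integral_cst// -/f qE leeD2l//.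
apply: (@le_trans _ _ ((3 * w2 * A)%:E * q%:E + (3 * w2 * (L * (A * q)))%:E * L%:E)%E).
  by apply: leeD2l; exact: lee_wpmul2l.
rewrite -!EFinM -EFinD lee_fin le_eqVlt; apply/orP; left; apply/eqP; ring.
Qed.

Section QV_iterated.
Context {R : realType}.
Notation mu := (@lebesgue_measure R).
Notation nu := (@planar_lebesgue R).
Variables (ell v0 v1 T : R) (F G : R -> R -> R -> R).
Hypothesis mF : measurable_fun (QV ell v0 v1 T) (uncurry3 F).
Hypothesis mG : measurable_fun (QV ell v0 v1 T) (uncurry3 G).
Hypothesis F0 : forall x v t, Om ell x -> Vel v0 v1 v -> Tm T t -> 0 <= F x v t.
Hypothesis G0 : forall x v t, Om ell x -> Vel v0 v1 v -> Tm T t -> 0 <= G x v t.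

Let mO : measurable (Om ell). Proof. exact: measurable_itv. Qed.
Let mT : measurable (Tm T). Proof. exact: measurable_itv. Qed.
Let mV := measurable_Vel v0 v1.
Let mOV : measurable (Om ell `*` Vel v0 v1). Proof. exact: measurableX. Qed.

Let mslice (H : R -> R -> R -> R) t : Tm T t ->
  measurable_fun (QV ell v0 v1 T) (uncurry3 H) ->
  measurable_fun (Om ell `*` Vel v0 v1) (fun z => H z.1 z.2 t).
Proof.
move=> tT /(measurable_restrictT _ (measurable_QV ell v0 v1 T)) mH.
apply/(measurable_restrictT _ mOV).
have := measurableT_comp mH (measurable_pair2 t); congr measurable_fun.
by apply/funext => z; rewrite /= !patchE /QV in_setX/= (mem_set tT) andbT.
Qed.

(** The scattering term couples all velocities, so its bound is available only for integrals over
    the velocity at fixed (x, t), not pointwise in [v]. *)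
Lemma le_integral_QV : {ae mu, forall t, Tm T t -> {ae mu, forall x, Om ell x ->
    (\int[mu]_(v in Vel v0 v1) (F x v t)%:E <= \int[mu]_(v in Vel v0 v1) (G x v t)%:E)%E}} ->
  (\int[leb3]_(z in QV ell v0 v1 T) (uncurry3 F z)%:E <=
   \int[leb3]_(z in QV ell v0 v1 T) (uncurry3 G z)%:E)%E.
Proof.
move=> FG.
have F0' z : QV ell v0 v1 T z -> 0 <= uncurry3 F z by move=> [[? ?] ?]; exact: F0.
have G0' z : QV ell v0 v1 T z -> 0 <= uncurry3 G z by move=> [[? ?] ?]; exact: G0.
have H0 (H : R -> R -> R -> R) t z :
    (forall x v t, Om ell x -> Vel v0 v1 v -> Tm T t -> 0 <= H x v t) ->
    Tm T t -> (Om ell `*` Vel v0 v1) z -> 0 <= H z.1 z.2 t.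
  by move=> H0 tT [? ?]; exact: H0.
rewrite (@tonelli_box21 _ _ _ _ R nu mu _ _ mOV mT _ mF F0').
rewrite (@tonelli_box21 _ _ _ _ R nu mu _ _ mOV mT _ mG G0').
apply: ae_ge0_le_integral => //.
- by move=> t tT; apply: integral_ge0 => z Dz; rewrite lee_fin; apply: F0'; split.
- exact: (@measurable_box2 _ _ _ _ R nu _ _ mOV mT _ mF F0').
- by move=> t tT; apply: integral_ge0 => z Dz; rewrite lee_fin; apply: G0'; split.
- exact: (@measurable_box2 _ _ _ _ R nu _ _ mOV mT _ mG G0').
apply: aeS FG => t FGt tT; have {}FGt := FGt tT.
have mFt := mslice tT mF; have mGt := mslice tT mG.
have F0t z := @H0 F t z F0 tT; have G0t z := @H0 G t z G0 tT.
have EF := @tonelli_box12 _ _ _ _ R mu mu _ _ mO mV _ mFt F0t.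
have EG := @tonelli_box12 _ _ _ _ R mu mu _ _ mO mV _ mGt G0t.
rewrite [leLHS]EF [leRHS]EG; apply: ae_ge0_le_integral => //.
- by move=> x xO; apply: integral_ge0 => v vV; rewrite lee_fin; exact: F0.
- exact: (@measurable_box1 _ _ _ _ R mu _ _ mO mV _ mFt F0t).
- by move=> x xO; apply: integral_ge0 => v vV; rewrite lee_fin; exact: G0.
- exact: (@measurable_box1 _ _ _ _ R mu _ _ mO mV _ mGt G0t).
Qed.

End QV_iterated.

(** The condition on [o] gives c k q <= a/2. Subtracting this from the right is legitimate only for
    finite [a], and doubles the remaining coefficients. *)
Lemma absorb_ereal (R : realType) (a r w q b : \bar R) (c k o : R) :
  0 < c -> 0 <= k -> 0 < o -> 2 * c * k <= o ->
  (0 <= w -> 0 <= q -> 0 <= b -> a < +oo -> a <= c%:E * (r + b) ->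
   r <= 3%:E * w + k%:E * q -> o%:E * q <= a ->
   a <= (6 * c)%:E * w + (2 * c)%:E * b)%E.
Proof.
move=> c0 k0 o0 cko w0 q0 b0 aoo ar rw qa.
have c2 : 0 < 2 * c by rewrite mulr_gt0.
have c6 : 0 < 6 * c by rewrite mulr_gt0.
have {ar rw} ar : (a <= c%:E * (3%:E * w + k%:E * q + b))%E.
  by apply: le_trans ar _; rewrite lee_pmul2l// leeD2r.
case: w w0 ar => [w| |] w0 ar //; last first.
  rewrite gt0_muley ?lte_fin// addye ?leey// gt_eqF// (@lt_le_trans _ _ 0%E)//.
  by rewrite mule_ge0// lee_fin ltW.
case: b b0 ar => [b| |] b0 ar //; last by rewrite gt0_muley ?lte_fin// addey ?leey.
case: q q0 ar qa => [q| |] q0 ar qa //; last first.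
  by move: qa; rewrite gt0_muley ?lte_fin// leNgt aoo.
case: a aoo ar qa => [a| |] // _.
rewrite -?EFinM -?EFinD -?EFinM !lee_fin => ar qa; rewrite !lee_fin in w0 b0 q0.
have := ler_wpM2r q0 cko; nra.
Qed.

Section absorption.
Context {R : realType}.
Notation mu := (@lebesgue_measure R).
Notation nu := (@planar_lebesgue R).
Variables (ell v0 v1 T m N s A : R) (g g1 g2 : R -> R) (p : nat) (M : R).
Hypotheses (ell_gt0 : 0 < ell) (v0_gt0 : 0 < v0) (v1_gt0 : 0 < v1) (T_gt0 : 0 < T).
Hypotheses (m_gt0 : 0 < m) (N_gt0 : 0 < N) (A_gt0 : 0 < A).
Hypotheses (mg : measurable_fun setT g) (mg1 : measurable_fun setT g1)
  (mg2 : measurable_fun setT g2).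
Hypotheses (cg : {within `[0, ell], continuous g})
  (cg1 : {within `[0, ell], continuous g1}) (cg2 : {within `[0, ell], continuous g2}).
Hypotheses (dg : forall x, 0 < x < ell -> is_derive x 1 g (g1 x))
  (dg1 : forall x, 0 < x < ell -> is_derive x 1 g1 (g2 x)).
Hypothesis g_bd : forall x, 0 <= x <= ell ->
  [/\ m <= g x <= N, m <= g1 x <= N & m <= - g2 x <= N].
Hypotheses (M_ge0 : 0 <= M) (fluxM : weighted_flux_bound T (v1 ^+ 2) m N p M).
Let th0 := 4 / T ^+ 2.
Let c := carleman_cst (v0 ^+ 2) (v1 ^+ 2) m N T.
Let L := 2 * v1.
Let k := 3 * A * (1 + L ^+ 2).
(** Since [theta] is at least [th0] and [s] at least 1, both energy weights, s theta and s^3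
    theta^3, exceed [s * weight_floor]; this is the factor that absorbs the lower-order terms for
    large [s]. *)
Definition weight_floor : R := Num.min th0 (th0 ^+ 3).
Hypothesis s_ge : carleman_threshold (v0 ^+ 2) (v1 ^+ 2) m N T (5 / 2 * T ^+ 2) th0 <= s.
Hypothesis s_ge2 : 2 * c * k / weight_floor <= s.

Variables (sigma_t sigma_s : R -> R -> R) (pk : R -> R -> R -> R).
Let Dx := dx ell v0 v1 T.
Let Dt := dt ell v0 v1 T.
Local Notation V := (Vel v0 v1).
Local Notation Q := (QV ell v0 v1 T).
Hypothesis coef : forall x, `[0, ell]%classic x -> {ae mu, forall v, V v ->
  (forall u t, L1op ell v0 v1 T sigma_t u x v t ^+ 2 <=
     A * (Dx u x v t ^+ 2 + u x v t ^+ 2)) /\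
  {ae mu, forall v', V v' ->
     forall u t, Kop ell v0 v1 T sigma_t sigma_s pk u x v v' t ^+ 2 <=
       A * (Dx u x v' t ^+ 2 + u x v' t ^+ 2)}}.

Variables (u f : R -> R -> R -> R).
Hypotheses (Lu : L2 ell v0 v1 T u) (du : is_dx ell v0 v1 T u (Dx u))
  (dux : is_dx ell v0 v1 T (Dx u) (Dx (Dx u))) (dtu : is_dt ell v0 v1 T u (Dt u))
  (dut : is_dx ell v0 v1 T (Dt u) (Dx (Dt u))).
Hypothesis mf : measurable_fun Q (uncurry3 f).
Hypothesis equation : {ae leb3, forall z, Q z ->
  let x := z.1.1 in let v := z.1.2 in let t := z.2 in
  Dt u x v t - v ^+ 2 * Dx (Dx u) x v t - L1op ell v0 v1 T sigma_t u x v t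
    - \int[leb1]_(v' in V) Kop ell v0 v1 T sigma_t sigma_s pk u x v v' t = f x v t}.
Hypothesis u_init : {ae leb2, forall z, (Om ell `*` V) z ->
  trt ell v0 v1 T u z.1 z.2 0 = 0}.
Hypothesis u_inflow : forall x, x = 0 \/ x = ell ->
  {ae leb2, forall z, Gamma_minus ell v0 v1 (x, z.1) -> Tm T z.2 ->
    trx ell v0 v1 T u x z.1 z.2 = 0}.

Let w2 x t := weight T s g x t ^+ 2.
Let res x v t := residual3 T s g (Dx (Dx u)) (Dt u) x v t.
Let en x v t := energy3 T s g u (Dx u) (Dt u) x v t.
Let h x v t := Dx u x v t ^+ 2 + u x v t ^+ 2.
Let S x v t := w2 x t * h x v t.
Let wf x v t := w2 x t * f x v t ^+ 2.

Let mQ : measurable Q := measurable_QV ell v0 v1 T.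
Let mV : measurable V := measurable_Vel v0 v1.

Let s_ge1 : 1 <= s.
Proof.
apply: le_trans s_ge; rewrite /carleman_threshold -addrA lerDl.
have := ltW v0_gt0; have := ltW v1_gt0; have := ltW m_gt0; have := ltW N_gt0.
have := ltW T_gt0 => *; rewrite /th0; nonneg.
Qed.

Let w2_gt0 x t : 0 < w2 x t.
Proof. by rewrite exprn_gt0// expR_gt0. Qed.

Let mcutQ (w : R -> R -> R -> R) : L2 ell v0 v1 T w -> measurable_fun Q (uncurry3 w).
Proof.
move=> Lw; apply: (eq_measurable_fun (uncurry3 (cut ell v0 v1 T w))).
  by move=> [[x v] t] /[!inE] -[[/= ? ?] ?]; rewrite /uncurry3/= cutE.
by apply: measurable_funTS; exact: measurable_cut.
Qed.

Let mw2 : measurable_fun Q (fun z => w2 z.1.1 z.2).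
Proof.
apply: measurable_funTS; apply: measurable_funX.
have h1 : measurable_fun setT (fun z : R * R * R => theta T z.2).
  exact: (measurableT_comp (measurable_theta T) measurable_snd).
have h2 : measurable_fun setT (fun z : R * R * R => g z.1.1).
  exact: (measurableT_comp mg (measurableT_comp measurable_fst measurable_fst)).
by apply: (measurableT_comp (@measurable_expR R)); meas_tac.
Qed.

Let mh : measurable_fun Q (uncurry3 h).
Proof.
have := mcutQ Lu; have := mcutQ du.1; rewrite /uncurry3 => ? ?.
by rewrite /h; meas_tac.
Qed.

Let mS : measurable_fun Q (uncurry3 S).
Proof. exact: measurable_funM mw2 mh. Qed.

Let mwf : measurable_fun Q (uncurry3 wf).
Proof. by apply: measurable_funM mw2 _; exact: measurable_funX. Qed.

Let mres : measurable_fun Q (uncurry3 res).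
Proof. exact: (measurable_residual3 s mg dux dtu). Qed.

Let men : measurable_fun Q (uncurry3 en).
Proof. exact: (measurable_energy3 s mg Lu du dtu). Qed.

Let h_ge0 x v t : 0 <= h x v t.
Proof. by rewrite addr_ge0 ?sqr_ge0. Qed.

Let mslice (H : R -> R -> R -> R) x t : Om ell x -> Tm T t ->
  measurable_fun Q (uncurry3 H) -> measurable_fun V (fun v => H x v t).
Proof.
move=> xO tT /(measurable_restrictT _ mQ) mH; apply/(measurable_restrictT _ mV).
have := measurableT_comp mH (measurableT_comp (measurable_pair2 t) (measurable_pair1 x)).
congr measurable_fun; apply/funext => v.
by rewrite /= !patchE /QV !in_setX/= (mem_set tT) (mem_set xO) andbT.
Qed.

Let c_gt0 : 0 < c.
Proof.
have := ltW v0_gt0; have := ltW v1_gt0; have := ltW m_gt0; have := ltW N_gt0.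
have := ltW T_gt0 => *; rewrite /c /carleman_cst.
apply: mulr_gt0; first by apply: ltr_wpDl => //; nonneg.
by apply: ltr_wpDr; [nonneg|apply: ltr_wpDr => //; nonneg].
Qed.

Let k_gt0 : 0 < k.
Proof. by rewrite /k !mulr_gt0// ltr_pwDl// sqr_ge0. Qed.

Let residual_bound :
  (\int[leb3]_(z in Q) (uncurry3 res z)%:E <=
   3%:E * (\int[leb3]_(z in Q) (uncurry3 wf z)%:E) +
   k%:E * (\int[leb3]_(z in Q) (uncurry3 S z)%:E))%E.
Proof.
have wf0 x v t : 0 <= wf x v t by rewrite mulr_ge0 ?sqr_ge0.
have S0 x v t : 0 <= S x v t by rewrite mulr_ge0 ?sqr_ge0.
pose G x v t := 3 * wf x v t + k * S x v t.
have mG : measurable_fun Q (uncurry3 G).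
  by apply: measurable_funD; exact: measurable_funM.
apply: (@le_trans _ _ (\int[leb3]_(z in Q) (uncurry3 G z)%:E)%E); last first.
  rewrite le_eqVlt; apply/orP; left; apply/eqP.
  rewrite -!ge0_integralZl_EFin//.
  - rewrite -ge0_integralD//.
    + by move=> z _; rewrite lee_fin mulr_ge0// /uncurry3 wf0.
    + by apply: measurable_funeM; exact/measurable_EFinP.
    + by move=> z _; rewrite lee_fin mulr_ge0// ?(ltW k_gt0)// /uncurry3 S0.
    + by apply: measurable_funeM; exact/measurable_EFinP.
  - by move=> z _; rewrite lee_fin /uncurry3 S0.
  - exact/measurable_EFinP.
  - exact: ltW.
  - by move=> z _; rewrite lee_fin /uncurry3 wf0.
  - exact/measurable_EFinP.
apply: le_integral_QV => //.
- by move=> x v t _ _ _; exact: sqr_ge0.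
- by move=> x v t _ _ _; rewrite /G addr_ge0// mulr_ge0// ltW.
apply: aeS (@ae_section2 _ _ _ _ R nu mu _ equation) => t Ht tT.
apply: aeS (@ae_section1 _ _ _ _ R mu mu _ Ht) => x Hx xO.
have Ix : `[0, ell]%classic x.
  by move: xO; rewrite /Om/= !in_itv/= => /andP[/ltW -> /ltW ->].
apply: (@velocity_slice_bound _ _ _ mu V L A (w2 x t) (fun v => res x v t)
  (fun v => f x v t ^+ 2) (fun v => h x v t) (fun v => (\int[mu]_(v' in V)
    Kop ell v0 v1 T sigma_t sigma_s pk u x v v' t) ^+ 2)) => //.
- by rewrite mulr_ge0// ltW.
- exact: Vel_measure_le.
- exact: mslice.
- by apply: measurable_funX; exact: mslice.
- exact: mslice.
- by move=> v _; exact: sqr_ge0.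
- by move=> v _; exact: sqr_ge0.
apply: aeS2 (coef Ix) Hx => v Hv /= E Vv; have [L1v Kv] := Hv Vv.
have {}E := E (conj (conj xO Vv) tT).
split.
  rewrite /res /residual3 /residual_sq exprMn -/(w2 x t).
  rewrite [leRHS](_ : _ = w2 x t * (3 * (f x v t ^+ 2 + A * h x v t +
    (\int[mu]_(v' in V) Kop ell v0 v1 T sigma_t sigma_s pk u x v v' t) ^+ 2))); last by ring.
  rewrite ler_wpM2l ?(ltW (w2_gt0 _ _))//.
  have -> : Dt u x v t - v ^+ 2 * Dx (Dx u) x v t = f x v t +
    L1op ell v0 v1 T sigma_t u x v t + \int[mu]_(v' in V)
      Kop ell v0 v1 T sigma_t sigma_s pk u x v v' t by rewrite -E; ring.
  apply: (@le_trans _ _ (3 * (f x v t ^+ 2 + L1op ell v0 v1 T sigma_t u x v t ^+ 2 +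
    (\int[mu]_(v' in V) Kop ell v0 v1 T sigma_t sigma_s pk u x v v' t) ^+ 2))).
    move: (f _ _ _) (L1op _ _ _ _ _ _ _ _ _) (Rintegral _ _ _) => a b e.
    have := sqr_ge0 (a - b); have := sqr_ge0 (a - e); have := sqr_ge0 (b - e); lra.
  by rewrite ler_pM2l// lerD2r lerD2l; exact: L1v.
apply: sq_Rintegral_le => //.
- by rewrite mulr_gt0.
- exact: Vel_measure_le.
- by apply: measurable_funM => //; exact: mslice.
- by move=> v' _; rewrite mulr_ge0// ltW.
- by apply: aeS Kv => v' /[apply]; exact.
Qed.

Let th0_gt0 : 0 < th0.
Proof. by rewrite divr_gt0// exprn_gt0. Qed.

Let floor_gt0 : 0 < weight_floor.
Proof. by rewrite lt_min th0_gt0 exprn_gt0. Qed.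

Let S_le_energy x v t : Tm T t -> s * weight_floor * S x v t <= en x v t.
Proof.
rewrite /Tm/= in_itv/= => tT; have tth := theta_ge T_gt0 tT; rewrite -/th0 in tth.
have t0 : 0 <= theta T t by rewrite (le_trans _ tth)// ltW.
have s0 : 0 <= s by rewrite (le_trans _ s_ge1).
have f1 : weight_floor <= theta T t.
  by apply: le_trans tth; rewrite ge_min lexx.
have f2 : weight_floor <= theta T t ^+ 3.
  apply: (@le_trans _ _ (th0 ^+ 3)); first by rewrite ge_min lexx orbT.
  by rewrite lerXn2r// nnegrE// ltW.
rewrite /S /en /energy3 /energy /h -/(w2 x t) mulrCA [leRHS]mulrC.
rewrite ler_wpM2l ?(ltW (w2_gt0 _ _))// mulrDr -[leRHS]addrA.
apply: ler_wpDl; first by rewrite mulr_ge0 ?sqr_ge0// invr_ge0 mulr_ge0.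
apply: lerD; first by rewrite ler_wpM2r ?sqr_ge0// ler_wpM2l.
rewrite ler_wpM2r ?sqr_ge0//; apply: ler_pM => //; first exact: ltW.
by rewrite -[leLHS]expr1 ler_weXn2l.
Qed.

(** Needed before absorbing. Three powers of [s * theta] times the squared weight are bounded, and
    the inverse of [s * theta] is bounded by that of [s * th0], so the energy is at most a constant
    times squares of L^2 functions. *)
Let energy_fin : (\int[leb3]_(z in Q) (uncurry3 en z)%:E < +oo)%E.
Proof.
have [M' M'0 HM] := exp_weight_bound 3 m_gt0.
pose K := (s * th0)^-1 + M' * expR (3%:R * s).
have s0' : 0 <= s by rewrite (le_trans _ s_ge1).
have K0 : 0 <= K.
  by rewrite addr_ge0 ?mulr_ge0 ?expR_ge0// invr_ge0 mulr_ge0// ltW.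
pose B x v t := cut ell v0 v1 T (Dt u) x v t ^+ 2 +
  (cut ell v0 v1 T (Dx u) x v t ^+ 2 + cut ell v0 v1 T u x v t ^+ 2).
have i w : L2 ell v0 v1 T w ->
    (nu \x mu)%E.-integrable setT (EFin \o (fun z => uncurry3 (cut ell v0 v1 T w) z ^+ 2)).
  move=> Lw; apply: integrable_ge0 => //.
  - by apply: measurable_funX; exact: measurable_cut.
  - by move=> z _; exact: sqr_ge0.
  - exact: cut_sq_lty.
have h1 := integrable_addr measurableT (i _ du.1) (i _ Lu).
have h2 := integrable_addr measurableT (i _ dtu.1) h1.
have iB := integrable_mulr measurableT K h2.
have iBQ : (nu \x mu)%E.-integrable Q (EFin \o (fun z => K * uncurry3 B z)).
  exact: integrableS iB.
apply: le_lt_trans (@integrable_lty _ _ R (nu \x mu)%E Q mQ _ iBQ).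
apply: ge0_le_integral => //.
- move=> [[x v] t] [_ tT]; rewrite lee_fin.
  exact: (energy3_ge0 g v0_gt0 v1_gt0 T_gt0 m_gt0 N_gt0 s_ge).
- exact/measurable_EFinP.
- exact: (@measurable_int _ _ R (nu \x mu)%E _ _ iBQ).
move=> [[x v] t] [[/= xO vV] tT]; rewrite lee_fin /uncurry3/= /B !cutE//.
rewrite /en /energy3 /energy.
move: (tT); rewrite /Tm/= in_itv/= => tT'.
have tth := theta_ge T_gt0 tT'; rewrite -/th0 in tth.
have t0 : 0 < theta T t by rewrite (lt_le_trans _ tth).
have t0' := ltW t0.
have s0 : 0 < s by rewrite (lt_le_trans _ s_ge1).
have Ix : 0 <= x <= ell by move: xO; rewrite /Om/= in_itv/= => /andP[/ltW -> /ltW ->].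
have [/andP[mgx _] _ _] := g_bd Ix.
have g0 : 0 <= g x by rewrite (le_trans _ mgx)// ltW.
have mgg : m <= g x + g x by rewrite (le_trans mgx)// lerDr.
have := HM s (theta T t) (g x + g x) s_ge1 t0' mgg.
set Th := (1 + s) * (1 + theta T t).
have -> : expR (- (s * theta T t * (g x + g x))) = w2 x t.
  by rewrite /w2 /weight -expRM_natl; congr expR; ring.
move=> Hw.
have w1 : w2 x t <= 1.
  rewrite expr_le1 ?expR_ge0// /weight -expR0 ler_expR oppr_le0.
  by rewrite !mulr_ge0.
have Th1 : s * theta T t <= Th.
  by apply: ler_pM => //; rewrite lerDr.
have Thge1 : 1 <= Th by rewrite -[leLHS]mulr1; apply: ler_pM => //; rewrite lerDl.
have w20 := ltW (w2_gt0 x t).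
have E0 := expR_ge0 (3%:R * s); have ME : 0 <= M' * expR (3%:R * s) by rewrite mulr_ge0.
have i0 : 0 <= (s * th0)^-1 by rewrite invr_ge0 mulr_ge0// ltW.
have b1 : (s * theta T t)^-1 * w2 x t <= K.
  apply: (@le_trans _ _ ((s * th0)^-1 * 1)).
    apply: ler_pM => //; first by rewrite invr_ge0 mulr_ge0.
    have h0 : s * th0 <= s * theta T t by rewrite ler_wpM2l.
    by rewrite lef_pV2// posrE mulr_gt0.
  by rewrite mulr1 lerDl.
have b2 : s * theta T t * w2 x t <= K.
  apply: (@le_trans _ _ (Th ^+ 3 * w2 x t)).
    rewrite ler_wpM2r//; apply: le_trans Th1 _.
    by rewrite -[leLHS]expr1 ler_weXn2l.
  by apply: le_trans Hw _; rewrite lerDr.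
have b3 : s ^+ 3 * theta T t ^+ 3 * w2 x t <= K.
  apply: (@le_trans _ _ (Th ^+ 3 * w2 x t)).
    rewrite ler_wpM2r// -exprMn; apply: lerXn2r => //; rewrite nnegrE.
      by rewrite mulr_ge0.
    by rewrite (le_trans _ Thge1).
  by apply: le_trans Hw _; rewrite lerDr.
rewrite -/(w2 x t); clearbody K.
rewrite mulrDl (mulrDl _ _ (w2 x t)) (mulrDr K) (mulrDr K) -addrA; apply: lerD.
  by rewrite mulrAC ler_wpM2r// sqr_ge0.
by apply: lerD; rewrite mulrAC ler_wpM2r// sqr_ge0.
Qed.

Let S_energy_bound : ((s * weight_floor)%:E * (\int[leb3]_(z in Q) (uncurry3 S z)%:E) <=
  \int[leb3]_(z in Q) (uncurry3 en z)%:E)%E.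
Proof.
have S0 x v t : 0 <= S x v t by rewrite mulr_ge0 ?sqr_ge0.
have o0 : 0 <= s * weight_floor by rewrite mulr_ge0 ?(le_trans _ s_ge1)// ltW.
rewrite -ge0_integralZl_EFin//.
- apply: ge0_le_integral => //.
  + by move=> z _; rewrite mule_ge0// lee_fin /uncurry3 S0.
  + by apply: measurable_funeM; exact/measurable_EFinP.
  + exact/measurable_EFinP.
  + by move=> [[x v] t] [_ tT]; rewrite -EFinM lee_fin; exact: S_le_energy.
- by move=> z _; rewrite lee_fin /uncurry3 S0.
- exact/measurable_EFinP.
Qed.

Let tr := trx ell v0 v1 T.

Lemma carleman_kinetic :
  (\int[leb3]_(z in Q) (uncurry3 en z)%:E <=
   (6 * c)%:E * (\int[leb3]_(z in Q) (uncurry3 wf z)%:E) +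
   (2 * c)%:E * ((2 * M * expR (p%:R * s))%:E *
     (\int[mu]_(t in Tm T) int_Gamma_plus ell v0 v1 (fun x v =>
    (`|tr u x v t| ^+ 2 + `|tr (Dt u) x v t| ^+ 2 + `|tr (Dx u) x v t| ^+ 2)%R) +
  \int[mu]_(v in V) \int[mu]_(t in Tm T) (`|tr (Dx u) 0 v t| ^+ 2)%:E)))%E.
Proof.
apply: (@absorb_ereal _ _ (\int[leb3]_(z in Q) (uncurry3 res z)%:E) _
  (\int[leb3]_(z in Q) (uncurry3 S z)%:E) _ _ k (s * weight_floor)).
- exact: c_gt0.
- exact: ltW.
- by rewrite mulr_gt0// (lt_le_trans _ s_ge1).
- by rewrite -ler_pdivrMr.
- by apply: integral_ge0 => z _; rewrite lee_fin mulr_ge0 ?sqr_ge0.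
- by apply: integral_ge0 => z _; rewrite lee_fin mulr_ge0 ?sqr_ge0.
- rewrite mule_ge0// ?lee_fin ?mulr_ge0 ?expR_ge0// adde_ge0//.
    apply: integral_ge0 => t _; rewrite adde_ge0//; apply: integral_ge0 => v _.
      by rewrite lee_fin !addr_ge0 ?sqr_ge0.
    by rewrite lee_fin !addr_ge0 ?sqr_ge0.
  by apply: integral_ge0 => v _; apply: integral_ge0 => t _; rewrite lee_fin sqr_ge0.
- exact: energy_fin.
- exact: (carleman_phase_space ell_gt0 v0_gt0 v1_gt0 T_gt0 m_gt0 N_gt0 mg mg1 mg2 cg cg1
    cg2 dg dg1 g_bd M_ge0 fluxM s_ge Lu du dux dtu dut u_init u_inflow).
- exact: residual_bound.
- exact: S_energy_bound.
Qed.

End absorption.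

(** * The weight *)

Lemma deriv_in_is_derive (R : realType) (ell x0 : R) (g : R -> R) : 0 < x0 < ell ->
  cvg (dquot g x0 x @[x --> within `[0, ell] (x0^')]) ->
  is_derive x0 1 g (deriv_in ell g x0).
Proof.
move=> /andP[x0_gt0 x0_lt] /cvgrPdist_le H.
suff Q : h^-1 *: ((g \o shift x0) (h *: 1) - g x0) @[h --> 0^'] --> deriv_in ell g x0.
  by apply: DeriveDef; [apply/cvg_ex; exists (deriv_in ell g x0)|exact: cvg_lim].
apply/cvgrPdist_le => e e0; have := H _ e0; rewrite -/(deriv_in ell g x0).
rewrite !near_withinE => /nbhs_ballP[r/= r0 rH].
apply/nbhs_ballP; exists (Num.min r (Num.min x0 (ell - x0))) => /=; first by rewrite !lt_min r0 x0_gt0 subr_gt0.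
move=> h; rewrite /ball/= sub0r normrN !lt_min => /and3P[hr hx hl] h0.
have -> : h^-1 *: (g (h *: 1 + x0) - g x0) = dquot g x0 (h + x0).
  by rewrite /dquot addrK /GRing.scale/= mulr1 mulrC.
apply: rH.
- by rewrite /ball/= opprD addrCA subrr addr0 normrN.
- by rewrite -subr_eq0 addrK.
- rewrite /= in_itv/=; move: hx hl; rewrite !ltr_norml; lra.
Qed.

Lemma within_continuousD (R : realType) (A : set R) (f g : R -> R) :
  {within A, continuous f} -> {within A, continuous g} ->
  {within A, continuous (fun x => f x + g x)}.
Proof. by move=> cf cg x; exact: (@continuousD _ R (subspace A) f g x (cf x) (cg x)). Qed.

Lemma within_continuousN (R : realType) (A : set R) (f : R -> R) :
  {within A, continuous f} -> {within A, continuous (fun x => - f x)}.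
Proof. by move=> cf x; exact: (@continuousN _ R (subspace A) f x (cf x)). Qed.

Lemma within_eq_continuous (R : realType) (A : set R) (f g : R -> R) :
  (forall x, A x -> f x = g x) -> {within A, continuous f} -> {within A, continuous g}.
Proof. by move=> fg; apply: subspace_eq_continuous => x /set_mem; exact: fg. Qed.

(** Extension by 0 gives measurability on the whole line at the price of differentiability at the
    end points, where only continuity within the segment is used. *)
Lemma C1_in_patch (R : realType) (ell : R) (g : R -> R) : C1_in ell g ->
  [/\ measurable_fun setT (g \_ `[0, ell]), {within `[0, ell], continuous (g \_ `[0, ell])} &
   forall x, 0 < x < ell -> is_derive x 1 (g \_ `[0, ell]) ((deriv_in ell g \_ `[0, ell]) x)].
Proof.
move=> [cg dg _].
have gE x : 0 <= x <= ell -> (g \_ `[0, ell]) x = g x.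
  by move=> xI; rewrite patchE mem_set//= in_itv.
split.
- apply/(measurable_restrictT _ (measurable_itv _)).
  exact: subspace_continuous_measurable_fun (measurable_itv _) cg.
- by apply: within_eq_continuous cg => x; rewrite /= in_itv/= => /gE.
move=> x xO; have xI : 0 <= x <= ell by case/andP: xO => /ltW -> /ltW ->.
rewrite patchE mem_set/= ?in_itv//.
apply: near_eq_is_derive (deriv_in_is_derive xO _); last by apply: dg; rewrite /= in_itv.
near=> y; rewrite gE//.
have : `]0, ell[%classic y by near: y; apply: near_in_itvoo; rewrite in_itv.
by rewrite /= in_itv/= => /andP[/ltW -> /ltW ->].
Unshelve. all: by end_near. Qed.

Section weight_from_d.
Context {R : realType}.
Variables (ell : R) (d : R -> R).
Hypotheses (ell_gt0 : 0 < ell) (dC2 : C2_in ell d).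
Hypotheses (d_gt0 : forall x, Om ell x -> 0 < d x)
  (d_decr : forall x, `[0, ell]%classic x -> deriv_in ell d x < 0).
Let I : set R := `[0, ell].
Let Nd := sup_norm_in ell d.

Lemma continuous_norm_bounded (f : R -> R) : {within I, continuous f} ->
  exists2 B, 0 <= B & forall x, 0 <= x <= ell -> `|f x| <= B.
Proof.
move=> cf; have [a _ Ha] := EVT_max (ltW ell_gt0) cf.
have [b _ Hb] := EVT_min (ltW ell_gt0) cf.
exists (`|f a| + `|f b|); first by rewrite addr_ge0.
move=> x xI; have := Ha x; have := Hb x; rewrite in_itv/= xI => /(_ isT) hb /(_ isT) ha.
rewrite ler_norml; have := ler_norm (f a); have := ler_norm (- f b); rewrite normrN.
have := normr_ge0 (f a); have := normr_ge0 (f b); lra.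
Qed.

Lemma sup_norm_in_bound x : 0 <= x <= ell -> `|d x| <= Nd.
Proof.
move=> xI; have [[cd _ _] _] := dC2; have [B _ HB] := continuous_norm_bounded cd.
apply: ub_le_sup; first by exists B => _ [y /= yI <-]; apply: HB; move: yI; rewrite in_itv.
by exists x => //=; rewrite in_itv.
Qed.

Lemma sup_norm_in_gt0 : 0 < Nd.
Proof.
have h : 0 < ell / 2 < ell by rewrite divr_gt0// ltr_pdivrMr// mulr_natr mulr2n ltrDl.
apply: (@lt_le_trans _ _ (d (ell / 2))); first by apply: d_gt0; rewrite /Om/= in_itv.
apply: le_trans (ler_norm _) _; apply: sup_norm_in_bound.
by case/andP: h => /ltW -> /ltW ->.
Qed.

(** Here -g'' = (lambda d'' + lambda^2 d'^2) e^(lambda d): the quadratic term wins for large lambda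
    because d' is bounded away from 0, whatever the sign of d''. *)
Lemma carleman_weight : exists2 lambda0, 0 < lambda0 & forall lambda, lambda0 < lambda ->
  exists m N (g g1 g2 : R -> R),
  [/\ 0 < m, 0 < N & [/\ measurable_fun setT g, measurable_fun setT g1 & measurable_fun setT g2]] /\
  [/\ [/\ {within I, continuous g}, {within I, continuous g1} & {within I, continuous g2}],
      forall x, 0 < x < ell -> is_derive x 1 g (g1 x),
      forall x, 0 < x < ell -> is_derive x 1 g1 (g2 x),
      forall x, 0 <= x <= ell -> [/\ m <= g x <= N, m <= g1 x <= N & m <= - g2 x <= N] &
      forall x, 0 <= x <= ell -> m <= expR (lambda * d x) <= N /\
        g x = expR (2 * lambda * Nd) - expR (lambda * d x)].
Proof.
have [dC1 d'C1] := dC2.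
set d0 := d \_ I; set d1 := deriv_in ell d \_ I; set d2 := deriv_in ell (deriv_in ell d) \_ I.
have [md0 cd0 dd0] := C1_in_patch dC1; have [md1 cd1 dd1] := C1_in_patch d'C1.
have cd2' : {within I, continuous (deriv_in ell (deriv_in ell d))} by case: d'C1.
have md2 : measurable_fun setT d2.
  apply/(measurable_restrictT _ (measurable_itv _)).
  exact: subspace_continuous_measurable_fun (measurable_itv _) cd2'.
have IE x : 0 <= x <= ell -> x \in I by move=> xI; rewrite mem_set//= /I/= in_itv.
have cd2 : {within I, continuous d2}.
  by apply: within_eq_continuous cd2' => x xI; rewrite /d2 patchE mem_set.
have [D1 D1_ge0 HD1] := continuous_norm_bounded cd1.
have [D2 D2_ge0 HD2] := continuous_norm_bounded cd2.
have [x1 x1I Hx1] := EVT_max (ltW ell_gt0) cd1.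
(* The maximum of d' is attained on the compact segment and negative, so d' stays below [- del]. *)
pose del := - d1 x1.
have del0 : 0 < del.
  have x1I' : x1 \in I by rewrite IE// -in_itv.
  by rewrite oppr_gt0 /d1 patchE x1I'; apply: d_decr; exact: set_mem.
have d1b x : 0 <= x <= ell -> del <= - d1 x <= D1.
  move=> xI; rewrite lerN2 Hx1 ?in_itv//=.
  by apply: le_trans (HD1 _ xI); rewrite -normrN ler_norm.
have d0b x : 0 <= x <= ell -> - Nd <= d0 x <= Nd.
  by move=> xI; rewrite -ler_norml /d0 patchE IE// sup_norm_in_bound.
(* Exactly what makes [l ^+ 2 * del ^+ 2 - l * D2] positive. *)
exists (1 + D2 / del ^+ 2).
  by rewrite ltr_pwDl// divr_ge0// exprn_ge0// ltW.
move=> l l0.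
have l1 : 0 < l by rewrite (lt_trans _ l0)// ltr_pwDl// divr_ge0// exprn_ge0// ltW.
have ld : 0 < l ^+ 2 * del ^+ 2 - l * D2.
  have : D2 / del ^+ 2 < l by rewrite (lt_trans _ l0)// ltrDr.
  rewrite ltr_pdivrMr ?exprn_gt0// => h.
  rewrite expr2 -mulrA -mulrBr mulr_gt0// subr_gt0.
  by [].
pose E x := expR (l * d0 x).
pose g x := expR (2 * l * Nd) - E x.
pose g1 x := - (l * (d1 x * E x)).
pose g2 x := - (l * (d2 x * E x + l * (d1 x * (d1 x * E x)))).
have N0 := sup_norm_in_gt0.
have Elo x : 0 <= x <= ell -> expR (- (l * Nd)) <= E x <= expR (l * Nd).
  move=> xI; rewrite !ler_expR -mulrN !ler_pM2l//; exact: d0b.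
pose lo := expR (- (l * Nd)); pose hi := expR (l * Nd).
have lo0 : 0 < lo := expR_gt0 _; have hi0 : 0 < hi := expR_gt0 _.
pose gap := expR (2 * l * Nd) - hi.
(* The 2 in the exponent of the constant term keeps [g] away from 0, as [Nd] is positive. *)
have gap0 : 0 < gap by rewrite subr_gt0 ltr_expR mulrAC -subr_gt0; nra.
(* Lower bounds for e^(l d), [g], [g1] and [- g2], in this order; [N] is the sum of the
   corresponding upper bounds. *)
pose m := Num.min (Num.min lo gap) (Num.min (l * (del * lo)) ((l ^+ 2 * del ^+ 2 - l * D2) * lo)).
pose N := expR (2 * l * Nd) + hi + l * (D1 * hi) + (l * D2 + l ^+ 2 * D1 ^+ 2) * hi.
have l0' := ltW l1; have lo0' := ltW lo0; have hi0' := ltW hi0; have del0' := ltW del0.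
have DD : 0 <= l * D2 + l ^+ 2 * D1 ^+ 2 by nonneg.
have LD : 0 <= l * (D1 * hi) by nonneg.
have LL : 0 <= (l * D2 + l ^+ 2 * D1 ^+ 2) * hi by rewrite mulr_ge0.
have X0 : 0 < expR (2 * l * Nd) := expR_gt0 _.
have mE : measurable_fun setT E.
  by apply: (measurableT_comp (@measurable_expR R)); exact: measurable_funM.
have cl : {within I, continuous (fun=> l)} by move=> x; exact: cst_continuous.
have cE : {within I, continuous E}.
  have := within_continuousM cl cd0 => c x.
  exact: continuous_comp (c x) (@continuous_expR R _).
have dE x : 0 < x < ell -> is_derive x 1 E (l * (d1 x * E x)).
  move=> /dd0 hd; apply: is_derive_eq.
  by rewrite /GRing.scale/= /E /d1; ring.
exists m, N, g, g1, g2; split.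
  split.
  - rewrite !lt_min lo0 gap0/= !mulr_gt0//.
  - by rewrite /N; move: X0 hi0 LD LL; lra.
  - split.
    + exact: measurable_funB.
    + by apply: measurableT_comp => //; do 2 apply: measurable_funM => //.
    + apply: measurableT_comp => //; apply: measurable_funM => //.
      apply: measurable_funD; first exact: measurable_funM.
      by do 3 apply: measurable_funM => //.
split.
- split.
  + apply: within_continuousD; last exact: within_continuousN.
    by move=> x; exact: cst_continuous.
  + by apply: within_continuousN; do 2 apply: within_continuousM => //.
  + apply: within_continuousN; apply: within_continuousM => //.
    by apply: within_continuousD; do 3 ?apply: within_continuousM => //.
- move=> x xO; have := dE x xO => hE; apply: is_derive_eq.
  by rewrite /g1; ring.
- move=> x xO; have := dE x xO => hE; have := dd1 x xO => hd; apply: is_derive_eq.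
  by rewrite /g2 /d1 /d2 /GRing.scale/=; ring.
- move=> x xI; have /andP[E1 E2] := Elo x xI; have /andP[p1 p2] := d1b x xI.
  rewrite -/lo -/hi in E1 E2.
  have E0 : 0 <= E x by exact: expR_ge0.
  have p0 : 0 <= - d1 x by rewrite (le_trans _ p1).
  have := HD2 x xI; rewrite ler_norml => /andP[q1 q2].
  have mgap : m <= gap by rewrite /m !ge_min lexx orbT.
  have md : m <= l * (del * lo) by rewrite /m !ge_min lexx !orbT.
  have mld : m <= (l ^+ 2 * del ^+ 2 - l * D2) * lo by rewrite /m !ge_min lexx !orbT.
  have g1E : g1 x = l * (- d1 x * E x) by rewrite /g1; ring.
  have g2E : - g2 x = (l * d2 x + l ^+ 2 * (- d1 x) ^+ 2) * E x by rewrite /g2; ring.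
  have sq1 : del ^+ 2 <= (- d1 x) ^+ 2 by apply: lerXn2r.
  have sq2 : (- d1 x) ^+ 2 <= D1 ^+ 2 by apply: lerXn2r.
  have l2 : 0 <= l ^+ 2 by nonneg.
  have lq1 : - (l * D2) <= l * d2 x by rewrite -mulrN ler_wpM2l.
  have lq2 : l * d2 x <= l * D2 by rewrite ler_wpM2l.
  have ls1 := ler_wpM2l l2 sq1; have ls2 := ler_wpM2l l2 sq2.
  split; apply/andP; split.
  + by apply: le_trans mgap _; rewrite lerD2l lerN2.
  + by rewrite /N -!addrA lerD2l (@le_trans _ _ 0) ?oppr_le0// !addr_ge0.
  + by rewrite g1E; apply: le_trans md _; rewrite ler_wpM2l// ler_pM.
  + rewrite g1E; apply: (@le_trans _ _ (l * (D1 * hi))).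
      by rewrite ler_wpM2l// ler_pM.
    by rewrite /N; move: X0 hi0 LL; lra.
  + rewrite g2E; apply: le_trans mld _; apply: ler_pM => //; first exact: ltW.
    by move: lq1 ls1; lra.
  + rewrite g2E; apply: (@le_trans _ _ ((l * D2 + l ^+ 2 * D1 ^+ 2) * hi)).
      apply: ler_pM => //; last by move: lq2 ls2; lra.
      by move: ld lq1 ls1; lra.
    by rewrite /N; move: X0 hi0 LD; lra.
- move=> x xI; have /andP[E1 E2] := Elo x xI; rewrite -/lo -/hi in E1 E2.
  have EE : E x = expR (l * d x) by rewrite /E /d0 /patch IE.
  rewrite /g -EE; split => //; apply/andP; split.
    by apply: le_trans E1; rewrite /m !ge_min lexx.
  by apply: le_trans E2 _; rewrite /N; move: X0 LD LL; lra.
Qed.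
End weight_from_d.

(** * Return to the weights alpha and varphi *)

Section original_weight.
Context {R : realType}.
Variables (ell v0 v1 T m N s l : R) (d g : R -> R) (X : R).
Hypotheses (m_gt0 : 0 < m) (N_gt0 : 0 < N) (s_gt0 : 0 < s) (l_gt0 : 0 < l).
Hypotheses (mg : measurable_fun setT g) (XE : X = expR (2 * l * sup_norm_in ell d)).
Hypothesis gE : forall x, 0 <= x <= ell ->
  m <= expR (l * d x) <= N /\ g x = X - expR (l * d x).
Let Q := QV ell v0 v1 T.
Let mQ : measurable Q := measurable_QV ell v0 v1 T.

Lemma expR_alpha x t : 0 <= x <= ell ->
  expR (2 * s * alpha ell T d l x t) = weight T s g x t ^+ 2.
Proof.
move=> /gE[_ gx]; rewrite /weight -expRM_natl; congr expR.
by rewrite gx /alpha -XE /theta; ring.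
Qed.

Variables (u ux ut : R -> R -> R -> R).
Hypotheses (Lu : L2 ell v0 v1 T u) (Lux : L2 ell v0 v1 T ux) (Lut : L2 ell v0 v1 T ut).
Hypothesis men : measurable_fun Q (uncurry3 (energy3 T s g u ux ut)).
Let C := m^-1 + l ^+ 2 * N + l ^+ 4 * N ^+ 3.

(** [varphi] is [theta] times e^(l d), which lies between [m] and [N]. The three terms of [C]
    convert the weights of [ut], [ux] and [u], and also absorb the powers of lambda. *)
Lemma weighted_lhs_le_energy :
  (int_QV ell v0 v1 T (fun x v t =>
      ((s * varphi T d l x t)^-1 * `|ut x v t| ^+ 2
       + s * l ^+ 2 * varphi T d l x t * `|ux x v t| ^+ 2
       + s ^+ 3 * l ^+ 4 * varphi T d l x t ^+ 3 * `|u x v t| ^+ 2)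
      * expR (2 * s * alpha ell T d l x t))%R <=
   C%:E * \int[leb3]_(z in Q) (uncurry3 (energy3 T s g u ux ut) z)%:E)%E.
Proof.
have m0 := ltW m_gt0; have N0 := ltW N_gt0; have s0 := ltW s_gt0; have l0 := ltW l_gt0.
have C1 : 0 <= m^-1 by rewrite invr_ge0.
have C2 : 0 <= l ^+ 2 * N by nonneg.
have C3 : 0 <= l ^+ 4 * N ^+ 3 by nonneg.
have C0 : 0 <= C by rewrite !addr_ge0.
pose ph (x t : R) := (X - g x) * theta T t.
pose F (z : R * R * R) := ((s * ph z.1.1 z.2)^-1 * ut z.1.1 z.1.2 z.2 ^+ 2
  + s * l ^+ 2 * ph z.1.1 z.2 * ux z.1.1 z.1.2 z.2 ^+ 2
  + s ^+ 3 * l ^+ 4 * ph z.1.1 z.2 ^+ 3 * u z.1.1 z.1.2 z.2 ^+ 2) *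
  weight T s g z.1.1 z.2 ^+ 2.
have IE (x : R) : Om ell x -> 0 <= x <= ell.
  by rewrite /Om/= in_itv/= => /andP[/ltW -> /ltW ->].
have energy0 z : Q z -> 0 <= uncurry3 (energy3 T s g u ux ut) z.
  move=> [_ tT]; have := tT; rewrite /Tm/= in_itv/= => /theta_gt0/ltW t0.
  by rewrite /uncurry3 /energy3 /energy; nonneg.
apply: le_trans (_ : (\int[leb3]_(z in Q) (F z)%:E <= _)%E).
  rewrite le_eqVlt; apply/orP; left; apply/eqP.
  apply: (@eq_integral _ _ R leb3 Q) => z /[!inE] -[[/= xO vV] tT].
  have [_ gx] := gE (IE _ xO).
  rewrite expR_alpha ?IE// !real_normK ?num_real//.
  by rewrite /F /ph gx /varphi /theta opprB addrCA subrr addr0.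
rewrite -ge0_integralZl_EFin//.
- apply: ge0_le_integral => //.
  + move=> z [[/= xO _] tT]; rewrite lee_fin /F.
    have := tT; rewrite /Tm/= in_itv/= => /theta_gt0/ltW t0.
    have [/andP[e1 _] gx] := gE (IE _ xO).
    have e0 : 0 <= X - g z.1.1 by rewrite gx opprB addrCA subrr addr0 (le_trans _ e1).
    by rewrite /ph; nonneg.
  + apply/measurable_EFinP; have mw (w : R -> R -> R -> R) : L2 ell v0 v1 T w ->
        measurable_fun Q (fun z => w z.1.1 z.1.2 z.2).
      move=> Lw; apply: (eq_measurable_fun (uncurry3 (cut ell v0 v1 T w))).
        by move=> [[x v] t] /[!inE] -[[/= ? ?] ?]; rewrite /uncurry3/= cutE.
      by apply: measurable_funTS; exact: measurable_cut.
    have := mw _ Lu; have := mw _ Lux; have := mw _ Lut => m1 m2 m3.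
    have m4 : measurable_fun Q (fun z : R * R * R => theta T z.2).
      apply: measurable_funTS.
      exact: (measurableT_comp (measurable_theta T) measurable_snd).
    have m5 : measurable_fun Q (fun z : R * R * R => g z.1.1).
      apply: measurable_funTS.
      exact: (measurableT_comp mg (measurableT_comp measurable_fst measurable_fst)).
    have m6 : measurable_fun Q (fun z : R * R * R => ph z.1.1 z.2).
      by rewrite /ph; meas_tac.
    have m7 : measurable_fun Q (fun z : R * R * R => (s * ph z.1.1 z.2)^-1).
      by apply: (measurableT_comp (@measurable_inv R)); meas_tac.
    have m8 : measurable_fun Q (fun z : R * R * R => weight T s g z.1.1 z.2).
      by apply: (measurableT_comp (@measurable_expR R)); meas_tac.
    by rewrite /F; meas_tac.
  + by apply: measurable_funeM; exact/measurable_EFinP.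
  + move=> z [[/= xO _] tT]; rewrite -EFinM lee_fin /F /uncurry3 /energy3 /energy.
    have := tT; rewrite /Tm/= in_itv/= => /theta_gt0 t1; have t0 := ltW t1.
    have [/andP[e1 e2] gx] := gE (IE _ xO).
    have eE : X - g z.1.1 = expR (l * d z.1.1) by rewrite gx opprB addrCA subrr addr0.
    rewrite /ph eE; move: (expR (l * _)) e1 e2 => e e1 e2.
    have e0 : 0 < e := lt_le_trans m_gt0 e1; have e0' := ltW e0.
    rewrite [leRHS]mulrA; apply: ler_wpM2r; first exact: sqr_ge0.
    rewrite (mulrDr C) (mulrDr C); apply: lerD; first apply: lerD.
    * rewrite [leRHS]mulrA; apply: ler_wpM2r; first exact: sqr_ge0.
      have -> : (s * (e * theta T z.2))^-1 = e^-1 * (s * theta T z.2)^-1.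
        by rewrite -invfM mulrCA.
      apply: ler_wpM2r; first by rewrite invr_ge0 mulr_ge0.
      apply: (@le_trans _ _ m^-1); first by rewrite lef_pV2.
      by rewrite /C -addrA lerDl addr_ge0.
    * rewrite [leRHS]mulrA; apply: ler_wpM2r; first exact: sqr_ge0.
      have -> : s * l ^+ 2 * (e * theta T z.2) = l ^+ 2 * e * (s * theta T z.2) by ring.
      apply: ler_wpM2r; first by rewrite mulr_ge0.
      apply: (@le_trans _ _ (l ^+ 2 * N)); first by rewrite ler_wpM2l// exprn_ge0.
      by rewrite /C addrAC lerDr addr_ge0.
    * rewrite [leRHS]mulrA; apply: ler_wpM2r; first exact: sqr_ge0.
      have -> : s ^+ 3 * l ^+ 4 * (e * theta T z.2) ^+ 3 =
        l ^+ 4 * e ^+ 3 * (s ^+ 3 * theta T z.2 ^+ 3) by ring.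
      apply: ler_wpM2r; first by nonneg.
      apply: (@le_trans _ _ (l ^+ 4 * N ^+ 3)); last by rewrite /C lerDr addr_ge0.
      by rewrite ler_wpM2l ?exprn_ge0//; apply: lerXn2r.
- exact/measurable_EFinP.
Qed.

End original_weight.

(** * Choice of the constants *)

Lemma has_dxP (R : realType) (ell v0 v1 T : R) u :
  has_dx ell v0 v1 T u -> is_dx ell v0 v1 T u (dx ell v0 v1 T u).
Proof. exact: xgetPex. Qed.

Lemma has_dtP (R : realType) (ell v0 v1 T : R) u :
  has_dt ell v0 v1 T u -> is_dt ell v0 v1 T u (dt ell v0 v1 T u).
Proof. exact: xgetPex. Qed.

Lemma collect_constants (R : realType) (C c6 c2 K s0 S : R) (E W B1 B2 : \bar R) :
  0 <= C -> 0 <= c6 -> 0 <= c2 -> 0 <= K -> C * c6 <= s0 -> C * c2 * K <= S ->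
  (0 <= W -> 0 <= B1 -> 0 <= B2 -> E <= c6%:E * W + c2%:E * (K%:E * (B1 + B2)) ->
   C%:E * E <= s0%:E * W + S%:E * B1 + S%:E * B2)%E.
Proof.
move=> C0 c60 c20 K0 h1 h2 W0 B10 B20 /(lee_wpmul2l (_ : (0 <= C%:E)%E))-/(_ C0) h.
apply: le_trans h _; rewrite ge0_muleDr ?mule_ge0 ?adde_ge0//.
rewrite !muleA -!EFinM ge0_muleDr// -addeA.
by apply: leeD; [|apply: leeD]; rewrite lee_wpmul2r// lee_fin.
Qed.

Lemma le_one_add_norms (R : realDomainType) (a b e f : R) (s := 1 + `|a| + `|b| + `|e| + `|f|) :
  [/\ a <= s, b <= s, e <= s & f <= s].
Proof.
have := normr_ge0 a; have := normr_ge0 b; have := normr_ge0 e; have := normr_ge0 f.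
have := ler_norm a; have := ler_norm b; have := ler_norm e; have := ler_norm f.
by rewrite /s; split; lra.
Qed.

Theorem proposition5p1 (R : realType) (ell v0 v1 T : R)
    (ell_gt0 : 0 < ell) (v0_gt0 : 0 < v0) (v1_gt0 : 0 < v1) (T_gt0 : 0 < T)
    (sigma_t sigma_s : R -> R -> R) (p : R -> R -> R -> R)
    (sigma_tC1 : C1_Linfty leb1 (Vel v0 v1) ell sigma_t)
    (sigma_sC1 : C1_Linfty leb1 (Vel v0 v1) ell sigma_s)
    (pC1 : C1_Linfty leb2 (VV v0 v1) ell (fun x z => p x z.1 z.2))
    (p_gt0 : forall x, Om ell x ->
      {ae leb2, forall z, VV v0 v1 z -> 0 < p x z.1 z.2})
    (d : R -> R) (dC2 : C2_in ell d)
    (d_gt0 : forall x, Om ell x -> 0 < d x)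
    (d_decr : forall x, `[0, ell]%classic x -> deriv_in ell d x < 0)
    (M : R) (M_gt0 : 0 < M) :
  let Dx := dx ell v0 v1 T in
  let Dt := dt ell v0 v1 T in
  let tr := trx ell v0 v1 T in
  exists lambda0 : R, 0 < lambda0 /\
  exists C : R -> R, (forall s0, 0 < s0 -> 0 < C s0) /\
  forall lambda, lambda0 < lambda ->
  exists s0 : R, 0 < s0 /\
  exists Clambda : R, 0 < Clambda /\
  forall s, s0 < s ->
  forall u, in_U ell v0 v1 T M u ->
  forall f, measurable_fun (QV ell v0 v1 T) (uncurry3 f) ->
  {ae leb3, forall z, QV ell v0 v1 T z ->
    let x := z.1.1 in let v := z.1.2 in let t := z.2 in
    Dt u x v t - v ^+ 2 * Dx (Dx u) x v t
      - L1op ell v0 v1 T sigma_t u x v t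
      - \int[leb1]_(v' in Vel v0 v1)
          Kop ell v0 v1 T sigma_t sigma_s p u x v v' t
    = f x v t} ->
  {ae leb2, forall z, (Om ell `*` Vel v0 v1) z ->
    trt ell v0 v1 T u z.1 z.2 0 = 0} ->
  (forall x, x = 0 \/ x = ell ->
    {ae leb2, forall z, Gamma_minus ell v0 v1 (x, z.1) -> Tm T z.2 ->
      tr u x z.1 z.2 = 0}) ->
  let al := alpha ell T d lambda in
  let ph := varphi T d lambda in
  (int_QV ell v0 v1 T (fun x v t =>
      ((s * ph x t)^-1 * `|Dt u x v t| ^+ 2
       + s * lambda ^+ 2 * ph x t * `|Dx u x v t| ^+ 2
       + s ^+ 3 * lambda ^+ 4 * ph x t ^+ 3 * `|u x v t| ^+ 2)
      * expR (2 * s * al x t))%R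
   <= (C s0)%:E * int_QV ell v0 v1 T (fun x v t =>
        `|f x v t| ^+ 2 * expR (2 * s * al x t))%R
    + (C s0 * expR (Clambda * s))%:E *
        (\int[leb1]_(t in Tm T) int_Gamma_plus ell v0 v1 (fun x v =>
          `|tr u x v t| ^+ 2 + `|tr (Dt u) x v t| ^+ 2
          + `|tr (Dx u) x v t| ^+ 2)%R)
    + (C s0 * expR (Clambda * s))%:E *
        (\int[leb1]_(v in Vel v0 v1) (\int[leb1]_(t in Tm T)
          (`|tr (Dx u) 0 v t| ^+ 2)%:E)))%E.
Proof.
move=> Dx Dt tr.
have [A A_ge0 HA] := coefficient_bounds T ell_gt0 v1_gt0 sigma_tC1 sigma_sC1 pC1.
have A1_gt0 : 0 < A + 1 by rewrite ltr_wpDl.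
have [l0 l0_gt0 Hl] := carleman_weight ell_gt0 dC2 d_gt0 d_decr.
exists l0; split => //; exists id; split => // l /[dup] ll0 /Hl.
have l_gt0 : 0 < l := lt_trans l0_gt0 ll0.
move=> [m [N [g [g1 [g2 [[m_gt0 N_gt0 [mg mg1 mg2]] [[cg cg1 cg2] dg dg1 g_bd gE]]]]]]].
have [q [B [B_ge0 fluxB]]] := weighted_flux_bounds (v1 ^+ 2) N T_gt0 m_gt0.
pose c := carleman_cst (v0 ^+ 2) (v1 ^+ 2) m N T.
pose k := 3 * (A + 1) * (1 + (2 * v1) ^+ 2).
pose C := m^-1 + l ^+ 2 * N + l ^+ 4 * N ^+ 3.
(* [s1] is the threshold of the pointwise inequality and [s2] that of the absorption, while [s3] and
   [s4] are the coefficients of the source and boundary terms, which [s0] has to dominate. *)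
pose s1 := carleman_threshold (v0 ^+ 2) (v1 ^+ 2) m N T (5 / 2 * T ^+ 2) (4 / T ^+ 2).
pose s2 := 2 * c * k / weight_floor T.
pose s3 := C * (6 * c); pose s4 := C * (2 * c) * (2 * B).
pose s0 := 1 + `|s1| + `|s2| + `|s3| + `|s4|.
have s0_gt0 : 0 < s0 by do 4 apply: ltr_wpDr => //.
have [s10 s20 s30 s40] := le_one_add_norms s1 s2 s3 s4.
(* [q] is the exponential rate in the flux bound; the 1 only makes the constant positive. *)
exists s0; split => //; exists (q%:R + 1); split; first by rewrite ltr_wpDl.
move=> s s0s u [[Lu [hdt _] hdx hdxx _] _ _] f mf equation u_init u_inflow /=.
have s_gt0 : 0 < s := lt_trans s0_gt0 s0s.
have s_ge1 : s1 <= s by rewrite (le_trans s10)// ltW.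
have s_ge2 : s2 <= s by rewrite (le_trans s20)// ltW.
have du := has_dxP (hdx 0%N isT); have dut := has_dxP (hdx 1%N isT).
have dux := has_dxP hdxx; have dtu := has_dtP hdt.
(* The coefficient bound may be 0, for instance if all coefficients vanish, while the absorption
   requires a positive one; hence [A + 1]. *)
have HA1 x : `[0, ell]%classic x -> {ae leb1, forall v, Vel v0 v1 v ->
  (forall u t, L1op ell v0 v1 T sigma_t u x v t ^+ 2 <=
     (A + 1) * (dx ell v0 v1 T u x v t ^+ 2 + u x v t ^+ 2)) /\
  {ae leb1, forall v', Vel v0 v1 v' ->
     forall u t, Kop ell v0 v1 T sigma_t sigma_s p u x v v' t ^+ 2 <=
       (A + 1) * (dx ell v0 v1 T u x v' t ^+ 2 + u x v' t ^+ 2)}}.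
  move=> xI; have AA (a b : R) : A * (a ^+ 2 + b ^+ 2) <= (A + 1) * (a ^+ 2 + b ^+ 2).
    by rewrite ler_wpM2r ?addr_ge0 ?sqr_ge0// lerDl.
  apply: aeS (HA x xI) => v Hv Vv; have [H1 H2] := Hv Vv; split.
    by move=> w t; apply: le_trans (H1 w t) (AA _ _).
  by apply: aeS H2 => v' H2 Vv' w t; apply: le_trans (H2 Vv' w t) (AA _ _).
have main := carleman_kinetic ell_gt0 v0_gt0 v1_gt0 T_gt0 m_gt0 N_gt0 A1_gt0 mg mg1 mg2
  cg cg1 cg2 dg dg1 g_bd B_ge0 fluxB s_ge1 s_ge2 HA1 Lu du dux dtu dut mf equation
  u_init u_inflow.
have men := measurable_energy3 s mg Lu du dtu.
have lhs := weighted_lhs_le_energy m_gt0 N_gt0 s_gt0 l_gt0 mg erefl gE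
  Lu du.1 dtu.1 men.
apply: le_trans lhs _.
have c_ge0 : 0 <= c.
  have := ltW v0_gt0; have := ltW v1_gt0; have := ltW m_gt0; have := ltW N_gt0.
  by have := ltW T_gt0 => *; rewrite /c /carleman_cst; nonneg.
have C_ge0 : 0 <= C.
  have := ltW m_gt0; have := ltW N_gt0; have := ltW l_gt0 => *.
  by rewrite !addr_ge0 ?invr_ge0//; nonneg.
have s4_ge0 : 0 <= s4.
  by apply: mulr_ge0; last exact: mulr_ge0; apply: mulr_ge0 => //; exact: mulr_ge0.
have f_eq : int_QV ell v0 v1 T (fun x v t => `|f x v t| ^+ 2 *
      expR (2 * s * alpha ell T d l x t)) =
    (\int[leb3]_(z in QV ell v0 v1 T)
      (uncurry3 (fun x v t => weight T s g x t ^+ 2 * f x v t ^+ 2) z)%:E)%E.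
  apply: (@eq_integral _ _ R leb3) => z /[!inE] -[[/= xO _] _].
  have xI : 0 <= z.1.1 <= ell.
    by move: xO; rewrite /Om/= in_itv/= => /andP[/ltW -> /ltW ->].
  by rewrite (expR_alpha T s erefl gE z.2 xI) real_normK ?num_real// mulrC.
rewrite f_eq.
apply: (collect_constants _ _ _ _ _ _ _ _ _ main) => //.
- by rewrite mulr_ge0.
- by rewrite mulr_ge0.
- by rewrite !mulr_ge0 ?expR_ge0.
- rewrite [leLHS]mulrA -/s4; apply: ler_pM => //.
  by rewrite ler_expR ler_wpM2r ?(ltW s_gt0)// lerDl.
- by apply: integral_ge0 => z _; rewrite lee_fin mulr_ge0 ?sqr_ge0.
- apply: integral_ge0 => t _; rewrite adde_ge0//; apply: integral_ge0 => v _.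
    by rewrite lee_fin !addr_ge0 ?sqr_ge0.
  by rewrite lee_fin !addr_ge0 ?sqr_ge0.
- by apply: integral_ge0 => v _; apply: integral_ge0 => t _; rewrite lee_fin sqr_ge0.
Qed.
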